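(* Let $g=0$ and let $Z^n_\kappa$ be a divisor of the second kind in $\overline{\mathcal{M}}_{0,n}$, i.e. $\kappa=(k_1,\dots,k_n,f_1^{\alpha_1},\dots,f_m^{\alpha_m})$ (with $f_i\neq f_j$ for $i\ne j$) is a list of integers summing to $-2$, none equal to $-1$, having $p\ge 1$ negative entries and exactly $|\kappa|=n+p-2$ entries in total. Then every irreducible component of the divisor $Z_\kappa^n$ is $F$-nef.
   Context: All curves are over $\mathbb{C}$. For a signature $\kappa=(\kappa_1,\dots,\kappa_r)$ with $\sum\kappa_i=-2$ put $$\mathcal{Z}(\kappa)=\{[C,p_1,\dots,p_r]\in\mathcal{M}_{0,r}\mid \textstyle\sum \kappa_ip_i=(\omega)\text{ for a differential }\omega\text{ with }\mathrm{res}_{p_i}(\omega)=0\text{ whenever }\kappa_i\le-2\},$$ and let $\overline{\mathcal{Z}}(\kappa)$ be its closure in $\overline{\mathcal{M}}_{0,r}$. For $\kappa=(k_1,\dots,k_n,f_1^{\alpha_1},\dots,f_m^{\alpha_m})$ as in the claim (exponents denote repetition), $$Z^n_\kappa:=\frac{1}{\alpha_1!\cdots\alpha_m!}\,\varphi_*\overline{\mathcal{Z}}(\kappa),$$ where $\varphi:\overline{\mathcal{M}}_{0,n+p-2}\to\overline{\mathcal{M}}_{0,n}$ forgets the last $\sum\alpha_i=p-2$ marked points. (As usual, components contracted by $\varphi$ push forward to zero.) An $F$-curve in $\overline{\mathcal{M}}_{0,n}$ is an irreducible component of the one-dimensional locus of stable curves with at least $n-4$ nodes. A divisor is $F$-nef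 if it has non-negative intersection with every $F$-curve. *)

(* Defs.v *)
From HB Require Import structures.
From mathcomp Require Import all_boot all_order all_algebra.
From mathcomp Require Import boolp classical_sets fsbigop.
From mathcomp Require Import reals complex.
From mathcomp Require mpoly.

Set Implicit Arguments.
Unset Strict Implicit.
Unset Printing Implicit Defensive.

Import GRing.Theory.
Local Open Scope classical_set_scope.
Local Open Scope ring_scope.

(* A projective line over K is [option K], with [None] the point at infinity.
   Varieties are subsets of a finite product of projective lines. *)
Section ProductsOfLines.
Variables (K : closedFieldType) (Q : finType).

Definition P1prod : Type := {ffun Q -> option K}.
HB.instance Definition _ := Choice.on P1prod.

Definition inv_P1 (b : option K) : option K :=
  if b is Some z then if z == 0 then None else Some z^-1 else Some 0.

(* The affine coordinate of b on the chart around a: z if a is finite, 1/z if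
   a is infinite; [None] when b lies outside this chart. *)
Definition coord_P1 (a b : option K) : option K :=
  if a is Some _ then b else inv_P1 b.

Definition in_chart (x y : P1prod) : bool :=
  [forall q, coord_P1 (x q) (y q) != None].

(* The value at y of the polynomial p in the affine coordinates of the chart
   around x; meaningful when [in_chart x y]. *)
Definition ev (x : P1prod) (p : mpoly.mpoly #|Q| K) (y : P1prod) : K :=
  mpoly.meval (fun i => odflt 0 (coord_P1 (x (enum_val i)) (y (enum_val i)))) p.

Definition zclosure (V : set P1prod) : set P1prod :=
  [set x | forall p : mpoly.mpoly #|Q| K,
     (forall y, V y -> in_chart x y -> ev x p y = 0) -> ev x p x = 0].

Definition zclosed (V : set P1prod) : Prop := zclosure V `<=` V.

Definition irreducible (V : set P1prod) : Prop :=
  V !=set0 /\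
  forall A B : set P1prod, zclosed A -> zclosed B ->
    V `<=` A `|` B -> V `<=` A \/ V `<=` B.

Definition irreducible_component (V W : set P1prod) : Prop :=
  [/\ W `<=` V, irreducible W &
      forall W', irreducible W' -> W' `<=` V -> W `<=` W' -> W' = W].

(* P holds on a Zariski neighbourhood of x in V. *)
Definition zariski_near (V : set P1prod) (x : P1prod) (P : P1prod -> Prop) :
    Prop :=
  exists2 q, ev x q x != 0 &
    forall y, V y -> in_chart x y -> ev x q y != 0 -> P y.

(* The total function f represents a germ in the local ring of V at x.  Its
   values outside a neighbourhood of x are irrelevant; when V is irreducible,
   f agrees with a rational function on a dense open subset of V. *)
Definition regular_at (V : set P1prod) (x : P1prod) (f : P1prod -> K) : Prop :=
  exists p q, ev x q x != 0 /\
    forall y, V y -> in_chart x y -> ev x q y != 0 ->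
      f y = ev x p y / ev x q y.

(* f generates the ideal of D in the local ring of V at x. *)
Definition local_equation (V D : set P1prod) (x : P1prod) (f : P1prod -> K) :
    Prop :=
  [/\ regular_at V x f, zariski_near D x (fun y => f y = 0) &
      forall g, regular_at V x g -> zariski_near D x (fun y => g y = 0) ->
        exists2 h, regular_at V x h &
          zariski_near V x (fun y => g y = f y * h y)].

(* C is an irreducible curve, smooth at x, and the function u on C, rational on
   a dense open subset, has order m at x: u = v * pi ^ m generically on C, with
   pi a uniformizer and v a unit of the local ring at x. *)
Definition order_at (C : set P1prod) (x : P1prod) (u : P1prod -> K) (m : int) :
    Prop :=
  exists (pi v : P1prod -> K) (k l : nat),
    [/\ local_equation C [set x] x pi,
        regular_at C x v,
        v x != 0,
        exists2 c, C c &
          zariski_near C c (fun y => u y * pi y ^+ k = v y * pi y ^+ l) &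
        m = l%:Z - k%:Z].

(* d = deg (O_V(D)|_C), for a codimension-one closed subset D of a smooth
   variety V and a smooth complete irreducible curve C in V, which may lie in D.
   With f x a local equation of D at x, the quotient u x = f x / f x0 is a unit
   of the local ring of V at the generic point of C, so that it restricts to a
   nonzero rational function on C; the degree is the number of zeros minus poles
   on C of the rational section 1 / f x0 of O_V(D), whose order at x is that of
   u x. *)
Definition intersection_number (V D C : set P1prod) (d : int) : Prop :=
  exists (f u : P1prod -> P1prod -> K) (m : P1prod -> int) (x0 : P1prod)
         (s : seq P1prod),
    [/\ C x0,
        forall x, C x -> local_equation V D x (f x),
        forall x, C x -> exists c,
          [/\ C c, regular_at V c (u x), u x c != 0 &
              zariski_near V c (fun y => f x y = f x0 y * u x y)],
        forall x, C x -> order_at C x (u x) (m x) &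
        [/\ uniq s, forall x, x \in s <-> C x /\ m x != 0 &
            d = \sum_(x <- s) m x]].

End ProductsOfLines.

Section Moduli.
Variable K : closedFieldType.

(* Pairwise distinct labels give the cross-ratios; the other coordinates take
   the same value at all configurations of distinct points. *)
Definition cr_space (n : nat) : Type := P1prod K (4.-tuple 'I_n).

Definition cross_ratio (a b c d : K) : K :=
  ((a - c) * (b - d)) / ((a - d) * (b - c)).

(* The class of (P^1, p_0, ..., p_(n-1)) in M_{0,n}, embedded by cross-ratios.
   As K is infinite, every class has a representative with all points finite. *)
Definition marked_line (n : nat) (p : 'I_n -> K) : cr_space n :=
  [ffun q : 4.-tuple 'I_n =>
     Some (cross_ratio (p (tnth q (inord 0))) (p (tnth q (inord 1)))
                       (p (tnth q (inord 2))) (p (tnth q (inord 3))))].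

Definition M0 (n : nat) : set (cr_space n) :=
  [set x | exists2 p : 'I_n -> K, injective p & x = marked_line p].

(* For n >= 3, the closure of M_{0,n} under all cross-ratios is the moduli space
   of stable n-pointed rational curves (Gerritzen, Herrlich and van der Put,
   Stable n-pointed trees of projective lines, 1988). *)
Definition Mbar0 (n : nat) : set (cr_space n) := zclosure (@M0 n).

(* The stable curve x has a node whose removal separates the points marked in S
   from the others: the cross-ratios with p_i, p_j in S and p_k, p_l outside S
   take the value 1 of a collision of p_i and p_j. *)
Definition separates (n : nat) (x : cr_space n) (S : {set 'I_n}) : bool :=
  [&& (1 < #|S|)%N, (1 < #|~: S|)%N &
   [forall i in S, forall j in S, forall k in ~: S, forall l in ~: S,
      x [tuple i; j; k; l] == Some 1]].

(* A node of a stable pointed rational curve is determined by the unordered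
   bipartition of the marked points that it induces. *)
Definition nodes (n : nat) (x : cr_space n) : nat :=
  #|[set [set S; ~: S] | S : {set 'I_n} & separates x S]%SET|.

Definition F_curve (n : nat) (C : set (cr_space n)) : Prop :=
  irreducible_component [set x | @Mbar0 n x /\ (n - 4 <= nodes x)%N] C.

Definition F_nef (n : nat) (D : set (cr_space n)) : Prop :=
  forall C, F_curve C ->
    exists2 d : int, intersection_number (@Mbar0 n) D C d & 0 <= d.

(* Cross-ratios of the first n points are among the coordinates, so that the
   morphism forgetting the last s points is a coordinate projection. *)
Definition forget (n s : nat) (x : cr_space (n + s)) : cr_space n :=
  [ffun q : 4.-tuple 'I_n => x (map_tuple (@lshift n s) q)].

(* The differential (N / M) dz on the projective line has divisor
   sum_i kappa_i p_i; the last condition is that infinity, which is not marked,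
   is neither a zero nor a pole. *)
Definition has_divisor (r : nat) (N M : {poly K}) (p : 'I_r -> K)
    (kappa : seq int) : Prop :=
  [/\ N != 0, M != 0,
      forall z, (mup z N)%:Z - (mup z M)%:Z = \sum_(i < r | p i == z) kappa`_i &
      (size M)%:Z - (size N)%:Z - 2 = 0].

(* N / M = T / (z - a) ^ (e + 1) + (a function regular at a), and c is the
   coefficient of (z - a) ^ (-1) in T / (z - a) ^ (e + 1). *)
Definition has_residue (N M : {poly K}) (a c : K) : Prop :=
  exists (e : nat) (T : {poly K}),
    ('X - a%:P) ^+ (mup a M + e.+1) %| N * ('X - a%:P) ^+ e.+1 - T * M /\
    c = (T \Po ('X + a%:P))`_e.

Definition stratum (r : nat) (kappa : seq int) : set (cr_space r) :=
  [set x | exists p : 'I_r -> K,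
     [/\ injective p, x = marked_line p &
         exists N M : {poly K}, has_divisor N M p kappa /\
           forall i : 'I_r, kappa`_i <= -2 -> has_residue N M (p i) 0]].

Definition stratum_closure (r : nat) (kappa : seq int) : set (cr_space r) :=
  zclosure (@stratum r kappa).

(* The number of points of a general fibre of W over its image, which in
   characteristic zero is the degree of W over its image; 0 when general fibres
   are infinite, that is, when W is contracted. *)
Definition forget_degree (n s : nat) (W : set (cr_space (n + s))) : nat :=
  xget 0%N [set e | exists A : set (cr_space n),
    [/\ zclosed A, ~ (@forget n s @` W `<=` A) &
        forall y, (@forget n s @` W) y -> ~ A y ->
          exists t : seq (cr_space (n + s)),
            [/\ uniq t, size t = e &
                forall x, x \in t <-> W x /\ forget x = y]]].

(* The signature (f_1 ^ alpha_1, ..., f_m ^ alpha_m). *)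
Definition repeated (m : nat) (f : 'I_m -> int) (alpha : 'I_m -> nat) :
    seq int :=
  flatten [seq nseq (alpha i) (f i) | i <- enum 'I_m].

(* The coefficient of D in the cycle Z^n_kappa, for
   kappa = (k_1, ..., k_n, f_1 ^ alpha_1, ..., f_m ^ alpha_m). *)
Definition Z_coefficient (n m : nat) (k : n.-tuple int) (f : 'I_m -> int)
    (alpha : 'I_m -> nat) (D : set (cr_space n)) : rat :=
  let s := (\sum_i alpha i)%N in
  ((\prod_i (alpha i)`!)%N%:R)^-1 *
  \sum_(W \in [set W | irreducible_component
                         (@stratum_closure (n + s) (k ++ repeated f alpha)) W /\
                       @forget n s @` W = D])
    ((forget_degree W)%:R : rat).

Definition Z_component (n m : nat) (k : n.-tuple int) (f : 'I_m -> int)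
    (alpha : 'I_m -> nat) (D : set (cr_space n)) : Prop :=
  Z_coefficient k f alpha D != 0.

End Moduli.

(* Main.v *)
(* The image D of a component of the stratum is a hypersurface: in coordinates
   (e, z) on M_{0,n+s}, with s = p - 2, the stratum is cut out by the vanishing of
   s + 1 residues, and the fibres over the n - 3 coordinates e are finite.

   D contains no point with n - 3 nodes.  At such a limit, the points p_i form
   nested clusters.  Vanishing residues mean that the differential is exact, and
   rescaling its primitive at a cluster yields an exact differential whose zeros
   and poles are the subclusters; counting ramification there gives inductively
   that a cluster with j zeros contains at most j clusters, itself included, and at
   most j - 1 if its total order is nonnegative.  With a pole p_o at infinity, o <= n,
   there are n - 2 zeros, whence at most n - 4 nodes after forgetting points.

   Mbar_{0,n} is covered by charts indexed by binary trees, in which the boundary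
   is the union of the coordinate hyperplanes and the one-dimensional strata are the
   coordinate axes; the origin is a point with n - 3 nodes.  So an F-curve C is not
   contained in D, and local equations of D restrict to nonzero functions on C,
   regular everywhere: D . C >= 0. *)
Require Import Defs.
From HB Require Import structures.
From mathcomp Require Import all_boot all_order all_algebra.
From mathcomp Require Import boolp classical_sets fsbigop reals complex.
From mathcomp Require Import mpoly.
From mathcomp Require Import ring lra zify.
Set Implicit Arguments.
Unset Strict Implicit.
Unset Printing Implicit Defensive.
Import GRing.Theory.
Local Open Scope ring_scope.

(** * Places *)

(** Limits are taken along places instead of curves. A point of a Zariski closure evaluates the
    polynomial functions on the family consistently; by Chevalley's extension argument this
    evaluation extends to a place on all functions of the family, under which any two magnitudes can
    be compared. Clusters, rescalings and limits of primitives then make sense without models or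
    base change.

    Two properties of the field enter: characteristic zero, so that a function is determined by its
    differential up to a constant, and uncountability, which gives a short proof of the
    Nullstellensatz. The dimension count behind the hypersurface claim is a growth estimate at an
    isolated zero, and the single equation of D in a chart comes from unique factorization, as a
    chart is an open subset of affine space. The number s + 1 of equations is p - 1, because the
    residue at the pole moved to infinity is determined by the others. Finite fibres are what a
    nonzero coefficient of D in the cycle provides: contracted components have degree 0. *)

Section Places.
Variables (K : closedFieldType) (I : Type).
Implicit Types (Phi : (I -> K) -> K -> Prop) (f g : I -> K).

(** The graph of a homomorphism of [K]-algebras from a subalgebra of the functions on [I] to [K]. As
    a relation it can be enlarged by Zorn's lemma. *)
Definition partial_hom Phi : Prop :=
  [/\ forall c, Phi (fun=> c) c,
      forall f g a b, Phi f a -> Phi g b -> Phi (fun i => f i + g i) (a + b),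
      forall f g a b, Phi f a -> Phi g b -> Phi (fun i => f i * g i) (a * b) &
      forall f a b, Phi f a -> Phi f b -> a = b].

(* [Phi f c] means that f tends to c.  The value 1 of f / f says that f has no zero
   near the place, which 1 / 0 = 0 does not exclude. *)
Definition place Phi : Prop :=
  partial_hom Phi /\
  forall f, (exists c, Phi f c) \/
    Phi (fun i => (f i)^-1) 0 /\ Phi (fun i => f i / f i) 1.

(** The uniform bound on the sizes turns coefficients of products and values at a point into sums of
    bounded length, through which limits pass. *)
Definition reduces Phi (P : I -> {poly K}) (p : {poly K}) : Prop :=
  (exists d, forall i, (size (P i) <= d)%N) /\
  forall k, Phi (fun i => (P i)`_k) p`_k.

Section PartialHom.
Variable Phi : (I -> K) -> K -> Prop.
Hypothesis hPhi : partial_hom Phi.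

Lemma phC c : Phi (fun=> c) c. Proof. by case: hPhi. Qed.
Lemma phD f g a b : Phi f a -> Phi g b -> Phi (fun i => f i + g i) (a + b).
Proof. by case: hPhi => _ + _ _; apply. Qed.
Lemma phM f g a b : Phi f a -> Phi g b -> Phi (fun i => f i * g i) (a * b).
Proof. by case: hPhi => _ _ + _; apply. Qed.
Lemma ph_inj f a b : Phi f a -> Phi f b -> a = b.
Proof. by case: hPhi => _ _ _; apply. Qed.
Lemma ph_ext f g a b : Phi f a -> f =1 g -> a = b -> Phi g b.
Proof. by move=> h /funext <- <-. Qed.
Lemma phN f a : Phi f a -> Phi (fun i => - f i) (- a).
Proof.
move=> h; apply: ph_ext (phM (phC (-1)) h) _ _ => [i|]; exact: mulN1r.
Qed.
Lemma phB f g a b : Phi f a -> Phi g b -> Phi (fun i => f i - g i) (a - b).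
Proof. by move=> h1 h2; apply: phD (phN _). Qed.
Lemma phX f a k : Phi f a -> Phi (fun i => f i ^+ k) (a ^+ k).
Proof.
move=> h; elim: k => [|k IH]; first exact: phC.
apply: ph_ext (phM h IH) _ _ => [i|]; by rewrite exprS.
Qed.
Lemma ph_sum (J : Type) (r : seq J) (P : pred J) (F : J -> I -> K) a :
  (forall j, P j -> Phi (F j) (a j)) ->
  Phi (fun i => \sum_(j <- r | P j) F j i) (\sum_(j <- r | P j) a j).
Proof.
move=> h; elim: r => [|j r IH].
  by apply: ph_ext (phC 0) _ _ => [i|]; rewrite big_nil.
case Pj: (P j).
  by apply: ph_ext (phD (h _ Pj) IH) _ _ => [i|]; rewrite big_cons Pj.
by apply: ph_ext IH _ _ => [i|]; rewrite big_cons Pj.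
Qed.
Lemma ph_prod (J : Type) (r : seq J) (P : pred J) (F : J -> I -> K) a :
  (forall j, P j -> Phi (F j) (a j)) ->
  Phi (fun i => \prod_(j <- r | P j) F j i) (\prod_(j <- r | P j) a j).
Proof.
move=> h; elim: r => [|j r IH].
  by apply: ph_ext (phC 1) _ _ => [i|]; rewrite big_nil.
case Pj: (P j).
  by apply: ph_ext (phM (h _ Pj) IH) _ _ => [i|]; rewrite big_cons Pj.
by apply: ph_ext IH _ _ => [i|]; rewrite big_cons Pj.
Qed.

Lemma reducesC f a : Phi f a -> reduces Phi (fun i => (f i)%:P) a%:P.
Proof.
move=> h; split=> [|k]; first by exists 1%N => i; rewrite size_polyC leq_b1.
have [->|k0] := eqVneq k 0%N.
  by apply: ph_ext h _ _ => [i|]; rewrite coefC.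
by apply: ph_ext (phC 0) _ _ => [i|]; rewrite coefC (negPf k0).
Qed.
Lemma reduces_cst p : reduces Phi (fun=> p) p.
Proof. by split=> [|k]; [exists (size p) | exact: phC]. Qed.
Lemma reducesD P Q p q : reduces Phi P p -> reduces Phi Q q ->
  reduces Phi (fun i => P i + Q i) (p + q).
Proof.
move=> [[d hd] hP] [[e he] hQ]; split.
  exists (maxn d e) => i; apply: leq_trans (size_polyD _ _) _.
  by rewrite geq_max !leq_max hd he orbT.
by move=> k; apply: ph_ext (phD (hP k) (hQ k)) _ _ => [i|]; rewrite coefD.
Qed.
Lemma reducesM P Q p q : reduces Phi P p -> reduces Phi Q q ->
  reduces Phi (fun i => P i * Q i) (p * q).
Proof.
move=> [[d hd] hP] [[e he] hQ]; split.
  exists (d + e)%N => i; apply: leq_trans (size_polyMleq _ _) _.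
  by apply: leq_trans (leq_pred _) _; apply: leq_add.
move=> k; apply: ph_ext (ph_sum (index_enum _)
  (fun (j : 'I_k.+1) _ => phM (hP j) (hQ (k - j)%N))) _ _ => [i|];
  by rewrite coefM.
Qed.
Lemma reducesZ f a P p : Phi f a -> reduces Phi P p ->
  reduces Phi (fun i => f i *: P i) (a *: p).
Proof.
move=> hf hP; have [hd hk] := reducesM (reducesC hf) hP.
by split=> [|k]; move: hd (hk); [move=> [d hd] _; exists d => i; have := hd i
   | move=> _ /(_ k) hk'; apply: ph_ext hk' _ _ => [i|]]; rewrite mul_polyC.
Qed.
Lemma reducesN P p : reduces Phi P p -> reduces Phi (fun i => - P i) (- p).
Proof.
move=> hP; have := reducesZ (phC (-1)) hP.
under [fun i => _ *: _]funext => i do rewrite scaleN1r.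
by rewrite scaleN1r.
Qed.
Lemma reducesB P Q p q : reduces Phi P p -> reduces Phi Q q ->
  reduces Phi (fun i => P i - Q i) (p - q).
Proof. by move=> h1 h2; apply: reducesD (reducesN _). Qed.
Lemma reduces_prod (J : Type) (r : seq J) (A : pred J) (F : J -> I -> {poly K}) a :
  (forall j, A j -> reduces Phi (F j) (a j)) ->
  reduces Phi (fun i => \prod_(j <- r | A j) F j i) (\prod_(j <- r | A j) a j).
Proof.
move=> h; elim: r => [|j r IH].
  under [fun i => _]funext => i do rewrite big_nil.
  by rewrite big_nil; apply: reduces_cst.
under [fun i => _]funext => i do rewrite big_cons.
by rewrite big_cons; case Aj: (A j) => //; apply: reducesM (h _ Aj) IH.
Qed.
Lemma reducesX P p k : reduces Phi P p ->
  reduces Phi (fun i => P i ^+ k) (p ^+ k).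
Proof.
move=> h; elim: k => [|k IH]; first exact: reduces_cst.
under [fun i => _]funext => i do rewrite exprS.
by rewrite exprS; apply: reducesM.
Qed.
Lemma reduces_deriv P p : reduces Phi P p ->
  reduces Phi (fun i => (P i)^`()) p^`().
Proof.
move=> [[d hd] hP]; split=> [|k].
  exists d => i; apply: leq_trans (hd i).
  by apply: leq_trans (size_poly _ _) (leq_pred _).
apply: ph_ext (phM (phC k.+1%:R) (hP k.+1)) _ _ => [i|];
  by rewrite coef_deriv mulr_natl.
Qed.
Lemma reduces_inj P p q : reduces Phi P p -> reduces Phi P q -> p = q.
Proof. by move=> [_ h1] [_ h2]; apply/polyP => k; apply: ph_inj (h1 k) (h2 k). Qed.

End PartialHom.

(* Adjoining x with value xi is consistent as soon as xi is a root of every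
   reduction of a relation satisfied by x. *)
Lemma partial_hom_adjoin Phi x xi : partial_hom Phi ->
  (forall P p, reduces Phi P p -> (forall i, (P i).[x i] = 0) -> p.[xi] = 0) ->
  exists2 Psi, partial_hom Psi & Psi x xi /\ (forall f a, Phi f a -> Psi f a).
Proof.
move=> hPhi hxi.
exists (fun f c => exists P p,
  [/\ reduces Phi P p, forall i, f i = (P i).[x i] & c = p.[xi]]).
  split.
  - move=> c; exists (fun=> c%:P), c%:P.
    by split=> [|i|]; rewrite ?hornerC //; apply: reduces_cst.
  - move=> f g a b [P [p [hP hf ->]]] [Q [q [hQ hg ->]]].
    exists (fun i => P i + Q i), (p + q).
    by split=> [|i|]; rewrite ?hornerD ?hf ?hg //; apply: reducesD.
  - move=> f g a b [P [p [hP hf ->]]] [Q [q [hQ hg ->]]].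
    exists (fun i => P i * Q i), (p * q).
    by split=> [|i|]; rewrite ?hornerM ?hf ?hg //; apply: reducesM.
  - move=> f a b [P [p [hP hf ->]]] [Q [q [hQ hg ->]]].
    apply/eqP; rewrite -subr_eq0 -hornerN -hornerD; apply/eqP.
    apply: (hxi (fun i => P i - Q i)); first exact: reducesB.
    by move=> i; rewrite hornerD hornerN -hf -hg subrr.
split.
  exists (fun=> 'X), 'X.
  by split=> [|i|]; rewrite ?hornerX //; apply: reduces_cst.
move=> f a hf; exists (fun i => (f i)%:P), a%:P.
by split=> [|i|]; rewrite ?hornerC //; apply: reducesC.
Qed.

Section Maximal.
Variable Phi : (I -> K) -> K -> Prop.
Hypothesis hPhi : partial_hom Phi.
Hypothesis Pmax : forall Psi, partial_hom Psi ->
  (forall f a, Phi f a -> Psi f a) -> forall f a, Psi f a -> Phi f a.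

Let max_adjoin x xi :
  (forall P p, reduces Phi P p -> (forall i, (P i).[x i] = 0) -> p.[xi] = 0) ->
  Phi x xi.
Proof.
by move=> /(partial_hom_adjoin hPhi) [Psi hPsi [hx sub]]; apply: Pmax sub _ _ hx.
Qed.

(** The obstruction in Chevalley's theorem: the constant coefficient tends to 1 and all others to 0,
    so no finite value of x is compatible with such a relation. *)
Let relation x := exists2 P, reduces Phi P 1 & forall i, (P i).[x i] = 0.

(** The reductions of the relations of x form an ideal of [K[X]]. If it contains no nonzero
    constant, a nonzero member of least degree has a root in the algebraically closed field and
    divides all the others; this root is a consistent value. *)
Let value_or_relation x : (exists c, Phi x c) \/ relation x.
Proof.
have [hrel|nrel] := pselect (relation x); [by right | left].
pose J p := exists2 P, reduces Phi P p & forall i, (P i).[x i] = 0.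
have [[p0 [p0n0 Jp0]]|] := pselect (exists p, p != 0 /\ J p); last first.
  move=> h; exists 0; apply: max_adjoin => P p hP hx; have [->|p0] := eqVneq p 0.
    by rewrite horner0.
  by case: h; exists p; split=> //; exists P.
have [m] := ubnP (size p0); elim: m => // m IH in p0 p0n0 Jp0 *; rewrite ltnS => sm.
have [[q [q0 Jq sq]]|min] :=
    pselect (exists q, [/\ q != 0, J q & (size q < size p0)%N]).
  by apply: (IH q) => //; apply: leq_trans sq sm.
have [s1|s1] := eqVneq (size p0) 1%N.
  have [c c0 p0E] := size_poly1P _ (introT eqP s1).
  case: nrel; case: Jp0 => P hP hx; exists (fun i => c^-1 *: P i).
    by have := reducesZ hPhi (phC hPhi c^-1) hP; rewrite p0E scale_polyC mulVf.
  by move=> i; rewrite hornerZ hx mulr0.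
have [xi /eqP rxi] := closed_rootP p0 s1.
exists xi; apply: max_adjoin => P p hP hx.
rewrite (divp_eq p p0) hornerD hornerM rxi mulr0 add0r.
have [->|r0] := eqVneq (p %% p0) 0; first by rewrite horner0.
case: min; exists (p %% p0); split=> //; last by rewrite ltn_modp.
case: Jp0 => P0 hP0 hx0; exists (fun i => P i - (p %/ p0) * P0 i).
  have := reducesB hPhi hP (reducesM hPhi (reduces_cst hPhi (p %/ p0)) hP0).
  by rewrite {2}(divp_eq p p0) [X in X - _]addrC addrK.
by move=> i; rewrite hornerD hornerN hornerM hx hx0 mulr0 subrr.
Qed.

Let max_inv a al : Phi a al -> al != 0 -> Phi (fun i => (a i)^-1) al^-1.
Proof.
move=> ha al0; apply: max_adjoin => P p hP hx.
case: (hP) => [[d hd] hk]; pose e := maxn d (size p).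
suff: p.[al^-1] * al ^+ e.+1 = 0.
  by move/eqP; rewrite mulf_eq0 expf_eq0 (negPf al0) andbF orbF => /eqP.
rewrite (horner_coef_wide _ (leq_maxr d _)) -/e big_distrl /=.
apply: (ph_inj hPhi (f := fun=> 0)); last exact: phC.
apply: (ph_ext (ph_sum hPhi (index_enum _) (P := predT)
  (fun (j : 'I_e) _ => phM hPhi (hk j) (phX hPhi (e.+1 - j) ha)))).
  move=> i; have := hx i; rewrite (horner_coef_wide _ (leq_trans (hd i) (leq_maxl _ (size p)))) -/e.
  move/(congr1 (fun z => z * a i ^+ e.+1)); rewrite mul0r big_distrl /= => h.
  rewrite -[RHS]h; apply: eq_bigr => j _; rewrite -mulrA; congr (_ * _).
  (* Where [a i] vanishes both sides are 0, since all the exponents [e.+1 - j] are positive. *)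
  have [->|ai0] := eqVneq (a i) 0; first by rewrite !expr0n subn_eq0 ltnNge ltnW //= mulr0.
  rewrite expfB; last exact: leq_trans (ltn_ord j) (leqnSn _).
  by rewrite exprVn mulrC.
apply: eq_bigr => j _; rewrite -mulrA; congr (_ * _).
rewrite expfB; last exact: leq_trans (ltn_ord j) (leqnSn _).
by rewrite exprVn mulrC.
Qed.

(** At an index where e is 0 a relation reads [P(0) = 0], and where e is 1 it reads [P(0) + M = 0].
    So the product of [P(0)] and [P(0) + M] vanishes identically, although it tends to 1. *)
Let max_idem e : (forall i, e i * e i = e i) -> exists c, Phi e c.
Proof.
move=> he; case: (value_or_relation e) => // -[P [[d hd] hk] hx]; exfalso.
pose M i := \sum_(k < d) (P i)`_k.+1.
have hM : Phi M 0.
  have := ph_sum hPhi (index_enum _) (P := predT) (fun (k : 'I_d) _ => hk k.+1).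
  move/ph_ext; apply=> //; rewrite big1 // => k _; by rewrite coef1.
have h0 := hk 0%N; rewrite coef1 eqxx in h0.
suff: (1 : K) * (1 + 0) = 0 by rewrite addr0 mulr1; apply/eqP; rewrite oner_eq0.
apply: (ph_inj hPhi (f := fun=> 0)); last exact: phC.
apply: (ph_ext (phM hPhi h0 (phD hPhi h0 hM))) => // i.
have := hx i; rewrite (horner_coef_wide _ (leq_trans (hd i) (leqnSn d))) big_ord_recl expr0 mulr1.
have /eqP := he i; rewrite -subr_eq0 -{3}[e i]mulr1 -mulrBr mulf_eq0 subr_eq0.
case/orP=> /eqP ->.
  rewrite big1 ?addr0 => [->|k _]; first by rewrite mul0r.
  by rewrite expr0n mulr0.
under eq_bigr do rewrite expr1n mulr1.
by rewrite /M => ->; rewrite mulr0.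
Qed.

Let relation_bound x d := exists P, [/\ reduces Phi P 1,
  forall i, (size (P i) <= d)%N & forall i, (P i).[x i] = 0].

(** The elimination in Chevalley's theorem: the relation of smaller degree, made into one for x by
    reversing its coefficients, cancels the leading term of the other one. That leading coefficient
    is infinitesimal, so the reduction 1 is preserved. *)
Let no_two_relations m x d d' : (d + d' < m)%N ->
  relation_bound x d -> relation_bound (fun i => (x i)^-1) d' -> False.
Proof.
elim: m => // m IH in x d d' *; rewrite ltnS => ledm.
wlog led : x d d' ledm / (d' <= d)%N.
  move=> H hx hy; case: (leqP d' d) => hd; first exact: H hd hx hy.
  apply: (H (fun i => (x i)^-1) d' d _ (ltnW hd) hy); first by rewrite addnC.
  by under [fun i => _]funext => i do rewrite invrK.
move=> [P [hP hsP hxP]] [Q [hQ hsQ hxQ]].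
have hP0 := hP.2 0%N; have hQ0 := hQ.2 0%N; rewrite coef1 /= in hP0 hQ0.
case: d' => [|[|d']] in ledm led Q hQ hQ0 hsQ hxQ *.
- have: (1 : K) = 0; last by apply/eqP; rewrite oner_eq0.
  apply: (ph_inj hPhi) hQ0 _; apply: (ph_ext (phC hPhi 0)) => // i.
  by have := hsQ i; rewrite leqn0 size_poly_eq0 => /eqP ->; rewrite coef0.
- have: (1 : K) = 0; last by apply/eqP; rewrite oner_eq0.
  apply: (ph_inj hPhi) hQ0 _; apply: (ph_ext (phC hPhi 0)) => // i.
  by have := hxQ i; rewrite {1}(size1_polyC (hsQ i)) hornerC.
case: d => [//|[//|d]] in ledm led P hP hP0 hsP hxP *.
rewrite !ltnS in led.
pose Rev i := \poly_(k < d'.+2) (Q i)`_(d'.+1 - k).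
pose m0 i := (P i)`_0; pose md i := (P i)`_d.+1; pose n0 i := (Q i)`_0.
(* The factor [m0] takes care of the indices with x = 0, where [Rev] need not vanish: there
   [m0 = P(0) = 0]. *)
pose S i := (m0 i * n0 i) *: P i - ((m0 i * md i) *: 'X^(d - d')) * Rev i.
apply: (IH x d.+1 d'.+2); first by rewrite -addSn.
  exists S; split.
  - have hmd : Phi md 0 by apply: ph_ext (hP.2 d.+1) _ _; rewrite // coef1.
    have hRev : reduces Phi Rev 'X^(d'.+1).
      split=> [|k]; first by exists d'.+2 => i; apply: size_poly.
      have := hQ.2 (d'.+1 - k)%N; case: (ltnP k d'.+2) => hk; last first.
        move=> _; apply: (ph_ext (phC hPhi 0)) => [i|].
          by rewrite coef_poly ltnNge hk.
        by rewrite coefXn gtn_eqF.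
      move/ph_ext; apply=> [i|]; first by rewrite coef_poly hk.
      by rewrite coef1 coefXn subn_eq0 eqn_leq (hk : (k <= d'.+1)%N).
    have e1 (u v : {poly K}) : (1 * 1) *: (1 : {poly K}) - ((1 * 0) *: u) * v = 1.
      by rewrite [1 * 1]mulr1 [1 * 0]mulr0 scale0r mul0r subr0 scale1r.
    have := (reducesB hPhi (reducesZ hPhi (phM hPhi hP0 hQ0) hP) (reducesM hPhi
      (reducesZ hPhi (phM hPhi hP0 hmd) (reduces_cst hPhi 'X^(d - d'))) hRev)).
    by rewrite e1.
  - move=> i; apply/leq_sizeP => k hk; rewrite /S coefB !coefZ -scalerAl coefZ coefXnM.
    have -> : (k < d - d')%N = false by apply/negbTE; rewrite -leqNgt (leq_trans (leq_subr _ _)) // ltnW.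
    rewrite coef_poly; case: (eqVneq k d.+1) => [->|nk].
      rewrite subSn ?leq_subr // subKn // ltnSn subnn.
      by rewrite -/(md i) -/(n0 i) mulrAC subrr.
    have ltk : (d.+1 < k)%N by rewrite ltn_neqAle eq_sym nk.
    rewrite (_ : (k - (d - d') < d'.+2)%N = false).
      rewrite [(P i)`_k]nth_default ?mulr0 ?subrr //; exact: leq_trans (hsP i) ltk.
    by apply/negbTE; rewrite -leqNgt leq_subRL ?(leq_trans (leq_subr _ _)) // ?addnS ?subnK ?ltnS // ltnW // ltnW.
  - move=> i; rewrite /S hornerD hornerN hornerZ hxP mulr0 -scalerAl hornerZ hornerM hornerXn.
    have [x0|x0] := eqVneq (x i) 0.
      by have := hxP i; rewrite x0 horner_coef0 /m0 => ->; rewrite !mul0r subr0.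
    suff -> : (Rev i).[x i] = 0 by rewrite !mulr0 subr0.
    have h := hxQ i; rewrite (horner_coef_wide _ (hsQ i)) in h.
    rewrite horner_poly (reindex_inj rev_ord_inj) /=.
    rewrite -[RHS](mulr0 (x i ^+ d'.+1)) -[X in _ = _ * X]h big_distrr /=; apply: eq_bigr => k _.
    rewrite subSS subKn -1?ltnS //; rewrite [RHS]mulrCA; congr (_ * _).
    by rewrite exprVn expfB_cond // (negPf x0) add0n -ltnS.
by exists Q.
Qed.

(** If f has no value then its inverse has one, and this value is 0 since otherwise [max_inv] would
    give f a value. *)
Lemma maximal_place : place Phi.
Proof.
split=> // f; case: (value_or_relation f) => [|hrel]; first by left.
case: (value_or_relation (fun i => (f i)^-1)) => [[c hc]|hrel']; last first.
  case: hrel hrel' => P hP hx [Q hQ hy].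
  case: (hP) (hQ) => -[d hd] _ [[d' hd'] _]; exfalso.
  by apply: (@no_two_relations _ f d d' (leqnn _)); [exists P | exists Q].
have [c0|c0] := eqVneq c 0; last first.
  left; exists c^-1; have := max_inv hc c0.
  by under [fun i => _^-1]funext => i do rewrite invrK.
right; split; first by rewrite -c0.
(* [f / f] is idempotent, so it has a value [e]. Where f vanishes its relation reads [P(0) = 0];
   hence the product of [P(0)] and [1 - f / f] is identically 0, and [e = 1]. *)
have [e he] : exists c, Phi (fun i => f i / f i) c.
  by apply: max_idem => i; have [->|fi] := eqVneq (f i) 0; rewrite ?mul0r // divff // mulr1.
suff: 1 * (1 - e) = 0 :> K by rewrite mul1r => /eqP; rewrite subr_eq0 => /eqP e1; rewrite e1.
case: hrel => P [_ hk] hx; have h0 := hk 0%N; rewrite coef1 /= in h0.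
apply: (ph_inj hPhi (f := fun=> 0)); last exact: phC.
apply: (ph_ext (phM hPhi h0 (phB hPhi (phC hPhi 1) he))) => // i.
have [fi|fi] := eqVneq (f i) 0; last by rewrite divff // subrr mulr0.
by have := hx i; rewrite fi horner_coef0 => ->; rewrite mul0r.
Qed.
End Maximal.

(** Chevalley's extension theorem: the union of a chain of consistent relations is consistent, so
    Zorn's lemma gives a maximal one. *)
Theorem place_extension Phi0 : partial_hom Phi0 ->
  exists2 Phi, place Phi & forall f a, Phi0 f a -> Phi f a.
Proof.
move=> h0; pose T := {Phi | partial_hom Phi /\ forall f a, Phi0 f a -> Phi f a}.
pose R (s t : T) := `[< forall f a, sval s f a -> sval t f a >].
have Rrefl t : R t t by apply/asboolP.
have Rtrans r s t : R r s -> R s t -> R r t.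
  by move=> /asboolP h1 /asboolP h2; apply/asboolP => f a /h1 /h2.
have Ranti s t : R s t -> R t s -> s = t.
  case: s t => [s hs] [t ht] /asboolP /= h1 /asboolP /= h2.
  apply: eq_exist; apply/funext => f; apply/funext => a; apply/propext.
  by split=> [/h1|/h2].
have Rchain (A : set T) : total_on A (fun s t => R s t) ->
    exists t, forall s, A s -> R s t.
  move=> tot; have [[s0 As0]|A0] := pselect (exists s, A s); last first.
    have h : partial_hom Phi0 /\ (forall f a, Phi0 f a -> Phi0 f a) by [].
    by exists (exist _ Phi0 h) => s As; case: A0; exists s.
  pose U f a := exists2 s, A s & sval s f a.
  have up s t : A s -> A t -> exists2 r, A r & R s r /\ R t r.
    by move=> As At; case: (tot s t As At) => h; [exists t | exists s].
  have hU : partial_hom U /\ forall f a, Phi0 f a -> U f a.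
    split; last by move=> f a hf; exists s0 => //; apply: (svalP s0).2.
    split.
    - by move=> c; exists s0 => //; apply: phC (svalP s0).1 _.
    - move=> f g a b [s As hs] [t At ht]; have [r Ar [/asboolP sr /asboolP tr]] := up _ _ As At.
      by exists r => //; apply: phD (svalP r).1 _ _ _ _ (sr _ _ hs) (tr _ _ ht).
    - move=> f g a b [s As hs] [t At ht]; have [r Ar [/asboolP sr /asboolP tr]] := up _ _ As At.
      by exists r => //; apply: phM (svalP r).1 _ _ _ _ (sr _ _ hs) (tr _ _ ht).
    - move=> f a b [s As hs] [t At ht]; have [r Ar [/asboolP sr /asboolP tr]] := up _ _ As At.
      exact: ph_inj (svalP r).1 _ _ _ (sr _ _ hs) (tr _ _ ht).
  by exists (exist _ U hU) => s As; apply/asboolP => f a hs; exists s.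
have [[Phi [hPhi sub]] hmax] := Zorn Rrefl Rtrans Ranti Rchain.
exists Phi => //; apply: maximal_place => // Psi hPsi PP f a hf.
have h : partial_hom Psi /\ (forall f a, Phi0 f a -> Psi f a).
  by split=> // g b /sub /PP.
have := hmax (exist _ Psi h) (introT (asboolP _) PP).
by move/(congr1 sval) => /= <-.
Qed.

End Places.

(** * The Zariski topology of products of projective lines *)


Lemma mpoly_ring_ind n (R : comNzRingType) (P : {mpoly R[n]} -> Prop) :
  (forall c, P c%:MP) -> (forall i, P 'X_i) ->
  (forall p q, P p -> P q -> P (p + q)) ->
  (forall p q, P p -> P q -> P (p * q)) -> forall p, P p.
Proof.
move=> hC hX hD hM; apply: mpolyind => [|c m p _ _ hp]; first by rewrite -mpolyC0.
apply: hD => //; rewrite -mul_mpolyC mpolyXE_id; apply: (hM) => //.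
apply: (big_ind P) => [||i _]; [by rewrite -mpolyC1 | exact: hM |].
by elim: (m i) => [|k IH]; rewrite ?expr0 -?mpolyC1 ?exprS //; apply: hM.
Qed.

(** * Negligible sets and limits along a place *)

Section PlaceMore.
Variables (K : closedFieldType) (I : Type) (Phi : (I -> K) -> K -> Prop).
Hypothesis hPhi : place Phi.
Let hom := hPhi.1.

Lemma place_neq01 (f : I -> K) : Phi f 1 -> Phi f 0 -> False.
Proof.
by move=> h1 h0; have := oner_eq0 K; rewrite (ph_inj hom h1 h0) eqxx.
Qed.

(** A place decides every property of the indices and so defines an ultrafilter; the value 1 of an
    indicator function means that the property holds near the place. *)
Lemma place_bool (b : I -> bool) :
  Phi (fun i => (b i)%:R) 1 \/ Phi (fun i => (b i)%:R) 0.
Proof.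
case: (hPhi.2 (fun i => (b i)%:R)) => [[c hc]|[_ h]].
  have /eqP : c = c * c.
    by apply: (ph_inj hom hc); apply: ph_ext (phM hom hc hc) _ _ => // i;
      case: (b i); rewrite ?mulr1 ?mulr0.
  rewrite -subr_eq0 -{1}[c]mulr1 -mulrBr mulf_eq0 subr_eq0.
  by case/orP=> /eqP e; [right|left]; rewrite e // in hc *; rewrite -e in hc *.
by left; apply: ph_ext h _ _ => // i; case: (b i); rewrite ?divr1 ?mul0r.
Qed.

(** A function supported on a negligible set cannot tend to infinity: its quotient by itself would
    tend to 1, but it is supported on the same set. *)
Lemma place_mul_negligible (f : I -> K) (b : I -> bool) :
  Phi (fun i => (b i)%:R) 0 -> Phi (fun i => f i * (b i)%:R) 0.
Proof.
move=> hb; case: (hPhi.2 (fun i => f i * (b i)%:R)) => [[c hc]|[_ h]].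
  apply: ph_ext (phM hom hc hb) _ _ => [i|]; last by rewrite mulr0.
  by case: (b i); rewrite ?mulr1 ?mulr0.
exfalso; apply: (@place_neq01 _ h); apply: ph_ext (phM hom h hb) _ _ => [i|].
  by case: (b i); rewrite ?mulr1 ?mulr0 ?mul0r.
by rewrite mulr0.
Qed.

Lemma place_ae (f g : I -> K) (b : I -> bool) c :
  Phi (fun i => (b i)%:R) 1 -> (forall i, b i -> f i = g i) -> Phi f c -> Phi g c.
Proof.
move=> hb fg hf.
have nb : Phi (fun i => (~~ b i)%:R) 0.
  apply: ph_ext (phB hom (phC hom 1) hb) _ _ => [i|]; last by rewrite subrr.
  by case: (b i); rewrite ?subrr ?subr0.
apply: ph_ext (phD hom hf (place_mul_negligible (fun i => g i - f i) nb)) _ _ => [i|].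
  case bi: (b i) => /=; last by rewrite mulr1 addrC subrK.
  by rewrite mulr0 addr0 fg.
by rewrite addr0.
Qed.

Lemma place_bool_le (a b : I -> bool) : (forall i, a i -> b i) ->
  Phi (fun i => (a i)%:R) 1 -> Phi (fun i => (b i)%:R) 1.
Proof.
move=> ab ha; apply: (@place_ae (fun=> 1) _ a) (phC hom 1) => // i /ab.
by move=> ->.
Qed.

Lemma place_bool_all (T : finType) (b : T -> I -> bool) :
  (forall t, Phi (fun i => (b t i)%:R) 1) ->
  Phi (fun i => [forall t, b t i]%:R) 1.
Proof.
move=> hb; have := ph_prod hom (index_enum T) (P := predT) (fun t _ => hb t).
move/ph_ext; apply=> [i|]; last by rewrite big1.
case: forallP => [h|h]; first by rewrite big1 // => t _; rewrite h.
have [t ht] : exists t, ~~ b t i by apply/existsP; rewrite -negb_forall; apply/forallP.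
by rewrite (bigD1 t) //= (negPf ht) mul0r.
Qed.

(** The first clause keeps [h] in the chart around [l]; outside it [odflt 0] yields a meaningless
    0. *)
Definition limit_P1 (h : I -> option K) (l : option K) : Prop :=
  Phi (fun i => (coord_P1 l (h i) != None)%:R) 1 /\
  Phi (fun i => odflt 0 (coord_P1 l (h i))) (odflt 0 l).

(** Completeness of the projective line: a function without finite limit has an inverse that tends
    to 0. *)
Lemma limit_P1_exists h : exists l, limit_P1 h l.
Proof.
pose g i := odflt 0 (h i).
have einv i : odflt 0 (inv_P1 (h i)) = (g i)^-1.
  rewrite /g; case: (h i) => [z|] /=; last by rewrite invr0.
  by case: eqVneq => [->|_] //=; rewrite invr0.
case: (place_bool (fun i => h i == None)) => hb.
  exists None; split => /=.
    by apply: place_bool_le hb => i /eqP ->.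
  apply: (place_ae (f := fun=> 0) hb _ (phC hom 0)) => i /eqP hi.
  by rewrite hi.
have hb1 : Phi (fun i => (h i != None)%:R) 1.
  apply: ph_ext (phB hom (phC hom 1) hb) _ _ => [i|]; last by rewrite subr0.
  by case: (h i == None); rewrite ?subrr ?subr0.
case: (hPhi.2 g) => [[c hc]|[h0 h1]]; first by exists (Some c); split.
exists None; split => /=; last by apply: ph_ext h0 _ _.
apply: (place_ae (f := fun i => g i / g i) hb1 _ h1) => i.
rewrite /g; case: (h i) => [z _|//]; rewrite /inv_P1 /=.
by case: (eqVneq z 0) => [->|z0]; [rewrite mul0r | rewrite divff].
Qed.

Lemma limit_P1_unique h l l' : limit_P1 h l -> limit_P1 h l' -> l = l'.
Proof.
have key b : limit_P1 h (Some b) -> limit_P1 h None -> False.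
  move=> [/= h1 h2] [/= h3 h4].
  have h5 := phM hom h1 h3; rewrite mulr1 in h5; apply: (place_neq01 h5).
  apply: ph_ext (phM hom h2 h4) _ _ => [i|]; last by rewrite mulr0.
  case: (h i) => [z|] /=; rewrite ?mul0r //.
  by case: eqVneq => [->|z0] /=; rewrite ?mulr0 // mulfV // mulr1.
case: l l' => [a|] [b|] //; try by move=> h1 h2; case: (key _ h1 h2); case: (key _ h2 h1).
- by move=> [_ h1] [_ h2]; congr Some; exact: (ph_inj hom (f := fun i => odflt 0 (h i)) h1 h2).
- by move=> h1 h2; case: (key _ h2 h1).
Qed.

End PlaceMore.

Section Topology.
Variables (K : closedFieldType) (Q : finType).
Notation P1 := (P1prod K Q).
Implicit Types (x y z w : P1) (V W A B : set P1).

Definition crd x y q : K := odflt 0 (coord_P1 (x q) (y q)).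

Lemma evX x q y : ev x 'X_(enum_rank q) y = crd x y q.
Proof. by rewrite /ev mevalXU enum_rankK. Qed.
Lemma evC x c y : ev x c%:MP y = c. Proof. exact: mevalC. Qed.
Lemma evD x p q y : ev x (p + q) y = ev x p y + ev x q y. Proof. exact: mevalD. Qed.
Lemma evB x p q y : ev x (p - q) y = ev x p y - ev x q y. Proof. exact: mevalB. Qed.
Lemma evM x p q y : ev x (p * q) y = ev x p y * ev x q y. Proof. exact: mevalM. Qed.
Lemma ev1 x y : ev x 1 y = 1. Proof. exact: meval1. Qed.
Lemma evXn x p k y : ev x (p ^+ k) y = ev x p y ^+ k. Proof. exact: rmorphXn. Qed.
Lemma ev_prod (J : Type) (r : seq J) (P : pred J) F x y :
  ev x (\prod_(j <- r | P j) F j) y = \prod_(j <- r | P j) ev x (F j) y.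
Proof. exact: rmorph_prod. Qed.

Lemma in_chart_refl x : in_chart x x.
Proof. by apply/forallP => q; case: (x q). Qed.

Lemma in_chartP x y q : in_chart x y -> coord_P1 (x q) (y q) != None.
Proof. by move/forallP. Qed.

(** The factor [c] is a power of the product [u] of the coordinates inverted between the charts. It
    clears denominators, and in the new chart it vanishes exactly outside the old one. *)
Lemma chart_change x y p : in_chart x y -> exists (p' : {mpoly K[#|Q|]}) (c : P1 -> K),
  forall z, in_chart y z ->
    ev y p' z = c z * (if in_chart x z then ev x p z else 0) /\
    (in_chart x z -> c z != 0).
Proof.
(* As y lies in the chart around x, finite coordinates of x are finite at y; only coordinates that
   are infinite at x and finite at y change. *)
move=> xy; pose bad q := (x q == None) && (y q != None).
pose u := \prod_(q | bad q) ('X_(enum_rank q) : {mpoly K[#|Q|]}).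
have good z q : ~~ bad q -> coord_P1 (x q) (z q) = coord_P1 (y q) (z q).
  have := in_chartP q xy; rewrite /bad.
  by case: (x q) (y q) => [a|] [b|].
have badE z q : bad q -> coord_P1 (x q) (z q) = inv_P1 (z q) /\
    coord_P1 (y q) (z q) = z q.
  by rewrite /bad; case: (x q) (y q) => [a|] [b|].
have uE z : ev y u z = \prod_(q | bad q) crd y z q.
  by rewrite /u ev_prod; apply: eq_bigr => q _; rewrite evX.
have u0 z : in_chart y z -> in_chart x z -> ev y u z != 0.
  move=> yz xz; rewrite uE; apply/prodf_neq0 => q bq.
  rewrite /crd (badE z q bq).2; have := in_chartP q xz; rewrite (badE z q bq).1.
  have := in_chartP q yz; rewrite (badE z q bq).2.
  by case: (z q) => [a|//] _ /=; case: (eqVneq a 0).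
suff [d [p' hp']] : exists d p', forall z, in_chart y z -> in_chart x z ->
    ev y p' z = ev y u z ^+ d * ev x p z.
  exists (p' * u), (fun z => ev y u z ^+ d.+1) => z yz; split; last first.
    by move=> xz; rewrite expf_neq0 // u0.
  rewrite evM; case: ifP => xz; first by rewrite hp' // exprSr mulrAC.
  rewrite mulr0; suff -> : ev y u z = 0 by rewrite mulr0.
  have /forallPn [q] : ~~ in_chart x z by rewrite xz.
  rewrite negbK => /eqP hq; have bq : bad q.
    by apply: contraT => /good gq; have := in_chartP q yz; rewrite -gq hq.
  rewrite uE (bigD1 q) //= /crd (badE z q bq).2; move: hq; rewrite (badE z q bq).1.
  by case: (z q) => //= a; case: eqVneq => // -> _; rewrite mul0r.
elim/mpoly_ring_ind: p => [c|i|p q [d [p' hp]] [e [q' hq]]|p q [d [p' hp]] [e [q' hq]]].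
- by exists 0%N, c%:MP => z _ _; rewrite !evC mul1r.
- rewrite -(enum_valK i); move: (enum_val i) => q.
  case bq: (bad q); last first.
    exists 0%N, 'X_(enum_rank q) => z _ _.
    by rewrite !evX mul1r /crd good ?bq.
  exists 1%N, (\prod_(j | bad j && (j != q)) 'X_(enum_rank j)) => z yz xz.
  rewrite ev_prod expr1 uE [in RHS](bigD1 q) //= evX [crd x z q]/crd (badE z q bq).1.
  rewrite {1}/crd (badE z q bq).2; have := in_chartP q xz; rewrite (badE z q bq).1.
  have := in_chartP q yz; rewrite (badE z q bq).2; case: (z q) => //= a _.
  case: (eqVneq a 0) => [->|a0 _]; rewrite ?eqxx //= mulrAC mulfV // mul1r.
  by apply: eq_bigr => j _; rewrite evX.
- exists (d + e)%N, (p' * u ^+ e + q' * u ^+ d) => z yz xz.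
  by rewrite !evD !evM !evXn hp // hq // exprD; ring.
- exists (d + e)%N, (p' * q') => z yz xz.
  by rewrite !evM hp // hq // exprD; ring.
Qed.

Lemma sub_zclosure V : (V `<=` zclosure V)%classic.
Proof. by move=> x Vx p; apply => //; apply: in_chart_refl. Qed.

Lemma zclosureS V W : (V `<=` W -> zclosure V `<=` zclosure W)%classic.
Proof. by move=> VW x Vx p hp; apply: Vx => y /VW; apply: hp. Qed.

Definition basic_closed x p : set P1 := [set y | in_chart x y -> ev x p y = 0].

Lemma zclosed_basic x p : zclosed (basic_closed x p).
Proof.
move=> y hy xy; have [p' [c hc]] := chart_change p xy.
have [/= e1 c0] := hc y (in_chart_refl y).
have : ev y p' y = 0.
  apply: hy => z hz yz; rewrite (hc z yz).1; case: ifP => [xz|_]; last exact: mulr0.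
  by rewrite hz // mulr0.
by rewrite e1 xy => /eqP; rewrite mulf_eq0 (negPf (c0 xy)) => /eqP.
Qed.

Lemma zclosureK V : zclosed (zclosure V).
Proof.
move=> x hx p hp; apply: hx => y hy xy.
by apply: (zclosed_basic (zclosureS (W := basic_closed x p) _ hy)) xy => z Vz xz; apply: hp.
Qed.

Lemma zclosure_min V A : zclosed A -> (V `<=` A)%classic -> (zclosure V `<=` A)%classic.
Proof. by move=> cA VA x /(zclosureS VA) /cA. Qed.

Lemma notin_zclosure V x : ~ zclosure V x -> exists2 p,
  forall y, V y -> in_chart x y -> ev x p y = 0 & ev x p x != 0.
Proof.
move=> h; apply: contrapT => n; apply: h => p hp; apply: contrapT => /eqP px.
by apply: n; exists p.
Qed.

Lemma zclosedU A B : zclosed A -> zclosed B -> zclosed (A `|` B)%classic.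
Proof.
move=> cA cB x hx; apply: contrapT => /not_orP [nA nB].
have [p hp px] : exists2 p, forall y, A y -> in_chart x y -> ev x p y = 0 & ev x p x != 0.
  by apply: notin_zclosure => /cA.
have [q hq qx] : exists2 p, forall y, B y -> in_chart x y -> ev x p y = 0 & ev x p x != 0.
  by apply: notin_zclosure => /cB.
have : ev x (p * q) x = 0.
  by apply: hx => y [Ay|By] xy; rewrite evM; [rewrite hp // mul0r | rewrite hq // mulr0].
by rewrite evM => /eqP; rewrite mulf_eq0 (negPf px) (negPf qx).
Qed.

Lemma zclosed0 : zclosed (@set0 P1).
Proof. by move=> x /(_ 1) h; have := oner_eq0 K; rewrite -(ev1 x x) h ?eqxx. Qed.

Lemma irreducible_zclosure V : irreducible V -> irreducible (zclosure V).
Proof.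
move=> [[x Vx] irr]; split; first by exists x; apply: sub_zclosure.
move=> A B cA cB VAB.
have /(irr A B cA cB) [] : (V `<=` A `|` B)%classic by move=> y /sub_zclosure /VAB.
- by move=> VA; left; apply: zclosure_min.
- by move=> VB; right; apply: zclosure_min.
Qed.

Lemma component_zclosed V W : zclosed V -> irreducible_component V W -> zclosed W.
Proof.
move=> cV [WV iW maxW]; have e : zclosure W = W.
  by apply: maxW; [apply: irreducible_zclosure | apply: zclosure_min | apply: sub_zclosure].
by move=> x; rewrite e.
Qed.

Lemma irreducible_dense V x p y0 : irreducible V -> V y0 -> in_chart x y0 ->
  ev x p y0 != 0 ->
  (V `<=` zclosure [set y | V y /\ (in_chart x y /\ ev x p y != 0)])%classic.
Proof.
move=> [_ irr] Vy0 xy0 py0; set A := zclosure _.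
have /irr [||//|h] : (V `<=` A `|` basic_closed x p)%classic.
- move=> y Vy; have [h|h] := pselect (in_chart x y /\ ev x p y != 0).
    by left; apply: sub_zclosure.
  right=> xy; apply: contrapT => /eqP py; exact: h.
- exact: zclosureK.
- exact: zclosed_basic.
- by move: py0; rewrite (h y0 Vy0 xy0) eqxx.
Qed.

Lemma irreducible_image M (V : set ('I_M -> K)) (m : ('I_M -> K) -> P1) :
  V !=set0%classic ->
  (forall p q : {mpoly K[M]}, (forall v, V v -> p.@[v] * q.@[v] = 0) ->
    (forall v, V v -> p.@[v] = 0) \/ (forall v, V v -> q.@[v] = 0)) ->
  (forall x p, exists p' : {mpoly K[M]}, forall v, V v ->
    (p'.@[v] = 0 <-> (in_chart x (m v) -> ev x p (m v) = 0))) ->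
  irreducible [set m v | v in V]%classic.
Proof.
move=> [v0 Vv0] prime reg; split; first by exists (m v0), v0.
move=> A B cA cB VAB; apply: contrapT => /not_orP [nA nB].
have sep C : zclosed C -> ~ ([set m v | v in V] `<=` C)%classic ->
    exists2 p : {mpoly K[M]}, forall v, V v -> C (m v) -> p.@[v] = 0 &
      exists2 v, V v & p.@[v] != 0.
  move=> cC; move/existsNP => [_ /not_implyP [[v Vv <-] nC]].
  have [p hp px] : exists2 p, forall y, C y -> in_chart (m v) y -> ev (m v) p y = 0
      & ev (m v) p (m v) != 0 by apply: notin_zclosure => /cC.
  have [p' hp'] := reg (m v) p; exists p'.
    by move=> v' Vv' Cv'; apply/(hp' _ Vv') => h; apply: hp.
  exists v => //; apply/eqP => /(hp' _ Vv) /(_ (in_chart_refl _)) e.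
  by rewrite e eqxx in px.
have [p hp [v Vv pv]] := sep A cA nA; have [q hq [v' Vv' qv']] := sep B cB nB.
have [|h|h] := prime p q.
- move=> u Vu; have [Au|Bu] : (A `|` B)%classic (m u) by apply: VAB; exists u.
    by rewrite hp // mul0r.
  by rewrite hq // mulr0.
- by move: pv; rewrite h ?eqxx.
- by move: qv'; rewrite h ?eqxx.
Qed.

(** Membership in the closure is what makes evaluation at [w] well defined on the functions
    [ev w p (m i)]; a place extending it plays the role of a curve tending to [w]. Values outside
    the chart around [w] are left free, which makes those indices negligible. *)
Lemma closure_place (I : Type) (m : I -> P1) w : zclosure (range m) w ->
  exists2 Phi : (I -> K) -> K -> Prop, place Phi & forall p f,
    (forall i, in_chart w (m i) -> f i = ev w p (m i)) -> Phi f (ev w p w).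
Proof.
move=> hw; pose Phi0 (f : I -> K) c := exists2 p,
  forall i, in_chart w (m i) -> f i = ev w p (m i) & c = ev w p w.
have [|Phi hPhi sub] := @place_extension K I Phi0.
  split.
  - by move=> c; exists c%:MP => *; rewrite evC.
  - move=> f g a b [p hp ->] [q hq ->]; exists (p + q) => [i wi|]; rewrite evD //.
    by rewrite hp // hq.
  - move=> f g a b [p hp ->] [q hq ->]; exists (p * q) => [i wi|]; rewrite evM //.
    by rewrite hp // hq.
  - move=> f a b [p hp ->] [q hq ->]; apply/eqP; rewrite -subr_eq0 -evB; apply/eqP.
    by apply: hw => _ [i _ <-] wi; rewrite evB -hp // -hq // subrr.
by exists Phi => // p f h; apply: sub; exists p.
Qed.

(** Polynomials in the chart around [w] converge to their values at [w], so one that vanishes on [V]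
    has the limit 0. *)
Lemma place_closure (I : Type) (m : I -> P1) (V : set P1) w
    (Phi : (I -> K) -> K -> Prop) : place Phi -> (forall i, V (m i)) ->
  (forall q, limit_P1 Phi (fun i => m i q) (w q)) -> zclosure V w.
Proof.
move=> hPhi Vm hq p hp; have hom := hPhi.1.
have hchart : Phi (fun i => (in_chart w (m i))%:R) 1.
  apply: (place_bool_all hPhi (b := fun q i => coord_P1 (w q) (m i q) != None)).
  by move=> q; apply: (hq q).1.
have hev r : Phi (fun i => ev w r (m i)) (ev w r w).
  elim/mpoly_ring_ind: r => [c|i|r s hr hs|r s hr hs].
  - by apply: ph_ext (phC hom c) _ _ => [i|]; rewrite evC.
  - rewrite -(enum_valK i); apply: ph_ext (hq (enum_val i)).2 _ _ => [j|]; rewrite evX //.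
    by rewrite /crd; case: (w _).
  - by apply: ph_ext (phD hom hr hs) _ _ => [i|]; rewrite evD.
  - by apply: ph_ext (phM hom hr hs) _ _ => [i|]; rewrite evM.
apply: (ph_inj hom (hev p)).
by apply: (place_ae hPhi hchart _ (phC hom 0)) => i wi; rewrite hp.
Qed.

Lemma closure_place_limit (I : Type) (m : I -> P1) w (Phi : (I -> K) -> K -> Prop) :
  place Phi -> (forall p f,
    (forall i, in_chart w (m i) -> f i = ev w p (m i)) -> Phi f (ev w p w)) ->
  forall q, limit_P1 Phi (fun i => m i q) (w q).
Proof.
move=> hPhi h q; split.
  apply: ph_ext (h 1 (fun i => (coord_P1 (w q) (m i q) != None)%:R) _) _ _ => //.
    by move=> i wi; rewrite ev1 (in_chartP q wi).
  by rewrite ev1.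
apply: ph_ext (h 'X_(enum_rank q) (fun i => crd w (m i) q) _) _ _ => //.
  by move=> i wi; rewrite evX.
by rewrite evX /crd; case: (w q).
Qed.

End Topology.

(** Projections between products of complete lines are closed: along a place tending to x the
    remaining coordinates have limits too, and the limit point lies in the closed set [W]. *)
Lemma zclosed_pullback (K : closedFieldType) (Q Q' : finType) (e : Q -> Q')
    (W : set (P1prod K Q')) : zclosed W ->
  zclosed [set ([ffun q => w (e q)] : P1prod K Q) | w in W]%classic.
Proof.
move=> cW x hx; pose m (w : {w | W w}) : P1prod K Q := [ffun q => sval w (e q)].
have /closure_place [Phi hPhi hev] : zclosure (range m) x.
  by apply: zclosureS hx => _ [w Ww <-]; exists (exist _ w Ww).
have lim := closure_place_limit hPhi hev.
have /choice [l hl] q := limit_P1_exists hPhi (fun w : {w | W w} => sval w q).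
exists [ffun q => l q].
  apply: cW; apply: (place_closure (m := sval) hPhi) => [w|q]; first exact: svalP w.
  by rewrite ffunE.
apply/ffunP => q; rewrite !ffunE; apply: limit_P1_unique hPhi _ _ _ (hl (e q)) _.
rewrite (_ : (fun w => _) = (fun w => m w q)); first exact: lim.
by apply/funext => w; rewrite ffunE.
Qed.

(** * Hilbert's basis theorem and Nullstellensatz *)


Section Noetherian.
Variables (K : fieldType) (n : nat).
Implicit Types (J : set {mpoly K[n]}) (p q : {mpoly K[n]}).

Lemma nondecreasing_subsequence (u : nat -> nat) : exists phi : nat -> nat,
  (forall i j, (i < j)%N -> (phi i < phi j)%N) /\
  (forall i j, (i <= j)%N -> (u (phi i) <= u (phi j))%N).
Proof.
have tailmin N : exists i, (N <= i)%N /\ forall j, (i <= j)%N -> (u i <= u j)%N.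
  have [m] := ubnP (u N); elim: m N => // m IH N uN.
  have [[j [Nj uj]]|h] := pselect (exists j, (N <= j)%N /\ (u j < u N)%N).
    have [|i [ji hi]] := IH j; first exact: leq_trans uj uN.
    by exists i; split => //; apply: leq_trans Nj ji.
  exists N; split => // j Nj; rewrite leqNgt; apply/negP => uj; apply: h.
  by exists j.
have [f hf] := choice tailmin.
pose phi k := iter k (fun x => f x.+1) (f 0%N).
have phiS k : phi k.+1 = f (phi k).+1 by [].
have inc i j : (i < j)%N -> (phi i < phi j)%N.
  elim: j => // j IH; rewrite ltnS leq_eqVlt => /orP [/eqP ->|/IH h].
    by rewrite phiS; apply: (hf _).1.
  by apply: ltn_trans h _; rewrite phiS; apply: (hf _).1.
exists phi; split => // i j; rewrite leq_eqVlt => /orP [/eqP -> //|/inc h].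
by case: i h => [|i] h; rewrite ?phiS; apply: (hf _).2; rewrite -?phiS ltnW.
Qed.

Lemma dickson (m : nat -> 'X_{1..n}) : exists i j, (i < j)%N /\ (m i <= m j)%MM.
Proof.
suff [phi [inc h]] : exists phi : nat -> nat,
    (forall i j, (i < j)%N -> (phi i < phi j)%N) /\
    (forall (k : 'I_n), k \in enum 'I_n -> forall i j, (i <= j)%N -> (m (phi i) k <= m (phi j) k)%N).
  exists (phi 0%N), (phi 1%N); split; first exact: inc.
  by apply/mnm_lepP => k; apply: h; rewrite ?mem_enum.
elim: (enum 'I_n) => [|k s [phi [inc h]]]; first by exists id; split.
have [psi [inc' h']] := nondecreasing_subsequence (fun i => m (phi i) k).
exists (phi \o psi); split=> [i j ij|k']; first exact/inc/inc'.
rewrite inE => /orP [/eqP -> //|/h hk i j ij]; apply: hk.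
by move: ij; rewrite leq_eqVlt => /orP [/eqP -> //|/inc' /ltnW].
Qed.

Definition is_ideal J := [/\ J 0, forall p q, J p -> J q -> J (p + q) &
  forall p q, J q -> J (p * q)].

Lemma idealB J p q : is_ideal J -> J p -> J q -> J (p - q).
Proof. by move=> [_ D M] Jp Jq; apply: D => //; rewrite -mulN1r; apply: M. Qed.

Lemma ideal_sum J (T : Type) (r : seq T) (P : pred T) F : is_ideal J ->
  (forall t, P t -> J (F t)) -> J (\sum_(t <- r | P t) F t).
Proof. by move=> [J0 D _] h; apply: big_ind. Qed.

(* Hilbert's basis theorem, as an induction principle for the ascending chain
   condition. *)
Lemma noetherian_ind (P : set {mpoly K[n]} -> Prop) :
  (forall J, is_ideal J -> (forall J', is_ideal J' -> (J `<=` J')%classic ->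
     ~ (J' `<=` J)%classic -> P J') -> P J) ->
  forall J, is_ideal J -> P J.
Proof.
move=> step J0 iJ0; apply: contrapT => nP0.
pose T := {J | is_ideal J /\ ~ P J}.
have next (t : T) : exists t' : T,
    (sval t `<=` sval t')%classic /\ ~ (sval t' `<=` sval t)%classic.
  case: t => J [iJ nP] /=; apply: contrapT => h; apply: nP; apply: step => // J' iJ' s1 s2.
  apply: contrapT => nP'; apply: h.
  by exists (exist (fun J => is_ideal J /\ ~ P J) J' (conj iJ' nP')).
have [nx hnx] := choice next.
pose F k := sval (iter k nx (exist (fun J => is_ideal J /\ ~ P J) J0 (conj iJ0 nP0))).
have iF k : is_ideal (F k) by rewrite /F; case: (iter _ _ _) => /= J [].
have FS k : (F k `<=` F k.+1)%classic /\ ~ (F k.+1 `<=` F k)%classic by apply: hnx.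
have Fle i j : (i <= j)%N -> (F i `<=` F j)%classic.
  by move/subnK <-; elim: (j - i)%N => // d IH p /IH; rewrite addSn; apply: (FS _).1.
have pickf k : exists p, [/\ F k.+1 p, ~ F k p & forall q, F k.+1 q -> ~ F k q ->
    ~ (mlead q < mlead p)%O].
  have /existsNP [p /not_implyP [Fp nFp]] := (FS k).2.
  move: {-1}(mlead p) (erefl (mlead p)) => m; elim/(@ltmwf n): m p Fp nFp => m IH p Fp nFp mp.
  have [[q [Fq nFq lt]]|h] := pselect (exists q, [/\ F k.+1 q, ~ F k q & (mlead q < mlead p)%O]).
    by apply: (IH (mlead q) _ q) => //; rewrite -mp.
  by exists p; split=> // q Fq nFq lt; apply: h; exists q.
have [f hf] := choice pickf.
(* By Dickson's lemma the leading monomial of some [f j] is a multiple of that of an earlier [f i].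
   Subtracting a multiple of [f i], which lies in [F j], lowers the leading monomial and contradicts
   the minimal choice of [f j]. *)
have [i [j [ij le]]] := dickson (fun k => mlead (f k)).
have [Fi nFi _] := hf i; have [Fj nFj minj] := hf j.
have fi0 : f i != 0 by apply/eqP => e; apply: nFi; rewrite e; case: (iF i).
have fj0 : f j != 0 by apply/eqP => e; apply: nFj; rewrite e; case: (iF j).
pose m := (mlead (f j) - mlead (f i))%MM; pose c := mleadc (f j) / mleadc (f i).
pose r := (c *: 'X_[m]) * f i; pose q := f j - r.
have mE : (m + mlead (f i))%MM = mlead (f j) by apply: submK.
have lc0 : mleadc (f i) != 0 by rewrite mleadc_eq0.
have rj : r@_(mlead (f j)) = mleadc (f j).
  by rewrite /r -scalerAl mcoeffZ ['X_[m] * _]mulrC -{1}mE mcoeffMX /c divfK.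
have Fr : F j r.
  by apply: (Fle i.+1) => //; have [_ _ M] := iF i.+1; apply: M.
have Fq : F j.+1 q by apply: idealB => //; apply: (FS _).1.
have nFq : ~ F j q.
  by move=> h; apply: nFj; have [_ D _] := iF j; rewrite -[f j](subrK r); apply: D.
apply: (minj q Fq nFq).
have q0 : q != 0 by apply/eqP => e; apply: nFq; rewrite e; case: (iF j).
have r0 : c *: 'X_[m] != 0 :> {mpoly K[n]}.
  apply/eqP => e; move: rj; rewrite /r e mul0r mcoeff0 => /esym/eqP.
  by rewrite mleadc_eq0 (negPf fj0).
have mr : mlead r = mlead (f j).
  rewrite /r mleadM // mleadZ; first by rewrite mleadXm mE.
  by apply: contraNneq r0 => ->; rewrite scale0r.
rewrite Order.POrderTheory.lt_neqAle; apply/andP; split.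
  apply/eqP => e; have := q0; rewrite -mleadc_eq0 e mcoeffB rj.
  by rewrite subrr eqxx.
by apply: Order.POrderTheory.le_trans (mleadB_le _ _) _; rewrite mr Order.JoinTheory.joinxx.
Qed.

Section Decomposition.
Variables (X : Type) (e : X -> 'I_n -> K).
Implicit Types (U V : set X).

Definition vanishing V : set {mpoly K[n]} := [set p | forall v, V v -> p.@[e v] = 0]%classic.

Lemma vanishing_ideal V : is_ideal (vanishing V).
Proof.
split=> [v _|p q hp hq v Vv|p q hq v Vv]; first exact: meval0.
  by rewrite mevalD hp // hq // addr0.
by rewrite mevalM hq // mulr0.
Qed.

(** Primality of the vanishing ideal; the set itself need not be closed. The coordinates [e] allow
    both affine parameters and points of products of lines. *)
Definition prime_set V := V !=set0%classic /\
  forall p q, (forall v, V v -> p.@[e v] * q.@[e v] = 0) ->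
    vanishing V p \/ vanishing V q.

(** Noetherian induction on the vanishing ideal: if it is not prime, [V] is the union of its zero
    loci of p and of q, whose ideals are strictly larger. *)
Lemma prime_decomposition V : exists k (U : 'I_k -> set X),
  (forall i, prime_set (U i)) /\ (forall v, V v <-> exists i, U i v).
Proof.
suff H J : is_ideal J -> forall V, vanishing V = J -> exists k (U : 'I_k -> set X),
  (forall i, prime_set (U i)) /\ (forall v, V v <-> exists i, U i v).
  exact: H (vanishing_ideal V) _ erefl.
elim/noetherian_ind => {}J _ IH {}V VJ.
have [[v0 Vv0]|V0] := pselect (V !=set0)%classic; last first.
  exists 0%N, (fun _ => V); split=> [[]//|v]; split=> [Vv|[[]//]].
  by case: V0; exists v.
have [pV|npV] := pselect (prime_set V).
  by exists 1%N, (fun _ => V); split=> // v; split=> [|[]//]; exists ord0.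
have [p [q [hpq np nq]]] : exists p q, [/\ forall v, V v -> p.@[e v] * q.@[e v] = 0,
    ~ vanishing V p & ~ vanishing V q].
  apply: contrapT => h; apply: npV; split; first by exists v0.
  move=> p q hpq; apply: contrapT => /not_orP [np nq]; apply: h.
  by exists p, q.
have part r : ~ vanishing V r -> exists k (U : 'I_k -> set X),
    (forall i, prime_set (U i)) /\
    (forall v, (V v /\ r.@[e v] = 0) <-> exists i, U i v).
  move=> nr; apply: (IH (vanishing [set v | V v /\ r.@[e v] = 0]%classic)) => //.
  - exact: vanishing_ideal.
  - by rewrite -VJ => s hs v [Vv _]; apply: hs.
  - by rewrite -VJ => /(_ r) h; apply: nr; apply: h => v [].
have [k [U [hU eU]]] := part p np; have [l [W [hW eW]]] := part q nq.
exists (k + l)%N, (fun i => match split i with inl i => U i | inr i => W i end).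
split=> [i|v]; first by case: split.
split=> [Vv|]; last case=> i.
  have /eqP := hpq v Vv; rewrite mulf_eq0 => /orP [] /eqP e0.
    by have /eU [i Ui] : V v /\ p.@[e v] = 0 by []; exists (unsplit (inl i)); rewrite unsplitK.
  by have /eW [i Wi] : V v /\ q.@[e v] = 0 by []; exists (unsplit (inr i)); rewrite unsplitK.
by case: split => j h; [have /eU [] : exists i, U i v by exists j
                       |have /eW [] : exists i, W i v by exists j].
Qed.

(** [h] is a product of functions that vanish on the other parts but not on [U i0]. They exist
    because the ideal of [U i0] is minimal: a part whose ideal does not contain it has an equation
    failing on [U i0]. *)
Lemma isolate_component V k (U : 'I_k -> set X) i0 :
  (forall i, prime_set (U i)) -> (forall v, V v -> exists i, U i v) ->
  (forall j, (vanishing (U j) `<=` vanishing (U i0))%classic ->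
     (vanishing (U i0) `<=` vanishing (U j))%classic) ->
  exists2 h, ~ vanishing (U i0) h & forall v, V v -> h.@[e v] != 0 ->
    forall p, vanishing (U i0) p -> p.@[e v] = 0.
Proof.
move=> pU VU hmax.
have hj j : exists p, ~ vanishing (U i0) p /\
    ((vanishing (U i0) `<=` vanishing (U j))%classic \/ vanishing (U j) p).
  have [s|ns] := pselect (vanishing (U i0) `<=` vanishing (U j))%classic.
    exists 1; split; last by left.
    have [[v Uv] _] := pU i0 => /(_ v Uv); rewrite meval1; apply/eqP; exact: oner_neq0.
  have /existsNP [p /not_implyP [h1 h2]] : ~ (vanishing (U j) `<=` vanishing (U i0))%classic.
    by move=> /hmax.
  by exists p; split=> //; right.
have [f hf] := choice hj.
exists (\prod_j f j).
  elim/big_rec: _ => [|j p _ np]; first by case: (pU i0) => -[v Uv] _ /(_ v Uv);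
    rewrite meval1; apply/eqP/oner_neq0.
  move=> h; case: ((pU i0).2 (f j) p) => [v Uv||//]; last exact: (hf j).1.
  by rewrite -mevalM; apply: h.
move=> v Vv; rewrite rmorph_prod /= => /prodf_neq0 h p hp.
have [j Ujv] := VU v Vv; case: (hf j) => _ [s|h']; first exact: (s p hp v Ujv).
by have := h j isT; rewrite h' ?eqxx.
Qed.

End Decomposition.
End Noetherian.

(** * The Nullstellensatz and isolated zeros over an uncountable field *)

Section Nullstellensatz.
Variable K : closedFieldType.
Hypothesis uncountable : forall f : nat -> K, exists a, forall i, f i != a.

(** If all fibres were finite lists, pairs of a class and a position in its list would enumerate the
    field. *)
Lemma infinite_fibre (c : K -> nat) : exists t, forall N, exists s : seq K,
  [/\ uniq s, size s = N & forall a, a \in s -> c a = t].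
Proof.
apply: contrapT => h.
have fin t : exists s : seq K, forall a, c a = t -> a \in s.
  have /existsNP [N hN] : ~ forall N, exists s : seq K,
      [/\ uniq s, size s = N & forall a, a \in s -> c a = t].
    by move=> hh; apply: h; exists t.
  apply: contrapT => nos; apply: hN; elim: N => [|N [s [us ss hs]]]; first by exists [::].
  have /existsNP [a /not_implyP [ca /negP nas]] := fun hh => nos (ex_intro _ s hh).
  exists (a :: s); split; rewrite /= ?nas ?ss // => b; rewrite inE => /orP [/eqP ->//|].
  exact: hs.
have [s hs] := choice fin.
have [a ha] := uncountable (fun k => if unpickle k is Some (t, i) then nth 0 (s t) i else 0).
have := ha (pickle (c a, index a (s (c a)))).
by rewrite pickleK nth_index ?eqxx // hs.
Qed.

Lemma linear_dependence m k (A : 'M[K]_(m, k)) : (k < m)%N ->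
  exists2 u : 'rV_m, u != 0 & u *m A = 0.
Proof.
move=> km; have nf : kermx A != 0.
  rewrite kermx_eq0 -row_leq_rank -ltnNge; exact: leq_ltn_trans (rank_leq_col A) km.
exists (nz_row (kermx A)); first by rewrite nz_row_eq0.
have : (nz_row (kermx A) <= kermx A)%MS by apply: nz_row_sub.
by move/sub_kermxP.
Qed.

Lemma mpoly_dependence (n d N : nat) (q : 'I_N -> {mpoly K[n]}) :
  (forall i, (msize (q i) <= d)%N) -> (#|{: 'X_{1..n < d}}| < N)%N ->
  exists lam : 'I_N -> K, (exists i, lam i != 0) /\ \sum_i lam i *: q i = 0.
Proof.
move=> sq lt; pose A := \matrix_(i < N, j < #|{: 'X_{1..n < d}}|) (q i)@_(enum_val j).
have [u u0 uA] := linear_dependence A lt; exists (fun i => u ord0 i); split.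
  have /rV0Pn [i hi] := u0; by exists i.
apply/mpolyP => m; rewrite mcoeff0 raddf_sum /=.
case: (ltnP (mdeg m) d) => hm; last first.
  apply: big1 => i _; rewrite mcoeffZ [_@_m](_ : _ = 0) ?mulr0 //.
  by apply/eqP; rewrite mcoeff_eq0 msize_mdeg_ge // (leq_trans (sq i)).
have := congr1 (fun B : 'rV_#|{: 'X_{1..n < d}}| => B ord0 (enum_rank (BMultinom hm))) uA.
rewrite !mxE => h; rewrite -[RHS]h; apply: eq_bigr => i _.
by rewrite mcoeffZ !mxE enum_rankK.
Qed.

Variable n : nat.
Implicit Types (J : set {mpoly K[n]}) (p q h : {mpoly K[n]}).

(** An ideal maximal among those without powers of h is prime. If no [X_i - a] lies in it, then for
    every a some [h ^ k] is a multiple [r * (X_i - a)] modulo the ideal. Infinitely many a share k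
    and the degree of r, so these cofactors are linearly dependent, which gives a nonzero P with
    [h ^ k * P(X_i)] in the ideal. As P splits, primality puts some [X_i - z] there after all; so
    the ideal is that of a point, where h is nonzero. *)
Theorem nullstellensatz J h : is_ideal J ->
  (forall a : 'I_n -> K, (forall p, J p -> p.@[a] = 0) -> h.@[a] = 0) ->
  exists k, J (h ^+ k).
Proof.
move=> iJ0 hJ0; apply: contrapT => nJ0.
suff [a ha h0] : exists2 a : 'I_n -> K, (forall p, J p -> p.@[a] = 0) & h.@[a] != 0.
  by move: h0; rewrite hJ0 ?eqxx.
move: nJ0 {hJ0}; elim/noetherian_ind: iJ0 => {}J iJ IH nJ.
have [J0 JD JM] := iJ.
have [[J' [iJ' s1 s2 nJ']]|max] := pselect (exists J', [/\ is_ideal J', (J `<=` J')%classic,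
    ~ (J' `<=` J)%classic & ~ exists k, J' (h ^+ k)]).
  by have [a ha h0] := IH J' iJ' s1 s2 nJ'; exists a => // p /s1; apply: ha.
have grow p : ~ J p -> exists k r, J (h ^+ k - r * p).
  move=> nJp; apply: contrapT => nk; apply: max.
  exists [set f | exists r, J (f - r * p)]%classic; split.
  - split; first by exists 0; rewrite mul0r subr0.
      move=> f g [r hr] [s hs]; exists (r + s).
      by rewrite (_ : _ - _ = (f - r * p) + (g - s * p)); [apply: JD | ring].
    move=> f g [r hr]; exists (f * r).
    by rewrite (_ : _ - _ = f * (g - r * p)); [apply: JM | ring].
  - by move=> f Jf; exists 0; rewrite mul0r subr0.
  - by move=> /(_ p) s; apply: nJp; apply: s; exists 1; rewrite mul1r subrr.
  - by move=> [k [r hr]]; apply: nk; exists k, r.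
have prime p q : J (p * q) -> J p \/ J q.
  move=> Jpq; apply: contrapT => /not_orP [/grow [k [r hr]] /grow [l [s hs]]].
  apply: nJ; exists (k + l)%N; rewrite exprD.
  rewrite (_ : _ * _ = h ^+ l * (h ^+ k - r * p) + (r * p) * (h ^+ l - s * q) + (r * s) * (p * q)).
    by do 2?[apply: (JD)]; apply: JM.
  by ring.
have nJ1 : ~ J 1 by move=> J1; apply: nJ; exists 0%N; rewrite expr0.
have nJX k : ~ J (h ^+ k) by move=> hk; apply: nJ; exists k.
have linear (i : 'I_n) : exists a : K, J ('X_i - a%:MP).
  apply: contrapT => hno.
  have /choice [kr hkr] (a : K) : exists kr, J (h ^+ kr.1 - kr.2 * ('X_i - a%:MP)).
    have /grow [k [r hr]] : ~ J ('X_i - a%:MP) by move=> Ja; apply: hno; exists a.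
    by exists (k, r).
  (* Infinitely many scalars have cofactors of the same degree with the same power of [h]. *)
  have [t ht] := infinite_fibre (fun a => pickle ((kr a).1, msize (kr a).2)).
  have [s0 [_ ss0 hs0]] := ht 1%N.
  have [k [d kd]] : exists k d : nat, t = pickle (k, d).
    have [a as0] : exists a, a \in s0.
      by case: (s0) ss0 => // a s1 _; exists a; rewrite mem_head.
    by exists (kr a).1, (msize (kr a).2); rewrite -(hs0 a as0).
  have [s [us ss hs]] := ht (#|{: 'X_{1..n < d}}|.+1).
  have hs' a : a \in s -> (kr a).1 = k /\ msize (kr a).2 = d.
    move=> /hs; rewrite kd => /(congr1 (@unpickle (nat * nat)%type)).
    by rewrite !pickleK => -[-> ->].
  pose N := (#|{: 'X_{1..n < d}}|.+1); pose b (j : 'I_N) := nth 0 s j.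
  have bs j : b j \in s by rewrite mem_nth // ss.
  have [||lam [[j0 lj0] hlam]] := @mpoly_dependence n d N (fun j => (kr (b j)).2).
  - by move=> j; rewrite (hs' _ (bs j)).2.
  - exact: ltnSn.
  (* The combination that kills the cofactors after multiplication by all the linear factors. It is
     nonzero, as in Lagrange interpolation: at [b j0] only the summand of index [j0] survives. *)
  pose P : {poly K} := \sum_j lam j *: \prod_(l | l != j) ('X - (b l)%:P).
  pose sub (R : {poly K}) : {mpoly K[n]} := (map_poly (@mpolyC n K) R).['X_i].
  have subX c : sub ('X - c%:P) = 'X_i - c%:MP.
    by rewrite /sub rmorphB /= map_polyX map_polyC hornerD hornerN hornerX hornerC.
  have JP : J (h ^+ k * sub P).
    rewrite /sub /P rmorph_sum horner_sum big_distrr /=.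
    pose F j := \prod_(l | l != j) ('X_i - (b l)%:MP_[n]).
    have FE j : (map_poly (@mpolyC n K) (lam j *: \prod_(l | l != j) ('X - (b l)%:P))).['X_i]
        = lam j *: F j.
      rewrite map_polyZ hornerZ mul_mpolyC rmorph_prod horner_prod; congr (_ *: _).
      by apply: eq_bigr => l _; apply: subX.
    rewrite (_ : \sum_j _ = \sum_j (lam j *: F j) * (h ^+ k - (kr (b j)).2 * ('X_i - (b j)%:MP))).
      by apply: ideal_sum => // j _; apply: JM; rewrite -(hs' _ (bs j)).1.
    under [RHS]eq_bigr do rewrite mulrBr.
    rewrite sumrB [X in _ - X](_ : _ = 0) ?subr0.
      by apply: eq_bigr => j _; rewrite FE mulrC.
    transitivity ((\prod_l ('X_i - (b l)%:MP_[n])) * \sum_j lam j *: (kr (b j)).2).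
      rewrite big_distrr; apply: eq_bigr => j _ /=.
      rewrite [in RHS](bigD1 j) //= -/(F j) -!scalerAl -scalerAr; congr (_ *: _).
      by ring.
    by rewrite hlam mulr0.
  have P0 : P != 0.
    apply: contraNneq lj0 => P0; have := congr1 (fun R => R.[b j0]) P0.
    rewrite horner0 /P horner_sum (bigD1 j0) //= [X in _ + X]big1 ?addr0; last first.
      move=> j jj0; rewrite hornerZ horner_prod (bigD1 j0) 1?eq_sym //=.
      by rewrite hornerXsubC subrr mul0r mulr0.
    rewrite hornerZ horner_prod => /eqP; rewrite mulf_eq0 => /orP [//|].
    move=> /prodf_eq0 [l lj]; rewrite hornerXsubC subr_eq0 nth_uniq ?ss // => /eqP e.
    by move: lj; rewrite -(inj_eq val_inj) /= e eqxx.
  have [//|JsP] := prime _ _ JP; first exact: nJX.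
  have [rs rsE] := closed_field_poly_normal P.
  have subM R S : sub (R * S) = sub R * sub S by rewrite /sub rmorphM hornerM.
  have : J (sub (\prod_(z <- rs) ('X - z%:P))).
    have -> : sub (\prod_(z <- rs) ('X - z%:P)) = ((lead_coef P)^-1)%:MP * sub P.
      rewrite {2}rsE -mul_polyC subM mulrA /sub map_polyC hornerC -mpolyCM mulVf ?mul1r //.
      by rewrite lead_coef_eq0.
    exact: JM.
  elim: rs {rsE} => [|z rs IHr]; first by rewrite big_nil /sub rmorph1 hornerC.
  rewrite big_cons subM => /prime [|]; last exact: IHr.
  by rewrite subX => Jz; apply: hno; exists z.
have [a ha] := choice linear.
have congp p : J (p - (p.@[a])%:MP).
  elim/mpolyind: p => [|c m p _ _ hp]; first by rewrite meval0 mpolyC0 subrr.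
  rewrite mevalD mpolyCD mevalZ.
  rewrite (_ : _ - _ = c%:MP * ('X_[m] - ('X_[m].@[a])%:MP) + (p - (p.@[a])%:MP)); last first.
    by rewrite mpolyCM -mul_mpolyC; ring.
  apply: (JD) => //; apply: (JM); rewrite mpolyXE_id.
  have congM r1 r2 : J (r1 - (r1.@[a])%:MP) -> J (r2 - (r2.@[a])%:MP) ->
      J (r1 * r2 - ((r1 * r2).@[a])%:MP).
    move=> h1 h2; rewrite mevalM mpolyCM.
    rewrite (_ : _ - _ = r2 * (r1 - (r1.@[a])%:MP) + (r1.@[a])%:MP * (r2 - (r2.@[a])%:MP)).
      by apply: (JD); apply: (JM).
    by ring.
  have cong1 : J (1 - (1 : {mpoly K[n]}).@[a]%:MP) by rewrite meval1 mpolyC1 subrr.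
  apply: (big_ind (fun r => J (r - (r.@[a])%:MP))) => // i _.
  elim: (m i) => [|k IHk]; first by rewrite expr0.
  by rewrite exprS; apply: congM => //; rewrite mevalXU.
exists a => [p Jp|].
  apply: contrapT => /eqP pa; apply: nJ1.
  have Jc : J (p.@[a])%:MP by have := idealB iJ Jp (congp p); rewrite opprB addrC subrK.
  by have := JM ((p.@[a])^-1)%:MP _ Jc; rewrite -mpolyCM mulVf // mpolyC1.
apply/eqP => h0; apply: (nJX 1%N); have := congp h.
by rewrite h0 mpolyC0 subr0 expr1.
Qed.

Section IsolatedZero.
Variables (c l k : nat) (G : 'I_c -> {mpoly K[n]}) (u u' : {mpoly K[n]}).

(** Membership in the d-th power of the maximal ideal at the origin. *)
Definition low_order p d := forall m, (mdeg m < d)%N -> p@_m = 0.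

Lemma low_orderD p q d : low_order p d -> low_order q d -> low_order (p + q) d.
Proof. by move=> hp hq m hm; rewrite mcoeffD hp // hq // addr0. Qed.
Lemma low_orderN p d : low_order p d -> low_order (- p) d.
Proof. by move=> hp m hm; rewrite mcoeffN hp // oppr0. Qed.
Lemma low_orderM p q d e : low_order p d -> low_order q e ->
  low_order (p * q) (d + e).
Proof.
move=> hp hq m hm; rewrite mcoeffM big1 // => i /eqP mE.
have [h|h] := ltnP (mdeg i.1) d; first by rewrite hp // mul0r.
have [h'|h'] := ltnP (mdeg i.2) e; first by rewrite hq // mulr0.
by exfalso; move: hm; rewrite (congr1 (@mdeg n) mE) mdegD ltnNge leq_add.
Qed.
Lemma low_order0 p : low_order p 0. Proof. by []. Qed.
Lemma low_orderMl p q d : low_order q d -> low_order (p * q) d.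
Proof. by move=> h; rewrite -[d]add0n; apply: low_orderM. Qed.
Lemma low_order_const p : p.@[fun=> 0] = 0 -> low_order p 1.
Proof.
move=> p0 m; rewrite ltnS leqn0 mdeg_eq0 => /eqP ->.
move: p0; rewrite mevalE; have [p0|np0] := boolP (0%MM \in msupp p); last first.
  by move=> _; apply/eqP; rewrite mcoeff_eq0.
rewrite (bigD1_seq 0%MM) //= ?msupp_uniq // big1 ?mulr1.
  rewrite big1 => [|m' m'0]; first by rewrite addr0.
  have [i hi] : exists i, m' i != 0%N.
    apply: contrapT => h; move/eqP: m'0; apply; apply/mnmP => i; rewrite mnm0E.
    by apply: contrapT => /eqP hi; apply: h; exists i.
  by rewrite (bigD1 i) //= expr0n (negPf hi) mul0r mulr0.
by move=> i _; rewrite mnm0E expr0.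
Qed.
Lemma low_orderX p d e : low_order p d -> low_order (p ^+ e) (d * e).
Proof.
move=> hp; elim: e => [|e IH]; first by rewrite muln0.
by rewrite exprS mulnS; apply: low_orderM.
Qed.

Hypothesis G0 : forall i, (G i).@[fun=> 0] = 0.
Hypothesis uu' : low_order (u' * u - 1) l.
Hypothesis hu : forall m : 'X_{1..n}, (exists i, (k <= m i)%N) ->
  exists f : 'I_c -> {mpoly K[n]}, u * 'X_[m] = \sum_i G i * f i.

Let T := ({ffun 'I_n -> 'I_k} * {ffun 'I_c -> 'I_l})%type.
Let term (t : T) : {mpoly K[n]} :=
  'X_[[multinom (t.1 i : nat) | i < n]] * \prod_i G i ^+ t.2 i.
Let spanned p := exists a : T -> K, low_order (p - \sum_t a t *: term t) l.

Let spannedD p q : spanned p -> spanned q -> spanned (p + q).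
Proof.
move=> [a ha] [b hb]; exists (fun t => a t + b t).
under eq_bigr do rewrite scalerDl.
rewrite big_split /= opprD addrACA; exact: low_orderD.
Qed.
Let spannedZ x p : spanned p -> spanned (x *: p).
Proof.
move=> [a ha]; exists (fun t => x * a t).
under eq_bigr do rewrite -scalerA.
by rewrite -scaler_sumr -scalerBr -mul_mpolyC; apply: low_orderMl.
Qed.
Let spanned0 : spanned 0.
Proof.
exists (fun=> 0); under eq_bigr do rewrite scale0r.
by rewrite big1 // subrr => m; rewrite mcoeff0.
Qed.
Let spanned_sum (S : Type) (r : seq S) F :
  (forall t, spanned (F t)) -> spanned (\sum_(t <- r) F t).
Proof.
by move=> h; apply: (big_ind spanned) => // *; apply: spannedD.
Qed.
Let spanned_congr p q : low_order (p - q) l -> spanned q -> spanned p.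
Proof.
move=> h [a ha]; exists a; rewrite -[p](subrK q) -addrA; exact: low_orderD.
Qed.

(** A monomial with an exponent at least k becomes, by [hu] and the approximate inverse [u'], a
    combination of the [G i], which raises the total exponent of G by one. Once this total reaches
    l, the product has order l and is negligible. *)
Let spanned_mul d (be : 'I_c -> nat) p : (l <= \sum_i be i + d)%N ->
  spanned ((\prod_i G i ^+ be i) * p).
Proof.
elim: d => [|d IH] in be p *.
  rewrite addn0 => hl; apply: (@spanned_congr _ 0) => //.
  rewrite subr0 mulrC; apply: low_orderMl => m hm.
  suff: low_order (\prod_i G i ^+ be i) (\sum_i be i) by apply; apply: leq_trans hm hl.
  elim/big_rec2: _ => [|i x y _ hy]; first exact: low_order0.
  apply: low_orderM => //; rewrite -[X in low_order _ X]mul1n; apply: low_orderX.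
  exact: low_order_const.
rewrite addnS leq_eqVlt => /orP [/eqP hl|]; last by rewrite ltnS; apply: IH.
rewrite (mpolyE p) big_distrr /=; apply: spanned_sum => m.
rewrite -scalerAr; apply: spannedZ.
have [h|h] := pselect (exists i, (k <= m i)%N); last first.
  have hm i : (m i < k)%N by rewrite ltnNge; apply/negP => hi; apply: h; exists i.
  have hb i : (be i < l)%N.
    by rewrite hl ltnS (bigD1 i) //= -addnA leq_addr.
  pose t0 : T := ([ffun i => Ordinal (hm i)], [ffun i => Ordinal (hb i)]).
  exists (fun t => (t == t0)%:R).
  have -> : \sum_t (t == t0)%:R *: term t = \prod_i G i ^+ be i * 'X_[m].
    have delta (S : finType) (F : S -> {mpoly K[n]}) s0 :
        \sum_s (s == s0)%:R *: F s = F s0.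
      rewrite (bigD1 s0) //= eqxx scale1r big1 ?addr0 // => s /negPf ->.
      by rewrite scale0r.
    rewrite delta /term /= mulrC; congr (_ * _).
      by apply: eq_bigr => i _; rewrite ffunE.
    by congr 'X_[_]; apply/mnmP => i; rewrite mnmE ffunE.
  by rewrite subrr => m' _; rewrite mcoeff0.
have [f hf] := hu h.
pose Gb := \prod_i G i ^+ be i.
apply: (@spanned_congr _ (\sum_i Gb * G i * (u' * f i))).
  rewrite (_ : _ - _ = - ((Gb * 'X_[m]) * (u' * u - 1))); first exact/low_orderN/low_orderMl.
  rewrite (_ : \sum_i _ = Gb * (u' * (u * 'X_[m]))); first by rewrite -/Gb; ring.
  by rewrite hf !big_distrr; apply: eq_bigr => i _ /=; ring.
apply: spanned_sum => i.
have -> : Gb * G i = \prod_j G j ^+ (be j + (j == i)).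
  rewrite /Gb (bigD1 i) //= [in RHS](bigD1 i) //= eqxx addn1 exprSr.
  rewrite mulrAC; congr (_ * _); apply: eq_bigr => j /negPf ->.
  by rewrite addn0.
apply: IH; rewrite big_split /= [X in (_ + X + _)%N](_ : _ = 1%N).
  by rewrite hl addn1 addSn.
by rewrite (bigD1 i) //= eqxx big1 ?addn0 // => j /negPf ->.
Qed.

(** The [L ^ n] monomials with exponents below L have degree less than [l = n L + 1], so they stay
    independent modulo order l, while they are spanned by the [k ^ n * l ^ c] terms. *)
Lemma isolated_zero_count L : l = (n * L).+1 ->
  (L ^ n <= k ^ n * l ^ c)%N.
Proof.
move=> lE; rewrite leqNgt; apply/negP => lt.
have hs p : spanned p.
  have := @spanned_mul l (fun=> 0%N) p; rewrite big1 // add0n => /(_ (leqnn _)).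
  by under eq_bigr do rewrite expr0; rewrite big1 // mul1r.
pose B := {ffun 'I_n -> 'I_L}.
pose mon (b : B) := [multinom (b i : nat) | i < n].
have [a ha] := choice (fun b : B => hs 'X_[mon b]).
pose A := \matrix_(i < #|{: B}|, j < #|{: T}|) a (enum_val i) (enum_val j).
have [|w w0 wA] := linear_dependence A.
  by rewrite card_prod !card_ffun !card_ord.
have [i hi] := rV0Pn _ w0.
suff: low_order (\sum_j w ord0 j *: 'X_[mon (enum_val j)]) l.
  move/(_ (mon (enum_val i))) => h; move: hi; rewrite -h ?raddf_sum /=.
    rewrite (bigD1 i) //= mcoeffZ mcoeffX eqxx mulr1 big1 ?addr0 ?eqxx // => j ji.
    rewrite mcoeffZ mcoeffX; case: eqP => [e|]; last by rewrite mulr0.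
    case/eqP: ji; apply: enum_val_inj; apply/ffunP => x; apply: val_inj.
    by move/mnmP/(_ x): e; rewrite !mnmE.
  rewrite lE ltnS mdegE; apply: (@leq_trans (\sum_(j < n) L)%N).
    by apply: leq_sum => j _; rewrite mnmE ltnW.
  by rewrite sum_nat_const card_ord.
have -> : \sum_j w ord0 j *: 'X_[mon (enum_val j)] =
    \sum_j w ord0 j *: ('X_[mon (enum_val j)] - \sum_t a (enum_val j) t *: term t).
  under [RHS]eq_bigr do rewrite scalerBr.
  rewrite sumrB [X in _ - X](_ : _ = 0) ?subr0 //.
  under eq_bigr do rewrite scaler_sumr.
  rewrite exchange_big big1 //= => t _.
  under eq_bigr do rewrite scalerA.
  rewrite -scaler_suml (_ : \sum_j _ = 0) ?scale0r //.
  have := congr1 (fun C : 'rV_#|{: T}| => C ord0 (enum_rank t)) wA.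
  rewrite !mxE => e; rewrite -[RHS]e; apply: eq_bigr => j _.
  by rewrite mxE enum_rankK.
apply: (big_ind (fun p => low_order p l)).
- by move=> m _; rewrite mcoeff0.
- by move=> *; apply: low_orderD.
- by move=> j _; rewrite -mul_mpolyC; apply: low_orderMl; apply: ha.
Qed.

End IsolatedZero.

(* Krull's height theorem at an isolated zero: if u X^m lies in the ideal (G)
   for all monomials with some exponent at least k, then modulo the l-th power of
   the maximal ideal every polynomial is a combination of X^a G^b with a < k,
   b < l, so the C(l + n, n)-dimensional quotient has dimension O(l ^ c). *)
Theorem isolated_zero c (G : 'I_c -> {mpoly K[n]}) (v : {mpoly K[n]})
    (N : nat) (s : 'I_N -> 'I_n -> K) :
  (forall i, (G i).@[fun=> 0] = 0) -> v.@[fun=> 0] != 0 ->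
  (forall x : 'I_n -> K, (forall i, (G i).@[x] = 0) -> v.@[x] != 0 ->
     exists j, x =1 s j) ->
  (n <= c)%N.
Proof.
move=> G0 v0 fin.
pose J := [set p | exists f, p = \sum_i G i * f i]%classic.
have iJ : is_ideal J.
  split.
  - by exists (fun=> 0); rewrite big1 // => i _; rewrite mulr0.
  - move=> p q [f ->] [g ->]; exists (fun i => f i + g i).
    by rewrite -big_split; apply: eq_bigr => i _; rewrite mulrDr.
  - move=> p q [f ->]; exists (fun i => p * f i).
    by rewrite big_distrr; apply: eq_bigr => i _ /=; rewrite mulrCA.
have JG i : J (G i).
  exists (fun j => (j == i)%:R); rewrite (bigD1 i) //= eqxx mulr1 big1 ?addr0 // => j /negPf ->.
  by rewrite mulr0.
(* Multiplying v by functions that vanish at the other zeros in the list leaves the origin as the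
   only common zero of G off the zeros of [v1]. *)
have [v1 v10 hv1] : exists2 v1 : {mpoly K[n]}, v1.@[fun=> 0] != 0 &
    forall x : 'I_n -> K, (forall i, (G i).@[x] = 0) -> v1.@[x] != 0 -> x =1 (fun=> 0).
  have sepj j : exists w : {mpoly K[n]}, w.@[fun=> 0] != 0 /\
      (w.@[s j] != 0 -> s j =1 fun=> 0).
    have [h|/existsNP [i hi]] := pselect (s j =1 fun=> 0).
      by exists 1; rewrite meval1 oner_neq0.
    exists ('X_i - (s j i)%:MP); rewrite !mevalB !mevalXU !mevalC subrr eqxx sub0r oppr_eq0.
    by split=> //; apply/eqP.
  have [w hw] := choice sepj; exists (v * \prod_j w j).
    rewrite mevalM mulf_neq0 // rmorph_prod; apply/prodf_neq0 => j _; exact: (hw j).1.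
  move=> x Gx; rewrite mevalM mulf_eq0 negb_or => /andP [vx].
  have [j xj] := fin x Gx vx.
  rewrite rmorph_prod => /prodf_neq0 /(_ j isT) wx y; rewrite xj; apply: (hw j).2.
  by rewrite -(meval_eq _ xj).
have /choice [ks hks] (i : 'I_n) : exists e, J (('X_i * v1) ^+ e).
  apply: nullstellensatz => // a ha.
  rewrite mevalM mevalXU; have [->|va] := eqVneq v1.@[a] 0; first exact: mulr0.
  by rewrite (hv1 a) ?mul0r // => j; apply/ha/JG.
pose k := (\max_i ks i)%N.
(* The normalization to value 1 at the origin makes [1 - u] of order 1, so a truncated geometric
   series inverts u modulo order l. *)
pose u := ((v1.@[fun=> 0])^-1 ^+ k) *: v1 ^+ k.
have u0 : u.@[fun=> 0] = 1 by rewrite mevalZ rmorphXn /= -exprMn mulVf // expr1n.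
have hu (m : 'X_{1..n}) : (exists i, (k <= m i)%N) ->
    exists f : 'I_c -> {mpoly K[n]}, u * 'X_[m] = \sum_i G i * f i.
  move=> [i hi]; have [_ _ JM] := iJ; have le : (ks i <= k)%N by apply: leq_bigmax.
  have -> : u * 'X_[m] = ((v1.@[fun=> 0])^-1 ^+ k)%:MP * v1 ^+ (k - ks i) *
      'X_[(m - U_(i) *+ ks i)%MM] * ('X_i * v1) ^+ ks i; last exact: JM.
    have mE : m = ((m - U_(i) *+ ks i) + U_(i) *+ ks i)%MM.
      apply/mnmP => j; rewrite mnmDE mnmBE mulmnE mnm1E.
      case: eqVneq => [<-|_]; last by rewrite mul0n subn0 addn0.
      by rewrite mul1n subnK // (leq_trans le).
    have ek : v1 ^+ k = v1 ^+ (k - ks i) * v1 ^+ ks i by rewrite -exprD subnK.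
    by rewrite {1}mE mpolyXD /u -mul_mpolyC -mpolyXn exprMn ek; ring.
rewrite leqNgt; apply/negP => cn.
have n0 : (0 < n)%N by apply: leq_ltn_trans cn.
(* If [c < n], then since [l <= (n + 1) L] the number of terms is at most [C * L ^ c], which is less
   than [L ^ c.+1 <= L ^ n] for [L = C + 1]. *)
pose C := (k ^ n * (n.+1 ^ c))%N.
pose L := C.+1; pose l := (n * L).+1.
pose u' := \sum_(i < l) (1 - u) ^+ i.
have uu' : low_order (u' * u - 1) l.
  have -> : u' * u - 1 = - ((1 - u) ^+ l).
    have := subrX1 (1 - u) l; rewrite /u' => h.
    by move/eqP: h; rewrite subr_eq => /eqP ->; ring.
  apply: low_orderN; rewrite -[X in low_order _ X]mul1n; apply: low_orderX.
  by apply: low_order_const; rewrite mevalB meval1 u0 subrr.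
have := isolated_zero_count G0 uu' hu (erefl : l = (n * L).+1).
apply/negP; rewrite -ltnNge.
apply: (@leq_trans (L ^ c.+1)); last by rewrite leq_pexp2l.
have le : (l <= n.+1 * L)%N by rewrite /l mulSn -addn1 addnC leq_add2r.
apply: (@leq_ltn_trans (k ^ n * (n.+1 * L) ^ c)).
  have leX (a b e : nat) : (a <= b)%N -> (a ^ e <= b ^ e)%N.
    by move=> ab; elim: e => // e IHe; rewrite !expnS leq_mul.
  by rewrite leq_mul2l leX ?orbT.
by rewrite expnMn mulnA expnS ltn_pmul2r ?expn_gt0 // /L /C ltnS.
Qed.

End Nullstellensatz.

(** * Hypersurfaces *)


Section Factorial.
Variable A : idomainType.
Implicit Types (a b : A) (f g h : {poly A}).

Definition divides (B : idomainType) (x y : B) := exists z, y = x * z.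

Definition prime_elt (B : idomainType) (x : B) :=
  [/\ x != 0, x \isn't a GRing.unit &
      forall y z, divides x (y * z) -> divides x y \/ divides x z].

(** Unique factorization, stated as existence of factorizations into prime elements; uniqueness is
    then automatic. *)
Definition factorial (B : idomainType) := forall x : B, x != 0 ->
  exists (s : seq B) u, [/\ u \is a GRing.unit, forall y, y \in s -> prime_elt y
    & x = u * \prod_(y <- s) y].

Lemma divides_trans (B : idomainType) (x y z : B) : divides x y -> divides y z -> divides x z.
Proof. by move=> [a ->] [b ->]; exists (a * b); rewrite mulrA. Qed.
Lemma dividesD (B : idomainType) (x y z : B) : divides x y -> divides x z -> divides x (y + z).
Proof. by move=> [a ->] [b ->]; exists (a + b); rewrite mulrDr. Qed.
Lemma dividesN (B : idomainType) (x y : B) : divides x y -> divides x (- y).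
Proof. by move=> [a ->]; exists (- a); rewrite mulrN. Qed.
Lemma dividesMr (B : idomainType) (x y z : B) : divides x y -> divides x (y * z).
Proof. by move=> [a ->]; exists (a * z); rewrite mulrA. Qed.
Lemma divides_mulr (B : idomainType) (x y : B) : divides x (x * y).
Proof. by exists y. Qed.
Lemma divides_sum (B : idomainType) (x : B) (T : Type) (r : seq T) (P : pred T) F :
  (forall t, P t -> divides x (F t)) -> divides x (\sum_(t <- r | P t) F t).
Proof.
move=> h; apply: big_ind => //; first by exists 0; rewrite mulr0.
by move=> *; apply: dividesD.
Qed.
Lemma prime_ndiv_unit (B : idomainType) (x u : B) : prime_elt x -> u \is a GRing.unit ->
  ~ divides x u.
Proof.
by move=> [_ + _] uu [z uz]; rewrite uz unitrM in uu; case/andP: uu => ->.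
Qed.

(** Dividing by a prime shortens a prime factorization; this is the termination measure of
    [content]. *)
Lemma prime_cancel_factor (pi : A) (s : seq A) u b : prime_elt pi ->
  u \is a GRing.unit -> (forall y, y \in s -> prime_elt y) ->
  u * \prod_(y <- s) y = pi * b ->
  exists (s' : seq A) u', [/\ u' \is a GRing.unit, forall y, y \in s' -> prime_elt y,
    (size s' < size s)%N & b = u' * \prod_(y <- s') y].
Proof.
move=> ppi; elim: s u b => [|x s IH] u b uu ps e.
  by case: (prime_ndiv_unit ppi uu); exists b; rewrite -e big_nil mulr1.
have px : prime_elt x by apply: ps; rewrite mem_head.
have ps' y : y \in s -> prime_elt y by move=> ys; apply: ps; rewrite inE ys orbT.
have [pi0 _ pip] := ppi; have [x0 _ pxp] := px.
rewrite big_cons mulrCA in e.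
case: (pip x (u * \prod_(y <- s) y)) => [|[z xz]|[z uz]]; first by exists b.
- case: (pxp pi z) => [|[w piw]|[w zw]]; first by exists 1; rewrite mulr1.
    have wz : w * z = 1.
      by apply: (mulfI x0); rewrite mulr1 mulrA -piw.
    exists s, (z * u); split=> //; first by rewrite unitrM uu andbT; apply/unitrP; exists w; rewrite [z * w]mulrC wz.
    by apply: (mulfI pi0); rewrite -e xz !mulrA.
  have pw : pi * w = 1 by apply: (mulfI x0); rewrite mulr1 mulrCA -zw -xz.
  case: (prime_ndiv_unit ppi (unitr1 _)); by exists w.
- have [s' [u' [uu' ps1 lt bE]]] := IH u z uu ps' uz.
  exists (x :: s'), u'; split=> //.
    by move=> y; rewrite inE => /orP [/eqP ->|/ps1].
  apply: (mulfI pi0); rewrite -e uz big_cons bE; move: (\prod_(j <- s') j) => t.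
  by rewrite !mulrA; ring.
Qed.

Lemma divides_polyC (pi : A) f : divides pi%:P f <-> forall i, divides pi f`_i.
Proof.
split=> [[g ->] i|h]; first by rewrite coefCM; exists g`_i.
have [c hc] := choice h.
exists (\poly_(i < size f) c i); apply/polyP => i; rewrite coefCM coef_poly.
by case: ltnP => hi; [rewrite -hc | rewrite mulr0 nth_default].
Qed.

Lemma first_ndivides (pi : A) f : ~ divides pi%:P f ->
  exists i, ~ divides pi f`_i /\ forall j, (j < i)%N -> divides pi f`_j.
Proof.
move=> nf; have [i0 hi0] : exists i, ~ divides pi f`_i.
  by apply: contrapT => h; apply: nf; apply/divides_polyC => i; apply: contrapT => h'; apply: h; exists i.
have [m] := ubnP i0; elim: m => // m IH in i0 hi0 *; rewrite ltnS => le.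
have [[j [ji hj]]|h] := pselect (exists j, (j < i0)%N /\ ~ divides pi f`_j).
  by apply: (IH j) => //; apply: leq_trans ji le.
exists i0; split=> // j ji; apply: contrapT => hj; apply: h; by exists j.
Qed.

(** Gauss's argument: if i and j are the first indices of coefficients of f and g not divisible by
    pi, then the coefficient of index i + j of the product is not divisible by pi. *)
Lemma polyC_prime (pi : A) : prime_elt pi -> prime_elt pi%:P.
Proof.
move=> [pi0 piu pip]; split; first by rewrite polyC_eq0.
  by rewrite poly_unitE coefC eqxx (negPf piu) andbF.
move=> f g hfg; apply: contrapT => /not_orP [/first_ndivides [i [fi hi]] /first_ndivides [j [gj hj]]].
suff /pip [] : divides pi (f`_i * g`_j) by [].
have /divides_polyC /(_ (i + j)%N) := hfg.
have lei : (i < (i + j).+1)%N by rewrite ltnS leq_addr.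
rewrite coefM (bigD1 (Ordinal lei)) //= addKn => hd.
rewrite -[f`_i * g`_j](addrK (\sum_(k < (i + j).+1 | k != Ordinal lei) f`_k * g`_(i + j - k))).
apply: dividesD => //; apply/dividesN/divides_sum => k ki.
have [lt|ge] := ltnP k i; first by apply: dividesMr; apply: hi.
rewrite mulrC; apply: dividesMr; apply: hj.
have lt : (i < k)%N.
  by rewrite ltn_neqAle ge andbT; apply: contra ki => /eqP e; apply/eqP/val_inj.
rewrite -subn_gt0 -ltnS in lt *; have := ltn_ord k; lia.
Qed.

Hypothesis facA : factorial A.

Definition primitive f := forall pi : A, prime_elt pi -> ~ divides pi%:P f.

(** A prime factor of r divides f times the quotient; it does not divide the primitive f, so it
    divides the quotient and can be cancelled on both sides. *)
Lemma primitive_cancel f h r : primitive f -> r != 0 -> divides f (r%:P * h) ->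
  divides f h.
Proof.
move=> pf r0; have [s [u [uu ps ->]]] := facA r0.
elim: s ps h => [|pi s IH] ps h.
  rewrite big_nil mulr1 => -[q e]; exists (u^-1%:P * q).
  by rewrite mulrCA -e mulrA -polyCM mulVr // mul1r.
have ppi : prime_elt pi by apply: ps; rewrite mem_head.
rewrite big_cons mulrCA polyCM -mulrA => -[q e].
have [_ _ pp] := polyC_prime ppi.
case: (pp f q) => [|/(pf _ ppi) []|[q' qE]]; first by rewrite -e; apply: divides_mulr.
apply: IH => [y ys|]; first by apply: ps; rewrite inE ys orbT.
exists q'; have pi0 : pi%:P != 0 by rewrite polyC_eq0; case: ppi.
by apply: (mulfI pi0); rewrite e qE mulrCA.
Qed.

(** Constant primes dividing f are split off one by one. Each also divides the leading coefficient,
    whose number of prime factors bounds the process. *)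
Lemma content f : f != 0 -> exists c g, [/\ c != 0, primitive g & f = c%:P * g].
Proof.
move=> f0; have [|s [u [uu ps e]]] := facA (x := lead_coef f); first by rewrite lead_coef_eq0.
have [m] := ubnP (size s); elim: m => // m IH in f f0 s u uu ps e *; rewrite ltnS => le.
have [pf|/existsNP [pi /not_implyP [ppi /contrapT [g fE]]]] := pselect (primitive f).
  by exists 1, f; rewrite oner_neq0 mul1r.
have [pi0 _ _] := ppi.
have g0 : g != 0 by apply: contraNneq f0 => g0; rewrite fE g0 mulr0.
have lE : u * \prod_(y <- s) y = pi * lead_coef g.
  by rewrite -e fE lead_coefM lead_coefC.
have [s' [u' [uu' ps' lt e']]] := prime_cancel_factor ppi uu ps lE.
have [c [g' [c0 pg' gE]]] := IH g g0 s' u' uu' ps' e' (leq_trans lt le).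
exists (pi * c), g'; rewrite mulf_neq0 //; split=> //.
by rewrite fE gE polyCM mulrA.
Qed.

(** Pseudo-division by an element of least degree leaves remainder 0; primitivity then cancels the
    power of the leading coefficient. *)
Lemma ideal_min_divides (P : {poly A} -> Prop) f : P f -> f != 0 ->
  (forall g h, P g -> P h -> P (g + h)) -> (forall g h, P h -> P (g * h)) ->
  (forall g, P g -> g != 0 -> (size f <= size g)%N) -> primitive f ->
  forall g, P g -> divides f g.
Proof.
move=> Pf f0 PD PM min pf g Pg.
have e := Pdiv.Idomain.divp_eq g f; set r := Pdiv.Idomain.modp g f in e.
set q := Pdiv.Idomain.divp g f in e.
have Pr : P r.
  have -> : r = (lead_coef f ^+ Pdiv.Idomain.scalp g f)%:P * g + (- q) * f.
    by rewrite mul_polyC e mulNr addrAC subrr add0r.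
  by apply: PD; apply: PM.
have r0 : r = 0.
  apply: contrapT => /eqP r0; have := min r Pr r0; rewrite leqNgt.
  by rewrite Pdiv.Idomain.ltn_modpN0.
apply: (@primitive_cancel f g (lead_coef f ^+ Pdiv.Idomain.scalp g f)) => //.
  by rewrite expf_neq0 // lead_coef_eq0.
by exists q; rewrite mul_polyC e r0 addr0 mulrC.
Qed.

Lemma min_size (P : {poly A} -> Prop) f0 : P f0 -> f0 != 0 -> exists f,
  [/\ P f, f != 0 & forall g, P g -> g != 0 -> (size f <= size g)%N].
Proof.
move=> Pf0 f00; have [m] := ubnP (size f0); elim: m => // m IH in f0 Pf0 f00 *; rewrite ltnS => le.
have [[g [Pg g0 lt]]|h] := pselect (exists g, [/\ P g, g != 0 & (size g < size f0)%N]).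
  by apply: (IH g) => //; apply: leq_trans lt le.
exists f0; split=> // g Pg g0; rewrite leqNgt; apply/negP => lt; apply: h; by exists g.
Qed.

(** Let r have least degree in the ideal of f and g. If r is constant, f divides r h, hence h.
    Otherwise the primitive part of r divides f and g, and by irreducibility it is f up to a
    constant, so f divides g. *)
Lemma primitive_irreducible_prime f : primitive f -> (1 < size f)%N ->
  (forall g h, f = g * h -> ~ ((1 < size g)%N /\ (1 < size h)%N)) -> prime_elt f.
Proof.
move=> pf sf irr; have f0 : f != 0 by rewrite -size_poly_eq0 -lt0n ltnW.
split=> //; first by rewrite poly_unitE gtn_eqF.
move=> g h [k ghk]; apply: contrapT => /not_orP [ng nh].
pose P r := exists a b : {poly A}, r = a * f + b * g.
have PD x y : P x -> P y -> P (x + y).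
  move=> [a [b ->]] [a' [b' ->]]; exists (a + a'), (b + b'); ring.
have PM x y : P y -> P (x * y).
  move=> [a [b ->]]; exists (x * a), (x * b); ring.
have Pf : P f by exists 1, 0; ring.
have Pg : P g by exists 0, 1; ring.
have [r [Pr r0 minr]] := min_size Pf f0.
have [c [r1 [c0 pr1 rE]]] := content r0.
have [sr|sr] := leqP (size r) 1.
  have [a [b e]] := Pr; apply: nh; apply: (@primitive_cancel f h r`_0) => //.
    by rewrite -polyC_eq0 -size1_polyC.
  by exists (a * h + b * k); rewrite -size1_polyC // e mulrDl -[b * g * h]mulrA ghk; ring.
have sr1 : size r1 = size r by rewrite rE mul_polyC size_scale.
have r10 : r1 != 0 by rewrite -size_poly_eq0 sr1 -lt0n ltnW.
(* The primitive part [r1] need not lie in the ideal, only [c * r1] does. *)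
pose P' x := P (c%:P * x).
have dv x : P' x -> divides r1 x.
  apply: (ideal_min_divides (P := P')) => //; rewrite /P' -?rE //.
  - by move=> y z h1 h2; rewrite mulrDr; apply: PD.
  - by move=> y z h1; rewrite mulrCA; apply: PM.
  - move=> y Py y0; rewrite sr1; have := minr _ Py; rewrite mul_polyC size_scale //; apply.
    by rewrite -size_poly_eq0 size_scale // size_poly_eq0.
have [s fE] : divides r1 f by apply: dv; apply: PM.
have rg : divides r1 g by apply: dv; apply: PM.
have ss : (size s <= 1)%N.
  by rewrite leqNgt; apply/negP => ss; apply: (irr r1 s fE); rewrite sr1.
apply: ng; apply: divides_trans rg; rewrite (size1_polyC ss) in fE.
have s0 : s`_0 != 0 by apply: contraNneq f0 => s0; rewrite fE s0 mulr0.
apply: (primitive_cancel pf s0); exists 1; by rewrite mulr1 fE mulrC.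
Qed.

Lemma factorial_poly : factorial {poly A}.
Proof.
move=> f f0; have [m] := ubnP (size f); elim: m => // m IH in f f0 *; rewrite ltnS => le.
have [c [g [c0 pg fE]]] := content f0.
have [sc [uc [uuc psc cE]]] := facA c0.
have comb (B : {poly A}) : (exists (s : seq {poly A}) u, [/\ u \is a GRing.unit,
    forall y, y \in s -> prime_elt y & B = u * \prod_(y <- s) y]) ->
    exists (s : seq {poly A}) u, [/\ u \is a GRing.unit,
    forall y, y \in s -> prime_elt y & c%:P * B = u * \prod_(y <- s) y].
  move=> [s [u [uu ps ->]]]; exists (map polyC sc ++ s), (uc%:P * u); split.
  - by rewrite unitrM uu andbT (rmorph_unit polyC).
  - move=> y; rewrite mem_cat => /orP [/mapP [z zs ->]|/ps //].
    by apply: polyC_prime; apply: psc.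
  - by rewrite big_cat big_map /= cE polyCM rmorph_prod; move: (\prod_(i <- s) i) => t; ring.
rewrite fE; apply: comb.
have sg : size g = size f by rewrite fE mul_polyC size_scale.
have g0 : g != 0 by rewrite -size_poly_eq0 sg size_poly_eq0.
have [s1|s1] := leqP (size g) 1.
  have gE := size1_polyC s1.
  have a0 : g`_0 != 0 by rewrite -polyC_eq0 -gE.
  exists [::], g; split=> //; last by rewrite big_nil mulr1.
  have [[|pi s] [u [uu ps e]]] := facA a0.
    by rewrite gE e big_nil mulr1 (rmorph_unit polyC).
  case: (pg pi); first by apply: ps; rewrite mem_head.
  by rewrite gE e big_cons mulrCA polyCM; apply: divides_mulr.
have [[g1 [g2 [gE s1' s2']]]|irr] := pselect (exists g1 g2, [/\ g = g1 * g2,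
    (1 < size g1)%N & (1 < size g2)%N]).
  have g10 : g1 != 0 by apply: contraNneq g0 => e; rewrite gE e mul0r.
  have g20 : g2 != 0 by apply: contraNneq g0 => e; rewrite gE e mulr0.
  have sM : size g = (size g1 + size g2).-1 by rewrite gE size_mul.
  have [|s [u [uu ps e]]] := IH g1 g10; first by rewrite -sg sM in le; lia.
  have [|s' [u' [uu' ps' e']]] := IH g2 g20; first by rewrite -sg sM in le; lia.
  exists (s ++ s'), (u * u'); split; first by rewrite unitrM uu.
    by move=> y; rewrite mem_cat => /orP [/ps|/ps'].
  rewrite gE {1}e e' big_cat /=; move: (\prod_(i <- s) i) (\prod_(i <- s') i) => t t'; ring.
exists [:: g], 1; split; [exact: unitr1 | | by rewrite big_seq1 mul1r].
move=> y; rewrite inE => /eqP ->; apply: primitive_irreducible_prime => // g1 g2 e [h1 h2].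
by apply: irr; exists g1, g2.
Qed.

(** The content of an element of least degree is a constant outside the ideal, so primality puts its
    primitive part inside, and this divides everything. *)
Lemma prime_ideal_principal (P : {poly A} -> Prop) :
  P 0 -> (forall g h, P g -> P h -> P (g + h)) -> (forall g h, P h -> P (g * h)) ->
  (forall g h, P (g * h) -> P g \/ P h) -> (forall c, P c%:P -> c = 0) ->
  exists2 f, P f & forall g, P g -> divides f g.
Proof.
move=> P0 PD PM Pprime PC.
have [[f0 [Pf0 f00]]|h] := pselect (exists f, P f /\ f != 0); last first.
  exists 0 => // g Pg; exists 0; rewrite mul0r; apply: contrapT => /eqP g0.
  by apply: h; exists g.
have [f [Pf f0' min]] := min_size Pf0 f00.
have [c [g [c0 pg fE]]] := content f0'.
have Pg : P g.
  by move: (Pf); rewrite fE => /Pprime [/PC e|//]; rewrite e eqxx in c0.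
have sg : size g = size f by rewrite fE mul_polyC size_scale.
have g0 : g != 0 by rewrite -size_poly_eq0 sg size_poly_eq0.
exists g => //; apply: ideal_min_divides => // h Ph h0; rewrite sg; exact: min.
Qed.

End Factorial.

Lemma factorial_iso (A B : idomainType) (f : A -> B) (g : B -> A) :
  cancel f g -> cancel g f -> {morph f : x y / x * y} -> f 1 = 1 -> f 0 = 0 ->
  factorial B -> factorial A.
Proof.
move=> fK gK fM f1 f0 fB x x0.
have gM : {morph g : x y / x * y} by move=> y z; rewrite -{1}(gK y) -{1}(gK z) -fM fK.
have g1 : g 1 = 1 by rewrite -f1 fK.
have g0 : g 0 = 0 by rewrite -f0 fK.
have unit_morph (S T : unitRingType) (h : S -> T) : {morph h : x y / x * y} ->
    h 1 = 1 -> forall y, y \is a GRing.unit -> h y \is a GRing.unit.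
  move=> hM h1 y /unitrP [z [zy yz]]; apply/unitrP; exists (h z).
  by rewrite -!hM zy yz h1.
have fx0 : f x != 0 by apply: contraNneq x0 => e; rewrite -(fK x) e g0.
have gdiv y z : divides y z -> divides (g y) (g z).
  by move=> [w ->]; exists (g w); rewrite gM.
have [s [u [uu ps e]]] := fB _ fx0.
exists (map g s), (g u); split.
- exact: unit_morph uu.
- move=> _ /mapP [y ys ->]; have [y0 yu yp] := ps y ys; split.
  + by apply: contraNneq y0 => e0; rewrite -(gK y) e0 f0.
  + by apply: contra yu => /(unit_morph _ _ f fM f1); rewrite gK.
  + move=> z w [t ht]; case: (yp (f z) (f w)).
    * by exists (f t); rewrite -fM ht fM gK.
    * by move=> /gdiv; rewrite fK; left.
    * by move=> /gdiv; rewrite fK; right.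
- rewrite -{1}(fK x) e gM; congr (_ * _); elim: (s) => [|y s' IHs]; first by rewrite !big_nil.
  by rewrite !big_cons gM IHs.
Qed.

Section SplitVariable.
Variables (K : fieldType) (n : nat) (j : 'I_n.+1).

Fact var_key : unit. Proof. exact: tt. Qed.

Let split_def : {mpoly K[n.+1]} -> {poly {mpoly K[n]}} :=
  mmap (polyC \o @mpolyC n K)
    (fun i => if unlift j i is Some i' then ('X_i')%:P else 'X).
Definition split_var := locked_with var_key split_def.
Let split_varE : split_var = split_def. Proof. by rewrite /split_var unlock. Qed.

Let embed_def : {mpoly K[n]} -> {mpoly K[n.+1]} :=
  mmap (@mpolyC n.+1 K) (fun i => 'X_(lift j i)).
Definition embed_var := locked_with var_key embed_def.
Let embed_varE : embed_var = embed_def. Proof. by rewrite /embed_var unlock. Qed.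

Let join_def (p : {poly {mpoly K[n]}}) : {mpoly K[n.+1]} :=
  (map_poly embed_def p).['X_j].
Definition join_var := locked_with var_key join_def.
Let join_varE : join_var = join_def. Proof. by rewrite /join_var unlock. Qed.

Lemma split_varD p q : split_var (p + q) = split_var p + split_var q.
Proof. rewrite split_varE; exact: rmorphD. Qed.
Lemma split_varM p q : split_var (p * q) = split_var p * split_var q.
Proof. rewrite split_varE; exact: rmorphM. Qed.
Lemma split_varC c : split_var c%:MP = (c%:MP)%:P.
Proof. rewrite split_varE; exact: mmapC. Qed.
Lemma split_varX i : split_var 'X_i =
  if unlift j i is Some i' then ('X_i')%:P else 'X.
Proof. by rewrite split_varE /split_def mmapX mmap1U. Qed.
Lemma embed_varD p q : embed_var (p + q) = embed_var p + embed_var q.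
Proof. rewrite embed_varE; exact: rmorphD. Qed.
Lemma embed_varM p q : embed_var (p * q) = embed_var p * embed_var q.
Proof. rewrite embed_varE; exact: rmorphM. Qed.
Lemma embed_varC c : embed_var c%:MP = c%:MP. Proof. rewrite embed_varE; exact: mmapC. Qed.
Lemma embed_varX i : embed_var 'X_i = 'X_(lift j i).
Proof. by rewrite embed_varE /embed_def mmapX mmap1U. Qed.
Lemma join_varC c : join_var c%:P = embed_var c.
Proof. by rewrite join_varE embed_varE /join_def map_polyC hornerC. Qed.
Lemma join_varX : join_var 'X = 'X_j.
Proof. by rewrite join_varE /join_def map_polyX hornerX. Qed.
Lemma join_varD p q : join_var (p + q) = join_var p + join_var q.
Proof. by rewrite join_varE /join_def rmorphD hornerD. Qed.
Lemma join_varM p q : join_var (p * q) = join_var p * join_var q.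
Proof. by rewrite join_varE /join_def rmorphM hornerM. Qed.

Lemma split_varK : cancel split_var join_var.
Proof.
elim/mpoly_ring_ind => [c|i|p q hp hq|p q hp hq].
- by rewrite split_varC join_varC embed_varC.
- rewrite split_varX; case: unliftP => [i' ->|->]; last exact: join_varX.
  by rewrite join_varC embed_varX.
- by rewrite split_varD join_varD hp hq.
- by rewrite split_varM join_varM hp hq.
Qed.

Lemma embed_varK c : split_var (embed_var c) = c%:P.
Proof.
elim/mpoly_ring_ind: c => [c|i|a b ha hb|a b ha hb].
- by rewrite embed_varC split_varC.
- by rewrite embed_varX split_varX liftK.
- by rewrite embed_varD split_varD polyCD ha hb.
- by rewrite embed_varM split_varM polyCM ha hb.
Qed.

Lemma join_varK : cancel join_var split_var.
Proof.
elim/poly_ind => [|p c hp].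
  by rewrite -polyC0 join_varC embed_varK.
by rewrite join_varD join_varM join_varX join_varC split_varD split_varM hp
  embed_varK split_varX unlift_none.
Qed.

Lemma meval_embed_var c a : (embed_var c).@[a] = c.@[a \o lift j].
Proof.
elim/mpoly_ring_ind: c => [c|i|p q hp hq|p q hp hq].
- by rewrite embed_varC !mevalC.
- by rewrite embed_varX !mevalXU.
- by rewrite embed_varD !mevalD hp hq.
- by rewrite embed_varM !mevalM hp hq.
Qed.

Lemma meval_split_var p a :
  p.@[a] = (map_poly (meval (a \o lift j)) (split_var p)).[a j].
Proof.
elim/mpoly_ring_ind: p => [c|i|p q hp hq|p q hp hq].
- by rewrite split_varC map_polyC hornerC /= !mevalC.
- rewrite split_varX mevalXU; case: unliftP => [i' ->|->].
    by rewrite map_polyC hornerC /= mevalXU.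
  by rewrite map_polyX hornerX.
- by rewrite mevalD hp hq split_varD rmorphD hornerD.
- by rewrite mevalM hp hq split_varM rmorphM hornerM.
Qed.

End SplitVariable.

Lemma factorial_mpoly (K : fieldType) n : factorial {mpoly K[n]}.
Proof.
elim: n => [|n IH]; last first.
  apply: (factorial_iso (@split_varK K n ord0) (@join_varK K n ord0)).
  - exact: split_varM.
  - by rewrite -mpolyC1 split_varC mpolyC1.
  - by rewrite -mpolyC0 split_varC mpolyC0.
  - exact: factorial_poly.
move=> x x0; exists [::], x; split=> //; last by rewrite big_nil mulr1.
have xE : x = (x@_0)%:MP.
  apply: msize1_polyC; rewrite msizeE; apply/bigmax_leqP_seq => m _ _.
  by rewrite mdegE big_ord0.
have x00 : x@_0 != 0 by apply: contraNneq x0 => e; rewrite xE e mpolyC0.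
apply/unitrP; exists ((x@_0)^-1)%:MP; rewrite {2 3}xE -!mpolyCM mulVf // mulfV //.
Qed.

Section Hypersurface.
Variable K : closedFieldType.
Hypothesis uncountable : forall f : nat -> K, exists a, forall i, f i != a.

Lemma closed_field_infinite (s : seq K) : exists a, a \notin s.
Proof.
have [a ha] := uncountable (nth 0 s); exists a; apply/negP => /(nthP 0) [i _ e].
by have := ha i; rewrite e eqxx.
Qed.

Lemma poly_eq_values (p q : {poly K}) : (forall t, p.[t] = q.[t]) -> p = q.
Proof.
move=> h; apply/eqP; rewrite -subr_eq0; apply: contraT => pq0.
have [r rE] := closed_field_poly_normal (p - q).
have [a ar] := closed_field_infinite r.
have : (p - q).[a] = 0 by rewrite hornerD hornerN h subrr.
rewrite rE hornerZ horner_prod => /eqP; rewrite mulf_eq0 lead_coef_eq0 (negPf pq0) /=.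
rewrite big_seq prodf_seq_eq0 => /hasP [z zr] /andP [_].
by rewrite hornerXsubC subr_eq0 => /eqP e; rewrite e zr in ar.
Qed.

Definition depends_on n (B : pred 'I_n) (p : {mpoly K[n]}) :=
  forall a b : 'I_n -> K, {in B, a =1 b} -> p.@[a] = p.@[b].

Lemma mpoly_eq_values n (p q : {mpoly K[n]}) :
  (forall a, p.@[a] = q.@[a]) -> p = q.
Proof.
elim: n => [|n IH] in p q * => h.
  have xE (x : {mpoly K[0]}) : x = (x@_0)%:MP.
    apply: msize1_polyC; rewrite msizeE; apply/bigmax_leqP_seq => m _ _.
    by rewrite mdegE big_ord0.
  have := h (fun=> 0); rewrite (xE p) (xE q) !mevalC => e.
  by rewrite e.
rewrite -(split_varK ord0 p) -(split_varK ord0 q); congr join_var.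
apply/polyP => k; apply: IH => a.
suff : map_poly (meval a) (split_var ord0 p) = map_poly (meval a) (split_var ord0 q).
  by move/(congr1 (fun r : {poly K} => r`_k)); rewrite !coef_map.
apply: poly_eq_values => t.
pose a' i := if unlift ord0 i is Some i' then a i' else t.
have e1 : a' \o lift ord0 =1 a by move=> i; rewrite /a' /= liftK.
have e2 : a' ord0 = t by rewrite /a' unlift_none.
have e3 r : map_poly (meval (a' \o lift ord0)) r = map_poly (meval a) r.
  by apply: eq_map_poly => x; apply: meval_eq.
by have := h a'; rewrite !(meval_split_var ord0) !e3 e2.
Qed.

(** [l] is the leading coefficient of [R] in the variable i. Where it is nonzero, the values of this
    variable are among the roots of a nonzero polynomial determined by the variables in [B]. *)
Lemma relation_roots n (B : pred 'I_n) i (R : {mpoly K[n]}) :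
  i \notin B -> R != 0 -> depends_on [predU1 i & B] R ->
  exists l : {mpoly K[n]}, [/\ l != 0, depends_on B l &
    forall w : 'I_n -> K, l.@[w] != 0 -> exists s : seq K, forall x : 'I_n -> K,
      {in B, x =1 w} -> R.@[x] = 0 -> x i \in s].
Proof.
case: n => [|n] in B i R *; first by case: i.
move=> iB R0 dR; pose S := split_var i R.
pose q (w : 'I_n.+1 -> K) := map_poly (meval (w \o lift i)) S.
have S0 : S != 0.
  by apply: contraNneq R0 => e; rewrite -(split_varK i R) -/S e -polyC0 join_varC -mpolyC0 embed_varC.
pose upd (w : 'I_n.+1 -> K) t k := if k == i then t else w k.
have qE w t : (q w).[t] = R.@[upd w t].
  rewrite (meval_split_var i) -/S /upd eqxx; congr _.[_].
  apply: eq_map_poly => x; apply: meval_eq => k /=; by rewrite eq_sym (negPf (neq_lift _ _)).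
have qB a b : {in B, a =1 b} -> q a = q b.
  move=> ab; apply: poly_eq_values => t; rewrite !qE; apply: dR => k.
  rewrite inE /upd; case: eqVneq => //= _; exact: ab.
exists (embed_var i (lead_coef S)); split.
- apply: contraNneq S0 => e; rewrite -lead_coef_eq0 -polyC_eq0 -(embed_varK i) e.
  by rewrite -mpolyC0 split_varC mpolyC0 polyC0.
- by move=> a b /qB; rewrite !meval_embed_var => /(congr1 (fun r : {poly K} => r`_(size S).-1));
    rewrite !coef_map.
move=> w; rewrite meval_embed_var => lw.
have qw0 : q w != 0.
  by apply: contraNneq lw => e; have := congr1 (fun r : {poly K} => r`_(size S).-1) e;
    rewrite coef0 coef_map => /eqP.
have [r rE] := closed_field_poly_normal (q w); exists r => x xw Rx.
have : root (q w) (x i).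
  apply/rootP; rewrite qE -[RHS]Rx; apply: dR => k; rewrite inE /upd.
  case: eqVneq => [->//|_ /=] kB; by rewrite xw.
rewrite rE rootZ ?lead_coef_eq0 // root_prod_XsubC //.
Qed.

(** Viewed as polynomials in the variable j over the polynomial ring in the others, the elements of
    [P] include no nonzero constant, so [prime_ideal_principal] applies. *)
Lemma principal_of_independent n (P : set {mpoly K[n]}) (j : 'I_n) :
  is_ideal P -> (forall p q, P (p * q) -> P p \/ P q) ->
  (forall p, P p -> depends_on (predC1 j) p -> p = 0) ->
  exists2 f, P f & forall g, P g -> exists h, g = f * h.
Proof.
case: n => [|n] in P j *; first by case: j.
move=> [P0 PD PM] Pp Pj.
have [||||c Pc|f Pf hf] := @prime_ideal_principal _ (@factorial_mpoly K n) (fun q => P (join_var j q)).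
- by rewrite -polyC0 join_varC -mpolyC0 embed_varC mpolyC0.
- by move=> g h h1 h2; rewrite join_varD; apply: PD.
- by move=> g h h1; rewrite join_varM; apply: PM.
- by move=> g h; rewrite join_varM; apply: Pp.
- have e : embed_var j c = 0.
    apply: Pj; first by rewrite -join_varC.
    move=> a b ab; rewrite !meval_embed_var; apply: meval_eq => k /=; apply: ab.
    by rewrite inE eq_sym neq_lift.
  by apply: polyC_inj; rewrite -(embed_varK j) e -mpolyC0 split_varC mpolyC0.
exists (join_var j f) => // g Pg; have [|h hE] := hf (split_var j g).
  by rewrite split_varK.
by exists (join_var j h); rewrite -join_varM -hE split_varK.
Qed.

(* A maximal independent set B of the first n variables parametrizes the image
   of V with finite fibres, so that fixing the variables in B isolates a point of
   V; hence n + s <= #|B| + s + 1 and B omits at most one of the n variables. *)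
Theorem image_hypersurface n s (G : 'I_s.+1 -> {mpoly K[n + s]})
    (V : set ('I_(n + s) -> K)) (h : {mpoly K[n + s]}) (a : {mpoly K[n]}) :
  let P := [set f : {mpoly K[n]} | forall v, V v -> f.@[v \o lshift s] = 0]%classic in
  (0 < n)%N -> prime_set id V ->
  (forall v i, V v -> (G i).@[v] = 0) ->
  ~ vanishing id V h ->
  (forall v, (forall i, (G i).@[v] = 0) -> h.@[v] != 0 -> V v) ->
  ~ P a ->
  (forall eta, a.@[eta] != 0 -> exists t : seq ('I_s -> K),
     forall v, V v -> v \o lshift s =1 eta -> v \o @rshift n s \in t) ->
  exists2 f, P f & forall g, P g -> exists h, g = f * h.
Proof.
move=> P n0 [V0 Vp] VG Vh hV Pa fin.
pose lft (f : {mpoly K[n]}) : {mpoly K[n + s]} := mmap (@mpolyC (n + s) K) (fun i => 'X_(lshift s i)) f.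
have lftE f v : (lft f).@[v] = f.@[v \o lshift s].
  elim/mpoly_ring_ind: f => [c|i|p q hp hq|p q hp hq].
  - by rewrite /lft mmapC !mevalC.
  - by rewrite /lft mmapX mmap1U !mevalXU.
  - by rewrite /lft rmorphD !mevalD -/(lft p) -/(lft q) hp hq.
  - by rewrite /lft rmorphM !mevalM -/(lft p) -/(lft q) hp hq.
have PE f : P f <-> vanishing id V (lft f).
  by split=> hf v Vv; [rewrite lftE; apply: hf | have := hf v Vv; rewrite lftE].
have iP : is_ideal P.
  split=> [v _|p q hp hq v Vv|p q hq v Vv]; first exact: meval0.
    by rewrite mevalD hp // hq // addr0.
  by rewrite mevalM hq // mulr0.
have Pp p q : P (p * q) -> P p \/ P q.
  move=> hpq; have [v Vv|hh|hh] := Vp (lft p) (lft q).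
  - by rewrite !lftE -mevalM; apply: hpq.
  - by left; apply/PE.
  - by right; apply/PE.
have P1 : ~ P 1 by case: V0 => v Vv /(_ v Vv); rewrite meval1; apply/eqP/oner_neq0.
(* Algebraic independence of the coordinates in [B] on the image of [V]. *)
pose indep (B : {set 'I_n}) := `[< forall p, P p -> depends_on (mem B) p -> p = 0 >].
have ind0 : indep finset.set0.
  apply/asboolP => p Pp0 dp; apply: mpoly_eq_values => x; rewrite meval0.
  by have [v Vv] := V0; rewrite -(Pp0 v Vv); apply: dp => i; rewrite inE.
have [B /asboolP iB maxB] : exists2 B, indep B & forall B', indep B' -> (#|B'| <= #|B|)%N.
  have [B] := arg_maxnP (fun B : {set 'I_n} => #|B|) ind0.
  by exists B.
have rel i : exists l : {mpoly K[n]}, ~ P l /\ forall w : 'I_n -> K, l.@[w] != 0 ->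
    exists r : seq K, forall v, V v -> {in B, v \o lshift s =1 w} -> v (lshift s i) \in r.
  have [Bi|Bi] := boolP (i \in B).
    exists 1; split=> // w _; exists [:: w i] => v _ /(_ i Bi) /= ->.
    by rewrite mem_head.
  have [R [PR dR R0]] : exists R, [/\ P R, depends_on [predU1 i & mem B] R & R != 0].
    have /existsNP [R /not_implyP [PR /not_implyP [dR R0]]] :
        ~ forall p, P p -> depends_on (mem (i |: B)) p -> p = 0.
      by move=> /asboolP /maxB; rewrite cardsU1 Bi add1n ltnn.
    exists R; split=> //; last by apply/eqP.
    by move=> x y xy; apply: dR => k kB; apply: xy; move: kB; rewrite !inE.
  have [l [l0 dl hl]] := relation_roots Bi R0 dR; exists l; split.
    by move=> Pl; case/eqP: l0; apply: iB.
  move=> w /hl [r hr]; exists r => v Vv vw.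
  by apply: (hr (v \o lshift s)) => //; apply: PR.
have [l hl] := choice rel.
(* None of [h], [a] and the [l i] vanishes identically on [V], so by primality they are all nonzero
   at some point of [V]. *)
have [w Vw gw] : exists2 w, V w & (h * lft (a * \prod_i l i)).@[w] != 0.
  apply: contrapT => hn; have hz v : V v -> h.@[v] * (lft (a * \prod_i l i)).@[v] = 0.
    by move=> Vv; rewrite -mevalM; apply: contrapT => /eqP hh; apply: hn; exists v.
  have [//|] := Vp _ _ hz; move/PE/Pp => [//|].
  apply: (big_rec (fun q => P q -> False)) => [//|i q _ IH] /Pp [] //.
  exact: (hl i).1.
move: gw; rewrite mevalM lftE mevalM => gw.
have hw : h.@[w] != 0 by apply: contraNneq gw => ->; rewrite mul0r.
have aw : a.@[w \o lshift s] != 0 by apply: contraNneq gw => ->; rewrite mul0r mulr0.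
have lw i : (l i).@[w \o lshift s] != 0.
  apply: contraNneq gw => e; rewrite rmorph_prod (bigD1 i) //= e mul0r !mulr0 //.
have /choice [r hr] i := (hl i).2 _ (lw i).
pose sh (f : {mpoly K[n + s]}) := f \mPo [tuple 'X_i + (w i)%:MP_[n + s] | i < n + s].
have shE f x : (sh f).@[x] = f.@[fun i => x i + w i].
  by rewrite comp_mpoly_meval; apply: meval_eq => i; rewrite tnth_mktuple mevalD mevalXU mevalC.
(* The equations of [V] with [w] moved to the origin, together with the vanishing of the coordinates
   in [B]. Off the zeros of [h] and [a] their solutions are finite in number: the first n
   coordinates are roots of finitely many polynomials, and the fibres are finite. *)
pose eqs (i : 'I_(s.+1 + #|B|)) := match split i with
  | inl i => sh (G i) | inr b => 'X_(lshift s (enum_val b)) end.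
have card_le : (n + s <= s.+1 + #|B|)%N.
  pose rs := flatten [seq r i | i <- enum 'I_n].
  pose T := seq_sub rs.
  pose fn (g : {ffun 'I_n -> T}) : 'I_n -> K := fun i => ssval (g i).
  pose etas := map fn (enum {ffun 'I_n -> T}).
  have etasP v : V v -> {in B, v \o lshift s =1 w \o lshift s} ->
      exists2 eta, eta \in etas & v \o lshift s = eta.
    move=> Vv vw.
    have inr i : v (lshift s i) \in rs.
      by apply/flattenP; exists (r i); [rewrite map_f ?mem_enum | apply: hr].
    exists (fn [ffun i => SeqSub (inr i)]); first by rewrite map_f ?mem_enum.
    by apply/funext => i; rewrite /fn ffunE.
  have /choice [ts hts] (eta : 'I_n -> K) : exists t : seq ('I_s -> K), a.@[eta] != 0 ->
      forall v, V v -> v \o lshift s =1 eta -> v \o @rshift n s \in t.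
    have [a0|a0] := eqVneq a.@[eta] 0; first by exists [::].
    by have [t ht] := fin eta a0; exists t.
  pose pts : seq ('I_(n + s) -> K) := [seq (fun k => match split k with
    | inl i => eta i - w k | inr i => z i - w k end) | eta <- etas, z <- ts eta].
  apply: (@isolated_zero K uncountable (n + s) (s.+1 + #|B|) eqs (sh (h * lft a)) (size pts)
    (fun j => nth (fun=> 0) pts j)).
  - move=> i; rewrite /eqs; case: split => [k|b]; last by rewrite mevalXU.
    rewrite shE -[RHS](VG w k Vw); apply: meval_eq => x; by rewrite add0r.
  - rewrite shE (meval_eq (v2 := w)) => [|x]; last by rewrite add0r.
    by rewrite mevalM lftE mulf_neq0.
  move=> x xG; rewrite shE mevalM lftE mulf_eq0 negb_or => /andP [hx ax].
  pose v k := x k + w k.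
  have Vv : V v.
    apply: hV => // i; have := xG (lshift _ i).
    by rewrite /eqs (unsplitK (inl i)) shE.
  have vB : {in B, v \o lshift s =1 w \o lshift s}.
    move=> i iB'; have := xG (rshift _ (enum_rank_in iB' i)).
    by rewrite /eqs (unsplitK (inr _)) mevalXU enum_rankK_in // /v /= => ->; rewrite add0r.
  have [eta eeta veta] := etasP v Vv vB.
  have zin : v \o @rshift n s \in ts eta by apply: hts => //; rewrite -veta.
  have xin : x \in pts.
    have -> : x = (fun k => match split k with
        | inl i => eta i - w k | inr i => (v \o @rshift n s) i - w k end).
      apply/funext => k; rewrite -veta; case: splitP => i ki.
        by rewrite /v /= (_ : lshift s i = k) ?addrK //; apply: val_inj.
      by rewrite /v /= (_ : rshift n i = k) ?addrK //; apply: val_inj.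
    by apply/allpairsPdep; exists eta, (v \o @rshift n s).
  have lt : (index x pts < size pts)%N by rewrite index_mem.
  by exists (Ordinal lt) => k /=; rewrite nth_index.
have [j jB] : exists j, forall i, i != j -> i \in B.
  have le1 : (#|~: B| <= 1)%N by have := cardsC B; rewrite card_ord; lia.
  have [e|[j jB]] := set_0Vmem (~: B).
    exists (Ordinal n0) => i _; have : i \notin ~: B by rewrite e inE.
    by rewrite inE negbK.
  exists j => i ij; apply: contraT => iB'.
  have : [set i; j]%SET \subset ~: B.
    apply/fintype.subsetP => x; rewrite !inE => /orP [] /eqP -> //.
    by move: jB; rewrite inE.
  by move/subset_leq_card; rewrite cards2 ij => /leq_trans /(_ le1).
apply: (principal_of_independent (j := j)) => // p Pp' dp; apply: iB => // x y xy.
by apply: dp => i ij; apply: xy; apply: jB.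
Qed.

End Hypersurface.

(** * Residues and primitives *)


Section Wronskian.
Variable K : closedFieldType.
Hypothesis char0 : forall n, n.+1%:R != 0 :> K.
Implicit Types (G H D N M P Q : {poly K}).

(** The numerator of the derivative of [G / D] over the denominator [D ^ 2]. *)
Definition Wr G D := G^`() * D - G * D^`().

Lemma char0_inj (m n : nat) : m%:R = n%:R :> K -> m = n.
Proof.
wlog le : m n / (m <= n)%N.
  by move=> H; case: (leqP m n) => [|/ltnW] h e; [|symmetry]; apply: H.
move=> e; apply/eqP; rewrite eqn_leq le /= leqNgt; apply/negP => lt.
have := char0 (n - m).-1; rewrite prednK ?subn_gt0 // natrB // e subrr eqxx //.
Qed.

Lemma charB_neq0 (m n : nat) : m != n -> m%:R - n%:R != 0 :> K.
Proof. by move=> mn; rewrite subr_eq0; apply: contraNneq mn => /char0_inj ->. Qed.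

Lemma WrBr G D c : Wr (G - c *: D) D = Wr G D.
Proof. by rewrite /Wr derivB derivZ -!mul_polyC; ring. Qed.
Lemma WrZ c G D : Wr (c *: G) D = c *: Wr G D.
Proof. by rewrite /Wr derivZ -!mul_polyC; ring. Qed.
Lemma WrZr c G D : Wr G (c *: D) = c *: Wr G D.
Proof. by rewrite /Wr derivZ -!mul_polyC; ring. Qed.
Lemma Wr_add G1 A G2 B : Wr (G1 * B + G2 * A) (A * B) =
  B ^+ 2 * Wr G1 A + A ^+ 2 * Wr G2 B.
Proof. by rewrite /Wr derivD !derivM; ring. Qed.
Lemma WrMM G D B : Wr (G * B) (D * B) = B ^+ 2 * Wr G D.
Proof. by rewrite /Wr !derivM; ring. Qed.

Lemma deriv_XsubCX (a : K) n : (('X - a%:P) ^+ n)^`() = ('X - a%:P) ^+ n.-1 *+ n.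
Proof. by rewrite deriv_exp derivXsubC mul1r. Qed.

Lemma mup_mulX (a : K) n Q : Q != 0 -> ~~ root Q a -> mup a (('X - a%:P) ^+ n * Q) = n.
Proof. by move=> Q0 Qa; rewrite mupMl // mup_XsubCX eqxx. Qed.

Lemma mup_factor (a : K) P : P != 0 -> exists2 Q, ~~ root Q a & P = ('X - a%:P) ^+ mup a P * Q.
Proof.
move=> P0; have : ('X - a%:P) ^+ mup a P %| P by rewrite -mup_geq.
move=> /dvdpP [Q PE]; exists Q; last by rewrite mulrC.
have Q0 : Q != 0 by apply: contraNneq P0 => e; rewrite PE e mul0r.
apply: contraT; rewrite negbK root_factor_theorem => /dvdpP [S QE].
have : ((mup a P).+1 <= mup a P)%N.
  by rewrite mup_geq // {2}PE QE -mulrA -exprS dvdp_mulIr.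
by rewrite ltnn.
Qed.

Lemma Wr_shape_ring (R : comPzRingType) (u v x c b G D G' D' : R) :
  (c * u * G + x * u * G') * (x * v * D) - x * u * G * (b * v * D + x * v * D') =
  x * (u * v) * ((c - b) * (G * D) + x * (G' * D - G * D')).
Proof. by ring. Qed.

Lemma Wr_shape (a : K) g d G D : (0 < g + d)%N ->
  Wr (('X - a%:P) ^+ g * G) (('X - a%:P) ^+ d * D) =
  ('X - a%:P) ^+ (g + d).-1 * ((g%:R - d%:R) *: (G * D) + ('X - a%:P) * Wr G D).
Proof.
rewrite /Wr !derivM !deriv_XsubCX; move: ('X - a%:P : {poly K}) => x.
have e k : x ^+ k.-1 *+ k * x = x ^+ k *+ k.
  by case: k => [|k]; rewrite ?mul0r //= mulrnAl -exprSr.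
case: g => [|g]; case: d => [|d] // _.
- by rewrite /= !expr0 !mulr0n sub0r scaleNr -mul_polyC polyC_natr exprS -mulr_natl; ring.
- by rewrite /= !expr0 !mulr0n addn0 subr0 -mul_polyC polyC_natr exprS -mulr_natl; ring.
- have e1 n (P : {poly K}) : P *+ n = (n%:R)%:P * P by rewrite polyC_natr mulr_natl.
  rewrite addSn addnS /= -mul_polyC polyCB (e1 g.+1) (e1 d.+1) (exprS x g) (exprS x d).
  rewrite -[(g + d).+1]addnS (exprD x g d.+1) (exprS x d).
  rewrite Wr_shape_ring; congr (_ * _); exact: mulrCA.
Qed.

Lemma Wr_pole (a : K) b H : Wr H (('X - a%:P) ^+ b) * ('X - a%:P) =
  ('X - a%:P) ^+ b * (H^`() * ('X - a%:P) - H *+ b).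
Proof.
rewrite /Wr deriv_XsubCX mulrBl -[H * _ * _]mulrA mulrnAl.
have -> : ('X - a%:P) ^+ b.-1 * ('X - a%:P) *+ b = ('X - a%:P) ^+ b *+ b.
  by case: b => [|b] //=; rewrite -exprSr.
move: (('X - a%:P) ^+ b) ('X - a%:P : {poly K}) (H^`()) => A x H'.
by rewrite mulrnAr mulrBr mulrnAr [H * _]mulrC mulrA [x ^+ b * H']mulrC.
Qed.

(** Differentiation lowers a nonzero order of [G / D] by one: the factor [g - d] in [Wr_shape] is
    nonzero in characteristic zero. *)
Lemma mup_Wr (a : K) G D : G != 0 -> D != 0 -> mup a G != mup a D ->
  Wr G D != 0 /\ (mup a (Wr G D)).+1 = (mup a G + mup a D)%N.
Proof.
move=> G0 D0 gd; have [G1 G1a GE] := mup_factor a G0; have [D1 D1a DE] := mup_factor a D0.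
have pos : (0 < mup a G + mup a D)%N by move: gd; case: (mup a G) (mup a D) => [|?] [|?].
move: (Wr_shape a G1 D1 pos); rewrite -GE -DE => ->.
set Q := (_ *: _ + _); have Qa : ~~ root Q a.
  rewrite /root /Q hornerD hornerM hornerXsubC subrr mul0r addr0 hornerZ hornerM.
  by rewrite !mulf_neq0 ?charB_neq0.
have Q0 : Q != 0 by apply: contraNneq Qa => ->; rewrite root0.
by rewrite mup_mulX // prednK // mulf_neq0 // expf_neq0 // polyXsubC_eq0.
Qed.

Lemma coefM_top P Q a b : (size P <= a.+1)%N -> (size Q <= b.+1)%N ->
  (P * Q)`_(a + b) = P`_a * Q`_b.
Proof.
move=> sP sQ; have lt : (a < (a + b).+1)%N by rewrite ltnS leq_addr.
rewrite coefM (bigD1 (Ordinal lt)) //= addKn big1 ?addr0 // => i ia.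
have [h|h] := leqP i a; last by rewrite nth_default ?mul0r // (leq_trans sP).
rewrite [Q`__]nth_default ?mulr0 // (leq_trans sQ) //.
have : (i < a)%N by rewrite ltn_neqAle h andbT; apply: contra ia => /eqP e; apply/eqP/val_inj.
by lia.
Qed.

Lemma size_deriv_leq P : (size P^`() <= (size P).-1)%N.
Proof. exact: size_poly. Qed.

(** The counterpart of [mup_Wr] at infinity; the top coefficient carries the difference of the
    degrees as a factor. *)
Lemma size_Wr G D : G != 0 -> D != 0 -> size G != size D ->
  Wr G D != 0 /\ (size (Wr G D)).+2 = (size G + size D)%N.
Proof.
move=> G0 D0 gd; have [g sg] : exists g, size G = g.+1.
  by exists (size G).-1; rewrite prednK // lt0n size_poly_eq0.
have [d sd] : exists d, size D = d.+1.
  by exists (size D).-1; rewrite prednK // lt0n size_poly_eq0.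
have ub : (size (Wr G D) <= g + d)%N.
  have hM (P Q : {poly K}) a b : (size P <= a)%N -> (size Q <= b.+1)%N -> (size (P * Q)%R <= a + b)%N.
    move=> h1 h2; apply: leq_trans (size_polyMleq _ _) _; lia.
  rewrite /Wr; apply: leq_trans (size_polyD _ _) _; rewrite size_polyN geq_max.
  rewrite hM ?sd //=; last by have := size_deriv_leq G; rewrite sg.
  by rewrite mulrC addnC hM ?sg //; have := size_deriv_leq D; rewrite sd.
have pos : (0 < g + d)%N by rewrite sg sd in gd; lia.
have top : (Wr G D)`_(g + d).-1 = (g%:R - d%:R) * (G`_g * D`_d).
  have h P Q a b : (size P <= a.+1)%N -> (size Q <= b.+1)%N ->
      (P^`() * Q)`_(a + b).-1 = a%:R * (P`_a * Q`_b).
    case: a => [|a] h1 h2.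
      by rewrite (size1_polyC h1) derivC mul0r coef0 mul0r.
    rewrite addSn /= coefM_top ?coef_deriv ?mulrnAl ?mul1r //.
    by apply: leq_trans (size_deriv_leq _) _; lia.
  rewrite /Wr coefB [G * _]mulrC h ?sg ?sd // [(g + d)%N]addnC h ?sg ?sd //; ring.
have tn0 : (Wr G D)`_(g + d).-1 != 0.
  rewrite top !mulf_neq0 ?charB_neq0 //.
  - by move: gd; rewrite sg sd.
  - by move: G0; rewrite -lead_coef_eq0 lead_coefE sg.
  - by move: D0; rewrite -lead_coef_eq0 lead_coefE sd.
have lb : ((g + d).-1 < size (Wr G D))%N.
  by rewrite ltnNge; apply: contra tn0 => h; rewrite nth_default.
split; first by apply: contraNneq tn0 => ->; rewrite coef0.
by rewrite sg sd; rewrite prednK // in lb; lia.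
Qed.

Lemma Wr_eq0 G D : D != 0 -> Wr G D = 0 -> exists c, G = c *: D.
Proof.
move=> D0 W0; have [->|G0] := eqVneq G 0; first by exists 0; rewrite scale0r.
have sGD H : H != 0 -> Wr H D = 0 -> size H = size D.
  by move=> H0 h; apply/eqP; apply: contraT => /(size_Wr H0 D0) []; rewrite h eqxx.
pose c := lead_coef G / lead_coef D; exists c; apply/eqP; rewrite -subr_eq0.
apply: contraT => n0; have e := sGD _ G0 W0.
have := sGD _ n0; rewrite WrBr => /(_ W0) e'.
have : (G - c *: D)`_(size D).-1 = 0.
  by rewrite coefB coefZ -{1}e -!lead_coefE /c divfK ?subrr // lead_coef_eq0.
by rewrite -e' -lead_coefE => /eqP; rewrite lead_coef_eq0 (negPf n0).
Qed.

(** If [G / D] has a pole at infinity, its order there is determined by the order of the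
    differential; otherwise [D] bounds the degree of [G]. *)
Lemma primitive_size G D R N : N != 0 -> D != 0 -> R != 0 -> Wr G D * R = N * D ->
  (size G + size R <= maxn (size D + size R) (size N + 2))%N.
Proof.
move=> N0 D0 R0 e; have [le|lt] := leqP (size G) (size D).
  by rewrite leq_max leq_add2r le.
have G0 : G != 0 by rewrite -size_poly_gt0 (leq_trans _ lt).
have [W0 sW] := size_Wr G0 D0 (negbT (gtn_eqF lt)).
have := congr1 (fun P : {poly K} => size P) e; rewrite /= !size_mul //.
move: N0 R0 W0 D0 sW; rewrite -!size_poly_gt0.
move: (size G) (size D) (size R) (size N) (size (Wr G D)) => g d r m w.
by move=> *; lia.
Qed.

End Wronskian.

Section Residues.
Variable K : closedFieldType.
Hypothesis char0 : forall n, n.+1%:R != 0 :> K.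
Implicit Types (G H D N M P Q T : {poly K}).
Local Notation lin a := ('X - a%:P).

Lemma lin_neq0 (a : K) k : lin a ^+ k != 0.
Proof. by rewrite expf_neq0 // polyXsubC_eq0. Qed.

Lemma coprime_linX (a : K) k Q : ~~ root Q a -> coprimep (lin a ^+ k) Q.
Proof. by move=> h; rewrite coprimep_expl // coprimep_sym coprimep_XsubC. Qed.

Lemma dvdp_shift_coef (a : K) k j P : lin a ^+ k %| P -> (j < k)%N ->
  (P \Po ('X + a%:P))`_j = 0.
Proof.
move=> /dvdpP [Q ->] jk; rewrite comp_polyM rmorphXn /= comp_polyB comp_polyX comp_polyC.
by rewrite addrK coefMXn jk.
Qed.

Lemma shift_linX (a : K) k P : (lin a ^+ k * P) \Po ('X + a%:P) = 'X^k * (P \Po ('X + a%:P)).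
Proof. by rewrite comp_polyM rmorphXn /= comp_polyB comp_polyX comp_polyC addrK. Qed.

Lemma residue_uniq N M (a c c' : K) : M != 0 ->
  has_residue N M a c -> has_residue N M a c' -> c = c'.
Proof.
move=> M0 [k [T [dT ->]]] [k' [T' [dT' ->]]].
have : lin a ^+ (mup a M + (k + k').+2) %|
    M * (T * lin a ^+ k'.+1 - T' * lin a ^+ k.+1).
  have -> : M * (T * lin a ^+ k'.+1 - T' * lin a ^+ k.+1) =
      lin a ^+ k.+1 * (N * lin a ^+ k'.+1 - T' * M) -
      lin a ^+ k'.+1 * (N * lin a ^+ k.+1 - T * M) by ring.
  apply: dvdp_sub.
    rewrite (_ : (mup a M + (k + k').+2)%N = (k.+1 + (mup a M + k'.+1))%N); last lia.
    by rewrite exprD dvdp_mul.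
  rewrite (_ : (mup a M + (k + k').+2)%N = (k'.+1 + (mup a M + k.+1))%N); last lia.
  by rewrite exprD dvdp_mul.
have [M1 M1a ME] := mup_factor a M0.
rewrite {2}ME exprD -mulrA dvdp_mul2l ?lin_neq0 // Gauss_dvdpr ?coprime_linX //.
move/dvdp_shift_coef/(_ (ltnSn _)).
rewrite comp_polyB coefB mulrC shift_linX coefXnM [T' * _]mulrC shift_linX coefXnM.
rewrite (_ : ((k + k').+1 < k'.+1)%N = false); last by lia.
rewrite (_ : ((k + k').+1 < k.+1)%N = false); last by lia.
rewrite (_ : ((k + k').+1 - k'.+1)%N = k); last by lia.
rewrite (_ : ((k + k').+1 - k.+1)%N = k'); last by lia.
by move/eqP; rewrite subr_eq0 => /eqP.
Qed.

Lemma residue_ratio N M N2 M2 (a c : K) : M != 0 -> M2 != 0 -> N * M2 = N2 * M ->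
  has_residue N M a c -> has_residue N2 M2 a c.
Proof.
move=> M0 M20 e [k [T [dT ->]]]; exists k, T; split=> //.
have : lin a ^+ (mup a M2 + k.+1 + mup a M) %| M * (N2 * lin a ^+ k.+1 - T * M2).
  have -> : M * (N2 * lin a ^+ k.+1 - T * M2) = M2 * (N * lin a ^+ k.+1 - T * M).
    by rewrite !mulrBr [M * (N2 * _)]mulrCA mulrA -e; ring.
  rewrite (_ : (_ + _ + _)%N = (mup a M2 + (mup a M + k.+1))%N); last lia.
  by rewrite exprD dvdp_mul // -mup_geq.
have [M1 M1a ME] := mup_factor a M0.
rewrite {2}ME exprD [_ ^+ _ * _ ^+ mup a M]mulrC -mulrA dvdp_mul2l ?lin_neq0 //.
by rewrite Gauss_dvdpr ?coprime_linX.
Qed.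

Lemma residueZ0 N M (a c : K) : has_residue N M a 0 -> has_residue (c *: N) M a 0.
Proof.
move=> [k [T [dT e]]]; exists k, (c *: T); split; last by rewrite comp_polyZ coefZ -e mulr0.
by rewrite -!scalerAl -scalerBr -mul_polyC dvdp_mull.
Qed.

Lemma glue_ring (R : comPzRingType) (d w1 A w2 x rr n1 n2 : R) :
  w1 * x = n1 * A -> w2 * rr = n2 * d ->
  (d ^+ 2 * w1 + A ^+ 2 * w2) * (x * rr) = (n1 * (d * rr) + n2 * (x * A)) * (A * d).
Proof.
move=> h1 h2.
have -> : (d ^+ 2 * w1 + A ^+ 2 * w2) * (x * rr) = d ^+ 2 * rr * (w1 * x) + A ^+ 2 * x * (w2 * rr) by ring.
by rewrite h1 h2; ring.
Qed.

(* The coefficient of h^(e-1) in N(a + h) / W(h), cleared of denominators by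
   W(0)^e. *)
Definition residue_num (R : comNzRingType) (a : R) (N M1 : {poly R}) (e : nat) : R :=
  let W := M1 \Po ('X + a%:P) in
  ((N \Po ('X + a%:P)) * \sum_(k < e) (W`_0)%:P ^+ (e.-1 - k) * ((W`_0)%:P - W) ^+ k)`_e.-1.

Lemma residue_numP (a : K) N M1 e : (0 < e)%N -> ~~ root M1 a ->
  has_residue N (lin a ^+ e * M1) a 0 <-> residue_num a N M1 e = 0.
Proof.
move=> e0 M1a; have M10 : M1 != 0 by apply: contraNneq M1a => ->; rewrite root0.
have M0 : lin a ^+ e * M1 != 0 by rewrite mulf_neq0 // lin_neq0.
pose W := M1 \Po ('X + a%:P); pose w := W`_0.
have w0 : w != 0.
  by rewrite /w /W -horner_coef0 horner_comp hornerD hornerX hornerC add0r.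
(* Up to the factor [w ^ e], a truncated geometric series for the inverse of [W]: the error
   [(w - W) ^ e] is divisible by [X ^ e]. *)
pose I := \sum_(k < e) w%:P ^+ (e.-1 - k) * (w%:P - W) ^+ k.
have WI : W * I = w%:P ^+ e - (w%:P - W) ^+ e.
  by rewrite subrXX /I; congr (_ * _); ring.
have dW : 'X^e %| (w%:P - W) ^+ e.
  apply: dvdp_exp2r; rewrite -[X in X %| _]subr0 -polyC0 -root_factor_theorem.
  by rewrite /root hornerD hornerN hornerC horner_coef0 subrr.
pose T := ((w ^+ e)^-1 *: N) * (I \Po ('X - a%:P)).
have hres : has_residue N (lin a ^+ e * M1) a ((w ^+ e)^-1 * residue_num a N M1 e).
  exists e.-1, T; split.
    rewrite prednK // mup_mulX // exprD.
    have -> : N * lin a ^+ e - T * (lin a ^+ e * M1) = lin a ^+ e * (N - T * M1) by ring.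
    rewrite dvdp_mul2l ?lin_neq0 //.
    have /(dvdp_comp_poly ('X - a%:P)) := dW; rewrite comp_Xn_poly => dW'.
    have M1E : M1 = W \Po ('X - a%:P) by rewrite comp_polyXaddC_K.
    have -> : N - T * M1 = ((w ^+ e)^-1 *: N) * (((w%:P - W) ^+ e) \Po ('X - a%:P)).
      have WI' : (w%:P - W) ^+ e = (w ^+ e)%:P - W * I by rewrite WI rmorphXn /=; ring.
      rewrite WI' comp_polyB comp_polyC comp_polyM -M1E /T -!mul_polyC.
      have : ((w ^+ e)^-1)%:P * (w ^+ e)%:P = 1 :> {poly K} by rewrite -polyCM mulVf ?expf_neq0.
      move: ((w ^+ e)^-1)%:P ((w ^+ e)%:P) (I \Po _) => x y z xy.
      by rewrite mulrBr [_ * y]mulrAC xy mul1r; ring.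
    by rewrite dvdp_mull.
  by rewrite /T comp_polyM comp_polyZ -scalerAl coefZ -comp_polyA comp_polyB comp_polyX comp_polyC addrK comp_polyXr.
split=> h; last by rewrite h mulr0 in hres.
have /esym/eqP := residue_uniq M0 hres h.
by rewrite eq_sym mulf_eq0 invr_eq0 expf_eq0 (negPf w0) andbF => /eqP.
Qed.

Section Poles.
Variables (T : eqType) (p : T -> K) (e : T -> nat).
(** A differential with denominator [poleM] has a primitive with poles of one order less, hence with
    denominator [poleD]; their quotient is [poleR]. *)
Local Notation poleM r := (\prod_(i <- r) lin (p i) ^+ e i).
Local Notation poleD r := (\prod_(i <- r) lin (p i) ^+ (e i).-1).
Local Notation poleR r := (\prod_(i <- r) lin (p i)).

Lemma pole_prod (r : seq T) : (forall i, i \in r -> (0 < e i)%N) -> poleD r * poleR r = poleM r.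
Proof.
move=> he; rewrite -big_split /= [LHS]big_seq [RHS]big_seq; apply: eq_bigr => i /he ei.
by rewrite -exprSr prednK.
Qed.

Lemma pole_neq0 (r : seq T) (f : T -> nat) : \prod_(i <- r) lin (p i) ^+ f i != 0.
Proof. by rewrite prodf_seq_neq0; apply/allP => i _; rewrite lin_neq0. Qed.

Lemma pole_nroot (r : seq T) (f : T -> nat) a : a \notin map p r ->
  ~~ root (\prod_(i <- r) lin (p i) ^+ f i) a.
Proof.
elim: r => [|i r IH]; first by rewrite big_nil root1.
rewrite inE negb_or big_cons rootM negb_or => /andP [ai /IH ->]; rewrite andbT.
by rewrite /root horner_exp hornerXsubC expf_neq0 // subr_eq0.
Qed.

(** Partial fractions: Bezout splits off one pole, [N / M = N1 / x ^ e + N2 / M']. The residue there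
    becomes a coefficient of [N1], the other residues are unchanged, and the two primitives are
    added. *)
Lemma primitive_of_residues (r : seq T) N :
  uniq (map p r) -> (forall i, i \in r -> (0 < e i)%N) ->
  (forall i, i \in r -> has_residue N (poleM r) (p i) 0) ->
  exists G, Wr G (poleD r) * poleR r = N * poleD r.
Proof.
elim: r N => [|i r IH] N /=.
  move=> _ _ _; exists (\poly_(k < (size N).+1) (N`_k.-1 / k%:R)).
  rewrite !big_nil !mulr1 /Wr derivC mulr0 subr0 mulr1.
  apply/polyP => k; rewrite coef_deriv coef_poly ltnS /=.
  case: ltnP => h; last by rewrite mul0rn nth_default.
  by rewrite -[LHS]mulr_natr divfK.
move=> /andP [ir ur] he hN; set a := p i in ir *.
have ei : (0 < e i)%N by apply: he; rewrite mem_head.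
have he' j : j \in r -> (0 < e j)%N by move=> jr; apply: he; rewrite inE jr orbT.
pose M' := poleM r; have M'a : ~~ root M' a by apply: pole_nroot.
have M'0 : M' != 0 by apply: pole_neq0.
have [[u v] /= uv] := Bezout_eq1_coprimepP _ _ (coprime_linX (e i) M'a).
pose N1 := N * v; pose N2 := N * u.
have NE : N = N1 * M' + N2 * lin a ^+ e i by rewrite -[LHS]mulr1 -uv /N1 /N2; ring.
have [G2 hG2] : exists G, Wr G (poleD r) * poleR r = N2 * poleD r.
  apply: IH => // j jr; have [k [S [dS S0]]] := hN j (@mem_behead _ (i :: r) _ jr).
  exists k, S; split=> //; move: dS; rewrite big_cons -/M' -/a.
  have pja : p j != a by apply: contraNneq ir => <-; rewrite map_f.
  have aj : ~~ root (lin a ^+ e i) (p j).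
    by rewrite /root horner_exp hornerXsubC expf_neq0 // subr_eq0.
  rewrite mupMr //.
  have -> : N * lin (p j) ^+ k.+1 - S * (lin a ^+ e i * M') =
     lin a ^+ e i * (N2 * lin (p j) ^+ k.+1 - S * M') + N1 * (M' * lin (p j) ^+ k.+1).
    by rewrite NE; ring.
  rewrite dvdp_addl; first by rewrite Gauss_dvdpr // coprime_linX.
  by rewrite dvdp_mull // exprD dvdp_mul // -mup_geq.
have n1 : (N1 \Po ('X + a%:P))`_(e i).-1 = 0.
  have [k [S [dS S0]]] := hN i (mem_head _ _); move: dS; rewrite big_cons -/M' -/a.
  rewrite mup_mulX //.
  have -> : N * lin a ^+ k.+1 - S * (lin a ^+ e i * M') =
     M' * (N1 * lin a ^+ k.+1 - S * lin a ^+ e i) + N2 * (lin a ^+ e i * lin a ^+ k.+1).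
    by rewrite NE; ring.
  rewrite dvdp_addl; last by rewrite dvdp_mull // exprD.
  rewrite Gauss_dvdpr ?coprime_linX // => /(dvdp_shift_coef (j := (e i).-1 + k.+1)).
  rewrite comp_polyB coefB mulrC shift_linX coefXnM [S * _]mulrC shift_linX coefXnM.
  have e1 : ((e i).-1 + k.+1 - k.+1 = (e i).-1)%N by lia.
  have e2 : ((e i).-1 + k.+1 - e i = k)%N by lia.
  have e3 : ((e i).-1 + k.+1 < k.+1)%N = false by lia.
  have e4 : ((e i).-1 + k.+1 < e i)%N = false by lia.
  by rewrite e1 e2 e3 e4 -S0 subr0; apply; lia.
pose b := (e i).-1.
have [G1 hG1] : exists G1, Wr G1 (lin a ^+ b) * lin a = N1 * lin a ^+ b.
  pose C := N1 \Po ('X + a%:P).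
  (* [H / X ^ b] is a primitive of [C / X ^ (b + 1)] if [(k - b) H_k = C_k] for all k; at [k = b]
     this is solvable because the residue [C_b] vanishes. *)
  pose H := \poly_(k < size C) (C`_k / (k%:R - b%:R)).
  exists (H \Po ('X - a%:P)).
  have hH : H^`() * 'X - H *+ b = C.
    apply/polyP => k; rewrite coefB coefMX coef_deriv coefMn.
    have -> : (if k == 0%N then 0 else (H`_k.-1.+1 *+ k.-1.+1)) = H`_k * k%:R.
      by case: (k) => [|k'] /=; rewrite ?mulr0 // mulr_natr.
    rewrite /H coef_poly; case: ltnP => hk; last by rewrite mul0r mul0rn subr0 nth_default.
    rewrite -[X in _ - X]mulr_natr -mulrBr; have [->|kb] := eqVneq k b; first by rewrite subrr mulr0 n1.
    by rewrite divfK // charB_neq0.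
  have := congr1 (fun P => P \Po ('X - a%:P)) hH.
  rewrite comp_polyB comp_polyM comp_polyX rmorphMn /= comp_polyXaddC_K => hC.
  by rewrite Wr_pole deriv_comp derivXsubC mulr1 hC mulrC.
exists (G1 * poleD r + G2 * lin a ^+ b).
rewrite !big_cons -/a -/b Wr_add.
have pE : poleD r * poleR r = M' by apply: pole_prod.
have eE : lin a ^+ e i = lin a * lin a ^+ b by rewrite -exprS prednK.
by rewrite {1}NE eE -pE; apply: glue_ring.
Qed.

(** Bezout writes the primitive as [H / x ^ b] plus a function regular at the pole. [S] is the
    numerator of the derivative of the first term, whose coefficient of index b is
    [b H_b - b H_b]. *)
Lemma residues_of_primitive (r : seq T) N G i :
  uniq (map p r) -> (forall i, i \in r -> (0 < e i)%N) -> i \in r ->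
  Wr G (poleD r) * poleR r = N * poleD r -> has_residue N (poleM r) (p i) 0.
Proof.
move=> ur he ir hG; have /perm_to_rem pr := ir; set r' := rem i r in pr.
have ur' : uniq (map p (i :: r')) by rewrite -(perm_uniq (perm_map p pr)).
have he' j : j \in i :: r' -> (0 < e j)%N by rewrite -(perm_mem pr); apply: he.
rewrite !(perm_big _ pr) /= in hG *; rewrite !big_cons in hG *.
move: ur' => /= /andP [ir' _]; set a := p i in ir' hG *.
have ei : (0 < e i)%N by apply: he.
set b := (e i).-1 in hG.
pose D1 := poleD r'; have D1a : ~~ root D1 a by apply: pole_nroot.
have D10 : D1 != 0 by apply: pole_neq0.
pose R1 := poleR r'; pose M1 := poleM r'.
have M1E : D1 * R1 = M1 by apply: pole_prod => j jr; apply: he'; rewrite inE jr orbT.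
have M1a : ~~ root M1 a by apply: pole_nroot.
rewrite -/D1 -/R1 in hG; rewrite -/M1.
have [[J I] /= IJ] := Bezout_eq1_coprimepP _ _ (coprime_linX (e i) D1a).
pose H := G * I; pose S := H^`() * lin a - H *+ b.
exists b, S; split; last first.
  rewrite comp_polyB comp_polyM comp_polyB comp_polyX comp_polyC addrK rmorphMn /=.
  have -> : H^`() \Po ('X + a%:P) = (H \Po ('X + a%:P))^`().
    by rewrite deriv_comp derivD derivX derivC addr0 mulr1.
  move: (H \Po _) => H'; rewrite coefB coefMX coef_deriv coefMn.
  by case: (b) => [|b'] /=; rewrite ?mulr0n ?subr0 // subrr.
have be : b.+1 = e i by rewrite prednK.
rewrite mup_mulX ?pole_neq0 // be exprD.
have -> : N * lin a ^+ e i - S * (lin a ^+ e i * M1) = lin a ^+ e i * (N - S * M1) by ring.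
rewrite dvdp_mul2l ?lin_neq0 //.
pose A := lin a ^+ b.
have key : A * D1 * (N - S * M1) = lin a * R1 * Wr (lin a ^+ e i * (G * J)) (A * D1).
  have GE : G = H * D1 + lin a ^+ e i * (G * J).
    by rewrite -[LHS]mulr1 -IJ /H; ring.
  have WHA : Wr H A * lin a = A * S by apply: Wr_pole.
  have h1 : A * D1 * N = Wr G (A * D1) * (lin a * R1) by rewrite hG mulrC.
  have WD : Wr G (A * D1) = Wr (H * D1) (A * D1) + Wr (lin a ^+ e i * (G * J)) (A * D1).
    by rewrite {1}GE /Wr derivD; ring.
  rewrite mulrBr h1 WD WrMM -M1E mulrDl.
  have -> : D1 ^+ 2 * Wr H A * (lin a * R1) = D1 ^+ 2 * (Wr H A * lin a) * R1 by ring.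
  by rewrite WHA; ring.
have : lin a ^+ (b + e i) %| A * D1 * (N - S * M1).
  rewrite key Wr_shape ?addn_gt0 ?ei //.
  rewrite (_ : (e i + b).-1 = (b + b)%N); last by rewrite -be; lia.
  have -> : lin a ^+ (b + e i) = lin a * lin a ^+ (b + b) by rewrite -exprS; congr (_ ^+ _); lia.
  move: (_ + _ * Wr _ _) => Z.
  by rewrite -[lin a * R1 * _]mulrA mulrCA mulrA mulrAC -mulrA dvdp_mul2l ?polyXsubC_eq0 // dvdp_mulr ?dvdp_mulIl || rewrite (_ : lin a * R1 * (lin a ^+ (b + b) * Z) = (lin a * lin a ^+ (b + b)) * (R1 * Z)) ?dvdp_mulIl //; ring.
rewrite exprD /A -mulrA dvdp_mul2l ?lin_neq0 // Gauss_dvdpr ?coprime_linX //.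
Qed.
End Poles.
End Residues.

(** * Exact differentials *)


Section Exact.
Variable K : closedFieldType.
Hypothesis char0 : forall n, n.+1%:R != 0 :> K.
Variable T : finType.
Implicit Types (G D R N P Q : {poly K}) (B : {set T}) (e : T -> nat) (p : T -> K).
Local Notation lin a := ('X - a%:P).

Definition lprod (R : comNzRingType) B e (p : T -> R) : {poly R} :=
  \prod_(i in B) lin (p i) ^+ e i.

Lemma lprod_neq0 B e p : lprod B e p != 0.
Proof. by apply/prodf_neq0 => i _; rewrite lin_neq0. Qed.

Lemma lprod_horner B e p z : (lprod B e p).[z] = \prod_(i in B) (z - p i) ^+ e i.
Proof. by rewrite horner_prod; apply: eq_bigr => i _; rewrite horner_exp hornerXsubC. Qed.

Lemma eq_lprod B e p p' : {in B, p =1 p'} -> lprod B e p = lprod B e p'.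
Proof. by move=> h; apply: eq_bigr => i /h ->. Qed.

Lemma size_lprod B e p : size (lprod B e p) = (\sum_(i in B) e i).+1.
Proof.
rewrite size_prod => [|i _]; last exact: lin_neq0.
under eq_bigr => i _ do rewrite size_exp_XsubC.
rewrite (eq_bigr (fun i => e i + 1)%N) => [|i _]; last by rewrite addn1.
by rewrite big_split /= sum1_card -addSn addnK.
Qed.

Lemma mup_lprod B e p z : mup z (lprod B e p) = (\sum_(i in B | p i == z) e i)%N.
Proof.
rewrite /lprod big_mkcondr -big_enum -[in RHS]big_enum /=.
elim: (enum B) => [|i s IH]; first by rewrite !big_nil mupNroot // root1.
rewrite !big_cons mupM ?lin_neq0 //; first by rewrite IH mup_XsubCX.
by rewrite prodf_seq_neq0; apply/allP => j _; rewrite lin_neq0.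
Qed.

Lemma lprod_affine B e p c d : d != 0 ->
  lprod B e p \Po (c%:P + d *: 'X) =
  (d ^+ (\sum_(i in B) e i)) *: lprod B e (fun i => (p i - c) / d).
Proof.
move=> d0; rewrite /lprod rmorph_prod /= -prodrXr -[RHS]mul_polyC rmorph_prod -big_split /=.
apply: eq_bigr => i _; rewrite rmorphXn /= rmorphXn /= -exprMn; congr (_ ^+ _).
rewrite comp_polyB comp_polyX comp_polyC mulrBr -polyCM [d * _]mulrC divfK //.
by rewrite mul_polyC polyCB; ring.
Qed.

Lemma Wr_affine G D c d : Wr (G \Po (c%:P + d *: 'X)) (D \Po (c%:P + d *: 'X)) =
  d *: (Wr G D \Po (c%:P + d *: 'X)).
Proof.
rewrite /Wr !deriv_comp derivD derivC add0r derivZ derivX alg_polyC.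
by rewrite comp_polyB !comp_polyM -[RHS]mul_polyC; ring.
Qed.

Lemma Wr_rescale G D R N a b c : a != 0 -> b != 0 ->
  Wr G (a *: D) * (b *: R) = (c *: N) * (a *: D) ->
  c != 0 -> Wr ((b / c) *: G) D * R = N * D.
Proof.
move=> a0 b0 e c0; rewrite WrZ; apply: (@scalerI _ _ (a * c)); first by rewrite mulf_neq0.
move: e; rewrite WrZr -!scalerAl -!scalerAr !scalerA => e.
by rewrite -[RHS](_ : c * a *: (N * D) = _) 1?mulrC // -e; congr (_ *: _); field.
Qed.

Variable kappa : T -> int.

(** With Z, D and R the products of linear factors with exponents [zexp], [pexp] and [pind], the
    differential is [Z / (D R) dz], and D is the denominator of its primitives. *)
Definition zexp i : nat := if 0 <= kappa i then `|kappa i|%N else 0%N.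
Definition pexp i : nat := if 0 <= kappa i then 0%N else `|kappa i|.-1.
Definition pind i : nat := (kappa i < 0)%R.

Lemma exp_balance i : (zexp i)%:Z - (pexp i)%:Z - (pind i)%:Z = kappa i.
Proof.
rewrite /zexp /pexp /pind; case: (Order.TotalTheory.leP 0 (kappa i)) => h /=; last by lia.
by lia.
Qed.

(* The differential \prod_(i in B) (z - p i) ^ kappa i dz is d (G / D), for D the
   product of the (z - p i) ^ (- kappa i - 1) with kappa i < 0. *)
Definition exact B p := exists G,
  Wr G (lprod B pexp p) * lprod B pind p = lprod B zexp p * lprod B pexp p.

Lemma eq_exact B p p' : {in B, p =1 p'} -> exact B p -> exact B p'.
Proof. by move=> h [G hG]; exists G; rewrite -!(eq_lprod _ h). Qed.

Lemma exact_affine B p c d : d != 0 -> exact B p -> exact B (fun i => (p i - c) / d).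
Proof.
move=> d0 [G hG]; pose l := c%:P + d *: 'X : {poly K}.
have := congr1 (fun P => P \Po l) hG; rewrite !comp_polyM !lprod_affine // => h.
eexists; apply: (@Wr_rescale (G \Po l) _ _ _ (d ^+ (\sum_(i in B) pexp i)) (d ^+ (\sum_(i in B) pind i)) (d * d ^+ (\sum_(i in B) zexp i))); rewrite ?mulf_neq0 ?expf_neq0 //.
rewrite -lprod_affine // Wr_affine -scalerAl h -!scalerAr -!scalerAl !scalerA.
by rewrite -/l lprod_affine // -!scalerAr !scalerA; congr (_ *: _); ring.
Qed.

Lemma exact_residues B p : {in B &, injective p} ->
  exact B p <-> forall i, i \in B -> kappa i < 0 ->
    has_residue (lprod B zexp p) (lprod B (fun i => pexp i + pind i)%N p) (p i) 0.
Proof.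
move=> inj; pose s := enum [set i in B | kappa i < 0]; pose e i := `|kappa i|%N.
have sE i : (i \in s) = (i \in B) && (kappa i < 0) by rewrite mem_enum inE.
have us : uniq (map p s).
  rewrite map_inj_in_uniq ?enum_uniq // => i j.
  by rewrite !sE => /andP [iB _] /andP [jB _]; apply: inj.
have red (f g : T -> nat) : (forall i, 0 <= kappa i -> f i = 0%N) ->
    (forall i, kappa i < 0 -> f i = g i) ->
    lprod B f p = \prod_(i <- s) lin (p i) ^+ g i.
  move=> h0 h; rewrite big_enum /= (eq_bigl (fun i => (i \in B) && (kappa i < 0))); last by move=> i; rewrite inE.
  rewrite big_mkcondr; apply: eq_bigr => i _; case: Order.TotalTheory.ltP => hi; first by rewrite h.
  by rewrite h0.
have E1 : lprod B pexp p = \prod_(i <- s) lin (p i) ^+ (e i).-1.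
  by apply: red => i h; rewrite /pexp ?h // Order.TotalTheory.leNgt h.
have E2 : lprod B pind p = \prod_(i <- s) lin (p i).
  rewrite (red _ (fun=> 1%N)); first by apply: eq_bigr => i _; rewrite expr1.
    by move=> i h; rewrite /pind Order.TotalTheory.ltNge h.
  by move=> i h; rewrite /pind h.
have E3 : lprod B (fun i => pexp i + pind i)%N p = \prod_(i <- s) lin (p i) ^+ e i.
  apply: red => i h; rewrite /pexp /pind ?h ?Order.TotalTheory.ltNge ?h // Order.TotalTheory.leNgt h /= /e; lia.
have ep i : i \in s -> (0 < e i)%N by rewrite sE /e => /andP [_]; lia.
rewrite /exact E1 E2 E3; split=> [[G hG] i iB ki|h].
  by apply: residues_of_primitive hG; rewrite ?sE ?iB.
by apply: primitive_of_residues => // i; rewrite sE => /andP [iB ki]; apply: h.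
Qed.
End Exact.

(** * Exact differentials under the inversion of the line *)

Section Reversal.
Variable K : closedFieldType.
Hypothesis char0 : forall n, n.+1%:R != 0 :> K.
Implicit Types (G D R N P Q : {poly K}).

(** The polynomial [z ^ d P(1 / z)], provided that P has degree at most d. *)
Definition rev_poly d P : {poly K} := \poly_(k < d.+1) P`_(d - k).

Lemma rev_horner d P z : (size P <= d.+1)%N -> z != 0 ->
  (rev_poly d P).[z] = z ^+ d * P.[z^-1].
Proof.
move=> sP z0; rewrite horner_poly (horner_coef_wide _ sP) mulr_sumr (reindex_inj rev_ord_inj) /=.
apply: eq_bigr => i _; rewrite subSS subKn -1?ltnS // mulrCA; congr (_ * _).
by rewrite exprVn expfB_cond ?(negPf z0) //= -ltnS ltn_ord.
Qed.

Lemma rev_deriv_horner d P z : (size P <= d.+1)%N -> z != 0 ->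
  z ^+ 2 * (rev_poly d P)^`().[z] = z ^+ d * (P.[z^-1] *+ d * z - P^`().[z^-1]).
Proof.
move=> sP z0.
have sX : (size ('X * P^`())%R <= d.+1)%N.
  apply: leq_trans (size_polyMleq _ _) _; rewrite size_polyX /=.
  have := size_deriv_leq P; move: (size P^`()) => k; lia.
have e : 'X * (rev_poly d P)^`() = rev_poly d P *+ d - rev_poly d ('X * P^`()).
  apply/polyP => k; rewrite coefXM coef_deriv coefB coefMn !coef_poly coefXM coef_deriv.
  case: k => [|k] /=; rewrite ?subn0.
    case: d sP {sX} => [|d] sP //=; first by rewrite mulr0n subrr.
    by rewrite subrr.
  case: ltnP => kd; last by rewrite !mul0rn subr0.
  case: eqP => [h|/eqP]; first by rewrite subr0; congr (_ *+ _); lia.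
  rewrite -lt0n => h; rewrite prednK // -mulrnBr; last exact: leq_subr.
  by congr (_ *+ _); lia.
have := congr1 (fun Q => z * Q.[z]) e.
rewrite hornerM hornerX mulrA -expr2 => ->.
rewrite hornerD hornerN hornerMn !rev_horner // hornerM hornerX.
by rewrite mulrBr !mulrA [z * _ * z^-1]mulrAC divff // mul1r; ring.
Qed.

Lemma poly_eq_nonzero P Q : (forall z, z != 0 -> P.[z] = Q.[z]) -> P = Q.
Proof.
move=> h; apply/eqP; rewrite -subr_eq0; apply: contraT => n0.
have n1 : ('X * (P - Q)) != 0 by rewrite mulf_neq0 // polyX_eq0.
have [z] := closed_nonrootP _ n1; rewrite rootM negb_or => /andP [z0 zr].
case/negP: zr; rewrite /root hornerD hornerN h ?subrr //.
by move: z0; rewrite /root hornerX.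
Qed.

(** The balance [d + r = n + 2] expresses that [dz] has a double pole at infinity: [z = 1 / w] turns
    [dz] into [- dw / w ^ 2], whence also the sign. *)
Lemma rev_Wr G D R N d r n :
  (size G <= d.+1)%N -> (size D <= d.+1)%N -> (size R <= r.+1)%N -> (size N <= n.+1)%N ->
  (d + r = n + 2)%N -> Wr G D * R = N * D ->
  Wr (rev_poly d G) (rev_poly d D) * rev_poly r R = - (rev_poly n N * rev_poly d D).
Proof.
move=> sG sD sR sN dr e; apply: poly_eq_nonzero => z z0.
apply: (@mulfI _ (z ^+ 2)); first by rewrite expf_neq0.
rewrite hornerM hornerN hornerM /Wr hornerD hornerN !hornerM !rev_horner //.
have e' : (G^`().[z^-1] * D.[z^-1] - G.[z^-1] * D^`().[z^-1]) * R.[z^-1] = N.[z^-1] * D.[z^-1].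
  by have := congr1 (fun P => P.[z^-1]) e; rewrite /Wr !hornerE.
have h1 := rev_deriv_horner sG z0; have h2 := rev_deriv_horner sD z0.
have zE : z ^+ d * z ^+ r = z ^+ n * z ^+ 2 by rewrite -!exprD dr.
move: e' h1 h2 zE; move: (_.[z]) ((rev_poly d D)^`().[z]) (G.[z^-1]) (D.[z^-1]) (N.[z^-1]) (R.[z^-1])
  (G^`().[z^-1]) (D^`().[z^-1]) (z ^+ d) (z ^+ r) (z ^+ n) => a b g x y t g' x' u v w e' h1 h2 zE.
have -> : z ^+ 2 * ((a * (u * x) - u * g * b) * (v * t)) =
  u * v * t * (x * (z ^+ 2 * a) - g * (z ^+ 2 * b)) by ring.
rewrite h1 h2 mulrnAl mulrnAl.
have -> : u * v * t * (x * (u * (g * z *+ d - g')) - g * (u * (x * z *+ d - x'))) =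
  - (u * (u * v) * ((g' * x - g * x') * t)) by ring.
by rewrite e' zE; ring.
Qed.
End Reversal.

Lemma degree_balance (T : finType) (kappa : T -> int) : \sum_i kappa i = -2 ->
  (\sum_i pexp kappa i + \sum_i pind kappa i = \sum_i zexp kappa i + 2)%N.
Proof.
move=> sum_kappa; have : \sum_i ((zexp kappa i)%:Z - (pexp kappa i)%:Z - (pind kappa i)%:Z) = -2.
  by rewrite -sum_kappa; apply: eq_bigr => i _; apply: exp_balance.
rewrite !sumrB -!(big_morph Posz PoszD erefl).
move: (\sum_i zexp _ i)%N (\sum_i pexp _ i)%N (\sum_i pind _ i)%N => a b c; lia.
Qed.

Section Inversion.
Variable K : closedFieldType.
Hypothesis char0 : forall n, n.+1%:R != 0 :> K.
Variables (T : finType) (o : T) (kappa : T -> int).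
Implicit Types (p q : T -> K) (e : T -> nat).
Hypothesis sum_kappa : \sum_i kappa i = -2.
Hypothesis kappa_o : kappa o < 0.
Local Notation A := (~: [set o])%SET.

Lemma rev_lprod_at_infinity e q : (forall i, i != o -> q i != 0) ->
  exists2 c, c != 0 & rev_poly (\sum_i e i) (lprod A e q) =
    c *: lprod [set: T] e (fun i => if i == o then 0 else (q i)^-1).
Proof.
move=> q0; exists (\prod_(i in A) (- q i) ^+ e i).
  by apply/prodf_neq0 => i; rewrite !inE => io; rewrite expf_neq0 // oppr_eq0 q0.
have sumE : (\sum_i e i = e o + \sum_(i in A) e i)%N.
  by rewrite (bigD1 o) //=; congr (_ + _)%N; apply: eq_bigl => i; rewrite !inE.
apply: poly_eq_nonzero => z z0; rewrite rev_horner ?size_lprod ?sumE ?ltnS ?leq_addl //.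
rewrite hornerZ !lprod_horner [X in _ = _ * X](bigD1 o) ?inE //= eqxx subr0.
rewrite exprD -mulrA [RHS]mulrCA; congr (_ * _).
rewrite -prodrXr -big_split /=.
rewrite [X in _ = _ * X](eq_bigl (fun i => i \in A)); last by move=> i; rewrite !inE.
rewrite -big_split /=; apply: eq_bigr => i; rewrite !inE => io; rewrite (negPf io) -!exprMn.
by congr (_ ^+ _); have := q0 i io; move=> ?; field; apply/andP.
Qed.

Lemma rev_polyK d (P : {poly K}) : (size P <= d.+1)%N -> rev_poly d (rev_poly d P) = P.
Proof.
move=> sP; apply/polyP => k; rewrite !coef_poly.
case: ltnP => kd; last by rewrite nth_default // (leq_trans sP).
by rewrite ltnS leq_subr subKn.
Qed.

Lemma rev_polyZ d c (P : {poly K}) : rev_poly d (c *: P) = c *: rev_poly d P.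
Proof. by apply/polyP => k; rewrite !(coefZ, coef_poly); case: ifP; rewrite ?mulr0. Qed.

Lemma rev_lprod_at_zero e p : p o = 0 -> (forall i, i != o -> p i != 0) ->
  exists2 c, c != 0 & rev_poly (\sum_i e i) (lprod [set: T] e p) =
    c *: lprod A e (fun i => (p i)^-1).
Proof.
move=> po p0; have q0 i : i != o -> (p i)^-1 != 0 by move=> /p0; rewrite invr_eq0.
have [c c0 hc] := rev_lprod_at_infinity e q0.
have pE : lprod [set: T] e p = lprod [set: T] e (fun i => if i == o then 0 else ((p i)^-1)^-1).
  by apply: eq_lprod => i _; case: eqP => [->|_]; rewrite ?invrK.
exists c^-1; first by rewrite invr_eq0.
rewrite pE -[lprod [set: T] _ _](scalerK c0) -hc rev_polyZ rev_polyK //.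
by rewrite size_lprod ltnS [X in (_ <= X)%N](bigD1 o) //= (eq_bigl (fun i => i != o)) ?leq_addl // => i; rewrite !inE.
Qed.

Lemma sum_off (e : T -> nat) : (\sum_i e i = e o + \sum_(i in A) e i)%N.
Proof. by rewrite (bigD1 o) //=; congr (_ + _)%N; apply: eq_bigl => i; rewrite !inE. Qed.

Lemma exact_to_infinity p : p o = 0 -> (forall i, i != o -> p i != 0) ->
  exact kappa [set: T] p -> exact kappa A (fun i => (p i)^-1).
Proof.
clear kappa_o; move=> po p0 [G hG].
set d := (\sum_i pexp kappa i)%N; set r := (\sum_i pind kappa i)%N; set n := (\sum_i zexp kappa i)%N.
have hd : (d + r = n + 2)%N := degree_balance sum_kappa.
have sz e : size (lprod [set: T] e p) = (\sum_i e i).+1.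
  by rewrite size_lprod; congr _.+1; apply: eq_bigl => i; rewrite inE.
have sG : (size G <= d.+1)%N.
  have := primitive_size char0 (lprod_neq0 _ _ _) (lprod_neq0 _ _ _) (lprod_neq0 _ _ _) hG.
  rewrite !sz -/d -/r -/n; move: (size G) hd => g; lia.
have := rev_Wr sG _ _ _ hd hG; rewrite !sz => /(_ (leqnn _) (leqnn _) (leqnn _)).
have [a a0 ->] := rev_lprod_at_zero (pexp kappa) po p0.
have [b b0 ->] := rev_lprod_at_zero (pind kappa) po p0.
have [c c0 ->] := rev_lprod_at_zero (zexp kappa) po p0.
rewrite -mulNr -scaleNr => h; have nc : - c != 0 by rewrite oppr_eq0.
by exists ((b / - c) *: rev_poly d G); apply: Wr_rescale h nc.
Qed.

Lemma exact_from_infinity q : (forall i, i != o -> q i != 0) ->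
  exact kappa A q -> exact kappa [set: T] (fun i => if i == o then 0 else (q i)^-1).
Proof.
move=> q0 [G hG].
set d := (\sum_i pexp kappa i)%N; set r := (\sum_i pind kappa i)%N; set n := (\sum_i zexp kappa i)%N.
have hd : (d + r = n + 2)%N := degree_balance sum_kappa.
have sz e : (size (lprod A e q) + e o)%N = (\sum_i e i).+1.
  by rewrite size_lprod sum_off addSn addnC.
have szd := sz (pexp kappa); have szr := sz (pind kappa); have szn := sz (zexp kappa).
rewrite -/d -/r -/n in szd szr szn.
have eo : pexp kappa o = `|kappa o|.-1 /\ pind kappa o = 1%N /\ zexp kappa o = 0%N.
  by rewrite /pexp /pind /zexp Order.TotalTheory.leNgt kappa_o.
(* As [o] is a pole, removing it takes one factor from the product with exponents [pind] and none
   from that with [zexp]; this bounds the degree of the primitive by d, so that reversal loses no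
   coefficient. *)
have sG : (size G <= d.+1)%N.
  have := primitive_size char0 (lprod_neq0 _ _ _) (lprod_neq0 _ _ _) (lprod_neq0 _ _ _) hG.
  case: eo => _ [e1 e2]; rewrite e1 in szr; rewrite e2 in szn.
  move: (size G) (size _) (size _) (size _) szd szr szn hd => g x y z; lia.
have := rev_Wr sG _ _ _ hd hG.
rewrite -szd -szr -szn !leq_addr => /(_ erefl erefl erefl).
have [a a0 ->] := rev_lprod_at_infinity (pexp kappa) q0.
have [b b0 ->] := rev_lprod_at_infinity (pind kappa) q0.
have [c c0 ->] := rev_lprod_at_infinity (zexp kappa) q0.
rewrite -mulNr -scaleNr => h; have nc : - c != 0 by rewrite oppr_eq0.
by exists ((b / - c) *: rev_poly d G); apply: Wr_rescale h nc.
Qed.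
End Inversion.

(** * Configurations with a point at infinity *)


Section Configurations.
Variable K : closedFieldType.
Hypothesis char0 : forall n, n.+1%:R != 0 :> K.
Local Notation lin a := ('X - a%:P).

Lemma mup_split (s : seq K) z : mup z (\prod_(x <- s) lin x) = count_mem z s.
Proof.
elim: s => [|x s IH]; first by rewrite big_nil mupNroot // root1.
rewrite big_cons mupM ?polyXsubC_eq0 ?monic_neq0 ?monic_prod_XsubC //.
by rewrite IH /= -[lin x]expr1 mup_XsubCX.
Qed.

Lemma eq_mup (P Q : {poly K}) : P != 0 -> Q != 0 -> (forall z, mup z P = mup z Q) ->
  exists2 c, c != 0 & P = c *: Q.
Proof.
move=> P0 Q0 h; have [r PE] := closed_field_poly_normal P.
have [s QE] := closed_field_poly_normal Q.
have a0 : lead_coef P != 0 by rewrite lead_coef_eq0.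
have b0 : lead_coef Q != 0 by rewrite lead_coef_eq0.
have mupZ (c : K) (t : seq K) z : c != 0 -> mup z (c *: \prod_(x <- t) lin x) = count_mem z t.
  by move=> c0; rewrite -mul_polyC mupMr ?mup_split // rootC.
have rs : perm_eq r s.
  by apply/allP => z _; apply/eqP; have := h z; rewrite PE QE !mupZ.
exists (lead_coef P / lead_coef Q); first by rewrite mulf_neq0 ?invr_eq0.
by rewrite {2}QE scalerA divfK // -(perm_big _ rs).
Qed.

Section Stratum.
Variables (r : nat) (kappa : seq int).
Local Notation kap := (fun i : 'I_r => kappa`_i).
Hypothesis sum_kappa : \sum_(i < r) kappa`_i = -2.
Hypothesis no_simple_pole : forall i : 'I_r, kappa`_i != -1.

(** A differential is determined by its divisor up to a constant factor, which does not affect the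
    vanishing of residues; so [N / M] can be replaced by the standard fraction [N0 / M0]. *)
Lemma divisor_exact (p : 'I_r -> K) : injective p ->
  (exists N M : {poly K}, has_divisor N M p kappa /\
     forall i : 'I_r, kappa`_i <= -2 -> has_residue N M (p i) 0) <->
  exact kap [set: 'I_r]%SET p.
Proof.
move=> inj; have injT : {in [set: 'I_r]%SET &, injective p} by move=> i j _ _; apply: inj.
set N0 := lprod [set: 'I_r]%SET (zexp kap) p.
set M0 := lprod [set: 'I_r]%SET (fun i => pexp kap i + pind kap i)%N p.
have N00 : N0 != 0 := lprod_neq0 _ _ _; have M00 : M0 != 0 := lprod_neq0 _ _ _.
have mup0 z : (mup z N0)%:Z - (mup z M0)%:Z = \sum_(i < r | p i == z) kappa`_i.
  rewrite !mup_lprod !(big_morph Posz PoszD erefl) -sumrB.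
  rewrite (eq_bigl (fun i => p i == z)) => [|i]; last by rewrite inE.
  by apply: eq_bigr => i _; rewrite PoszD opprD addrA; apply: (exp_balance kap).
have le (i : 'I_r) : (kappa`_i <= -2) = (kap i < 0) by have := no_simple_pole i; rewrite /=; lia.
rewrite exact_residues //; split=> [[N [M [[Nn0 Mn0 hm hs] hres]]] i _ ki|h].
  have [c c0 e] : exists2 c, c != 0 & N * M0 = c *: (N0 * M).
    apply: eq_mup; rewrite ?mulf_neq0 // => z; rewrite !mupM //.
    have := hm z; rewrite -mup0.
    by move: (mup z N) (mup z M) (mup z N0) (mup z M0) => a b a' b'; lia.
  have hr := hres i; rewrite le in hr; have {}hr := hr ki.
  have : has_residue (c *: N0) M0 (p i) 0 by apply: residue_ratio hr => //; rewrite e scalerAl.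
  by move/(residueZ0 c^-1); rewrite scalerK.
exists N0, M0; split; last by move=> i; rewrite le => ki; apply: h; rewrite ?inE.
split=> //; rewrite !size_lprod.
have := degree_balance sum_kappa; rewrite big_split /=.
have inT f : (\sum_(i in [set: 'I_r]%SET) f i = \sum_i f i)%N by apply: eq_bigl => i; rewrite inE.
rewrite !inT.
move: (\sum_i zexp _ i)%N (\sum_i pexp _ i)%N (\sum_i pind _ i)%N => a b c; lia.
Qed.
End Stratum.

Section MarkedLines.
Variables (n : nat) (o : 'I_n).
Implicit Types (p q : 'I_n -> K).

(* The difference q i - q j when q o is moved to infinity, up to a factor
   depending on i and one depending on j. *)
Definition dif (R : comNzRingType) (q : 'I_n -> R) i j : R :=
  if i == o then (j != o)%:R else if j == o then -1 else q i - q j.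

Definition crs (t : 4.-tuple 'I_n) (k : nat) := tnth t (inord k).
Definition cr_num (R : comNzRingType) (q : 'I_n -> R) t :=
  dif q (crs t 0) (crs t 2) * dif q (crs t 1) (crs t 3).
Definition cr_den (R : comNzRingType) (q : 'I_n -> R) t :=
  dif q (crs t 0) (crs t 3) * dif q (crs t 1) (crs t 2).

Definition mline q : cr_space K n := [ffun t => Some (cr_num q t / cr_den q t)].

Definition nondeg q := forall i j, i != j -> dif q i j != 0.

Lemma dif_off (R : comNzRingType) (q q' : 'I_n -> R) :
  (forall i, i != o -> q i = q' i) -> dif q =2 dif q'.
Proof.
move=> h i j; rewrite /dif; case: eqVneq => // io; case: eqVneq => // jo; by rewrite !h.
Qed.

Lemma mline_off q q' : (forall i, i != o -> q i = q' i) -> mline q = mline q'.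
Proof. by move=> h; apply/ffunP => t; rewrite !ffunE /cr_num /cr_den !(dif_off h). Qed.

Lemma mline_marked p : p o = 0 -> (forall i, i != o -> p i != 0) ->
  marked_line p = mline (fun i => (p i)^-1).
Proof.
(* Inversion multiplies the difference of points i and j by factors of i and of j. Each point occurs
   once in the numerator and once in the denominator of a cross-ratio, so these factors cancel. *)
move=> po p0; pose w i := if i == o then 1 else p i.
have w0 i : w i != 0 by rewrite /w; case: ifPn => [_|/p0 //]; rewrite oner_neq0.
have pE i j : p i - p j = - (w i * w j) * dif (fun i => (p i)^-1) i j.
  rewrite /w /dif; case: (eqVneq i o) => [->|io]; case: (eqVneq j o) => [->|jo] /=.
  - by rewrite subrr mulr0.
  - by rewrite po; ring.
  - by rewrite po; ring.
  - by have := p0 i io; have := p0 j jo => h1 h2; field; apply/andP.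
apply/ffunP => t; rewrite !ffunE /cross_ratio /cr_num /cr_den -!/(crs t _) !pE; congr Some.
move: (w0 (crs t 0)) (w0 (crs t 1)) (w0 (crs t 2)) (w0 (crs t 3)).
move: (w _) (w _) (w _) (w _) (dif _ _ _) (dif _ _ _) (dif _ _ _) (dif _ _ _) => a b c d x y z u a0 b0 c0 d0.
have -> : - (d * b) * u * (- (c * a) * z) = a * b * c * d * (u * z) by ring.
have -> : - (d * a) * y * (- (c * b) * x) = a * b * c * d * (y * x) by ring.
by rewrite -mulf_div divff ?mul1r // !mulf_neq0.
Qed.

Lemma marked_line_shift p c : marked_line (fun i => p i - c) = marked_line p.
Proof.
have e i j : (p i - c) - (p j - c) = p i - p j by ring.
by apply/ffunP => t; rewrite !ffunE /cross_ratio !e.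
Qed.

Lemma mline_shift q c : mline (fun i => q i - c) = mline q.
Proof.
have e : dif (fun i => q i - c) =2 dif q.
  by move=> i j; rewrite /dif; case: ifP => // _; case: ifP => // _; ring.
by apply/ffunP => t; rewrite !ffunE /cr_num /cr_den !e.
Qed.

Lemma avoid_values (T : finType) (q : T -> K) : exists c, forall i, q i != c.
Proof.
have [c] := closed_nonrootP _ (lprod_neq0 [set: T]%SET (fun=> 1%N) q).
rewrite /root lprod_horner => h; exists c => i; apply: contraNneq h => <-.
by rewrite (bigD1 i) ?inE //= subrr expr1 mul0r.
Qed.

Lemma to_infinity p : injective p -> exists q,
  [/\ nondeg q, marked_line p = mline q, (forall i, i != o -> q i != 0) &
      q = (fun i => (p i - p o)^-1)].
Proof.
move=> inj; have p0 i : i != o -> p i - p o != 0.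
  by rewrite subr_eq0 => /eqP io; apply/eqP => /inj.
exists (fun i => (p i - p o)^-1); split=> //.
- move=> i j ij; rewrite /dif; case: (eqVneq i o) => [io|io].
    by rewrite -io [j == i]eq_sym (negPf ij) oner_neq0.
  case: (eqVneq j o) => [_|jo]; first by rewrite oppr_eq0 oner_neq0.
  by rewrite subr_eq0; apply: contra ij => /eqP /invr_inj /addIr /inj ->.
- by rewrite -(marked_line_shift p (p o)) mline_marked ?subrr.
- by move=> i io; rewrite invr_eq0 p0.
Qed.

Lemma from_infinity q : nondeg q -> exists c p,
  [/\ injective p, marked_line p = mline q, p o = 0,
      forall i, i != o -> q i - c != 0 & 
      p = (fun i => if i == o then 0 else (q i - c)^-1)].
Proof.
move=> nd; have [c hc] := avoid_values q.
have q0 i : i != o -> q i - c != 0 by rewrite subr_eq0.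
exists c, (fun i => if i == o then 0 else (q i - c)^-1); split=> //; last by rewrite eqxx.
- move=> i j; case: (eqVneq i o) => [->|io]; case: (eqVneq j o) => [->|jo] //.
  + by move/esym/eqP; rewrite invr_eq0 (negPf (q0 j jo)).
  + by move/eqP; rewrite invr_eq0 (negPf (q0 i io)).
  + move/invr_inj/addIr => e; apply/eqP; apply: contraT => /nd.
    by rewrite /dif (negPf io) (negPf jo) e subrr eqxx.
- rewrite mline_marked ?eqxx //; last by move=> i io; rewrite (negPf io) invr_eq0 q0.
  by rewrite -(mline_shift q c); apply: mline_off => i io; rewrite (negPf io) invrK.
Qed.

Lemma M0_mline x : @M0 K n x <-> exists2 q, nondeg q & x = mline q.
Proof.
split=> [[p inj ->]|[q nd ->]]; first by have [q [nd e _ _]] := to_infinity inj; exists q.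
by have [c [p [inj e _ _ _]]] := from_infinity nd; exists p.
Qed.

(** Once the pole [o] is moved to infinity, exactness on the affine line remains; the residue at [o]
    is determined by the others. *)
Lemma stratum_mline (kappa : seq int) x :
  \sum_(i < n) kappa`_i = -2 -> (forall i : 'I_n, kappa`_i != -1) -> kappa`_o < 0 ->
  @stratum K n kappa x <-> exists q, [/\ nondeg q, x = mline q &
    exact (fun i : 'I_n => kappa`_i) (~: [set o])%SET q].
Proof.
move=> sk nk ko; split=> [[p [inj -> /divisor_exact ex]]|[q [nd -> ex]]].
  have [q [nd e q0 qE]] := to_infinity inj; exists q; split=> //; rewrite qE.
  have {ex} := exact_affine (p o) (oner_neq0 K) (ex sk nk inj) => ex.
  have {ex} : exact (fun i : 'I_n => kappa`_i) [set: 'I_n]%SET (fun i => p i - p o).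
    by apply: eq_exact ex => i _; rewrite divr1.
  move=> {}ex; have H := @exact_to_infinity _ char0 _ o _ sk (fun i => p i - p o) (subrr _) _ ex.
  by apply: H => i io; have := q0 i io; rewrite qE invr_eq0.
have [c [p [inj e po q0 pE]]] := from_infinity nd; exists p; split=> //.
apply/divisor_exact => //; rewrite pE.
have {ex} := exact_affine c (oner_neq0 K) ex => ex.
have {ex} : exact (fun i : 'I_n => kappa`_i) (~: [set o])%SET (fun i => q i - c).
  by apply: eq_exact ex => i _; rewrite divr1.
exact: (@exact_from_infinity _ char0 _ o _ sk ko (fun i => q i - c)).
Qed.
End MarkedLines.
End Configurations.

(** * Limits of exact differentials *)


Section Vertex.
Variable K : closedFieldType.
Hypothesis char0 : forall n, n.+1%:R != 0 :> K.
Variables (T : finType) (kappa : T -> int) (B : {set T}) (c : T -> K).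
Implicit Types (G D : {poly K}).

(** In a limit configuration several marked points may coincide; these are the distinct
    positions. *)
Definition values : seq K := undup [seq c i | i <- enum B].

Lemma mem_values i : i \in B -> c i \in values.
Proof. by move=> iB; rewrite mem_undup map_f // mem_enum. Qed.

Lemma sum_values (V : nmodType) (f : T -> V) :
  \sum_(z <- values) \sum_(i in B | c i == z) f i = \sum_(i in B) f i.
Proof.
under eq_bigr => z _ do rewrite big_mkcondr.
rewrite exchange_big /=; apply: eq_bigr => i iB.
rewrite -big_mkcond /= -(big_filter _ (fun z => c i == z)).
rewrite (eq_filter (a2 := pred1 (c i))) => [|z /=]; last by rewrite eq_sym.
by rewrite filter_pred1_uniq ?undup_uniq ?mem_values // big_seq1.
Qed.

Lemma sum_mup_lt (P : {poly K}) s : P != 0 -> uniq s -> (\sum_(z <- s) mup z P < size P)%N.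
Proof.
elim: s P => [|z s IH] P P0 /=; first by rewrite big_nil size_poly_gt0.
move=> /andP [zs us]; have [Q Qz PE] := mup_factor z P0.
have Q0 : Q != 0 by apply: contraNneq Qz => ->; rewrite root0.
rewrite big_cons [in X in (_ < X)%N]PE size_mul ?lin_neq0 // size_exp_XsubC addSn /= ltn_add2l.
rewrite (eq_big_seq (fun w => mup w Q)); first exact: IH.
move=> w ws; rewrite {1}PE mupMr // /root horner_exp hornerXsubC expf_neq0 //.
by rewrite subr_eq0; apply: contraNneq zs => <-.
Qed.

Lemma mup_subZ G D x z : D != 0 -> G != 0 -> (mup z G < mup z D)%N -> G - x *: D != 0 ->
  mup z (G - x *: D) != mup z D.
Proof.
move=> D0 G0 lt n0; apply/eqP => e; move: lt; rewrite ltnNge mup_geq // -e.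
rewrite [X in _ %| X](_ : G = (G - x *: D) + x *: D); last by rewrite subrK.
move/negP; apply; apply: dvdp_add; first by rewrite -mup_geq.
by rewrite e -mul_polyC dvdp_mull // -mup_geq.
Qed.

(* Let K be the order of the differential at a point z of [values] or at infinity.
   If K >= 0 for fewer than two of these points, the order of G / D - x is K + 1 at
   all of them for some x.  The sum of these orders is size values - 1, and must
   be 0. *)
Lemma vertex_count : exact kappa B c -> (1 < size values)%N ->
  (2 <= count (fun z => 0 <= \sum_(i in B | c i == z) kappa i)%R values +
        (\sum_(i in B) kappa i <= -2)%R)%N.
Proof.
move=> [G hG] s1; set D := lprod B _ c in hG; set R := lprod B _ c in hG; set N := lprod B _ c in hG.
have D0 : D != 0 := lprod_neq0 _ _ _; have R0 : R != 0 := lprod_neq0 _ _ _.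
have N0 : N != 0 := lprod_neq0 _ _ _.
have W0 : Wr G D != 0.
  by apply: contraTneq (mulf_neq0 N0 D0) => W0; rewrite -hG W0 mul0r eqxx.
pose Gs x := G - x *: D; have WE x : Wr (Gs x) D = Wr G D by apply: WrBr.
have G0 x : Gs x != 0.
  by apply: contraNneq W0 => e; rewrite -(WE x) e /Wr deriv0 !mul0r subrr.
pose kz z : int := \sum_(i in B | c i == z) kappa i; pose kB : int := \sum_(i in B) kappa i.
have good_mup z x : mup z (Gs x) != mup z D -> (mup z (Gs x))%:Z = kz z + 1 + (mup z D)%:Z.
  move=> ne; have [_] := mup_Wr char0 (G0 x) D0 ne; rewrite WE => e1.
  have := congr1 (mup z) hG; rewrite !mupM // => e2.
  have : (mup z N)%:Z - (mup z D)%:Z - (mup z R)%:Z = kz z.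
    rewrite !mup_lprod !(big_morph Posz PoszD erefl) -!sumrB; apply: eq_bigr => i _.
    exact: exp_balance.
  by move: e1 e2; move: (mup z (Gs x)) (mup z D) (mup z N) (mup z R) (mup z (Wr G D)) (kz z); lia.
have good_size x : size (Gs x) != size D -> (size (Gs x))%:Z = kB + 1 + (size D)%:Z.
  move=> ne; have [_] := size_Wr char0 (G0 x) D0 ne; rewrite WE => e1.
  have := congr1 (fun P : {poly K} => size P) hG; rewrite /= !size_mul // => e2.
  have : ((size N).-1)%:Z - ((size D).-1)%:Z - ((size R).-1)%:Z = kB.
    rewrite !size_lprod /= !(big_morph Posz PoszD erefl) -!sumrB; apply: eq_bigr => i _.
    exact: exp_balance.
  move: e1 e2 D0 N0 R0 W0; rewrite -!size_poly_gt0.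
  by move: (size (Gs x)) (size D) (size N) (size R) (size (Wr G D)) kB; lia.
(* If [G / D] is finite and nonzero at z, subtracting its value there produces a zero. *)
have ex_mup z : exists x, mup z (Gs x) != mup z D.
  have [G1 G1z GE] := mup_factor z (G0 0); have [D1 D1z DE] := mup_factor z D0.
  case: (eqVneq (mup z (Gs 0)) (mup z D)) => [e|ne]; last by exists 0.
  exists (G1.[z] / D1.[z]); apply/eqP => e'.
  have E : Gs (G1.[z] / D1.[z]) = ('X - z%:P) ^+ mup z D * (G1 - (G1.[z] / D1.[z]) *: D1).
    have -> : Gs (G1.[z] / D1.[z]) = Gs 0 - (G1.[z] / D1.[z]) *: D.
      by rewrite /Gs scale0r subr0.
    by rewrite mulrBr -scalerAr -DE {1}GE e.
  have rt : root (G1 - (G1.[z] / D1.[z]) *: D1) z.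
    by rewrite /root hornerD hornerN hornerZ divfK ?subrr.
  have := G0 (G1.[z] / D1.[z]); rewrite E mulf_eq0 negb_or => /andP [_ n0].
  have := leqnn (mup z D); rewrite -{2}e' E mupM ?lin_neq0 // mup_XsubCX eqxx.
  move: e'; rewrite E mupM ?lin_neq0 // mup_XsubCX eqxx => /eqP.
  by rewrite -[X in _ == X]addn0 eqn_add2l => /eqP m0; move: rt; rewrite root_factor_theorem XsubC_dvd // m0.
have ex_size : exists x, size (Gs x) != size D.
  case: (eqVneq (size (Gs 0)) (size D)) => [e|ne]; last by exists 0.
  exists (lead_coef (Gs 0) / lead_coef D); apply/eqP => e'.
  have : (Gs (lead_coef (Gs 0) / lead_coef D))`_(size D).-1 = 0.
    have -> : Gs (lead_coef (Gs 0) / lead_coef D) = Gs 0 - (lead_coef (Gs 0) / lead_coef D) *: D.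
      by rewrite /Gs scale0r subr0.
    by rewrite coefB coefZ -{1}e -!lead_coefE divfK ?subrr // lead_coef_eq0.
  by rewrite -e' -lead_coefE => /eqP; rewrite lead_coef_eq0 (negPf (G0 _)).
have shift x y : Gs x = Gs y - (x - y) *: D by rewrite /Gs scalerBl; ring.
(* Negative order of the differential means a pole of [G / D], and subtracting a constant does not
   change it. *)
have all_mup z : kz z < 0 -> forall x, mup z (Gs x) != mup z D.
  move=> neg x; have [y gy] := ex_mup z; rewrite (shift x y); apply: mup_subZ; rewrite -?shift //.
  by have := good_mup z y gy; move: gy neg; move: (kz z); lia.
have all_size : ~~ (kB <= -2) -> forall x, size (Gs x) != size D.
  move=> neg x; have [y gy] := ex_size; have := good_size y gy => e.
  have lt : (size D < size (Gs y))%N by move: e gy neg; move: (kB : int) (size _) (size _); lia.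
  rewrite (shift x y) size_polyDl ?gtn_eqF // size_polyN.
  by apply: leq_ltn_trans (size_scale_leq _ _) lt.
(* The multiplicities of [Gs x] at [values] add up to [kB + size values + deg D], whereas its degree
   is [kB + 1 + deg D]. *)
have bound x : (forall z, z \in values -> mup z (Gs x) != mup z D) ->
    size (Gs x) != size D -> False.
  move=> h1 h2; have := sum_mup_lt (G0 x) (undup_uniq [seq c i | i <- enum B]).
  rewrite -/values; have := good_size x h2.
  have : ((\sum_(z <- values) mup z (Gs x))%N%:Z = kB + (size values)%:Z + ((size D).-1)%:Z).
    rewrite (big_morph Posz PoszD erefl) (eq_big_seq (fun z => (kz z + (mup z D)%:Z) + 1)); last first.
      by move=> z /h1 /good_mup ->; ring.
    rewrite !big_split /= sum_values -/kB big_const_seq count_predT iter_addr_0.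
    rewrite (eq_bigr (fun z => \sum_(i in B | c i == z) (pexp kappa i)%:Z)); last first.
      by move=> z _; rewrite mup_lprod (big_morph Posz PoszD erefl).
    by rewrite sum_values size_lprod /= (big_morph Posz PoszD erefl) natz; ring.
  move: D0; rewrite -size_poly_gt0; move: s1.
  move: (\sum_(z <- values) _)%N (size (Gs x)) (size D) (size values) (kB : int); lia.
rewrite leqNgt; apply/negP => lt; case hB : (kB <= -2).
  have [x gx] := ex_size; apply: (bound x) => // z zv; apply: all_mup.
  rewrite Order.TotalTheory.ltNge; apply/negP => kz0.
  move: lt; rewrite -/kB hB addn1 !ltnS leqn0; apply/negP; rewrite -lt0n -has_count.
  by apply/hasP; exists z.
have [x hx] : exists x, forall z, z \in values -> mup z (Gs x) != mup z D.
  case: (boolP (has (fun z => 0 <= kz z) values)) => [/hasP [z0 z0v kz0]|/hasPn h]; last first.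
    by exists 0 => z /h; rewrite -Order.TotalTheory.ltNge => /all_mup; apply.
  have [x gx] := ex_mup z0; exists x => z zv; have [->//|zz0] := eqVneq z z0.
  apply: all_mup; rewrite Order.TotalTheory.ltNge; apply/negP => kz1.
  move: lt; rewrite -/kB hB addn0 -/kz ltnNge => /negP; apply.
  rewrite -size_filter; apply: (@uniq_leq_size _ [:: z; z0]).
    by rewrite /= inE zz0.
  by move=> w; rewrite !inE mem_filter => /orP [/eqP ->|/eqP ->]; apply/andP.
by apply: (bound x hx); apply: all_size; rewrite hB.
Qed.
End Vertex.

(** * Limits of primitives along a place *)

Section Reduction.
Variable K : closedFieldType.
Hypothesis char0 : forall n, n.+1%:R != 0 :> K.
Variables (I : Type) (Phi : (I -> K) -> K -> Prop).
Hypothesis hPhi : place Phi.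
Let hom := hPhi.1.

Lemma place_neq0 f x : Phi f x -> x != 0 -> Phi (fun i => (f i != 0)%:R) 1.
Proof.
move=> hf x0; case: (place_bool hPhi (fun i => f i != 0)) => // h.
case/eqP: x0; apply: (ph_inj hom) hf _.
apply: ph_ext (place_mul_negligible hPhi f h) _ _ => // i.
by case: eqP => [->|_]; rewrite ?mul0r ?mulr1.
Qed.

Lemma placeV f x : Phi f x -> x != 0 -> Phi (fun i => (f i)^-1) x^-1.
Proof.
move=> hf x0; case: (hPhi.2 (fun i => (f i)^-1)) => [[y hy]|[h _]].
  have h1 : Phi (fun i => f i * (f i)^-1) (x * y) by apply: phM.
  have h2 : Phi (fun i => f i * (f i)^-1) 1.
    apply: (place_ae hPhi (place_neq0 hf x0)) (phC hom 1) => i fi.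
    by rewrite divff.
  have e := ph_inj hom h1 h2; apply: ph_ext hy _ _ => //.
  by apply: (mulfI x0); rewrite e divff.
case/eqP: x0; apply: (ph_inj hom) hf _; apply: ph_ext h _ _ => // i; exact: invrK.
Qed.

(** Of any two functions, one of the two quotients has a finite limit; so a finite list has a
    largest member. The hypothesis on [g / g] keeps that member nonzero near the place. *)
Lemma dominant (g : I -> K) (s : seq (I -> K)) : Phi (fun i => g i / g i) 1 ->
  exists2 m, m = g \/ (exists2 k, (k < size s)%N & m = nth g s k) &
    Phi (fun i => m i / m i) 1 /\
    forall f, f = g \/ (exists2 k, (k < size s)%N & f = nth g s k) ->
      exists x, Phi (fun i => f i / m i) x.
Proof.
move=> hg; elim: s => [|f s [m hm [mm hs]]].
  by exists g; [left|split=> // f [->|[]//]; exists 1].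
have sub h : h = g \/ (exists2 k, (k < size s)%N & h = nth g s k) ->
    h = g \/ (exists2 k, (k < (size s).+1)%N & h = nth g (f :: s) k).
  by case=> [->|[k ks ->]]; [left|right; exists k.+1].
have cases h : h = g \/ (exists2 k, (k < (size s).+1)%N & h = nth g (f :: s) k) ->
    h = f \/ (h = g \/ (exists2 k, (k < size s)%N & h = nth g s k)).
  case=> [->|[[|k] ks ->]]; [by right; left|by left|by right; right; exists k].
case: (hPhi.2 (fun i => f i / m i)) => [[x hx]|[h1 h2]].
  exists m; first exact: sub.
  by split=> // h /cases [->|/hs //]; exists x.
have nz : Phi (fun i => ((f i / m i) != 0)%:R) 1.
  apply: ph_ext h2 _ _ => // i; case: eqP => [->|/eqP h]; rewrite ?mul0r ?divff //.
exists f; first by right; exists 0%N.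
split=> [|h /cases [->|/hs [y hy]]].
- apply: (place_ae hPhi nz) (phC hom 1) => i; rewrite mulf_eq0 negb_or => /andP [fi _].
  by rewrite divff.
- exists 1; apply: (place_ae hPhi nz) (phC hom 1) => i; rewrite mulf_eq0 negb_or => /andP [fi _].
  by rewrite divff.
exists (y * 0); apply: (place_ae hPhi nz) (phM hom hy h1) => i.
rewrite mulf_eq0 negb_or invr_eq0 => /andP [fi mi]; by field; apply/andP.
Qed.

(** The primitives may diverge, so a multiple of the denominator is subtracted to kill the
    coefficient of index d, and the result is divided by its largest coefficient or by 1. If the
    limit of [1 / m] is 0, the limit primitive has derivative 0, hence is a multiple of [D0]; its
    coefficient of index d vanishes, so it is 0, although its largest coefficient is 1. *)
Lemma reduce_primitive (G D R N : I -> {poly K}) (D0 R0 N0 : {poly K}) :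
  reduces Phi D D0 -> reduces Phi R R0 -> reduces Phi N N0 ->
  D0 != 0 -> R0 != 0 -> N0 != 0 ->
  (forall i, [/\ D i != 0, R i != 0 & N i != 0]) ->
  (forall i, Wr (G i) (D i) * R i = N i * D i) ->
  exists G0, Wr G0 D0 * R0 = N0 * D0.
Proof.
move=> rD rR rN D00 R00 N00 nz hG.
have [[dD bD] cD] := rD; have [[dR bR] cR] := rR; have [[dN bN] cN] := rN.
pose d := (size D0).-1.
have hd : Phi (fun i => (D i)`_d) D0`_d by [].
have ld : D0`_d != 0 by rewrite -lead_coefE lead_coef_eq0.
have ae := place_neq0 hd ld.
pose G1 i := G i - ((G i)`_d / (D i)`_d) *: D i.
have hG1 i : Wr (G1 i) (D i) * R i = N i * D i by rewrite WrBr.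
have G1d i : (D i)`_d != 0 -> (G1 i)`_d = 0.
  by move=> h; rewrite coefB coefZ divfK ?subrr.
pose e := (dD + dR + dN + 2)%N.
have bG i : (size (G1 i) <= e)%N.
  have [Di Ri Ni] := nz i; have := primitive_size char0 Ni Di Ri (hG1 i).
  have := bD i; have := bR i; have := bN i; rewrite /e.
  move: (size (G1 i)) (size (D i)) (size (R i)) (size (N i)); lia.
pose g k i := (G1 i)`_k; pose s := [seq g k | k <- iota 0 e].
have one1 : Phi (fun i => (1 : K) / 1) 1 by apply: ph_ext (phC hom 1) _ _ => // i; rewrite divr1.
have [m hm [mm hs]] := dominant s one1.
have gk k : exists x, Phi (fun i => g k i / m i) x.
  case: (ltnP k e) => ke.
    by apply: hs; right; exists k; rewrite ?size_map ?size_iota // (nth_map 0%N) ?size_iota // nth_iota.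
  exists 0; apply: ph_ext (phC hom 0) _ _ => // i.
  by rewrite /g nth_default ?mul0r // (leq_trans (bG i)).
have [gam hgam] := boolp.choice gk.
have [x hx] := hs (fun=> 1) (or_introl erefl).
pose G0 := \poly_(k < e) gam k.
have rG : reduces Phi (fun i => (m i)^-1 *: G1 i) G0.
  split; first by exists e => i; apply: leq_trans (size_scale_leq _ _) (bG i).
  move=> k; rewrite coef_poly; case: ltnP => ke.
    by apply: ph_ext (hgam k) _ _ => // i; rewrite coefZ mulrC.
  apply: ph_ext (phC hom 0) _ _ => // i.
  by rewrite nth_default // (leq_trans (size_scale_leq _ _)) // (leq_trans (bG i)).
have E : Wr G0 D0 * R0 = x *: (N0 * D0).
  have L := reducesM hom (reducesB hom (reducesM hom (reduces_deriv hom rG) rD)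
    (reducesM hom rG (reduces_deriv hom rD))) rR.
  have Rr := reducesZ hom hx (reducesM hom rN rD).
  apply: (reduces_inj hom) L _; congr (reduces Phi _ _): Rr; apply/funext => i.
  have -> : 1 / m i = (m i)^-1 by rewrite mul1r.
  by rewrite -hG1 -/(Wr _ _) WrZ -scalerAl.
have [x0|xn0] := eqVneq x 0; last first.
  by exists (x^-1 *: G0); rewrite WrZ -scalerAl E scalerK.
exfalso; rewrite x0 scale0r in E.
have W0 : Wr G0 D0 = 0 by apply/eqP; move/eqP: E; rewrite mulf_eq0 (negPf R00) orbF.
have [l G0E] := Wr_eq0 char0 D00 W0.
have gd : gam d = 0.
  apply: (ph_inj hom) (hgam d) _; apply: (place_ae hPhi ae) (phC hom 0) => i /G1d h.
  by rewrite /g h mul0r.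
have G0k k : G0`_k = gam k.
  rewrite coef_poly; case: ltnP => // ke; apply: (ph_inj hom) (phC hom 0) _.
  apply: ph_ext (hgam k) _ _ => // i; by rewrite /g nth_default ?mul0r // (leq_trans (bG i)).
have l0 : l = 0.
  by have := G0k d; rewrite G0E coefZ gd => /eqP; rewrite mulf_eq0 (negPf ld) orbF => /eqP.
case: hm => [|[k]].
    move=> m1; subst m; have := oner_eq0 K.
  by rewrite -(ph_inj hom hx one1) x0 eqxx.
rewrite size_map size_iota => ke; rewrite (nth_map 0%N) ?size_iota // nth_iota // => mE.
have mm' : Phi (fun i => g k i / m i) 1 by rewrite -[k]add0n -mE.
have := G0k k; rewrite G0E l0 scale0r coef0 => h; have := oner_eq0 K.
by rewrite -(ph_inj hom (hgam k) mm') -h eqxx.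
Qed.
End Reduction.

(** * Counting clusters *)

Section Clusters.
Variable K : closedFieldType.
Hypothesis char0 : forall n, n.+1%:R != 0 :> K.
Variables (I : Type) (Phi : (I -> K) -> K -> Prop).
Hypothesis hPhi : place Phi.
Let hom := hPhi.1.
Variables (T : finType) (kappa : T -> int) (A : {set T}) (q : T -> I -> K).
Hypothesis distinct : forall i j, i \in A -> j \in A -> i != j -> forall x, q i x != q j x.
Hypothesis exact_q : forall x, exact kappa A (fun i => q i x).

Lemma reduce_exact (B : {set T}) (a b : T) (c : T -> K) :
  B \subset A -> a \in B -> b \in B -> a != b ->
  (forall i, i \in B -> Phi (fun x => (q i x - q a x) / (q b x - q a x)) (c i)) ->
  (forall i, i \in A -> i \notin B ->
     Phi (fun x => (q b x - q a x) / (q i x - q a x)) 0) ->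
  exact kappa B c.
Proof.
move=> /fintype.subsetP BA aB bB ab hin hout.
have dif0 i j x : i \in A -> j \in A -> i != j -> q i x - q j x != 0.
  by move=> iA jA ij; rewrite subr_eq0 distinct.
have d0 x : q b x - q a x != 0 by apply: dif0; rewrite ?BA // eq_sym.
pose y i x := (q i x - q a x) / (q b x - q a x).
have out0 i x : i \in A -> i \notin B -> y i x != 0.
  move=> iA iB; apply: mulf_neq0; last by rewrite invr_eq0 d0.
  by apply: dif0 => //; [exact: BA | apply: contraNneq iB => ->].
pose C := A :\: B.
pose s e x := \prod_(i in C) (- y i x) ^+ e i.
(* A factor [z - y] with y tending to infinity is [- y] times [1 - z / y]; the first factor is
   collected in [s], the second tends to 1. *)
pose U (e : T -> nat) x : {poly K} := \prod_(i in C) (1 - (y i x)^-1 *: 'X) ^+ e i.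
have s0 e x : s e x != 0.
  by apply/prodf_neq0 => i; rewrite inE => /andP [iB iA]; rewrite expf_neq0 // oppr_eq0 out0.
have split_prod e x : lprod A e (y^~ x) = s e x *: (lprod B e (y^~ x) * U e x).
  rewrite scalerAr mulrC -mul_polyC rmorph_prod -big_split /=.
  have -> : \prod_(i in C) (((- y i x) ^+ e i)%:P * (1 - (y i x)^-1 *: 'X) ^+ e i) = lprod C e (y^~ x).
    apply: eq_bigr => i; rewrite inE => /andP [iB iA].
    rewrite rmorphXn /= -exprMn; congr (_ ^+ _); rewrite mulrBr mulr1 polyCN mulNr opprK.
    by rewrite -mul_polyC mulrA -polyCM divff ?out0 // mul1r addrC.
  rewrite /lprod (bigID (mem B)) mulrC /=; congr (_ * _).
    by apply: eq_bigl => i; case: (boolP (i \in B)) => iB; rewrite ?andbF // BA.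
  by apply: eq_bigl => i; rewrite inE andbC.
have redU e : reduces Phi (U e) 1.
  have -> : (1 : {poly K}) = \prod_(i in C) (1 - (0 : K) *: 'X) ^+ e i.
    by rewrite big1 // => i _; rewrite scale0r subr0 expr1n.
  apply: (reduces_prod hom) => i; rewrite inE => /andP [iB iA].
  apply: (reducesX hom); apply: (reducesB hom); first exact: reduces_cst.
  apply: (reducesZ hom); last exact: reduces_cst.
  apply: ph_ext (hout i iA iB) _ _ => // x; by rewrite /y invf_div.
have redB e : reduces Phi (fun x => lprod B e (y^~ x)) (lprod B e c).
  apply: (reduces_prod hom) => i iB; apply: (reducesX hom).
  apply: (reducesB hom); first exact: reduces_cst.
  by apply: (reducesC hom); apply: hin.
pose P e x := lprod B e (y^~ x) * U e x.
have redP e : reduces Phi (P e) (lprod B e c).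
  by rewrite -[lprod B e c]mulr1; apply: (reducesM hom).
have P0 e x : P e x != 0.
  have := lprod_neq0 A e (y^~ x); rewrite split_prod scaler_eq0 negb_or => /andP [_]; exact.
have /boolp.choice [G hG] x : exists G, Wr G (P (pexp kappa) x) * P (pind kappa) x =
    P (zexp kappa) x * P (pexp kappa) x.
  have [G] := exact_affine (q a x) (d0 x) (exact_q x); rewrite !split_prod => hG.
  by eexists; apply: Wr_rescale hG _.
have [G0 hG0] := reduce_primitive char0 hPhi (redP _) (redP _) (redP _)
  (lprod_neq0 _ _ _) (lprod_neq0 _ _ _) (lprod_neq0 _ _ _)
  (fun x => And3 (P0 _ x) (P0 _ x) (P0 _ x)) hG.
by exists G0.
Qed.

(* A cluster: under Phi the points of B are closer to each other than to the
   points outside B. *)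
Definition ball (B : {set T}) : bool := `[<forall a b c, a \in B -> b \in B -> c \in A ->
  c \notin B -> Phi (fun x => (q a x - q b x) / (q a x - q c x)) 0>].

Definition balls (B : {set T}) := [set C : {set T} | [&& (1 < #|C|)%N, C \subset B & ball C]].

Lemma farthest (B : {set T}) a : a \in B -> B \subset A -> (1 < #|B|)%N ->
  exists2 b, b \in B & a != b /\ forall i, i \in B ->
    exists c, Phi (fun x => (q i x - q a x) / (q b x - q a x)) c.
Proof.
move=> aB /fintype.subsetP BA B1.
have [b0 b0B ab0] : exists2 b, b \in B & a != b.
  have : (0 < #|B :\ a|)%N by move: B1; rewrite (cardsD1 a B) aB.
  by case/card_gt0P => b; rewrite !inE => /andP [ba bB]; exists b; rewrite // eq_sym.
pose f i x := q i x - q a x; pose s := [seq f i | i <- enum (B :\ a)].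
have f0 b x : b \in B -> a != b -> f b x != 0.
  by move=> bB ab; rewrite subr_eq0 distinct ?BA // eq_sym.
have ff b : b \in B -> a != b -> Phi (fun x => f b x / f b x) 1.
  move=> bB ab; apply: ph_ext (phC hom 1) _ _ => // x; by rewrite divff ?f0.
have [m hm [_ hs]] := dominant hPhi s (ff b0 b0B ab0).
have [b bB [ab mE]] : exists2 b, b \in B & a != b /\ m = f b.
  case: hm => [->|[k]]; first by exists b0.
  rewrite size_map => ks ->; exists (nth b0 (enum (B :\ a)) k).
    by have := mem_nth b0 ks; rewrite mem_enum !inE => /andP [].
  rewrite (nth_map b0) //; split=> //.
  by have := mem_nth b0 ks; rewrite mem_enum !inE eq_sym => /andP [].
exists b => //; split=> // i iB; have [->|ia] := eqVneq i a.
  exists 0; apply: ph_ext (phC hom 0) _ _ => // x; by rewrite subrr mul0r.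
rewrite mE in hs; apply: (hs (f i)); right; exists (index i (enum (B :\ a))).
  by rewrite size_map index_mem mem_enum !inE ia.
by rewrite (nth_map b0) ?index_mem ?mem_enum ?inE ?ia // nth_index // mem_enum !inE ia.
Qed.

(** The points of [B] split by their limit positions into smaller clusters, and every other cluster
    in [B] lies in one of these. By [vertex_count] at least one of them has nonnegative order, and
    at least two unless [B] has order at most -2. Each of these saves one in the induction
    hypothesis, which pays for [B] itself and for the extra 1 when the order of [B] is
    nonnegative. *)
Lemma ball_count (B : {set T}) : B \subset A -> ball B -> (0 < #|B|)%N ->
  (#|balls B| + (0 <= \sum_(i in B) kappa i)%R <= #|[set i in B | (0 <= kappa i)%R]|)%N.
Proof.
elim: {B}_.+1 {-2}B (ltnSn #|B|) => // N IH B BN BA bB B0.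
case: (ltngtP #|B| 1) => [|B1|/eqP/cards1P [a Ba]]; first by rewrite ltnNge B0.
  have /card_gt0P [a aB] := B0.
  have [b bBB [ab far]] := farthest aB BA B1.
  have /fintype.subsetP sBA := BA; move/asboolP: (bB) => hB.
  have /boolp.choice [c hc] i : exists c, i \in B -> Phi (fun x => (q i x - q a x) / (q b x - q a x)) c.
    by case: (boolP (i \in B)) => [/far [c h]|_]; [exists c|exists 0].
  have dif0 i j x : i \in A -> j \in A -> i != j -> q i x - q j x != 0.
    by move=> iA jA ij; rewrite subr_eq0 distinct.
  have d0 x : q b x - q a x != 0 by apply: dif0; rewrite ?sBA // eq_sym.
  have ca : c a = 0.
    apply: (ph_inj hom) (hc a aB) _; apply: ph_ext (phC hom 0) _ _ => // x.
    by rewrite subrr mul0r.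
  have cb : c b = 1.
    apply: (ph_inj hom) (hc b bBB) _; apply: ph_ext (phC hom 1) _ _ => // x.
    by rewrite divff.
  have ex : exact kappa B c.
    apply: (@reduce_exact B a b c) => // i iA iB.
    apply: ph_ext (hB a b i aB bBB iA iB) _ _ => // x.
    by rewrite -[q a x - q b x]opprB -[q a x - q i x]opprB invrN mulrNN.
  have val1 : (1 < size (values B c))%N.
    apply: (@uniq_leq_size _ [:: 0; 1]); first by rewrite /= inE eq_sym oner_eq0.
    by move=> z; rewrite !inE => /orP [] /eqP ->; [rewrite -ca|rewrite -cb]; apply: mem_values.
  have := vertex_count char0 ex val1.
  pose Bz z := [set i in B | c i == z].
  have BzB z : Bz z \subset B by apply/fintype.subsetP => i; rewrite inE => /andP [].
  have ballz z : ball (Bz z).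
    apply/asboolP => i j k; rewrite !inE => /andP [iB /eqP iz] /andP [jB /eqP jz] kA.
    case: (boolP (k \in B)) => kB /=; last by move=> _; apply: hB.
    move=> kz; have e : z - c k != 0 by rewrite subr_eq0 eq_sym.
    have h1 : Phi (fun x => (q i x - q j x) / (q b x - q a x)) 0.
      apply: ph_ext (phB hom (hc i iB) (hc j jB)) _ _; last by rewrite iz jz subrr.
      by move=> x; rewrite -mulrBl; congr (_ / _); ring.
    have h2 : Phi (fun x => (q i x - q k x) / (q b x - q a x)) (z - c k).
      apply: ph_ext (phB hom (hc i iB) (hc k kB)) _ _; last by rewrite iz.
      by move=> x; rewrite -mulrBl; congr (_ / _); ring.
    apply: ph_ext (phM hom h1 (placeV hPhi h2 e)) _ _; last by rewrite mul0r.
    by move=> x; rewrite invf_div mulrA divfK.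
  have IHz z : z \in values B c ->
      (#|balls (Bz z)| + (0 <= \sum_(i in B | c i == z) kappa i)%R <=
       #|[set i in Bz z | (0 <= kappa i)%R]|)%N.
    move=> zv; have -> : \sum_(i in B | c i == z) kappa i = \sum_(i in Bz z) kappa i.
      by apply: eq_bigl => i; rewrite inE.
    apply: IH => //.
    - rewrite -ltnS; apply: leq_trans BN; rewrite ltnS; apply: proper_card.
      rewrite properE BzB; apply/subsetPn; case: (eqVneq z 0) => [->|z0].
        by exists b; rewrite // inE bBB cb oner_eq0.
      by exists a; rewrite // inE aB ca eq_sym.
    - exact: fintype.subset_trans BA.
    - move: zv; rewrite mem_undup => /seq.mapP; case=> i; rewrite mem_enum => iB ->.
      by apply/card_gt0P; exists i; rewrite inE iB eqxx.
  have card_balls : (#|balls B| <= 1 + \sum_(z <- values B c) #|balls (Bz z)|)%N.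
    (* In a cluster other than [B], distances are infinitesimal compared with the distance to a
       point of [B] outside it, hence compared with that of a and b; so its points have one limit
       position. *)
    have sub : balls B \subset B |: \bigcup_(z <- values B c) balls (Bz z).
      apply/fintype.subsetP => C; rewrite !inE => /and3P [C1 CB bC].
      have [//|CnB] := eqVneq C B; rewrite /=.
      have /card_gt0P [i iC] : (0 < #|C|)%N by apply: leq_trans C1.
      have [k kB kC] : exists2 k, k \in B & k \notin C.
        by apply/subsetPn; apply: contra CnB => BC; rewrite finset.eqEsubset CB.
      move/fintype.subsetP: CB => CB; move/asboolP: (bC) => hC.
      rewrite (big_rem (c i)) ?mem_values ?CB //= finset.in_setU; apply/orP; left.
      rewrite !inE C1 bC andbT /=; apply/fintype.subsetP => j jC; rewrite inE CB //= eq_sym.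
      have h0 := hC i j k iC jC (sBA k kB) kC.
      have h1 : Phi (fun x => (q i x - q k x) / (q b x - q a x)) (c i - c k).
        apply: ph_ext (phB hom (hc i (CB i iC)) (hc k kB)) _ _ => //.
        by move=> x; rewrite -mulrBl; congr (_ / _); ring.
      have h2 := phB hom (hc i (CB i iC)) (hc j (CB j jC)).
      rewrite -subr_eq0; apply/eqP; apply: (ph_inj hom) h2 _.
      apply: ph_ext (phM hom h0 h1) _ _; last by rewrite mul0r.
      move=> x; rewrite mulrA divfK; last by apply: dif0; [exact: sBA (CB i iC)|exact: sBA|apply: contraNneq kC => <-].
      by rewrite -mulrBl; congr (_ / _); ring.
    apply: leq_trans (subset_leq_card sub) _.
    apply: leq_trans (leq_card_setU _ _) _; rewrite cards1 leq_add2l.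
    elim: (values B c) => [|z s IHs]; first by rewrite !big_nil cards0.
    by rewrite !big_cons; apply: leq_trans (leq_card_setU _ _) _; rewrite leq_add2l.
  have card_Z : (\sum_(z <- values B c) #|[set i in Bz z | (0 <= kappa i)%R]| =
      #|[set i in B | (0 <= kappa i)%R]|)%N.
    rewrite -sum1dep_card big_mkcondr -(sum_values B c) /=.
    apply: eq_bigr => z _; rewrite -sum1dep_card big_mkcondr; apply: eq_bigl => i.
    by rewrite inE.
  have sum_le : (\sum_(z <- values B c) #|balls (Bz z)| +
      count (fun z => (0 <= \sum_(i in B | c i == z) kappa i)%R) (values B c) <=
      #|[set i in B | (0 <= kappa i)%R]|)%N.
    rewrite -card_Z -sum1_count [X in (_ + X <= _)%N]big_mkcond -big_split /= big_seq [X in (_ <= X)%N]big_seq.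
    by apply: leq_sum => z zv; have := IHz z zv; case: ifP.
  move: card_balls sum_le; rewrite -/(Bz _).
  move: #|balls B| (\sum_(z <- _) _)%N (count _ _) #|_| (\sum_(i in B) kappa i) => a1 a2 a3 a4 a5; lia.
rewrite Ba big_set1 (_ : balls _ = finset.set0) ?cards0 ?add0n; last first.
  apply/setP => C; rewrite !inE; apply/negP => /and3P [C1 /subset_leq_card].
  by rewrite cards1 leqNgt C1.
case: (boolP (0 <= kappa a)) => // h; apply/card_gt0P; exists a; by rewrite !inE eqxx.
Qed.
End Clusters.

(** * Nodes of limits of the stratum *)


Section Depth.
Variable K : closedFieldType.
Hypothesis char0 : forall n, n.+1%:R != 0 :> K.

Lemma crs_tuple n (a b c d : 'I_n) : let t := [tuple a; b; c; d] in
  [/\ crs t 0 = a, crs t 1 = b, crs t 2 = c & crs t 3 = d].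
Proof. by split; rewrite /crs (tnth_nth a) inordK. Qed.

Lemma crs_map n m (f : 'I_n -> 'I_m) (t : 4.-tuple 'I_n) k : crs (map_tuple f t) k = f (crs t k).
Proof. by rewrite /crs tnth_map. Qed.

Section Trace.
Variables (I : Type) (Phi : (I -> K) -> K -> Prop).
Hypothesis hPhi : place Phi.
Let hom := hPhi.1.
Variables (n s : nat) (o : 'I_n) (q : 'I_(n + s) -> I -> K).
Local Notation A := (~: [set lshift s o])%SET.
Hypothesis distinct : forall i j, i \in A -> j \in A -> i != j -> forall x, q i x != q j x.
Variable w : cr_space K (n + s).
Hypothesis limit_w : forall t, limit_P1 Phi (fun x => mline (lshift s o) (q^~ x) t) (w t).

Definition trace (C : {set 'I_(n + s)}) : {set 'I_n} := [set i | lshift s i \in C].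

Lemma limit_one (a b c d : 'I_n) : forget w [tuple a; b; c; d] == Some 1 ->
  Phi (fun x => (dif (lshift s o) (q^~ x) (lshift s a) (lshift s c) *
                 dif (lshift s o) (q^~ x) (lshift s b) (lshift s d)) /
                (dif (lshift s o) (q^~ x) (lshift s a) (lshift s d) *
                 dif (lshift s o) (q^~ x) (lshift s b) (lshift s c))) 1.
Proof.
rewrite ffunE => /eqP e; have [_] := limit_w (map_tuple (@lshift n s) [tuple a; b; c; d]).
rewrite e /= => h; apply: ph_ext h _ _ => // x; rewrite ffunE /cr_num /cr_den !crs_map /=.
by have /= [-> -> -> ->] := crs_tuple a b c d.
Qed.

(** [S0] is the side of the node without [o]. A cross-ratio with one entry at infinity is a quotient
    of two differences; that it tends to 1 means that two points of [S0] are close compared with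
    their distance to a third point. *)
Lemma node_collision (S : {set 'I_n}) : separates (forget w) S -> exists S0 : {set 'I_n},
  [/\ [set S; ~: S]%SET = [set S0; ~: S0]%SET, (1 < #|S0|)%N, (1 < #|~: S0|)%N, o \notin S0 &
   forall a b c, a \in S0 -> b \in S0 -> c \notin S0 -> c != o ->
   Phi (fun x => (q (lshift s a) x - q (lshift s b) x) / (q (lshift s a) x - q (lshift s c) x)) 0].
Proof.
have ls_inj : injective (@lshift n s) by move=> i j /(congr1 val) /= /val_inj.
have dE i j x : i != o -> j != o ->
    dif (lshift s o) (q^~ x) (lshift s i) (lshift s j) = q (lshift s i) x - q (lshift s j) x.
  by move=> io jo; rewrite /dif !(inj_eq ls_inj) (negPf io) (negPf jo).
have dE1 j x : j != o -> dif (lshift s o) (q^~ x) (lshift s o) (lshift s j) = 1.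
  by move=> jo; rewrite /dif eqxx (inj_eq ls_inj) jo.
have dE2 j x : j != o -> dif (lshift s o) (q^~ x) (lshift s j) (lshift s o) = -1.
  by move=> jo; rewrite /dif eqxx (inj_eq ls_inj) (negPf jo).
have dn0 i j x : i != o -> j != o -> i != j -> q (lshift s i) x - q (lshift s j) x != 0.
  move=> io jo ij; rewrite subr_eq0; apply: distinct; rewrite ?inE ?(inj_eq ls_inj) //.
move=> /and3P [S1 S2 /forallP hS].
have {}hS i j k l : i \in S -> j \in S -> k \notin S -> l \notin S ->
    forget w [tuple i; j; k; l] == Some 1.
  move=> iS jS kS lS; have := hS i; rewrite iS /= => /forallP /(_ j).
  rewrite jS /= => /forallP /(_ k); rewrite inE kS /= => /forallP /(_ l).
  by rewrite inE lS.
case: (boolP (o \in S)) => oS.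
  exists (~: S)%SET; rewrite finset.setCK finset.setUC inE oS; split=> // a b c.
  rewrite !inE negbK => aS bS cS co.
  have ao : a != o by apply: contraNneq aS => ->.
  have bo : b != o by apply: contraNneq bS => ->.
  have ca : c != a by apply: contraTneq cS => ->.
  have cb : c != b by apply: contraTneq cS => ->.
  have h := limit_one (hS c o a b cS oS aS bS).
  have h1 := phB hom (phC hom 1) (placeV hPhi h (oner_neq0 _)).
  apply: ph_ext h1 _ _ => [x|]; last by rewrite invr1 subrr.
  rewrite !dE1 // !dE //; have := dn0 c a x co ao ca; have := dn0 c b x co bo cb.
  have : q (lshift s a) x - q (lshift s c) x != 0 by apply: dn0; rewrite // eq_sym.
  move: (q _ x) (q _ x) (q _ x) => u v y h2 h3 h4; field.
  by rewrite h2 h3 h4.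
exists S; split=> // a b c aS bS cS co.
have ao : a != o by apply: contraTneq aS => ->.
have bo : b != o by apply: contraTneq bS => ->.
have ac : a != c by apply: contraTneq aS => ->.
have bc : b != c by apply: contraTneq bS => ->.
have h := limit_one (hS a b c o aS bS cS oS).
have h1 := phB hom (phC hom 1) (placeV hPhi h (oner_neq0 _)).
apply: ph_ext h1 _ _ => [x|]; last by rewrite invr1 subrr.
rewrite !dE2 // !dE //; have := dn0 a c x ao co ac; have := dn0 b c x bo co bc.
move: (q _ x) (q _ x) (q _ x) => u v y h2 h3; field.
by rewrite h2 h3 oppr_eq0 oner_neq0.
Qed.

(** The points of [S0] need not form a cluster once the forgotten points are restored. [C] collects
    all points whose distance from a is at most comparable to the diameter of [S0]. *)
Lemma node_ball (S0 : {set 'I_n}) : (1 < #|S0|)%N -> (1 < #|~: S0|)%N -> o \notin S0 ->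
  (forall a b c, a \in S0 -> b \in S0 -> c \notin S0 -> c != o ->
   Phi (fun x => (q (lshift s a) x - q (lshift s b) x) / (q (lshift s a) x - q (lshift s c) x)) 0) ->
  exists2 C, C \in balls Phi A q A :\ A & trace C = S0.
Proof.
move=> S1 S2 oS col; have ls_inj : injective (@lshift n s) by move=> i j /(congr1 val) /= /val_inj.
pose L := [set lshift s i | i in S0].
have LE i : (lshift s i \in L) = (i \in S0) by rewrite mem_imset.
have LA : L \subset A.
  apply/fintype.subsetP => _ /imsetP [i iS ->]; rewrite !inE (inj_eq ls_inj).
  by apply: contraNneq oS => <-.
have [a aS] : exists a, a \in S0 by apply/card_gt0P; apply: leq_trans S1.
have aL : lshift s a \in L by rewrite LE.
have L1 : (1 < #|L|)%N by rewrite card_imset.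
have [b bL [ab far]] := farthest hPhi distinct aL LA L1.
have [b0 bS0 bE] : exists2 b0, b0 \in S0 & b = lshift s b0.
  by move/imsetP: bL => [b0 h ->]; exists b0.
have sLA := fintype.subsetP LA.
pose d x := q b x - q (lshift s a) x.
have d0 x : d x != 0 by rewrite subr_eq0; apply: distinct; rewrite ?sLA // eq_sym.
pose C := [set j in A | `[<exists c, Phi (fun x => (q j x - q (lshift s a) x) / d x) c>]].
have CA : C \subset A by apply/fintype.subsetP => j; rewrite inE => /andP [].
have outC c : c \notin S0 -> lshift s c \notin C.
  move=> cS; have [->|co] := eqVneq c o; first by rewrite !inE eqxx.
  rewrite inE negb_and orbC; apply/orP; left; apply/asboolP => -[f hf].
  have h0 := col a b0 c aS bS0 cS co.
  have ca : forall x, q (lshift s a) x - q (lshift s c) x != 0.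
    move=> x; rewrite subr_eq0; apply: distinct; first exact: sLA.
      by rewrite !inE (inj_eq ls_inj).
    by rewrite (inj_eq ls_inj); apply: contraNneq cS => <-.
  have h1 : Phi (fun=> 1) 0.
    apply: ph_ext (phM hom h0 hf) _ _ => [x|]; last by rewrite mul0r.
    rewrite -bE /d; have := ca x; have := d0 x; rewrite /d.
    by move: (q _ x) (q _ x) (q _ x) => u v y h2 h3; field; rewrite h2 h3.
  by have := place_neq01 hPhi (phC hom 1) h1.
have inC c : c \in S0 -> lshift s c \in C.
  by move=> cS; rewrite inE sLA ?LE //=; apply/asboolP; apply: far; rewrite LE.
have tC : trace C = S0.
  apply/setP => c; rewrite inE; apply/idP/idP => [|/inC //].
  by apply: contraLR => /outC.
exists C => //; rewrite !inE CA /=; apply/and3P; split.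
- apply/negP => /eqP CE.
  have [c [cS co]] : exists c, c \notin S0 /\ c != o.
    have oC : o \in ~: S0 by rewrite inE.
    have : (0 < #|(~: S0) :\ o|)%N by move: S2; rewrite (cardsD1 o) oC.
    by case/card_gt0P => c; rewrite !inE => /andP [co cS]; exists c.
  by have := outC c cS; rewrite CE !inE (inj_eq ls_inj) co.
- apply: leq_trans L1 (subset_leq_card _); apply/fintype.subsetP => _ /imsetP [i iS ->].
  exact: inC.
apply/asboolP => x y z; rewrite !inE => /andP [xA /asboolP [cx hx]] /andP [yA /asboolP [cy hy]] zA.
rewrite zA /= => zC.
have far_z : Phi (fun i => d i / (q z i - q (lshift s a) i)) 0.
  case: (hPhi.2 (fun i => (q z i - q (lshift s a) i) / d i)) => [[c hc]|[h _]].
    by case/asboolP: zC; exists c.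
  by apply: ph_ext h _ _ => // i; rewrite invf_div.
have za : z != lshift s a.
  apply/eqP => e; case/asboolP: zC; exists 0; apply: ph_ext (phC hom 0) _ _ => // i.
  by rewrite e subrr mul0r.
have za0 i : q z i - q (lshift s a) i != 0 by rewrite subr_eq0; apply: distinct; [rewrite !inE|exact: sLA|exact: za].
have zx : x != z by apply/eqP => e; case/asboolP: zC; exists cx; rewrite -e.
have zx0 i : q x i - q z i != 0 by rewrite subr_eq0 distinct ?inE.
have h1 := phB hom (phM hom hx far_z) (phC hom 1).
have h2 : Phi (fun i => ((q x i - q z i) / (q z i - q (lshift s a) i))^-1) (-1).
  have n1 : cx * 0 - 1 != 0 :> K by rewrite mulr0 sub0r oppr_eq0 oner_eq0.
  apply: ph_ext (placeV hPhi h1 n1) _ _ => [i|]; last by rewrite mulr0 sub0r invrN invr1.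
  congr (_^-1); have := za0 i; have := d0 i.
  by rewrite /d; move: (q _ i) (q _ i) (q _ i) (q _ i) => u v y' v' h3 h4; field; rewrite h3 h4.
apply: ph_ext (phM hom (phM hom (phB hom hx hy) far_z) h2) _ _ => [i|]; last by rewrite mulr0 mul0r.
have := za0 i; have := d0 i; have := zx0 i; rewrite /d.
by move: (q _ i) (q _ i) (q _ i) (q _ i) (q _ i) => u v y' v' t h3 h4 h5; field; rewrite h3 h4 h5.
Qed.

(** Every node is induced by the trace of a cluster. [A] itself is excluded, since only the point
    [o] lies outside its trace. *)
Lemma nodes_le_balls : (nodes (forget w) <= #|balls Phi A q A :\ A|)%N.
Proof.
apply: leq_trans (leq_imset_card (fun C => [set trace C; ~: trace C]%SET) _).
apply: subset_leq_card; apply/fintype.subsetP => _ /imsetP [S hS ->].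
move: hS; rewrite inE => /node_collision [S0 [-> S1 S2 oS col]].
have [C hC tC] := node_ball S1 S2 oS col.
by apply/imsetP; exists C => //; rewrite tC.
Qed.
End Trace.

Lemma sum_nth (V : nmodType) m (kappa : seq int) (F : int -> V) : size kappa = m ->
  \sum_(i < m) F kappa`_i = \sum_(a <- kappa) F a.
Proof. by move=> <-; rewrite (big_nth 0) big_mkord. Qed.

Lemma card_nth m (kappa : seq int) (P : pred int) : size kappa = m ->
  #|[set i : 'I_m | P kappa`_i]| = count P kappa.
Proof.
move=> sz; rewrite -sum1dep_card -sum1_count big_mkcond [RHS]big_mkcond.
exact: (sum_nth (V := nat) (fun a => if P a then 1%N else 0%N)).
Qed.

Lemma pole_among_first n s (kappa : seq int) : size kappa = (n + s)%N ->
  count (fun a => a < 0) kappa = s.+2 -> exists o : 'I_n, kappa`_(lshift s o) < 0.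
Proof.
move=> sz cneg; apply: contrapT => h; have : (#|[set i : 'I_(n + s) | (kappa`_i < 0)%R]| <= s)%N.
  apply: leq_trans (_ : #|[set @rshift n s j | j in [set: 'I_s]]| <= s)%N; last first.
    by apply: leq_trans (leq_imset_card _ _) _; rewrite cardsT card_ord.
  apply: subset_leq_card; apply/fintype.subsetP => i; rewrite inE => ki.
  case: (splitP i) => [j|j] e; last by apply/imsetP; exists j; rewrite ?inE //; apply: val_inj.
  by case: h; exists j; rewrite /= -e.
by rewrite (card_nth (fun a => (a < 0)%R) sz) cneg; lia.
Qed.

(** Of the n + s entries s + 2 are negative, which leaves n - 2 zeros. The order at infinity is at
    most -2, so the points of [A] have nonnegative total order, and [ball_count] allows n - 3
    clusters including [A]. *)
Lemma few_nodes n s (kappa : seq int) w : (3 <= n)%N -> size kappa = (n + s)%N ->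
  \sum_(a <- kappa) a = -2 -> -1 \notin kappa -> count (fun a => a < 0) kappa = s.+2 ->
  zclosure (@stratum K (n + s) kappa) w -> (nodes (forget w) + 4 <= n)%N.
Proof.
move=> n3 sz sumk nk cneg hw; pose kap := fun i : 'I_(n + s) => kappa`_i.
have cntI P : #|[set i | P (kap i)]| = count P kappa by apply: card_nth.
have kn1 (i : 'I_(n + s)) : kappa`_i != -1.
  by apply: contraNneq nk => <-; rewrite mem_nth // sz.
have [o ko] := pole_among_first sz cneg.
have ls_inj : injective (@lshift n s) by move=> i j /(congr1 val) /= /val_inj.
pose O := lshift s o; pose A := (~: [set O])%SET.
have sk : \sum_(i < n + s) kappa`_i = -2 by rewrite (sum_nth id sz).
pose I := {q : 'I_(n + s) -> K | nondeg O q /\ exact kap A q}.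
pose m (i : I) := mline O (sval i).
have hr : zclosure (range m) w.
  apply: zclosureS hw => x /(stratum_mline char0 _ sk kn1 ko) [q [nd -> ex]].
  by exists (exist _ q (conj nd ex)).
have [Phi hPhi hev] := closure_place hr.
have lim := closure_place_limit hPhi hev.
pose q j (i : I) := sval i j.
have distinct i j : i \in A -> j \in A -> i != j -> forall x, q i x != q j x.
  rewrite !inE => iO jO ij [f [nd ex]]; rewrite /q /= -subr_eq0.
  by have := nd i j ij; rewrite /dif (negPf iO) (negPf jO).
have exq x : exact kap A (q^~ x) by case: x => f [].
have A0 : (0 < #|A|)%N.
  by move: (cardsC1 O); rewrite card_ord -/A => ->; lia.
have bA : ball Phi A q A by apply/asboolP => a b c _ _ cA; rewrite cA.
have cnt := ball_count char0 hPhi distinct exq (fintype.subxx (mem A)) bA A0.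
have sA : \sum_(i in A) kap i = -2 - kap O.
  rewrite -[X in _ = X - _]sk [X in _ = X - _](bigD1 O) //= addrAC subrr add0r; apply: eq_bigl => i; by rewrite !inE.
have cA : #|[set i in A | (0 <= kap i)%R]| = (n - 2)%N.
  have -> : [set i in A | (0 <= kap i)%R] = (~: [set i | (kap i < 0)%R])%SET.
    apply/setP => i; rewrite !inE -Order.TotalTheory.leNgt.
    by case: eqVneq => //= ->; rewrite Order.TotalTheory.leNgt ko.
  by rewrite cardsCs finset.setCK (cntI (fun a => (a < 0)%R)) cneg card_ord; lia.
have kO : (0 <= \sum_(i in A) kap i)%R.
  by rewrite sA; have := kn1 O; move: ko; rewrite -/O /kap; lia.
have AA : A \in balls Phi A q A.
  rewrite inE bA fintype.subxx !andbT.
  by move: (cardsC1 O); rewrite card_ord -/A => ->; lia.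
have := @nodes_le_balls I Phi hPhi n s o q distinct w lim.
move: cnt; rewrite kO cA (cardsD1 A) AA -/A -/O.
by move: #|_ :\ _| (nodes _); lia.
Qed.
End Depth.

(** * Trees of nested clusters *)

Inductive btree (n : nat) := Leaf of 'I_n | Node of btree n & btree n.
HB.instance Definition _ n := gen_eqMixin (btree n).

Section Trees.
Variable n : nat.
Implicit Types (t l r v w : btree n) (a b c k : 'I_n).

Fixpoint leaves t : seq 'I_n :=
  match t with Leaf i => [:: i] | Node l r => leaves l ++ leaves r end.
Fixpoint lm t : 'I_n := match t with Leaf i => i | Node l r => lm l end.
(** If the leaves are distinct, then so are the keys of the inner vertices, by [lm_keys_perm];
    functions of labels thus serve as functions of inner vertices. *)
Definition key t : 'I_n := match t with Leaf i => i | Node l r => lm r end.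
Fixpoint inner t : seq (btree n) :=
  match t with Leaf _ => [::] | Node l r => t :: inner l ++ inner r end.
(** The root is omitted, as its size is normalized to 1. With n - 1 leaves this gives n - 3
    coordinates. *)
Definition inner' t : seq (btree n) := behead (inner t).

Lemma lm_leaves t : lm t \in leaves t.
Proof. by elim: t => [i|l IHl r _] /=; rewrite ?mem_head // mem_cat IHl. Qed.

Lemma key_leaves t : key t \in leaves t.
Proof. by case: t => [i|l r] /=; rewrite ?mem_head // mem_cat lm_leaves orbT. Qed.

Lemma inner_leaves t v : v \in inner t -> {subset leaves v <= leaves t}.
Proof.
elim: t => [i|l IHl r IHr] //=; rewrite inE mem_cat => /or3P [/eqP -> //|/IHl h|/IHr h] k /h kv.
  by rewrite mem_cat kv.
by rewrite mem_cat kv orbT.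
Qed.

Lemma inner'_Node l r : inner' (Node l r) = inner l ++ inner r. Proof. by []. Qed.

Lemma inner_cons t : inner t = (if t is Node _ _ then [:: t] else [::]) ++ inner' t.
Proof. by case: t. Qed.

Lemma lm_keys_perm t : perm_eq (lm t :: map key (inner t)) (leaves t).
Proof.
elim: t => [i|l IHl r IHr] //=; rewrite map_cat.
apply: perm_trans (perm_cat IHl IHr); rewrite /= perm_cons.
rewrite -[lm r :: _ ++ _]/([:: lm r] ++ _ ++ _) perm_catCA; exact: perm_refl.
Qed.

Lemma uniq_keys t : uniq (leaves t) -> uniq (map key (inner t)).
Proof. by rewrite -(perm_uniq (lm_keys_perm t)) /= => /andP []. Qed.

Lemma size_inner t : (size (inner t)).+1 = size (leaves t).
Proof. by rewrite -(perm_size (lm_keys_perm t)) /= size_map. Qed.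

Definition disj_leaves l r := forall k, k \in leaves l -> k \in leaves r -> False.

Lemma uniq_Node l r : uniq (leaves (Node l r)) ->
  [/\ uniq (leaves l), uniq (leaves r) & disj_leaves l r].
Proof.
rewrite /= cat_uniq => /and3P [ul /hasPn h ur]; split=> // k kl kr.
by have := h k kr; rewrite kl.
Qed.

Lemma inner_laminar t v w : uniq (leaves t) -> v \in inner t -> w \in inner t ->
  [\/ {subset leaves v <= leaves w}, {subset leaves w <= leaves v} | disj_leaves v w].
Proof.
elim: t => [i|l IHl r IHr] // /uniq_Node [ul ur dis].
move=> /[dup] vt; rewrite inE mem_cat => /or3P [/eqP ->|vl|vr];
move=> /[dup] wt; rewrite inE mem_cat => /or3P [/eqP ->|wl|wr].
- by constructor 1.
- by constructor 2; apply: inner_leaves.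
- by constructor 2; apply: inner_leaves.
- by constructor 1; apply: inner_leaves.
- exact: IHl.
- by constructor 3 => k /(inner_leaves vl) kl /(inner_leaves wr) kr; apply: dis kl kr.
- by constructor 1; apply: inner_leaves.
- by constructor 3 => k /(inner_leaves vr) kr /(inner_leaves wl) kl; apply: dis kl kr.
- exact: IHr.
Qed.

Lemma inner_inj t v w : uniq (leaves t) -> v \in inner t -> w \in inner t ->
  leaves v =i leaves w -> v = w.
Proof.
elim: t => [i|l IHl r IHr] // /uniq_Node [ul ur dis].
have nol v' w' : v' \in inner l -> w' \in inner r -> leaves v' =i leaves w' -> False.
  move=> vl wr e; apply: (dis (lm v')); first by apply: inner_leaves vl _ (lm_leaves _).
  by apply: inner_leaves wr _ _; rewrite -e lm_leaves.
have not (P : Prop) w' : w' \in inner l ++ inner r -> leaves (Node l r) =i leaves w' -> P.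
  rewrite mem_cat => /orP [wl|wr] e; exfalso.
    apply: (dis (lm r) _ (lm_leaves r)); apply: inner_leaves wl _ _.
    by rewrite -e /= mem_cat lm_leaves orbT.
  apply: (dis (lm l) (lm_leaves l)); apply: inner_leaves wr _ _.
  by rewrite -e /= mem_cat lm_leaves.
rewrite /= !inE => /orP [/eqP ->|vt] /orP [/eqP ->|wt] e //.
- exact: (not _ w).
- by apply: (not _ v) => // k; rewrite e.
move: vt wt; rewrite !mem_cat => /orP [vl|vr] /orP [wl|wr].
- exact: IHl.
- by case: (nol v w).
- by case: (nol w v) => // k; rewrite e.
- exact: IHr.
Qed.

Lemma inner_size t v : v \in inner t -> exists l r, v = Node l r.
Proof.
elim: t => [i|l IHl r IHr] //=; rewrite inE mem_cat => /or3P [/eqP ->|/IHl|/IHr] //.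
by exists l, r.
Qed.

Lemma inner_uniq t v : uniq (leaves t) -> v \in inner t -> uniq (leaves v).
Proof.
elim: t => [i|l IHl r IHr] // /[dup] ut /uniq_Node [ul ur dis].
by rewrite inE mem_cat => /or3P [/eqP -> //|/(IHl ul)|/(IHr ur)].
Qed.

Lemma inner'_proper t v : uniq (leaves t) -> v \in inner' t ->
  exists2 k, k \in leaves t & k \notin leaves v.
Proof.
case: t => [i|l r] // /uniq_Node [ul ur dis]; rewrite inner'_Node mem_cat => /orP [vl|vr].
  exists (lm r); first by rewrite /= mem_cat lm_leaves orbT.
  by apply/negP => /(inner_leaves vl) h; apply: dis h (lm_leaves r).
exists (lm l); first by rewrite /= mem_cat lm_leaves.
by apply/negP => /(inner_leaves vr) h; apply: dis (lm_leaves l) h.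
Qed.

Section Coordinates.
Variable R : comNzRingType.
Implicit Types (eta : 'I_n -> R).

(* The first leaves of the two subtrees of the root are at 0 and 1, and eta gives
   the size of each subtree relative to its parent; right subtrees are reversed. *)
Definition scale eta t : R := if t is Node _ r then eta (lm r) else 0.

Fixpoint tpos eta t k : R :=
  if t is Node l r then
    if k \in leaves l then scale eta l * tpos eta l k else 1 - scale eta r * tpos eta r k
  else 0.

(* tpos a - tpos b is tmon times tdu, and tdu is a unit at eta = 0. *)
Definition tmon eta t a b : R :=
  \prod_(v <- inner' t | (a \in leaves v) && (b \in leaves v)) eta (key v).

Fixpoint tdu eta t a b : R :=
  if t is Node l r then
    if a \in leaves l then
      if b \in leaves l then tdu eta l a b
      else scale eta l * tpos eta l a - (1 - scale eta r * tpos eta r b)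
    else if b \in leaves l then (1 - scale eta r * tpos eta r a) - scale eta l * tpos eta l b
    else - tdu eta r a b
  else 0.

Lemma tmon_part eta v a b : a \in leaves v -> b \in leaves v ->
  \prod_(v' <- inner v | (a \in leaves v') && (b \in leaves v')) eta (key v') =
  (if v is Node _ _ then scale eta v else 1) * tmon eta v a b.
Proof.
case: v => [i|l r] av bv; first by rewrite mul1r.
have -> : inner (Node l r) = Node l r :: inner' (Node l r) by [].
by rewrite big_cons av bv.
Qed.

Lemma tmon_out eta v a b : a \notin leaves v ->
  \prod_(v' <- inner v | (a \in leaves v') && (b \in leaves v')) eta (key v') = 1.
Proof.
move=> av; rewrite big_seq_cond big1 // => v' /andP [v'v /andP [av' _]].
by rewrite (inner_leaves v'v) in av.
Qed.

Lemma tpos_diff eta t a b : uniq (leaves t) -> a \in leaves t -> b \in leaves t ->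
  tpos eta t a - tpos eta t b = tmon eta t a b * tdu eta t a b.
Proof.
elim: t => [i|l IHl r IHr]; first by rewrite /= subrr mulr0.
move=> /[dup] ut /uniq_Node [ul ur dis] at_ bt_; rewrite /tmon inner'_Node big_cat /=.
have out k : k \in leaves l -> k \notin leaves r by move=> kl; apply/negP => /(dis k kl).
have outr k : k \in leaves (Node l r) -> k \notin leaves l -> k \in leaves r.
  by rewrite mem_cat => /orP [->|].
case: (boolP (a \in leaves l)) => al; case: (boolP (b \in leaves l)) => bl.
- rewrite [X in _ * X * _](tmon_out _ _ (out a al)) mulr1.
  rewrite tmon_part //.
  rewrite -mulrBr; case: l {IHr ut at_ bt_ dis out outr} ul al bl IHl => [i|l1 l2] ul al bl IHl.
    by rewrite /= !mul0r mulr0.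
  by rewrite IHl // mulrA.
- rewrite [X in _ * X * _]big1_seq ?mulr1; last first.
    by move=> v' /andP [/andP [av' _] v'r]; case: (dis a al); apply: inner_leaves v'r _ av'.
  rewrite big1_seq ?mul1r // => v' /andP [/andP [_ bv'] v'l].
  by rewrite (inner_leaves v'l bv') in bl.
- rewrite [X in X * _ * _](tmon_out _ _ al) mul1r big1_seq ?mul1r // => v' /andP [/andP [_ bv'] v'r].
  by case: (dis b bl); apply: inner_leaves v'r _ bv'.
- rewrite [X in X * _ * _](tmon_out _ _ al) mul1r.
  have ar := outr a at_ al; have br := outr b bt_ bl.
  rewrite tmon_part //.
  have -> : 1 - scale eta r * tpos eta r a - (1 - scale eta r * tpos eta r b) =
    - (scale eta r * (tpos eta r a - tpos eta r b)) by ring.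
  rewrite mulrN; congr (- _).
  case: r {IHl ut at_ bt_ dis out outr} ur ar br IHr => [i|l1 l2] ur ar br IHr.
    by rewrite /= !mul0r mulr0.
  by rewrite IHr // mulrA.
Qed.

Lemma scale_ext eta eta' t l r : t = Node l r ->
  {in map key (inner' t), eta =1 eta'} ->
  scale eta l = scale eta' l /\ scale eta r = scale eta' r.
Proof.
move=> -> h; split; [case: l h => [i|l1 l2] h|case: r h => [i|l1 l2] h] => //=; apply: h.
  by rewrite inner'_Node map_cat mem_cat /= mem_head.
by rewrite inner'_Node map_cat mem_cat /= mem_head orbT.
Qed.

Lemma inner'_sub l r v : v \in inner' l -> v \in inner' (Node l r).
Proof. by move=> h; rewrite inner'_Node mem_cat inner_cons mem_cat h orbT. Qed.
Lemma inner'_subr l r v : v \in inner' r -> v \in inner' (Node l r).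
Proof. by move=> h; rewrite inner'_Node mem_cat [inner r]inner_cons mem_cat h !orbT. Qed.

Lemma keys_sub l r : {subset map key (inner' l) <= map key (inner' (Node l r))}.
Proof. by move=> k /seq.mapP; case=> v vl ->; apply: map_f; apply: inner'_sub. Qed.
Lemma keys_subr l r : {subset map key (inner' r) <= map key (inner' (Node l r))}.
Proof. by move=> k /seq.mapP; case=> v vl ->; apply: map_f; apply: inner'_subr. Qed.

Lemma tpos_ext eta eta' t : {in map key (inner' t), eta =1 eta'} ->
  tpos eta t =1 tpos eta' t.
Proof.
elim: t => [i|l IHl r IHr] //= h k; have [-> ->] := scale_ext erefl h.
rewrite IHl ?IHr // => j jk; apply: h; [exact: keys_subr|exact: keys_sub].
Qed.

Lemma tdu_ext eta eta' t : {in map key (inner' t), eta =1 eta'} ->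
  tdu eta t =2 tdu eta' t.
Proof.
elim: t => [i|l IHl r IHr] //= h a b; have [-> ->] := scale_ext erefl h.
have hl : {in map key (inner' l), eta =1 eta'} by move=> j jk; apply: h; exact: keys_sub.
have hr : {in map key (inner' r), eta =1 eta'} by move=> j jk; apply: h; exact: keys_subr.
by rewrite !(tpos_ext hl) !(tpos_ext hr) IHl // IHr.
Qed.
End Coordinates.

Lemma tpos_morph (R S : comNzRingType) (f : {rmorphism R -> S}) eta t k :
  f (tpos eta t k) = tpos (f \o eta) t k.
Proof.
have sE v : f (scale eta v) = scale (f \o eta) v by case: v => //= i; rewrite rmorph0.
elim: t => [i|l IHl r IHr] /=; first by rewrite rmorph0.
by case: ifP => _; rewrite ?rmorphB ?rmorphM ?rmorph1 sE ?IHl ?IHr.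
Qed.

Lemma tdu_morph (R S : comNzRingType) (f : {rmorphism R -> S}) eta t a b :
  f (tdu eta t a b) = tdu (f \o eta) t a b.
Proof.
have sE v : f (scale eta v) = scale (f \o eta) v by case: v => //= i; rewrite rmorph0.
elim: t => [i|l IHl r IHr] /=; first by rewrite rmorph0.
case: ifP => _; case: ifP => _ //.
- by rewrite !rmorphB !rmorphM rmorph1 !sE !tpos_morph.
- by rewrite !rmorphB !rmorphM rmorph1 !sE !tpos_morph.
- by rewrite rmorphN IHr.
Qed.

(** At the origin the two subtrees of each vertex shrink to 0 and 1, so leaves in different subtrees
    differ by 1 up to sign. *)
Lemma tdu_at0 (R : comNzRingType) t a b : uniq (leaves t) ->
  a \in leaves t -> b \in leaves t -> a != b -> tdu (fun=> 0 : R) t a b != 0.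
Proof.
have s0 v : scale (fun=> 0 : R) v = 0 by case: v.
elim: t => [i|l IHl r IHr] /=; first by rewrite !inE => _ /eqP -> /eqP ->; rewrite eqxx.
move=> /uniq_Node [ul ur dis]; rewrite !mem_cat !s0 !mul0r subr0 sub0r subr0.
case: ifP => al; case: ifP => bl //= ar br ab.
- exact: IHl.
- by rewrite oppr_eq0 oner_neq0.
- exact: oner_neq0.
- by rewrite oppr_eq0 IHr.
Qed.

Section Ratios.
Variable K : fieldType.
Implicit Types (q : 'I_n -> K) (eta : 'I_n -> K).

Definition diam q t : K := if t is Node l r then q (lm r) - q (lm l) else 0.

(* The inverse of tpos: the value of eta that puts the leaves at q. *)
Fixpoint ratio t q k : K :=
  if t is Node l r then
    if k \in leaves l then
      if k == key l then diam q l / diam q (Node l r) else ratio l q k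
    else if k == key r then - diam q r / diam q (Node l r) else ratio r q k
  else 0.

Definition separated q t := forall a b, a \in leaves t -> b \in leaves t -> a != b -> q a != q b.

Lemma separatedl q l r : separated q (Node l r) -> separated q l.
Proof. by move=> h a b al bl; apply: h; rewrite /= mem_cat ?al ?bl. Qed.
Lemma separatedr q l r : separated q (Node l r) -> separated q r.
Proof. by move=> h a b al bl; apply: h; rewrite /= mem_cat ?al ?bl orbT. Qed.

Lemma diam_neq0 q l r : uniq (leaves (Node l r)) -> separated q (Node l r) -> diam q (Node l r) != 0.
Proof.
move=> /uniq_Node [_ _ dis] h; rewrite subr_eq0; apply: h; rewrite /= ?mem_cat ?lm_leaves ?orbT //.
by apply/eqP => e; apply: (dis (lm r)); rewrite ?lm_leaves // e lm_leaves.
Qed.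

Lemma ratio_keyl q l r : ratio (Node l r) q (key l) = diam q l / diam q (Node l r).
Proof. by rewrite [LHS]/= key_leaves eqxx. Qed.

Lemma ratio_keyr q l r : disj_leaves l r ->
  ratio (Node l r) q (key r) = - diam q r / diam q (Node l r).
Proof.
move=> dis; have -> : ratio (Node l r) q (key r) = if key r \in leaves l then
    (if key r == key l then diam q l / diam q (Node l r) else ratio l q (key r))
  else if key r == key r then - diam q r / diam q (Node l r) else ratio r q (key r) by [].
by rewrite eqxx; case: ifP => // h; case: (dis _ h (key_leaves r)).
Qed.

Lemma ratio_restrict q l r : uniq (leaves (Node l r)) ->
  [/\ {in map key (inner' l), ratio (Node l r) q =1 ratio l q},
      {in map key (inner' r), ratio (Node l r) q =1 ratio r q},
      scale (ratio (Node l r) q) l * diam q (Node l r) = diam q l \/ diam q (Node l r) = 0 &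
      scale (ratio (Node l r) q) r * diam q (Node l r) = - diam q r \/ diam q (Node l r) = 0].
Proof.
move=> /uniq_Node [ul ur dis].
have out k : k \in leaves r -> (k \in leaves l) = false by move=> kr; apply/negP => /dis /(_ kr).
have nk v k : uniq (leaves v) -> k \in map key (inner' v) -> (k == key v) = false.
  move=> /uniq_keys; rewrite inner_cons; case: v => //= l1 l2 /andP [h _] kv.
  by apply/negP => /eqP e; rewrite -e kv in h.
have lv v k : k \in map key (inner' v) -> k \in leaves v.
  move=> /seq.mapP; case=> w wv ->; apply: (inner_leaves _ (key_leaves w)).
  by rewrite inner_cons mem_cat wv orbT.
split.
- by move=> k kl; rewrite /= (lv l) // (nk l).
- by move=> k kr; rewrite /= (out k (lv r k kr)) (nk r).
- have [->|d0] := eqVneq (diam q (Node l r)) 0; [by right|left].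
  case: l {ul out nk dis} d0 => [i|l1 l2] d0; first by rewrite mul0r.
  have e : (lm l2 \in leaves (Node l1 l2)) by rewrite /= mem_cat lm_leaves orbT.
  by rewrite [scale _ _]/= -/(leaves (Node l1 l2)) e eqxx divfK.
- have [->|d0] := eqVneq (diam q (Node l r)) 0; [by right|left].
  case: r {ur nk dis} d0 out => [i|l1 l2] d0 out; first by rewrite mul0r oppr0.
  have e : (lm l2 \in leaves (Node l1 l2)) by rewrite /= mem_cat lm_leaves orbT.
  by rewrite [scale _ _]/= out // eqxx divfK.
Qed.

Lemma ratio_tpos q t k : uniq (leaves t) -> separated q t -> k \in leaves t ->
  q k - q (lm t) = diam q t * tpos (ratio t q) t k.
Proof.
elim: t k => [i|l IHl r IHr] k; first by rewrite /= inE mulr0 => _ _ /eqP ->; rewrite subrr.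
move=> /[dup] ut /[dup] /uniq_Node [ul ur dis] /(ratio_restrict q) [el er sl sr] sep.
have d0 := diam_neq0 ut sep; have {}sl : scale (ratio (Node l r) q) l * diam q (Node l r) = diam q l.
  by case: sl => // e; rewrite e eqxx in d0.
have {}sr : scale (ratio (Node l r) q) r * diam q (Node l r) = - diam q r.
  by case: sr => // e; rewrite e eqxx in d0.
move=> kt; rewrite -/(leaves (Node l r)) in kt.
have -> : tpos (ratio (Node l r) q) (Node l r) k = if k \in leaves l then
    scale (ratio (Node l r) q) l * tpos (ratio (Node l r) q) l k else
    1 - scale (ratio (Node l r) q) r * tpos (ratio (Node l r) q) r k by [].
case: (boolP (k \in leaves l)) => kl.
  rewrite (tpos_ext el) mulrA [diam _ _ * _]mulrC sl -IHl //; exact: separatedl sep.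
have kr : k \in leaves r by move: kt; rewrite mem_cat (negPf kl).
rewrite (tpos_ext er) mulrBr mulr1 mulrA [diam _ _ * _]mulrC sr mulNr opprK -IHr //; last exact: separatedr sep.
by rewrite /=; ring.
Qed.

Lemma tpos_lm eta t : tpos eta t (lm t) = 0.
Proof. by elim: t => [i|l IHl r _] //=; rewrite lm_leaves IHl mulr0. Qed.

Lemma tpos_key eta l r : uniq (leaves (Node l r)) -> tpos eta (Node l r) (lm r) = 1.
Proof.
move=> /uniq_Node [_ _ dis] /=; rewrite tpos_lm mulr0 subr0; case: ifP => // h.
by case: (dis _ h (lm_leaves r)).
Qed.

(** The affine map given by [x] and [y] carries the induction: on a subtree the positions are those
    of the subtree, rescaled and shifted. *)
Lemma ratio_of_tpos eta t q x y : uniq (leaves t) -> x != 0 ->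
  {in map key (inner' t), forall k, eta k != 0} ->
  {in leaves t, forall k, q k = x * tpos eta t k + y} ->
  {in map key (inner' t), ratio t q =1 eta}.
Proof.
elim: t x y => [i|l IHl r IHr] x y // /[dup] ut /uniq_Node [ul ur dis] x0 e0 hq.
have out k : k \in leaves r -> (k \in leaves l) = false by move=> kr; apply/negP => /dis /(_ kr).
have kl k : k \in leaves l -> k \in leaves (Node l r) by move=> h; rewrite /= mem_cat h.
have kr k : k \in leaves r -> k \in leaves (Node l r) by move=> h; rewrite /= mem_cat h orbT.
have dE : diam q (Node l r) = x.
  rewrite /diam (hq _ (kr _ (lm_leaves r))) (hq _ (kl _ (lm_leaves l))).
  by rewrite -[lm l]/(lm (Node l r)) tpos_lm tpos_key //; ring.
have ql k : k \in leaves l -> q k = (x * scale eta l) * tpos eta l k + y.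
  by move=> h; rewrite hq ?kl //= h mulrA.
have qr k : k \in leaves r -> q k = (- x * scale eta r) * tpos eta r k + (x + y).
  by move=> h; rewrite hq ?kr //= out //; ring.
have sub v k : k \in map key (inner v) -> v = l \/ v = r -> k \in map key (inner' (Node l r)).
  by move=> h [e|e]; rewrite inner'_Node map_cat mem_cat -e h ?orbT.
have dl l1 l2 : l = Node l1 l2 -> diam q l = x * eta (lm l2).
  move=> e; have el2 : lm l2 \in leaves l by rewrite e /= mem_cat lm_leaves orbT.
  have h1 : tpos eta l (lm l2) = 1 by rewrite e tpos_key // -e.
  have -> : diam q l = q (lm l2) - q (lm l) by rewrite e.
  have sE : scale eta l = eta (lm l2) by rewrite e.
  by rewrite !ql ?lm_leaves // h1 tpos_lm sE; ring.
have dr l1 l2 : r = Node l1 l2 -> diam q r = - x * eta (lm l2).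
  move=> e; have er2 : lm l2 \in leaves r by rewrite e /= mem_cat lm_leaves orbT.
  have h1 : tpos eta r (lm l2) = 1 by rewrite e tpos_key // -e.
  have -> : diam q r = q (lm l2) - q (lm r) by rewrite e.
  have sE : scale eta r = eta (lm l2) by rewrite e.
  by rewrite !qr ?lm_leaves // h1 tpos_lm sE; ring.
have [el er _ _] := ratio_restrict q ut.
have sl l1 l2 : l = Node l1 l2 -> eta (lm l2) != 0.
  by move=> e; apply: e0; apply: (sub l); rewrite ?e /= ?mem_head //; left.
have sr l1 l2 : r = Node l1 l2 -> eta (lm l2) != 0.
  by move=> e; apply: e0; apply: (sub r); rewrite ?e /= ?mem_head //; right.
move=> k; rewrite inner'_Node map_cat mem_cat !inner_cons !map_cat !mem_cat.
case/orP => /orP [h|h].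
- have kE : k = key l by move: h; case: (l) => [i|l1 l2] //=; rewrite inE => /eqP.
  rewrite kE ratio_keyl dE; case le: l h => [//|l1 l2] _.
  by rewrite -le (dl l1 l2 le) le /= mulrC mulKf.
- rewrite el //; case le: l h => [//|l1 l2] h; rewrite -le in h *.
  have x1 : x * scale eta l != 0 by rewrite mulf_neq0 // le /= (sl l1 l2).
  have e1 : {in map key (inner' l), forall k, eta k != 0} by move=> j jl; apply: e0; apply: keys_sub.
  exact: (IHl _ _ ul x1 e1 ql k h).
- have kE : k = key r by move: h; case: (r) => [i|l1 l2] //=; rewrite inE => /eqP.
  rewrite kE ratio_keyr // dE; case re: r h => [//|l1 l2] _.
  by rewrite -re (dr l1 l2 re) re /= -mulNr opprK [x * _]mulrC mulfK.
- rewrite er //; case re: r h => [//|l1 l2] h; rewrite -re in h *.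
  have x1 : - x * scale eta r != 0 by rewrite mulf_neq0 ?oppr_eq0 // re /= (sr l1 l2).
  have e1 : {in map key (inner' r), forall k, eta k != 0} by move=> j jl; apply: e0; apply: keys_subr.
  exact: (IHr _ _ ur x1 e1 qr k h).
Qed.
End Ratios.
End Trees.

(** * Charts of the moduli space of stable curves *)


Section LimitTree.
Variables (K : closedFieldType) (n : nat) (I : Type) (Phi : (I -> K) -> K -> Prop).
Hypothesis hPhi : place Phi.
Let hom := hPhi.1.
Variables (A : {set 'I_n}) (q : 'I_n -> I -> K).
Hypothesis distinct : forall i j, i \in A -> j \in A -> i != j -> forall x, q i x != q j x.
Implicit Types (t l r : btree n).

(** Distances in a vertex are bounded by its diameter, and comparable to it between the two
    subtrees. A right subtree may be as large as its parent; its coordinate then has a nonzero limit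
    and gives no node. *)
Fixpoint valid t : Prop :=
  if t is Node l r then
    [/\ forall a b, a \in leaves t -> b \in leaves t ->
          exists c, Phi (fun x => (q a x - q b x) / diam (q^~ x) t) c,
        forall a b, a \in leaves l -> b \in leaves r ->
          exists2 c, c != 0 & Phi (fun x => (q a x - q b x) / diam (q^~ x) t) c,
        valid l & valid r]
  else True.

(** After rescaling by two extremal points a and b, the points with the limit of a go to the left
    and all others to the right, even if these have several limits: this makes the tree binary. *)
Lemma valid_tree (S : {set 'I_n}) : S \subset A -> (0 < #|S|)%N ->
  exists t, [/\ uniq (leaves t), forall k, (k \in leaves t) = (k \in S) & valid t].
Proof.
have [N] := ubnP #|S|; elim: N S => // N IH S; rewrite ltnS => SN SA S0.
case: (ltngtP #|S| 1) => [|S1|/eqP/cards1P [a Sa]]; first by rewrite ltnNge S0.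
  have /card_gt0P [a aS] := S0; have [b bS [ab far]] := farthest hPhi distinct aS SA S1.
  have sSA := fintype.subsetP SA.
  have /boolp.choice [c hc] i : exists c, i \in S -> Phi (fun x => (q i x - q a x) / (q b x - q a x)) c.
    by case: (boolP (i \in S)) => [/far [c h]|_]; [exists c|exists 0].
  have d0 x : q b x - q a x != 0 by rewrite subr_eq0; apply: distinct; rewrite ?sSA // eq_sym.
  have ca : c a = 0.
    apply: (ph_inj hom) (hc a aS) _; apply: ph_ext (phC hom 0) _ _ => // x.
    by rewrite subrr mul0r.
  have cb : c b = 1.
    apply: (ph_inj hom) (hc b bS) _; apply: ph_ext (phC hom 1) _ _ => // x.
    by rewrite divff.
  pose L := [set k in S | c k == 0]; pose R := [set k in S | c k != 0].
  have LS : L \subset S by apply/fintype.subsetP => k; rewrite inE => /andP [].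
  have RS : R \subset S by apply/fintype.subsetP => k; rewrite inE => /andP [].
  have aL : a \in L by rewrite inE aS ca eqxx.
  have bR : b \in R by rewrite inE bS cb oner_neq0.
  have cardL : (#|L| < N)%N.
    apply: leq_trans SN; apply: proper_card; rewrite properE LS; apply/subsetPn; exists b => //.
    by rewrite inE bS cb oner_eq0.
  have cardR : (#|R| < N)%N.
    apply: leq_trans SN; apply: proper_card; rewrite properE RS; apply/subsetPn; exists a => //.
    by rewrite inE aS ca eqxx.
  have [l [ul lL vl]] : exists t, [/\ uniq (leaves t), forall k, (k \in leaves t) = (k \in L) & valid t].
    by apply: IH => //; [exact: fintype.subset_trans LS SA|apply/card_gt0P; exists a].
  have [r [ur rR vr]] : exists t, [/\ uniq (leaves t), forall k, (k \in leaves t) = (k \in R) & valid t].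
    by apply: IH => //; [exact: fintype.subset_trans RS SA|apply/card_gt0P; exists b].
  have lSl k : k \in leaves l -> k \in S /\ c k = 0 by rewrite lL inE => /andP [-> /eqP].
  have rSr k : k \in leaves r -> k \in S /\ c k != 0 by rewrite rR inE => /andP [-> ->].
  have [lmS clm] := lSl _ (lm_leaves l); have [rmS crm] := rSr _ (lm_leaves r).
  have dif i j : i \in S -> j \in S -> Phi (fun x => (q i x - q j x) / (q b x - q a x)) (c i - c j).
    move=> iS jS; apply: ph_ext (phB hom (hc i iS) (hc j jS)) _ _ => // x.
    by rewrite -mulrBl; congr (_ / _); ring.
  have hd := dif _ _ rmS lmS; rewrite clm subr0 in hd.
  have quo i j : i \in S -> j \in S ->
      Phi (fun x => (q i x - q j x) / diam (q^~ x) (Node l r)) ((c i - c j) / c (lm r)).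
    move=> iS jS; apply: ph_ext (phM hom (dif i j iS jS) (placeV hPhi hd crm)) _ _ => // x.
    by rewrite invf_div mulrA divfK.
  exists (Node l r); split.
  - rewrite /= cat_uniq ul ur andbT; apply/hasPn => k /rSr [_ ck].
    by apply/negP => /lSl [_ e]; rewrite e eqxx in ck.
  - move=> k; rewrite /= mem_cat lL rR !inE; case: (k \in S) => //=.
    by case: (c k == 0).
  - have memS k : k \in leaves (Node l r) -> k \in S.
      by rewrite /= mem_cat => /orP [/lSl []|/rSr []].
    split=> // [i j /memS iS /memS jS|i j /lSl [iS ci] /rSr [jS cj]].
      by eexists; apply: quo.
    exists ((c i - c j) / c (lm r)); last exact: quo.
    by rewrite ci sub0r mulf_neq0 ?invr_eq0 ?oppr_eq0.
exists (Leaf a); split=> // k; by rewrite Sa !inE.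
Qed.

Lemma valid_separated t x : {subset leaves t <= A} -> separated (q^~ x) t.
Proof. by move=> tA a b at_ bt ab; apply: distinct; rewrite ?tA. Qed.

Lemma ratio_limit t k : uniq (leaves t) -> valid t -> k \in map (@key n) (inner' t) ->
  exists c, Phi (fun x => ratio t (q^~ x) k) c.
Proof.
elim: t => [//|l IHl r IHr] /[dup] ut /uniq_Node [ul ur dis] [fin _ vl vr].
have kl v : v \in leaves l -> v \in leaves (Node l r) by move=> h; rewrite /= mem_cat h.
have kr v : v \in leaves r -> v \in leaves (Node l r) by move=> h; rewrite /= mem_cat h orbT.
rewrite inner'_Node map_cat mem_cat !inner_cons !map_cat !mem_cat.
case/orP => /orP [h|h].
- have kE : k = key l by move: h; case: (l) => [i|l1 l2] //=; rewrite inE => /eqP.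
  case le: l h => [//|l1 l2] _; rewrite -le kE.
  have [c hc] := fin (key l) (lm l) (kl _ (key_leaves l)) (kl _ (lm_leaves l)).
  by exists c; apply: ph_ext hc _ _ => // x; rewrite ratio_keyl le.
- have [c hc] := IHl ul vl h; exists c; apply: ph_ext hc _ _ => // x.
  by have [-> //] := ratio_restrict (q^~ x) ut.
- have kE : k = key r by move: h; case: (r) => [i|l1 l2] //=; rewrite inE => /eqP.
  case re: r h => [//|l1 l2] _; rewrite -re kE.
  have [c hc] := fin (lm r) (key r) (kr _ (lm_leaves r)) (kr _ (key_leaves r)).
  exists c; apply: ph_ext hc _ _ => // x; rewrite ratio_keyr // re /=.
  by rewrite opprB.
- have [c hc] := IHr ur vr h; exists c; apply: ph_ext hc _ _ => // x.
  by have [_ -> //] := ratio_restrict (q^~ x) ut.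
Qed.

Lemma tdu_limit t a b : uniq (leaves t) -> {subset leaves t <= A} -> valid t ->
  a \in leaves t -> b \in leaves t -> a != b ->
  exists2 c, c != 0 & Phi (fun x => tdu (ratio t (q^~ x)) t a b) c.
Proof.
elim: t a b => [i|l IHl r IHr] a b.
  by move=> _ _ _; rewrite /= !inE => /eqP -> /eqP ->; rewrite eqxx.
move=> /[dup] ut /uniq_Node [ul ur dis] tA [fin unit vl vr] at_ bt ab.
have lA : {subset leaves l <= A} by move=> k h; apply: tA; rewrite /= mem_cat h.
have rA : {subset leaves r <= A} by move=> k h; apply: tA; rewrite /= mem_cat h orbT.
have outr k : k \in leaves (Node l r) -> k \notin leaves l -> k \in leaves r.
  by rewrite /= mem_cat => /orP [->|].
have cross i j : i \in leaves l -> j \in leaves r -> forall x,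
    scale (ratio (Node l r) (q^~ x)) l * tpos (ratio (Node l r) (q^~ x)) l i -
    (1 - scale (ratio (Node l r) (q^~ x)) r * tpos (ratio (Node l r) (q^~ x)) r j) =
    (q i x - q j x) / diam (q^~ x) (Node l r).
  move=> il jr x; have sep := valid_separated x tA; have d0 := diam_neq0 ut sep.
  have i1 : i \in leaves (Node l r) by rewrite /= mem_cat il.
  have j1 : j \in leaves (Node l r) by rewrite /= mem_cat jr orbT.
  have jl : (j \in leaves l) = false by apply/negP => /dis /(_ jr).
  have h1 := ratio_tpos ut sep i1; have h2 := ratio_tpos ut sep j1.
  apply: (mulfI d0); rewrite [RHS]mulrC divfK // -[LHS]/(_ * (_ - _)).
  have -> : q i x - q j x = (q i x - q (lm (Node l r)) x) - (q j x - q (lm (Node l r)) x) by ring.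
  by rewrite h1 h2 -mulrBr; congr (_ * _); rewrite [tpos _ (Node l r) i]/= il [tpos _ (Node l r) j]/= jl.
have tduE x i j : tdu (ratio (Node l r) (q^~ x)) (Node l r) i j =
    let eta := ratio (Node l r) (q^~ x) in
    if i \in leaves l then
      if j \in leaves l then tdu eta l i j
      else scale eta l * tpos eta l i - (1 - scale eta r * tpos eta r j)
    else if j \in leaves l then (1 - scale eta r * tpos eta r i) - scale eta l * tpos eta l j
    else - tdu eta r i j by [].
case: (boolP (a \in leaves l)) => al; case: (boolP (b \in leaves l)) => bl.
- have [c c0 hc] := IHl a b ul lA vl al bl ab; exists c => //.
  apply: ph_ext hc _ _ => // x; rewrite tduE /= al bl.
  by have [el _ _ _] := ratio_restrict (q^~ x) ut; rewrite -(tdu_ext el).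
- have [c c0 hc] := unit a b al (outr b bt bl); exists c => //.
  apply: ph_ext hc _ _ => // x; rewrite tduE /= al (negPf bl) -cross //; exact: outr.
- have [c c0 hc] := unit b a bl (outr a at_ al); exists (- c); first by rewrite oppr_eq0.
  apply: ph_ext (phN hom hc) _ _ => // x; rewrite tduE /= (negPf al) bl -cross ?opprB //; exact: outr.
- have [c c0 hc] := IHr a b ur rA vr (outr a at_ al) (outr b bt bl) ab; exists (- c); first by rewrite oppr_eq0.
  apply: ph_ext (phN hom hc) _ _ => // x; rewrite tduE /= (negPf al) (negPf bl).
  by have [_ er _ _] := ratio_restrict (q^~ x) ut; rewrite -(tdu_ext er).
Qed.
End LimitTree.

Section Quadruples.
Variables (K : closedFieldType) (n : nat) (o : 'I_n).
Implicit Types (t l r : btree n).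

(* The cross-ratio of [quad t k] is the coordinate indexed by k on the chart of t. *)
Fixpoint quad t k : 4.-tuple 'I_n :=
  if t is Node l r then
    if k \in leaves l then
      if k == key l then [tuple key l; lm r; lm l; o] else quad l k
    else if k == key r then [tuple key r; lm l; lm r; o] else quad r k
  else [tuple o; o; o; o].

Lemma mline_quad t (q : 'I_n -> K) k : o \notin leaves t ->
  mline o q (quad t k) = Some (ratio t q k).
Proof.
have three a b c : a != o -> b != o -> c != o ->
    mline o q [tuple a; b; c; o] = Some ((q a - q c) / (q b - q c)).
  move=> ao bo co; rewrite ffunE /cr_num /cr_den.
  have /= [-> -> -> ->] := crs_tuple a b c o.
  rewrite /dif eqxx (negPf ao) (negPf bo) (negPf co).
  by rewrite mulrN1 mulN1r invrN mulrNN.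
elim: t => [i|l IHl r IHr] /=.
  by move=> _; rewrite ffunE /cr_num /cr_den; have /= [-> -> -> ->] := crs_tuple o o o o; rewrite /dif eqxx !mul0r.
rewrite mem_cat negb_or => /andP [ol or_].
have nl k' : k' \in leaves l -> k' != o by move=> h; apply: contraNneq ol => <-.
have nr k' : k' \in leaves r -> k' != o by move=> h; apply: contraNneq or_ => <-.
case: ifP => _; case: ifP => _; rewrite ?IHl ?IHr //.
  rewrite (three _ _ _ (nl _ (key_leaves l)) (nr _ (lm_leaves r)) (nl _ (lm_leaves l))).
  by case: l {IHl ol nl} => [i|l1 l2] //=; rewrite subrr.
rewrite (three _ _ _ (nr _ (key_leaves r)) (nl _ (lm_leaves l)) (nr _ (lm_leaves r))).
congr Some; rewrite -[q (lm l) - _]opprB invrN mulrN mulNr; congr (- (_ / _)).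
by case: r {IHr or_ nr} => [i|l1 l2] //=; rewrite subrr.
Qed.
End Quadruples.

Section LaminarFamilies.
Variables (T : finType) (N : nat) (F : 'I_N -> {set T}) (Z : pred 'I_N) (o : T).
Hypothesis laminar : forall i j, [\/ F i \subset F j, F j \subset F i | F i :&: F j = finset.set0].
Hypothesis oF : forall i, o \notin F i.

Lemma laminar_meet i j x : x \in F i -> x \in F j -> (F i \subset F j) || (F j \subset F i).
Proof.
move=> xi xj; case: (laminar i j) => [->//|->|e]; rewrite ?orbT //.
by have := finset.in_set0 x; rewrite -e inE xi xj.
Qed.

Lemma laminar_hit (S : {set T}) : (1 < #|S|)%N -> (exists2 c, c \notin S & c != o) -> o \notin S ->
  (forall a b c, a \in S -> b \in S -> a != b -> c \notin S -> c != o ->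
    exists2 i, Z i & [/\ a \in F i, b \in F i & c \notin F i]) ->
  exists2 i, Z i & F i = S.
Proof.
move=> S1 [c0 c0S c0o] oS hit.
have [a aS] : exists a, a \in S by apply/card_gt0P; apply: leq_trans S1.
have [b bS ab] : exists2 b, b \in S & a != b.
  have : (0 < #|S :\ a|)%N by move: S1; rewrite (cardsD1 a S) aS.
  by case/card_gt0P => b; rewrite !inE => /andP [ba bS]; exists b; rewrite // eq_sym.
have around c : c \notin S -> c != o -> exists i, [&& Z i, S \subset F i & c \notin F i].
  move=> cS co; have [i0 Zi0 [ai0 _ ci0]] := hit a b c aS bS ab cS co.
  pose P i := [&& Z i, a \in F i & c \notin F i].
  have Pi0 : P i0 by rewrite /P Zi0 ai0.
  have [i /and3P [Zi ai ci] imax] := arg_maxnP (fun i => #|F i|) Pi0.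
  exists i; rewrite Zi ci andbT /=; apply/fintype.subsetP => x xS.
  have [<-//|ax] := eqVneq a x.
  have [i' Zi' [ai' xi' ci']] := hit a x c aS xS ax cS co.
  case/orP: (laminar_meet ai ai') => [sub|/fintype.subsetP -> //].
  have : F i == F i' by rewrite finset.eqEcard sub; apply: imax; rewrite /P Zi' ai'.
  by move/eqP => ->.
have [i0 /and3P [Zi0 Si0 ci0]] := around c0 c0S c0o.
pose P i := Z i && (S \subset F i); have P0 : P i0 by rewrite /P Zi0.
have [i /andP [Zi Si] imin] := arg_minnP (fun i => #|F i|) P0.
exists i => //; apply/eqP; rewrite eq_sym finset.eqEsubset Si; apply/fintype.subsetP => x xi.
apply: contraT => xS; have xo : x != o by apply: contraTneq xi => ->; apply: oF.
have [i' /and3P [Zi' Si' xi']] := around x xS xo.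
case/orP: (laminar_meet (fintype.subsetP Si a aS) (fintype.subsetP Si' a aS)) => sub.
  by rewrite (fintype.subsetP sub x xi) in xi'.
have : F i' == F i by rewrite finset.eqEcard sub; apply: imin; rewrite /P Zi'.
by move/eqP => e; rewrite e xi in xi'.
Qed.
End LaminarFamilies.

(** * The chart of a binary tree *)

Section TreeChart.
Variable K : closedFieldType.
Hypothesis uncountable : forall f : nat -> K, exists a, forall i, f i != a.
Variables (n : nat) (o : 'I_n) (t : btree n).
Hypothesis n3 : (3 <= n)%N.
Hypothesis ut : uniq (leaves t).
Hypothesis tE : forall k, (k \in leaves t) = (k != o).
Local Notation N := (n - 3)%N.
Local Notation ckeys := (map (@key n) (inner' t)).

Lemma size_inner' : size (inner' t) = N.
Proof.
rewrite size_behead; have := size_inner t.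
have -> : size (leaves t) = #|[set k | k != o]|.
  by rewrite cardE; apply/perm_size/uniq_perm; rewrite ?enum_uniq // => k; rewrite mem_enum inE tE.
have -> : [set k | k != o] = (~: [set o])%SET by apply/setP => k; rewrite !inE.
by rewrite cardsC1 card_ord; lia.
Qed.

Definition cv (i : 'I_N) : btree n := nth t (inner' t) i.

Lemma cv_inner' i : cv i \in inner' t. Proof. by apply: mem_nth; rewrite size_inner'. Qed.
Lemma cv_inner i : cv i \in inner t.
Proof. by rewrite inner_cons mem_cat cv_inner' orbT. Qed.
Lemma o_cv i : o \notin leaves (cv i).
Proof. by apply/negP => /(inner_leaves (cv_inner i)); rewrite tE eqxx. Qed.

Lemma uniq_ckeys : uniq ckeys.
Proof. by have := uniq_keys ut; rewrite inner_cons map_cat cat_uniq => /and3P []. Qed.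

Lemma cv_inj : injective cv.
Proof.
move=> i j e; apply/val_inj/eqP; have u : uniq (inner' t) := map_uniq uniq_ckeys.
by rewrite -(nth_uniq t _ _ u) ?size_inner' ?ltn_ord //; apply/eqP.
Qed.

Section Variables_.
Variable R : comNzRingType.
Implicit Types e : 'I_N -> R.

Definition ceta e (k : 'I_n) : R :=
  if insub (index k ckeys) is Some i then e i else 0.

Lemma ceta_key e i : ceta e (key (cv i)) = e i.
Proof.
rewrite /ceta /cv -(nth_map t (key t)) ?size_inner' // index_uniq ?uniq_ckeys ?size_map ?size_inner' //.
by rewrite valK.
Qed.

Definition cpos e k : R := tpos (ceta e) t k.
Definition cdu e a b : R :=
  if a == o then (b != o)%:R else if b == o then -1 else tdu (ceta e) t a b.
Definition cdm e a b : R := \prod_(i < N | (a \in leaves (cv i)) && (b \in leaves (cv i))) e i.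

Lemma cpos_dif e a b : dif o (cpos e) a b = cdm e a b * cdu e a b.
Proof.
rewrite /dif /cdu; case: (eqVneq a o) => [->|ao].
  by rewrite /cdm big1 ?mul1r // => i /andP []; rewrite (negPf (o_cv i)).
case: (eqVneq b o) => [->|bo].
  by rewrite /cdm big1 ?mul1r // => i /andP [_]; rewrite (negPf (o_cv i)).
rewrite /cpos tpos_diff ?tE //; congr (_ * _).
rewrite /tmon /cdm (big_nth t) size_inner' big_mkord; apply: eq_bigr => i _.
by rewrite -ceta_key.
Qed.

Definition split2 (i : 'I_N) a c b d :=
  [&& a \in leaves (cv i), c \in leaves (cv i), b \notin leaves (cv i) & d \notin leaves (cv i)].
Definition pairing e a c b d : R := \prod_(i < N | split2 i a c b d || split2 i b d a c) e i.
(** The monomial shared by numerator and denominator of a cross-ratio: the exponents are symmetric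
    in c and d, by [commonC]. What remains is [pairing], the product over the clusters that separate
    the two pairs. *)
Definition common e a b c d : R := \prod_(i < N)
  e i ^+ (((a \in leaves (cv i)) && (c \in leaves (cv i))) +
          ((b \in leaves (cv i)) && (d \in leaves (cv i))) -
          (split2 i a c b d || split2 i b d a c)).

Lemma commonC e a b c d : common e a b c d = common e a b d c.
Proof.
apply: eq_bigr => i _; congr (_ ^+ _); rewrite /split2.
by case: (a \in _); case: (b \in _); case: (c \in _); case: (d \in _).
Qed.

Lemma cdm_pairing e a b c d : cdm e a c * cdm e b d = pairing e a c b d * common e a b c d.
Proof.
rewrite /cdm /pairing !(big_mkcond (fun i => _ && _)) (big_mkcond (fun i => _ || _)) -!big_split /=.
apply: eq_bigr => i _; rewrite /split2.
by case: (a \in _); case: (b \in _); case: (c \in _); case: (d \in _); rewrite /= ?mul1r ?mulr1 ?expr0 ?expr1.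
Qed.

(* Numerator and denominator of a cross-ratio after removing their common
   monomial factor. *)
Definition chA e (q : 4.-tuple 'I_n) : R :=
  if (crs q 0 == crs q 3) || (crs q 1 == crs q 2) then 0 else
  pairing e (crs q 0) (crs q 2) (crs q 1) (crs q 3) * (cdu e (crs q 0) (crs q 2) * cdu e (crs q 1) (crs q 3)).
Definition chB e (q : 4.-tuple 'I_n) : R :=
  if (crs q 0 == crs q 3) || (crs q 1 == crs q 2) then 1 else
  pairing e (crs q 0) (crs q 3) (crs q 1) (crs q 2) * (cdu e (crs q 0) (crs q 3) * cdu e (crs q 1) (crs q 2)).
(** Its nonvanishing defines the domain of the chart: there any two points are apart up to the
    monomials in [e]. *)
Definition chU e : R := \prod_(x : 'I_n * 'I_n | [&& x.1 != o, x.2 != o & x.1 != x.2]) cdu e x.1 x.2.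
End Variables_.

Section Morphisms.
Variables (R S : comNzRingType) (f : {rmorphism R -> S}).
Implicit Types e : 'I_N -> R.

Lemma ceta_morph e : f \o ceta e =1 ceta (f \o e).
Proof. by move=> k; rewrite /ceta /=; case: insub => [i|]; rewrite ?rmorph0. Qed.

Lemma cpos_morph e k : f (cpos e k) = cpos (f \o e) k.
Proof. by rewrite /cpos tpos_morph; apply: tpos_ext => j _; apply: ceta_morph. Qed.

Lemma cdu_morph e a b : f (cdu e a b) = cdu (f \o e) a b.
Proof.
rewrite /cdu; case: ifP => _; first exact: rmorph_nat.
case: ifP => _; first by rewrite rmorphN1.
by rewrite tdu_morph; apply: tdu_ext => j _; apply: ceta_morph.
Qed.

Lemma pairing_morph e a b c d : f (pairing e a b c d) = pairing (f \o e) a b c d.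
Proof. by rewrite /pairing rmorph_prod. Qed.

Lemma chA_morph e q : f (chA e q) = chA (f \o e) q.
Proof. by rewrite /chA; case: ifP => _; rewrite ?rmorph0 // !rmorphM /= pairing_morph !cdu_morph. Qed.
Lemma chB_morph e q : f (chB e q) = chB (f \o e) q.
Proof. by rewrite /chB; case: ifP => _; rewrite ?rmorph1 // !rmorphM /= pairing_morph !cdu_morph. Qed.
Lemma chU_morph e : f (chU e) = chU (f \o e).
Proof. by rewrite /chU rmorph_prod; apply: eq_bigr => x _; rewrite cdu_morph. Qed.
End Morphisms.

Implicit Types e : 'I_N -> K.

Definition phi e : cr_space K n :=
  [ffun q => if chB e q == 0 then None else Some (chA e q / chB e q)].
Definition generic e := chU e != 0 /\ forall i, e i != 0.

Lemma cdu_neq0 e a b : chU e != 0 -> a != b -> cdu e a b != 0.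
Proof.
move=> /prodf_neq0 h ab; have [ao|ao] := eqVneq a o.
  by rewrite /cdu ao eqxx -ao [b == a]eq_sym (negPf ab) oner_neq0.
have [bo|bo] := eqVneq b o; first by rewrite /cdu (negPf ao) bo eqxx oppr_eq0 oner_neq0.
by have := h (a, b); rewrite /= ao bo ab; apply.
Qed.

Lemma cluster_laminar i j : [\/ {subset leaves (cv i) <= leaves (cv j)},
  {subset leaves (cv j) <= leaves (cv i)} | disj_leaves (cv i) (cv j)].
Proof. exact: (inner_laminar ut (cv_inner i) (cv_inner j)). Qed.

(** Members of a laminar family cannot separate four points into pairs in two different ways. *)
Lemma pairing_excl e a b c d j : split2 j a d b c || split2 j b c a d -> pairing e a c b d = 1.
Proof.
move=> hj; rewrite /pairing big_pred0 // => i; apply/negbTE/negP => hi; move: hi hj; rewrite /split2.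
case: (cluster_laminar i j) => h; have := h a; have := h b; have := h c; have := h d;
move: (a \in _) (b \in _) (c \in _) (d \in _) (a \in _) (b \in _) (c \in _) (d \in _);
by do 8 case=> //=; intuition.
Qed.

(** If the denominator contains a coordinate, some cluster separates its pairs, and by
    [pairing_excl] the numerator is then free of coordinates. So [phi] is well defined where
    coordinates vanish. *)
Lemma ch_proper e q : chU e != 0 -> chA e q != 0 \/ chB e q != 0.
Proof.
move=> Ue; rewrite /chA /chB; case: ifPn => [_|]; first by right; apply: oner_neq0.
rewrite negb_or => /andP [ad bc].
move: (crs q 0) (crs q 1) (crs q 2) (crs q 3) ad bc => a b c d ad bc.
case: (pickP (fun i => split2 i a d b c || split2 i b c a d)) => [j hj|h]; last first.
  by right; rewrite /pairing big_pred0 // mul1r mulf_neq0 ?cdu_neq0.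
left; have ac : a != c by apply/eqP => e'; move: hj; rewrite /split2 e'; case: (c \in _); rewrite /= ?andbF.
have bd : b != d by apply/eqP => e'; move: hj; rewrite /split2 e'; case: (d \in _); rewrite /= ?andbF.
by rewrite (pairing_excl _ hj) mul1r mulf_neq0 ?cdu_neq0.
Qed.

Lemma generic_nondeg e : generic e -> nondeg o (cpos e).
Proof.
move=> [Ue e0] a b ab; rewrite cpos_dif mulf_neq0 ?cdu_neq0 //.
by apply/prodf_neq0 => i _.
Qed.

Lemma phi_generic e : generic e -> phi e = mline o (cpos e).
Proof.
move=> /[dup] ge [Ue e0]; have nd := generic_nondeg ge.
apply/ffunP => q; rewrite !ffunE /cr_num /cr_den /chA /chB.
move: (crs q 0) (crs q 1) (crs q 2) (crs q 3) => a b c d.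
have dif0 i : dif o (cpos e) i i = 0.
  by rewrite /dif; case: eqVneq => // _; rewrite subrr.
case: (boolP ((a == d) || (b == c))) => /= [deg|].
  by rewrite oner_eq0 mul0r; case/orP: deg => /eqP ->; rewrite dif0 ?mul0r ?mulr0 invr0 mulr0.
rewrite negb_or => /andP [ad bc].
have cm0 : common e a b c d != 0 by apply/prodf_neq0 => i _; rewrite expf_neq0.
have dE : dif o (cpos e) a d * dif o (cpos e) b c =
    common e a b c d * (pairing e a d b c * (cdu e a d * cdu e b c)).
  by rewrite !cpos_dif commonC mulrACA cdm_pairing -mulrA mulrCA.
have nE : dif o (cpos e) a c * dif o (cpos e) b d =
    common e a b c d * (pairing e a c b d * (cdu e a c * cdu e b d)).
  by rewrite !cpos_dif mulrACA cdm_pairing -mulrA mulrCA.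
have B0 : pairing e a d b c * (cdu e a d * cdu e b c) != 0.
  have : dif o (cpos e) a d * dif o (cpos e) b c != 0 by rewrite mulf_neq0 ?nd.
  by rewrite dE mulf_eq0 negb_or => /andP [].
rewrite (negPf B0) dE nE; congr Some.
by rewrite -[RHS]mulf_div divff ?mul1r.
Qed.

Lemma chU_at0 : chU (fun=> 0 : K) != 0.
Proof.
apply/prodf_neq0 => -[a b] /= /and3P [ao bo ab].
rewrite /cdu (negPf ao) (negPf bo) (tdu_ext (eta' := fun=> 0)).
  by apply: tdu_at0; rewrite ?tE.
by move=> k _; rewrite /ceta; case: insub.
Qed.

(* Opaque, so that unification never unfolds these polynomials. *)
Fact chUp_def : {P : {mpoly K[N]} | P = chU (fun i => 'X_i)}. Proof. by eexists. Qed.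
Fact chAp_def q : {P : {mpoly K[N]} | P = chA (fun i => 'X_i) q}. Proof. by eexists. Qed.
Fact chBp_def q : {P : {mpoly K[N]} | P = chB (fun i => 'X_i) q}. Proof. by eexists. Qed.
Definition chUp : {mpoly K[N]} := sval chUp_def.
Definition chAp q : {mpoly K[N]} := sval (chAp_def q).
Definition chBp q : {mpoly K[N]} := sval (chBp_def q).

Lemma evalX e : meval e \o (fun i : 'I_N => 'X_i) = e.
Proof. by apply/funext => i /=; rewrite mevalXU. Qed.
Lemma chUpE e : chUp.@[e] = chU e. Proof. by rewrite /chUp (svalP (chUp_def)) chU_morph evalX. Qed.
Lemma chApE e q : (chAp q).@[e] = chA e q. Proof. by rewrite /chAp (svalP (chAp_def q)) chA_morph evalX. Qed.
Lemma chBpE e q : (chBp q).@[e] = chB e q. Proof. by rewrite /chBp (svalP (chBp_def q)) chB_morph evalX. Qed.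

(** The generic locus is the complement of a hypersurface, and polynomials over an infinite field
    are determined by their values. *)
Lemma generic_eq (P Q : {mpoly K[N]}) : (forall e, generic e -> P.@[e] = Q.@[e]) ->
  forall e, P.@[e] = Q.@[e].
Proof.
move=> h; pose H := chUp * \prod_(i < N) 'X_i.
have HE e : H.@[e] != 0 -> generic e.
  rewrite /H mevalM chUpE rmorph_prod mulf_eq0 negb_or => /andP [Ue /prodf_neq0 e0].
  by split=> // i; have := e0 i isT; rewrite /= mevalXU.
have H0 : H != 0.
  rewrite mulf_neq0 //.
    by apply/negP => /eqP e; have := chU_at0; rewrite -chUpE e meval0 eqxx.
  apply/prodf_neq0 => i _; apply/negP => /eqP e.
  by have := mevalXU (fun=> 1 : K) i; rewrite e meval0 => /esym/eqP; rewrite oner_eq0.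
have : (P - Q) * H = 0.
  apply: (mpoly_eq_values uncountable) => e; rewrite mevalM mevalB meval0.
  by have [->|/HE ge] := eqVneq H.@[e] 0; rewrite ?mulr0 // h // subrr mul0r.
by move/eqP; rewrite mulf_eq0 (negPf H0) orbF subr_eq0 => /eqP ->.
Qed.

Definition chq (i : 'I_N) := quad o t (key (cv i)).

Lemma key_cv i : key (cv i) \in ckeys.
Proof. by apply: map_f; apply: cv_inner'. Qed.

Lemma phi_coord_generic e i : generic e -> phi e (chq i) = Some (e i).
Proof.
move=> /[dup] ge [_ e0]; rewrite phi_generic // mline_quad ?tE ?eqxx //; congr Some.
rewrite -[RHS]ceta_key; apply: (@ratio_of_tpos _ _ _ _ _ 1 0) => //.
- exact: oner_neq0.
- move=> k /seq.mapP; case=> v vt ->; have iv : (index v (inner' t) < N)%N by rewrite -size_inner' index_mem.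
  have -> : v = cv (Ordinal iv) by rewrite /cv /= nth_index.
  by rewrite ceta_key.
- by move=> k _; rewrite mul1r addr0.
- exact: key_cv.
Qed.

(** At generic points this is the inversion formula for [ratio]; with denominators cleared it is a
    polynomial identity and extends to the boundary. *)
Lemma phi_coord e i : chU e != 0 -> phi e (chq i) = Some (e i).
Proof.
move=> Ue; have E : forall e, chA e (chq i) = e i * chB e (chq i).
  move=> e'; rewrite -chApE -chBpE -[e' i]mevalXU -mevalM; apply: generic_eq => {}e' ge.
  have := phi_coord_generic i ge; rewrite ffunE chApE mevalM chBpE mevalXU.
  by case: eqP => // /eqP B0 [<-]; rewrite divfK.
have B0 : chB e (chq i) != 0.
  have [|//] := ch_proper (chq i) Ue; rewrite E; apply: contraNneq => ->; by rewrite mulr0.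
by rewrite ffunE (negPf B0) E mulfK.
Qed.

Lemma phi_onto q : nondeg o q -> exists e x y,
  [/\ generic e, x != 0 & forall k, k != o -> q k = x * cpos e k + y].
Proof.
move=> nd; have sep : separated q t.
  by move=> a b; rewrite !tE => ao bo /nd; rewrite /dif (negPf ao) (negPf bo) subr_eq0.
pose e i := ratio t q (key (cv i)); exists e, (diam q t), (q (lm t)).
have ext : {in ckeys, ratio t q =1 ceta e}.
  move=> k /seq.mapP; case=> v vt ->; have iv : (index v (inner' t) < N)%N by rewrite -size_inner' index_mem.
  have -> : v = cv (Ordinal iv) by rewrite /cv /= nth_index.
  by rewrite ceta_key.
have qE k : k != o -> q k = diam q t * cpos e k + q (lm t).
  by move=> ko; rewrite /cpos -(tpos_ext ext) -ratio_tpos ?tE // subrK.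
have d0 : diam q t != 0.
  have [[l [r te]]|] : (exists l r, t = Node l r) \/ exists i, t = Leaf i.
      by case: (t) => [i|l r]; [right; exists i|left; exists l, r].
    by have := @diam_neq0 _ _ q l r; rewrite -te; apply.
  case=> i te; exfalso; have := size_inner'; have := size_inner t; rewrite te /= => _ /= N0.
  have : (#|~: [set o]|%SET <= 1)%N.
    rewrite -(card1 i); apply: subset_leq_card; apply/fintype.subsetP => k; rewrite !inE -tE te /= inE => /eqP ->; exact: eqxx.
  by rewrite cardsC1 card_ord; lia.
split=> //; have pd a b : a != o -> b != o -> a != b -> cpos e a - cpos e b != 0.
  move=> ao bo ab; have := sep a b; rewrite !tE => /(_ ao bo ab).
  by apply: contraNneq => e'; rewrite (qE a ao) (qE b bo) (subr0_eq e').
have dd a b : a != o -> b != o -> a != b -> cdm e a b != 0 /\ cdu e a b != 0.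
  move=> ao bo ab; have := pd a b ao bo ab; have := cpos_dif e a b.
  rewrite /dif (negPf ao) (negPf bo) => ->; rewrite mulf_eq0 negb_or => /andP //.
split; first by apply/prodf_neq0 => -[a b] /= /and3P [ao bo ab]; have [] := dd a b ao bo ab.
move=> i; have [l [r vE]] := inner_size (cv_inner i).
have ll : lm l \in leaves (cv i) by rewrite vE /= mem_cat lm_leaves.
have lr : lm r \in leaves (cv i) by rewrite vE /= mem_cat lm_leaves orbT.
have inn := inner_leaves (cv_inner i).
have uv : uniq (leaves (cv i)).
  exact: inner_uniq ut (cv_inner i).
have [] := dd (lm l) (lm r).
- by rewrite -tE inn.
- by rewrite -tE inn.
- by apply/eqP => e'; move: uv; rewrite vE => /uniq_Node [_ _ dis]; apply: (dis (lm l)); rewrite ?lm_leaves // e' lm_leaves.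
by move=> /prodf_neq0 h _; apply: h; rewrite ll lr.
Qed.
End TreeChart.

Section Plucker.
Variables (K : closedFieldType) (n : nat) (o : 'I_n).
Implicit Types q : 'I_n -> K.

Lemma dif_plucker q a b c d :
  dif o q a c * dif o q b d - dif o q a d * dif o q b c = dif o q a b * dif o q c d.
Proof.
rewrite /dif; case: (eqVneq a o) => _; case: (eqVneq b o) => _; case: (eqVneq c o) => _;
by case: (eqVneq d o) => _ /=; ring.
Qed.

Lemma difC q a b : dif o q a b = - dif o q b a.
Proof. by rewrite /dif; case: (eqVneq a o) => _; case: (eqVneq b o) => _ /=; ring. Qed.

Lemma mline_affine (q q' : 'I_n -> K) x y : x != 0 ->
  (forall k, k != o -> q k = x * q' k + y) -> mline o q = mline o q'.
Proof.
move=> x0 h; pose w i := if i == o then x^-1 else 1.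
have w0 i : w i != 0 by rewrite /w; case: ifP => _; rewrite ?invr_eq0 ?oner_neq0.
have dE i j : dif o q i j = x * w i * w j * dif o q' i j.
  rewrite /w /dif; case: (eqVneq i o) => [_|io]; case: (eqVneq j o) => [_|jo] /=.
  - by rewrite mulr0.
  - by rewrite divff // !mulr1.
  - by rewrite mulr1 divff // mul1r.
  - by rewrite !h //; ring.
apply/ffunP => t; rewrite !ffunE /cr_num /cr_den !dE; congr Some.
move: (w0 (crs t 0)) (w0 (crs t 1)) (w0 (crs t 2)) (w0 (crs t 3)).
move: (w _) (w _) (w _) (w _) (dif _ _ _ _) (dif _ _ _ _) (dif _ _ _ _) (dif _ _ _ _) => a b c d z u s v a0 b0 c0 d0.
have -> : x * d * b * v * (x * c * a * s) = x ^+ 2 * a * b * c * d * (v * s) by ring.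
have -> : x * d * a * u * (x * c * b * z) = x ^+ 2 * a * b * c * d * (u * z) by ring.
by rewrite -mulf_div divff ?mul1r // !mulf_neq0 // expf_neq0.
Qed.
End Plucker.

Section ChartNodes.
Variable K : closedFieldType.
Hypothesis uncountable : forall f : nat -> K, exists a, forall i, f i != a.
Variables (n : nat) (o : 'I_n) (t : btree n).
Hypothesis n3 : (3 <= n)%N.
Hypothesis ut : uniq (leaves t).
Hypothesis tE : forall k, (k \in leaves t) = (k != o).
Local Notation N := (n - 3)%N.
Implicit Types e : 'I_N -> K.
Local Notation phi := (phi o t).
Local Notation chU := (chU o t).
Local Notation chA := (chA o t).
Local Notation chB := (chB o t).
Local Notation split2 := (split2 t).

Lemma generic_ratio e q : generic o t e -> chB e q != 0 /\
  chA e q = cr_num o (cpos t e) q / cr_den o (cpos t e) q * chB e q.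
Proof.
move=> ge; have := phi_generic n3 ut tE ge => /ffunP /(_ q); rewrite !ffunE.
by case: eqP => // /eqP B0 [<-]; rewrite divfK.
Qed.

Lemma generic_eq_mul (f1 f2 f3 f4 : ('I_N -> K) -> K) :
  (exists P : {mpoly K[N]}, forall e, P.@[e] = f1 e) ->
  (exists P : {mpoly K[N]}, forall e, P.@[e] = f2 e) ->
  (exists P : {mpoly K[N]}, forall e, P.@[e] = f3 e) ->
  (exists P : {mpoly K[N]}, forall e, P.@[e] = f4 e) ->
  (forall e, generic o t e -> f1 e * f2 e = (f2 e - f3 e) * f4 e) ->
  forall e, f1 e * f2 e = (f2 e - f3 e) * f4 e.
Proof.
move=> [P1 h1] [P2 h2] [P3 h3] [P4 h4] h e; rewrite -h1 -h2 -h3 -h4 -mevalB -!mevalM.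
by apply: (generic_eq uncountable ut tE) => {}e ge; rewrite !mevalM mevalB h1 h2 h3 h4 h.
Qed.

(** Exchanging the two middle points turns a cross-ratio into 1 minus itself. This is the Pluecker
    relation at generic points, extended to the boundary with denominators cleared. *)
Lemma swap_identity a b c d : a != d -> b != c -> forall e,
  chA e [tuple a; b; c; d] * chB e [tuple a; c; b; d] =
  (chB e [tuple a; c; b; d] - chA e [tuple a; c; b; d]) * chB e [tuple a; b; c; d].
Proof.
have rA q : exists P : {mpoly K[N]}, forall e, P.@[e] = chA e q by exists (chAp K o t q) => e; rewrite chApE.
have rB q : exists P : {mpoly K[N]}, forall e, P.@[e] = chB e q by exists (chBp K o t q) => e; rewrite chBpE.
move=> ad bc; apply: (generic_eq_mul (rA _) (rB _) (rA _) (rB _)) => e ge.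
have [B1 ->] := generic_ratio [tuple a; b; c; d] ge.
have [B2 ->] := generic_ratio [tuple a; c; b; d] ge.
rewrite /cr_num /cr_den; have /= [-> -> -> ->] := crs_tuple a b c d.
have /= [-> -> -> ->] := crs_tuple a c b d.
have nd := generic_nondeg n3 ut tE ge; have := nd a d ad; have := nd b c bc.
rewrite (difC _ _ c b); have := dif_plucker o (cpos t e) a b c d.
move: (dif _ _ a b) (dif _ _ c d) (dif _ _ a c) (dif _ _ b d) (dif _ _ a d) (dif _ _ b c).
move: (chB _ _) (chB _ _) => y z ab cd ac bd ad' bc' h h1 h2.
have -> : ac * bd = ab * cd + ad' * bc' by rewrite -h; ring.
field; rewrite ?oppr_eq0 ?h1 ?h2 //.
Qed.

Lemma phi_some e q z : phi e q = Some z <-> chB e q != 0 /\ chA e q = z * chB e q.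
Proof.
rewrite ffunE; case: eqP => [->|/eqP B0]; first by split=> // -[].
by split=> [[<-]|[_ ->]]; rewrite ?divfK // mulfK.
Qed.

Lemma phi_one e a b c d : chU e != 0 -> a != d -> b != c ->
  phi e [tuple a; b; c; d] = Some 1 <-> phi e [tuple a; c; b; d] = Some 0.
Proof.
move=> Ue ad bc; have E := swap_identity ad bc e; rewrite !phi_some mul1r mul0r.
split=> [[B1 A1]|[B2 A2]].
  have A2 : chA e [tuple a; c; b; d] = 0.
    move: E; rewrite A1 mulrC => /(mulIf B1) /eqP; rewrite -subr_eq0 opprB addrCA subrr addr0 => /eqP //.
  split=> //; have [|//] := ch_proper n3 ut tE [tuple a; c; b; d] Ue.
  by rewrite A2 eqxx.
have A1 : chA e [tuple a; b; c; d] = chB e [tuple a; b; c; d].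
  by move: E; rewrite A2 subr0 mulrC => /(mulfI B2).
by split=> //; have [|//] := ch_proper n3 ut tE [tuple a; b; c; d] Ue; rewrite A1.
Qed.

Lemma phi_zero_hit e a b c d : chU e != 0 -> a != d -> b != c -> a != b -> c != d ->
  phi e [tuple a; c; b; d] = Some 0 -> exists2 i, e i = 0 & split2 i a b c d || split2 i c d a b.
Proof.
move=> Ue ad bc ab cd /phi_some [_]; rewrite mul0r /chA; have /= [-> -> -> ->] := crs_tuple a c b d.
rewrite (negPf ad) [c == b]eq_sym (negPf bc) /= => /eqP; rewrite !mulf_eq0.
rewrite (negPf (cdu_neq0 Ue ab)) (negPf (cdu_neq0 Ue cd)) !orbF => /eqP p0.
apply: contrapT => h; move: p0; apply/eqP; apply/prodf_neq0 => i hi.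
by apply/eqP => ei; apply: h; exists i.
Qed.

Lemma phi_zero e i a b c d : chU e != 0 -> e i = 0 -> split2 i a b c d ->
  phi e [tuple a; c; b; d] = Some 0.
Proof.
move=> Ue ei hi; have A0 : chA e [tuple a; c; b; d] = 0.
  rewrite /chA; have /= [-> -> -> ->] := crs_tuple a c b d.
  by case: ifP => // _; rewrite /pairing (bigD1 i) ?hi //= ei !mul0r.
apply/phi_some; rewrite A0 mul0r; split=> //.
by have [|//] := ch_proper n3 ut tE [tuple a; c; b; d] Ue; rewrite A0 eqxx.
Qed.

Definition cl (i : 'I_N) : {set 'I_n} := [set k | k \in leaves (cv t i)].

(** A vanishing coordinate collapses its cluster, which gives a node. Conversely each cross-ratio
    condition of a node is caused by some vanishing coordinate, and by [laminar_hit] a single one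
    causes them all. *)
Lemma nodes_phi e : chU e != 0 -> nodes (phi e) = #|[set i | e i == 0]|.
Proof.
move=> Ue; have ocl i : o \notin cl i by rewrite inE (o_cv n3 ut tE).
have cl_inj : injective cl.
  move=> i j h; apply: (cv_inj n3 ut tE).
  apply: (inner_inj ut); rewrite ?(cv_inner n3 ut tE) // => k.
  by have := congr1 (fun S : {set 'I_n} => k \in S) h; rewrite /= !inE.
have f_inj : injective (fun i => [set cl i; ~: cl i]%SET).
  move=> i j h; apply: cl_inj; have : cl i \in [set cl j; ~: cl j]%SET by rewrite -h !inE eqxx.
  rewrite !inE => /orP [/eqP //|/eqP e']; have := ocl i; rewrite e' inE ocl //.
rewrite -(card_imset _ f_inj); apply: eq_card => Y; apply/imsetP/imsetP; last first.
  case=> i; rewrite inE => /eqP ei ->; exists (cl i) => //; rewrite inE.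
  have [l [r vE]] := inner_size (cv_inner n3 ut tE i).
  have [c ct cc] := inner'_proper ut (cv_inner' n3 ut tE i).
  have uv := inner_uniq ut (cv_inner n3 ut tE i).
  apply/and3P; split.
  - have [_ _ dis] : [/\ uniq (leaves l), uniq (leaves r) & disj_leaves l r] by apply: uniq_Node; rewrite -vE.
    apply: (@leq_trans #|[set lm l; lm r]|%SET).
      rewrite cards2; case: eqP => // e'; have [] := dis (lm l) (lm_leaves l).
      by rewrite e' lm_leaves.
    apply: subset_leq_card; apply/fintype.subsetP => k; rewrite !inE vE /= mem_cat => /orP [] /eqP ->.
      by rewrite lm_leaves.
    by rewrite lm_leaves orbT.
  - apply: (@leq_trans #|[set o; c]|%SET).
      by rewrite cards2 eq_sym -tE ct.
    apply: subset_leq_card; apply/fintype.subsetP => k; rewrite !inE => /orP [] /eqP -> //.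
    exact: (o_cv n3 ut tE).
  - apply/forallP => a; apply/implyP; rewrite inE => ai; apply/forallP => b; apply/implyP; rewrite inE => bi.
    apply/forallP => k; apply/implyP; rewrite !inE => ki; apply/forallP => d; apply/implyP; rewrite !inE => di.
    apply/eqP/(phi_one Ue); last by apply: (phi_zero Ue ei); rewrite /split2 ai bi ki.
      by apply: contraNneq di => <-.
    by apply: contraNneq ki => <-.
case=> S; rewrite inE => /and3P [S1 S2 /forallP hS] ->.
have {}hS i j k l : i \in S -> j \in S -> k \notin S -> l \notin S ->
    phi e [tuple i; j; k; l] = Some 1.
  move=> iS jS kS lS; apply/eqP; have := hS i; rewrite iS /= => /forallP /(_ j).
  rewrite jS /= => /forallP /(_ k); rewrite inE kS /= => /forallP /(_ l).
  by rewrite inE lS.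
have [S0 [SE S01 S02 oS hit]] : exists S0 : {set 'I_n}, [/\ [set S; ~: S]%SET = [set S0; ~: S0]%SET,
    (1 < #|S0|)%N, (1 < #|~: S0|)%N, o \notin S0 &
    forall a b c, a \in S0 -> b \in S0 -> a != b -> c \notin S0 -> c != o ->
    exists2 i, e i == 0 & [/\ a \in cl i, b \in cl i & c \notin cl i]].
  have mem (S' : {set 'I_n}) x y : x \in S' -> y \notin S' -> x != y.
    by move=> xS yS; apply: contraNneq yS => <-.
  case: (boolP (o \in S)) => oS.
    exists (~: S)%SET; rewrite finset.setCK finset.setUC inE oS; split=> // a b c.
    rewrite !inE negbK => aS bS ab cS co.
    have cb := mem S c b cS bS; have oa := mem S o a oS aS.
    have := hS c o a b cS oS aS bS; rewrite (phi_one Ue cb oa).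
    case/(phi_zero_hit Ue cb oa co ab) => i ei /orP [] /and4P [h1 h2 h3 h4].
      by rewrite (negPf (o_cv n3 ut tE i)) in h2.
    by exists i; rewrite ?ei // !inE h1 h2 h3.
  exists S; split=> // a b c aS bS ab cS co.
  have ao := mem S a o aS oS; have bc := mem S b c bS cS.
  have := hS a b c o aS bS cS oS; rewrite (phi_one Ue ao bc).
  case/(phi_zero_hit Ue ao bc ab co) => i ei /orP [] /and4P [h1 h2 h3 h4].
    by exists i; rewrite ?ei // !inE h1 h2 h3.
  by rewrite (negPf (o_cv n3 ut tE i)) in h2.
have [i ei clE] : exists2 i, e i == 0 & cl i = S0.
  apply: (@laminar_hit _ _ cl (fun i => e i == 0) o) => //.
    move=> i j; have [h|h|h] := cluster_laminar n3 ut tE i j.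
    - by constructor 1; apply/fintype.subsetP => k; rewrite !inE; apply: h.
    - by constructor 2; apply/fintype.subsetP => k; rewrite !inE; apply: h.
    - constructor 3; apply/setP => k; rewrite !inE; apply/negP => /andP [k1 k2]; exact: h k1 k2.
  have : (0 < #|(~: S0) :\ o|)%N by move: S02; rewrite (cardsD1 o) inE oS.
  by case/card_gt0P => c; rewrite !inE => /andP [co cS]; exists c.
by exists i; rewrite ?inE // SE clE.
Qed.
End ChartNodes.

Section ChartExistence.
Variable K : closedFieldType.
Hypothesis uncountable : forall f : nat -> K, exists a, forall i, f i != a.
Variables (n : nat) (o : 'I_n).
Hypothesis n3 : (3 <= n)%N.
Local Notation N := (n - 3)%N.

Lemma place_meval I (Phi : (I -> K) -> K -> Prop) M (P : {mpoly K[M]}) (u : I -> 'I_M -> K) u0 :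
  partial_hom Phi -> (forall i, Phi (u^~ i) (u0 i)) -> Phi (fun x => P.@[u x]) P.@[u0].
Proof.
move=> hom hu; elim/mpoly_ring_ind: P => [c|i|p q hp hq|p q hp hq].
- by apply: ph_ext (phC hom c) _ _ => [x|]; rewrite mevalC.
- by apply: ph_ext (hu i) _ _ => [x|]; rewrite mevalXU.
- by apply: ph_ext (phD hom hp hq) _ _ => [x|]; rewrite mevalD.
- by apply: ph_ext (phM hom hp hq) _ _ => [x|]; rewrite mevalM.
Qed.

(** A point of the closure is a limit along a place; the tree adapted to this place has converging
    coordinates, and their limit stays in the domain of the chart. *)
Lemma chart_exists (x : cr_space K n) : Mbar0 x -> exists t : btree n,
  [/\ uniq (leaves t), forall k, (k \in leaves t) = (k != o) &
      exists2 e : 'I_N -> K, chU o t e != 0 & x = phi o t e].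
Proof.
move=> hx; pose I := {q : 'I_n -> K | nondeg o q}; pose m (i : I) := mline o (sval i).
have /closure_place [Phi hPhi hev] : zclosure (range m) x.
  by apply: zclosureS hx => _ /(M0_mline o) [q nd ->]; exists (exist _ q nd).
have lim := closure_place_limit hPhi hev; have hom := hPhi.1.
pose A := (~: [set o])%SET; pose q k (i : I) := sval i k.
have distinct i j : i \in A -> j \in A -> i != j -> forall x, q i x != q j x.
  rewrite !inE => iO jO ij [f nd]; rewrite /q /= -subr_eq0.
  by have := nd i j ij; rewrite /dif (negPf iO) (negPf jO).
have A0 : (0 < #|A|)%N by rewrite cardsC1 card_ord; lia.
have [t [ut tA vt]] := valid_tree hPhi distinct (fintype.subxx (mem A)) A0.
have tE k : (k \in leaves t) = (k != o) by rewrite tA !inE.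
exists t; split=> //.
have /boolp.choice [e he] i : exists e, generic o t e /\ m i = phi o t e.
  have [e [x0 [y [ge x00 h]]]] := phi_onto n3 ut tE (svalP i); exists e; split=> //.
  by rewrite (phi_generic n3 ut tE ge) /m (mline_affine x00 h).
have eE i j : e i j = ratio t (sval i) (key (cv t j)).
  have [ge mE] := he i; have := phi_coord_generic n3 ut tE j ge.
  by rewrite -mE /m mline_quad ?tE ?eqxx // => -[].
have /boolp.choice [e0 he0] j : exists c, Phi (fun i => e i j) c.
  have kt : key (cv t j) \in map (@key n) (inner' t) by apply: map_f; apply: (cv_inner' n3 ut tE).
  have [c hc] := ratio_limit ut vt kt.
  by exists c; apply: ph_ext hc _ _ => // i; rewrite eE.
have tAs : {subset leaves t <= A} by move=> k; rewrite tA.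
have duE i : {in map (@key n) (inner' t), ratio t (sval i) =1 ceta t (e i)}.
  move=> k /seq.mapP; case=> v vt' ->.
  have iv : (index v (inner' t) < N)%N by rewrite -(size_inner' n3 ut tE) index_mem.
  have -> : v = cv t (Ordinal iv) by rewrite /cv /= nth_index.
  by rewrite (ceta_key n3 ut tE) eE.
have Ue : chU o t e0 != 0.
  apply/prodf_neq0 => -[a b] /= /and3P [ao bo ab].
  have := tdu_limit hPhi distinct ut tAs vt; move=> /(_ a b); rewrite !tE => /(_ ao bo ab) [c c0 hc].
  rewrite -(_ : c = cdu o t e0 a b) //; apply: (ph_inj hom) hc _.
  have := place_meval (cdu o t (fun j => 'X_j : {mpoly K[N]}) a b) hom he0.
  rewrite cdu_morph evalX => h; apply: ph_ext h _ _ => // i.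
  by rewrite cdu_morph evalX /cdu (negPf ao) (negPf bo) (tdu_ext (duE i)).
(* Both x and [phi e0] are limits of the same cross-ratios, and limits in the projective line are
   unique. *)
exists e0 => //; apply/ffunP => s; apply: (limit_P1_unique hPhi (lim s)).
have limA : Phi (fun i => chA o t (e i) s) (chA o t e0 s).
  by have := place_meval (chAp K o t s) hom he0; rewrite chApE => h; apply: ph_ext h _ _ => // i; rewrite chApE.
have limB : Phi (fun i => chB o t (e i) s) (chB o t e0 s).
  by have := place_meval (chBp K o t s) hom he0; rewrite chBpE => h; apply: ph_ext h _ _ => // i; rewrite chBpE.
have mE i : m i s = Some (chA o t (e i) s / chB o t (e i) s).
  have [ge ->] := he i; have [B0 _] := generic_ratio n3 ut tE s ge.
  by rewrite ffunE (negPf B0).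
have B0 i : chB o t (e i) s != 0 by have [ge _] := he i; have [] := generic_ratio n3 ut tE s ge.
rewrite /phi ffunE; case: eqP => [Bz|/eqP Bn0].
  have A00 : chA o t e0 s != 0 by have [//|] := ch_proper n3 ut tE s Ue; rewrite Bz eqxx.
  split.
    have h := place_neq0 hPhi limA A00; apply: (place_bool_le hPhi _ h) => i Ai.
    by rewrite mE /= mulf_eq0 invr_eq0 (negPf Ai) (negPf (B0 i)).
  apply: ph_ext (phM hom limB (placeV hPhi limA A00)) _ _ => [i|]; last by rewrite Bz mul0r.
  rewrite mE /=; case: eqP => [h0|_] /=; last by rewrite invf_div.
  by rewrite -invf_div h0 invr0.
split; first by apply: ph_ext (phC hom 1) _ _ => // i; rewrite mE.
by apply: ph_ext (phM hom limA (placeV hPhi limB Bn0)) _ _ => // i; rewrite mE.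
Qed.
End ChartExistence.

(** * Degrees on one-dimensional strata *)


Section IsolatedPoints.
Variables (K : closedFieldType) (Q : finType).
Local Notation P1 := (P1prod K Q).
Implicit Types (x y z : P1) (S V D : set P1).

Lemma crd_inj x y z : in_chart x y -> in_chart x z ->
  (forall q, crd x y q = crd x z q) -> y = z.
Proof.
move=> xy xz h; apply/ffunP => q; have := h q; rewrite /crd.
have := in_chartP q xy; have := in_chartP q xz; rewrite /coord_P1.
case: (x q) => [_|]; first by case: (y q) => // a; case: (z q) => // b _ _ /= ->.
rewrite /inv_P1; case: (y q) => [a|]; case: (z q) => [b|] //=.
- case: (eqVneq b 0) => // b0; case: (eqVneq a 0) => // a0 _ _ /= h'.
  by rewrite -[a]invrK h' invrK.
- by case: (eqVneq a 0) => // a0 _ _ /= /eqP; rewrite invr_eq0 (negPf a0).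
- by case: (eqVneq b 0) => // b0 _ _ /= /esym/eqP; rewrite invr_eq0 (negPf b0).
Qed.

Lemma zariski_nearI V x (P P' R : P1 -> Prop) :
  zariski_near V x P -> zariski_near V x P' ->
  (forall y, V y -> in_chart x y -> P y -> P' y -> R y) -> zariski_near V x R.
Proof.
move=> [p px hp] [q qx hq] h; exists (p * q); first by rewrite evM mulf_neq0.
move=> y Vy xy; rewrite evM mulf_eq0 negb_or => /andP [py qy].
by apply: h => //; [exact: hp|exact: hq].
Qed.

Lemma zariski_near_all V x (R : P1 -> Prop) :
  (forall y, V y -> in_chart x y -> R y) -> zariski_near V x R.
Proof. by move=> h; exists 1; rewrite ?ev1 ?oner_neq0 // => y Vy xy _; apply: h. Qed.

Lemma zariski_near_out D x (R : P1 -> Prop) : zclosed D -> ~ D x -> zariski_near D x R.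
Proof.
move=> cD nD; have [p hp px] : exists2 p, forall y, D y -> in_chart x y -> ev x p y = 0 & ev x p x != 0.
  by apply: notin_zclosure => /cD.
by exists p => // y Dy xy; rewrite hp ?eqxx.
Qed.

Lemma regular_sub V V' x f : (V' `<=` V)%classic -> regular_at V x f -> regular_at V' x f.
Proof. by move=> sub [p [q [qx h]]]; exists p, q; split=> // y /sub; apply: h. Qed.

(* Points with the same coordinates at infinity lie in one affine space, where
   a set of isolated points is a finite union of prime sets, each a point. *)
Lemma finite_isolated S : (forall x, S x -> zariski_near S x (fun y => y = x)) ->
  exists2 s : seq P1, uniq s & forall x, x \in s <-> S x.
Proof.
move=> iso; suff [s hs] : exists s : seq P1, forall x, S x -> x \in s.
  exists (undup [seq x <- s | `[<S x>]]); first exact: undup_uniq.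
  move=> x; rewrite mem_undup mem_filter; split=> [/andP [/asboolP]|Sx] //.
  by rewrite hs // andbT; apply/asboolP.
pose pat x : {ffun Q -> bool} := [ffun q => x q == None].
pose e x (i : 'I_#|Q|) : K := odflt 0 (x (enum_val i)).
have evE x y p : pat x = pat y -> ev x p y = p.@[e y].
  move=> xy; rewrite /ev /e; apply: meval_eq => i.
  have := congr1 (fun f : {ffun Q -> bool} => f (enum_val i)) xy; rewrite /= !ffunE.
  by case: (x _) => [a|]; case: (y _).
have chart x y : pat x = pat y -> in_chart x y.
  move=> xy; apply/forallP => q; have := congr1 (fun f : {ffun Q -> bool} => f q) xy; rewrite /= !ffunE.
  by case: (x _) => [a|]; case: (y _).
have ext x y : pat x = pat y -> e x =1 e y -> x = y.
  move=> xy exy; apply/ffunP => q; have := congr1 (fun f : {ffun Q -> bool} => f q) xy; rewrite /= !ffunE.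
  have := exy (enum_rank q); rewrite /e enum_rankK.
  by case: (x q) => [a|]; case: (y q) => [b|] //= ->.
have fin c : exists s : seq P1, forall x, S x -> pat x = c -> x \in s.
  have [k [W [pW hW]]] := prime_decomposition e [set x | S x /\ pat x = c]%classic.
  have hW' i x : W i x -> S x /\ pat x = c by move=> Wx; apply/(hW x); exists i.
  have /boolp.choice [w hw] i : exists w, forall x, W i x -> x = w.
    have [[w Ww] pr] := pW i; exists w => x Wx.
    have [Sw cw] := hW' i w Ww; have [g gw hg] := iso w Sw.
    have eqp y : W i y -> pat w = pat y by move=> /hW' [_ ->].
    apply: ext; first by rewrite -(eqp x Wx).
    move=> j; apply/eqP; rewrite -subr_eq0.
    have [|h|h] := pr ('X_j - (e w j)%:MP) g.
    - move=> y Wy; rewrite mevalB mevalXU mevalC.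
      have [->|g0] := eqVneq g.@[e y] 0; first by rewrite mulr0.
      have -> : y = w.
        apply: hg; rewrite ?evE ?(eqp y) //; first by case: (hW' i y Wy).
        by apply: chart; apply: eqp.
      by rewrite subrr mul0r.
    - by have := h x Wx; rewrite mevalB mevalXU mevalC => ->.
    - by move: gw; rewrite evE // h ?eqxx.
  exists [seq w i | i <- enum 'I_k] => x Sx cx.
  have [i /hw ->] : exists i, W i x by apply/(hW x).
  by rewrite map_f // mem_enum.
have /boolp.choice [s hs] := fin; exists (flatten [seq s c | c <- enum {ffun Q -> bool}]) => x Sx.
by apply/flattenP; exists (s (pat x)); rewrite ?map_f ?mem_enum ?hs.
Qed.

Lemma irreducible_between S W : irreducible S -> (S `<=` W)%classic -> (W `<=` zclosure S)%classic ->
  irreducible W.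
Proof.
move=> [[x Sx] irr] SW WS; split; first by exists x; apply: SW.
move=> A B cA cB WAB; have [h|h] := irr A B cA cB (fun y Sy => WAB y (SW y Sy)).
  by left => y /WS; apply: zclosure_min h y.
by right => y /WS; apply: zclosure_min h y.
Qed.

Lemma zclosed_seqU (J : eqType) (Z : J -> set P1) (s : seq J) : (forall j, zclosed (Z j)) ->
  zclosed [set x | exists2 j, j \in s & Z j x]%classic.
Proof.
move=> cZ; elim: s => [|i s IHs].
  have -> : [set x | exists2 j, j \in [::] & Z j x]%classic = set0.
    by apply/seteqP; split=> x //= [].
  exact: zclosed0.
have -> : [set x | exists2 j, j \in i :: s & Z j x]%classic = (Z i `|` [set x | exists2 j, j \in s & Z j x])%classic.
  apply/seteqP; split=> x /=.
    by case=> j'; rewrite inE => /orP [/eqP ->|js Zj]; [left|right; exists j'].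
  by case=> [Zi|[j' js Zj]]; [exists i; rewrite ?mem_head|exists j'; rewrite ?inE ?js ?orbT].
exact: zclosedU.
Qed.

Lemma irreducible_cover W S (J : finType) (Z : J -> set P1) : irreducible W ->
  (forall j, zclosed (Z j)) -> (W `<=` zclosure S)%classic -> (forall x, S x -> exists j, Z j x) ->
  exists j, (W `<=` Z j)%classic.
Proof.
move=> [W0 irr] cZ WS hS; suff H (s : seq J) : (forall x, W x -> exists2 j, j \in s & Z j x) ->
    exists j, (W `<=` Z j)%classic.
  apply: (H (enum J)) => x /WS; apply: (zclosure_min (zclosed_seqU (s := enum J) cZ)).
  by move=> y /hS [j Zj]; exists j; rewrite ?mem_enum.
elim: s => [|j s IH] h; first by have [x /h []] := W0.
have [|hj|hs] := irr _ _ (cZ j) (zclosed_seqU (s := s) cZ).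
- move=> x /h [j']; rewrite inE => /orP [/eqP ->|js Zj]; first by left.
  by right; exists j'.
- by exists j.
- by apply: IH => x /hs.
Qed.

Lemma zariski_near_sub V V' x (R : P1 -> Prop) : (V' `<=` V)%classic ->
  zariski_near V x R -> zariski_near V' x R.
Proof. by move=> sub [q qx h]; exists q => // y /sub; apply: h. Qed.

Lemma local_equation_unit V D x : zclosed D -> ~ D x -> local_equation V D x (fun=> 1).
Proof.
move=> cD nD; split.
- by exists 1, 1; rewrite ev1 oner_neq0; split=> // y _ _ _; rewrite ev1 divr1.
- exact: zariski_near_out.
- by move=> g hg _; exists g => //; apply: zariski_near_all => y _ _; rewrite mul1r.
Qed.
End IsolatedPoints.

(** * Rational maps into products of lines *)

Section RationalMaps.
Variables (K : closedFieldType) (Q : finType) (M : nat) (A B : Q -> {mpoly K[M]}).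
Variables (S : set ('I_M -> K)) (psi : ('I_M -> K) -> P1prod K Q).
Hypothesis psiE : forall v q, S v ->
  psi v q = if (B q).@[v] == 0 then None else Some ((A q).@[v] / (B q).@[v]).
Hypothesis proper : forall v q, S v -> (A q).@[v] != 0 \/ (B q).@[v] != 0.
Implicit Types (x : P1prod K Q) (v : 'I_M -> K) (p q : {mpoly K[#|Q|]}) (V : set ('I_M -> K)).

(** In the chart around x a coordinate of [psi v] is [A / B] or its inverse, according as x is
    finite or infinite there. *)
Definition cnum x k := if x k is Some _ then A k else B k.
Definition cden x k := if x k is Some _ then B k else A k.
Definition cH x := \prod_k cden x k.

Lemma cHE x v : ((cH x).@[v] != 0) = [forall k, (cden x k).@[v] != 0].
Proof.
rewrite /cH rmorph_prod /=; apply/prodf_neq0/forallP => h k; first exact: h.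
by move=> _; apply: h.
Qed.

Lemma coord_map x v k : S v ->
  coord_P1 (x k) (psi v k) = if (cden x k).@[v] == 0 then None else
    Some ((cnum x k).@[v] / (cden x k).@[v]).
Proof.
move=> Sv; rewrite /cden /cnum psiE //; case: (x k) => [_|] //=.
case: eqP => [B0|/eqP B0] /=.
  by have [/negPf ->|] := proper k Sv; rewrite B0 ?mul0r ?eqxx.
by rewrite mulf_eq0 invr_eq0 (negPf B0) orbF invf_div.
Qed.

Lemma in_chart_map x v : S v -> in_chart x (psi v) = ((cH x).@[v] != 0).
Proof.
by move=> Sv; rewrite cHE; apply: eq_forallb => k; rewrite coord_map //; case: (_ == 0).
Qed.

Lemma crd_map x v k : S v -> (cH x).@[v] != 0 ->
  crd x (psi v) k = (cnum x k).@[v] / (cden x k).@[v].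
Proof.
by move=> Sv; rewrite cHE /crd => /forallP /(_ k) h; rewrite coord_map // (negPf h).
Qed.

Lemma pullback x p : exists (P : {mpoly K[M]}) d, forall v, S v -> (cH x).@[v] != 0 ->
  ev x p (psi v) * (cH x).@[v] ^+ d = P.@[v].
Proof.
elim/mpoly_ring_ind: p => [a|i|p q [P [d hP]] [P' [d' hP']]|p q [P [d hP]] [P' [d' hP']]].
- by exists a%:MP, 0%N => v _ _; rewrite evC mulr1 mevalC.
- exists (cnum x (enum_val i) * \prod_(k | k != enum_val i) cden x k), 1%N => v Sv Hv.
  rewrite -{1}(enum_valK i) evX crd_map // expr1 /cH (bigD1 (enum_val i)) //= !mevalM mulrA divfK //.
  by move: Hv; rewrite cHE => /forallP.
- exists (P * cH x ^+ d' + P' * cH x ^+ d), (d + d')%N => v Sv Hv.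
  by rewrite evD mevalD !mevalM !rmorphXn /= -hP // -hP' // exprD; ring.
- exists (P * P'), (d + d')%N => v Sv Hv.
  by rewrite evM mevalM -hP // -hP' // exprD; ring.
Qed.

Lemma pullback_zeros x p : exists P : {mpoly K[M]}, forall v, S v ->
  P.@[v] = 0 <-> (in_chart x (psi v) -> ev x p (psi v) = 0).
Proof.
have [P [d hP]] := pullback x p; exists (P * cH x) => v Sv; rewrite mevalM in_chart_map //.
have [->|Hv] := eqVneq (cH x).@[v] 0; first by rewrite mulr0; split.
rewrite -hP //; split=> [/eqP + _|/(_ isT) ->]; last by rewrite !mul0r.
by rewrite !mulf_eq0 expf_eq0 (negPf Hv) andbF !orbF => /eqP.
Qed.

Lemma irreducible_map V : (V `<=` S)%classic -> prime_set id V -> irreducible (psi @` V)%classic.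
Proof.
move=> VS [V0 pV]; apply: irreducible_image => // x p.
by have [P hP] := pullback_zeros x p; exists P => v /VS /hP.
Qed.

Lemma zclosure_map V v : (V `<=` S)%classic -> S v ->
  (forall P : {mpoly K[M]}, vanishing id V P -> P.@[v] = 0) -> zclosure (psi @` V)%classic (psi v).
Proof.
move=> VS Sv h p hp; have [P hP] := pullback_zeros (psi v) p.
have /(hP _ Sv) : P.@[v] = 0; last by apply; apply: in_chart_refl.
by apply: h => w Vw; apply/(hP _ (VS w Vw)); apply: hp; exists w.
Qed.
End RationalMaps.

(* Coordinates on an open subset of the closure of V0, with cA / cB the ambient
   coordinates; the boundary lies in the coordinate hyperplanes, and the origin
   is in the chart. *)
Record chart (K : closedFieldType) (Q : finType) (N : nat) (V0 : set (P1prod K Q)) := Chart {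
  cA : Q -> {mpoly K[N]};
  cB : Q -> {mpoly K[N]};
  cU : {mpoly K[N]};
  ck : 'I_N -> Q;
  cphi : ('I_N -> K) -> P1prod K Q;
  cphiE : forall e q, cphi e q =
    if (cB q).@[e] == 0 then None else Some ((cA q).@[e] / (cB q).@[e]);
  cproper : forall e q, cU.@[e] != 0 -> (cA q).@[e] != 0 \/ (cB q).@[e] != 0;
  ccoord : forall e i, cU.@[e] != 0 -> cphi e (ck i) = Some (e i);
  corigin : cU.@[fun=> 0] != 0;
  cin : forall e, cU.@[e] != 0 -> (forall i, e i != 0) -> V0 (cphi e);
  conto : forall x, V0 x -> exists2 e, cU.@[e] != 0 & x = cphi e }.

Section ChartGeometry.
Variable K : closedFieldType.
Hypothesis uncountable : forall f : nat -> K, exists a, forall i, f i != a.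
Variables (Q : finType) (N : nat) (V0 : set (P1prod K Q)) (c : chart N V0).
Local Notation P1 := (P1prod K Q).
Local Notation V := (zclosure V0).
Local Notation phi := (cphi c).
Local Notation U := (cU c).
Implicit Types (x y : P1) (e : 'I_N -> K) (F G H : {mpoly K[N]}) (p q : {mpoly K[#|Q|]}).

Local Notation S0 := [set e | U.@[e] != 0]%classic.
Local Notation cH := (cH (cA c) (cB c)).
Local Notation cnum := (cnum (cA c) (cB c)).
Local Notation cden := (cden (cA c) (cB c)).

Lemma phiE e k : S0 e -> phi e k =
  if (cB c k).@[e] == 0 then None else Some ((cA c k).@[e] / (cB c k).@[e]).
Proof. by move=> _; apply: cphiE. Qed.
Lemma phi_proper e k : S0 e -> (cA c k).@[e] != 0 \/ (cB c k).@[e] != 0.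
Proof. exact: cproper. Qed.

Lemma in_chart_phi x e : U.@[e] != 0 -> in_chart x (phi e) = ((cH x).@[e] != 0).
Proof. exact: (in_chart_map phiE phi_proper). Qed.

Lemma crd_phi x e k : U.@[e] != 0 -> (cH x).@[e] != 0 ->
  crd x (phi e) k = (cnum x k).@[e] / (cden x k).@[e].
Proof. exact: (crd_map phiE phi_proper). Qed.

Lemma pullback_phi x p : exists (P : {mpoly K[N]}) d, forall e, U.@[e] != 0 -> (cH x).@[e] != 0 ->
  ev x p (phi e) * (cH x).@[e] ^+ d = P.@[e].
Proof. exact: (pullback phiE phi_proper). Qed.

Lemma phi_closure (S : set ('I_N -> K)) e0 : U.@[e0] != 0 ->
  (forall P : {mpoly K[N]}, (forall e, S e -> U.@[e] != 0 -> P.@[e] = 0) -> P.@[e0] = 0) ->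
  zclosure [set phi e | e in [set e | S e /\ U.@[e] != 0]]%classic (phi e0).
Proof.
move=> U0 hS; apply: (zclosure_map phiE phi_proper) => //; first by move=> e [].
by move=> P hP; apply: hS => e Se Ue; apply: hP.
Qed.

Lemma U_neq0 : U != 0.
Proof. by apply/eqP => h; have := corigin c; rewrite h meval0 eqxx. Qed.

Lemma phi_V e : U.@[e] != 0 -> V (phi e).
Proof.
move=> Ue; apply: (zclosureS _ (@phi_closure [set e | forall i, e i != 0]%classic e Ue _)).
  by move=> _ [e' [e0 U0] <-]; apply: cin.
move=> P hP; pose X : {mpoly K[N]} := \prod_(i < N) 'X_i.
have XE e' : X.@[e'] = \prod_i e' i.
  by rewrite /X rmorph_prod; apply: eq_bigr => i _ /=; rewrite mevalXU.
have X0 : X != 0.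
  apply/eqP => h; have := XE (fun=> 1); rewrite h meval0 big1 // => /esym/eqP.
  by rewrite oner_eq0.
have : P * U * X = 0.
  apply: (mpoly_eq_values uncountable) => e'; rewrite !mevalM meval0 XE.
  have [->|Ue'] := eqVneq U.@[e'] 0; first by rewrite mulr0 mul0r.
  case: (pickP (fun i => e' i == 0)) => [i /eqP ei|h]; first by rewrite (bigD1 i) //= ei mul0r mulr0.
  by rewrite hP ?mul0r // => i; rewrite h.
move/eqP; rewrite !mulf_eq0 (negPf U_neq0) (negPf X0) !orbF => /eqP ->.
exact: meval0.
Qed.

Definition ceval y : 'I_N -> K := fun i => odflt 0 (y (ck c i)).

(** The coordinates [e] are themselves ambient coordinates, by [ccoord], so polynomials in them are
    restrictions of ambient polynomials. *)
Definition chart_poly F : {mpoly K[#|Q|]} :=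
  mmap (@mpolyC #|Q| K) (fun i => 'X_(enum_rank (ck c i))) F.

Lemma ceval_phi e : U.@[e] != 0 -> ceval (phi e) = e.
Proof. by move=> Ue; apply/funext => i; rewrite /ceval ccoord. Qed.

Lemma ev_chart_poly e0 F y : U.@[e0] != 0 -> ev (phi e0) (chart_poly F) y = F.@[ceval y].
Proof.
move=> U0; rewrite /chart_poly; elim/mpoly_ring_ind: F => [a|i|p q hp hq|p q hp hq].
- by rewrite mmapC evC mevalC.
- by rewrite mmapX mmap1U evX mevalXU /crd ccoord.
- by rewrite rmorphD evD mevalD hp hq.
- by rewrite rmorphM evM mevalM hp hq.
Qed.

Section AtPoint.
Variable e0 : 'I_N -> K.
Hypothesis U0 : U.@[e0] != 0.
Local Notation x := (phi e0).

Lemma cH_center : (cH x).@[e0] != 0.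
Proof. by rewrite -in_chart_phi // in_chart_refl. Qed.

(** The equations that express all ambient coordinates through the chosen ones hold on [V0], hence
    on its closure. So near x every point of the closure is the image of its own chosen
    coordinates. *)
Lemma local_param : zariski_near V x
  (fun y => exists e, [/\ U.@[e] != 0, (cH x).@[e] != 0 & y = phi e]).
Proof.
exists (chart_poly (U * cH x)).
  by rewrite ev_chart_poly // ceval_phi // mevalM mulf_neq0 // cH_center.
move=> y Vy xy; rewrite ev_chart_poly // mevalM mulf_eq0 negb_or => /andP [Ue He].
exists (ceval y); split=> //; apply: (crd_inj xy) => [|k]; first by rewrite in_chart_phi.
have den0 : (cden x k).@[ceval y] != 0 by move: He; rewrite cHE => /forallP.
rewrite crd_phi //; apply: (mulIf den0); rewrite divfK //; apply/eqP; rewrite -subr_eq0.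
have : ev x ('X_(enum_rank k) * chart_poly (cden x k) - chart_poly (cnum x k)) y = 0.
  have sub : (V `<=` basic_closed x ('X_(enum_rank k) * chart_poly (cden x k) - chart_poly (cnum x k)))%classic.
    apply: zclosure_min; first exact: zclosed_basic.
    move=> _ /(conto c) [e Ue' ->]; rewrite /basic_closed /= in_chart_phi // => He'.
    rewrite evB evM evX !ev_chart_poly // ceval_phi // crd_phi // divfK ?subrr //.
    by move: He'; rewrite cHE => /forallP.
  exact: sub.
by rewrite evB evM evX !ev_chart_poly // => ->.
Qed.

Definition cfun F y : K := F.@[ceval y].

Lemma regular_cfun F : regular_at V x (cfun F).
Proof.
exists (chart_poly F), 1; rewrite ev1 oner_neq0; split=> // y _ _ _.
by rewrite ev1 divr1 ev_chart_poly.
Qed.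

Lemma regular_cfun_div F G : G.@[e0] != 0 -> regular_at V x (fun y => cfun F y / cfun G y).
Proof.
move=> G0; exists (chart_poly F), (chart_poly G); rewrite ev_chart_poly // ceval_phi //.
by split=> // y _ _ _; rewrite !ev_chart_poly.
Qed.

Lemma regular_quotient (V' : set P1) g : regular_at V' x g -> exists P P',
  P'.@[e0] != 0 /\ forall e, U.@[e] != 0 -> P'.@[e] != 0 -> V' (phi e) ->
    (cH x).@[e] != 0 /\ g (phi e) = P.@[e] / P'.@[e].
Proof.
move=> [p [q [qx hg]]]; have [P [d hP]] := pullback_phi x p; have [R [d' hR]] := pullback_phi x q.
exists (P * cH x ^+ d'.+1), (R * cH x ^+ d.+1); have H0 := cH_center; split.
  by rewrite mevalM rmorphXn /= mulf_neq0 ?expf_neq0 // -hR // mulf_neq0 ?expf_neq0.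
move=> e Ue; rewrite mevalM rmorphXn /= mulf_eq0 negb_or => /andP [Re].
rewrite expf_eq0 /= => He Ve; split=> //.
have qe : ev x q (phi e) != 0 by apply: contraNneq Re => h; rewrite -hR // h mul0r.
rewrite hg ?in_chart_phi // mevalM rmorphXn /= -hP // -hR // !exprS.
by field; rewrite He qe !expf_neq0.
Qed.

Lemma near_nonzero (V' : set P1) G : G.@[e0] != 0 -> zariski_near V' x (fun y => cfun G y != 0).
Proof.
move=> G0; exists (chart_poly G) => [|y _ _]; rewrite ev_chart_poly // ceval_phi //.
Qed.

Lemma cfun_phi F e : U.@[e] != 0 -> cfun F (phi e) = F.@[e].
Proof. by move=> Ue; rewrite /cfun ceval_phi. Qed.

(** Germs of regular functions at x are quotients of polynomials in [e], so it suffices that [F]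
    generate the polynomials vanishing on [D] in the chart. *)
Lemma local_equation_gen (D : set P1) F : (D `<=` V)%classic ->
  (forall e, U.@[e] != 0 -> D (phi e) -> F.@[e] = 0) ->
  (forall G, (forall e, U.@[e] != 0 -> D (phi e) -> G.@[e] = 0) -> exists H, G = F * H) ->
  local_equation V D x (cfun F).
Proof.
move=> DV hF1 hF2; split; first exact: regular_cfun.
  have [g gx hg] := local_param; exists g => // y Dy xy gy.
  by have [e [Ue _ yE]] := hg y (DV y Dy) xy gy; rewrite yE cfun_phi // hF1 // -yE.
move=> g /regular_quotient [P [P' [P'0 hg]]] [q2 q2x hq2].
have [R [d hR]] := pullback_phi x q2.
have R0 : R.@[e0] != 0 by rewrite -hR ?cH_center // mulf_neq0 // expf_neq0 // cH_center.
(* The factors [P'] and [R] vanish where the expression of [g] as a quotient or its vanishing on [D]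
   is not known, so the product vanishes on all of [D] in the chart. *)
have [e Ue De|H hH] := hF2 (P * P' * R).
  rewrite !mevalM; have [->|Pe] := eqVneq P'.@[e] 0; first by rewrite mulr0 mul0r.
  have [->|Re] := eqVneq R.@[e] 0; first by rewrite mulr0.
  have [He gE] := hg e Ue Pe (DV _ De).
  have : g (phi e) = 0.
    apply: hq2 => //; first by rewrite in_chart_phi.
    by apply: contraNneq Re => h; rewrite -hR // h mul0r.
  by rewrite gE => /eqP; rewrite mulf_eq0 invr_eq0 (negPf Pe) orbF => /eqP ->; rewrite !mul0r.
exists (fun y => cfun H y / cfun (P' ^+ 2 * R) y).
  by apply: regular_cfun_div; rewrite mevalM mulf_neq0 // rmorphXn expf_neq0.
apply: (zariski_nearI local_param (@near_nonzero V (P' * R) _)).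
  by rewrite mevalM mulf_neq0.
move=> y Vy xy [e [Ue He yE]]; rewrite yE !cfun_phi // expr2 !mevalM -expr2 mulf_eq0 negb_or => /andP [Pe Re].
have [_ ->] := hg e Ue Pe (phi_V Ue).
have := congr1 (meval e) hH; rewrite /= !mevalM => E.
have -> : F.@[e] * (H.@[e] / (P'.@[e] ^+ 2 * R.@[e])) = (F.@[e] * H.@[e]) / (P'.@[e] ^+ 2 * R.@[e]) by rewrite mulrA.
by rewrite -E; field; rewrite Pe Re.
Qed.
End AtPoint.

Section Axis.
Variable j : 'I_N.
Definition axis e := forall i, i != j -> e i = 0.
Definition upd0 (t : K) : 'I_N -> K := fun i => if i == j then t else 0.
Definition uni F : {poly K} := mmap (@polyC K) (fun i => if i == j then 'X else 0) F.
Definition back (s : {poly K}) : {mpoly K[N]} := (map_poly (@mpolyC N K) s).['X_j].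

Lemma axis_upd0 e : axis e -> e = upd0 (e j).
Proof. by move=> h; apply/funext => i; rewrite /upd0; case: eqVneq => [->|/h]. Qed.

Lemma uniE F t : (uni F).[t] = F.@[upd0 t].
Proof.
rewrite /uni; elim/mpoly_ring_ind: F => [a|i|p q hp hq|p q hp hq].
- by rewrite mmapC mevalC hornerC.
- by rewrite mmapX mmap1U mevalXU /upd0; case: ifP => _; rewrite ?hornerX ?horner0.
- by rewrite rmorphD hornerD mevalD hp hq.
- by rewrite rmorphM hornerM mevalM hp hq.
Qed.

Lemma uni_axis F e : axis e -> F.@[e] = (uni F).[e j].
Proof. by move=> /axis_upd0 {1}->; rewrite uniE. Qed.

Lemma backE s e : (back s).@[e] = s.[e j].
Proof.
rewrite /back; elim/poly_ind: s => [|p a IH]; first by rewrite map_poly0 !horner0 meval0.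
rewrite rmorphD rmorphM /= map_polyX map_polyC /= !hornerE mevalD mevalM IH mevalC mevalXU //.
Qed.

Lemma axis_origin : axis (fun=> 0). Proof. by []. Qed.

Definition axis_points : set P1 := [set phi e | e in [set e | axis e /\ U.@[e] != 0]]%classic.

Lemma irreducible_axis : irreducible axis_points.
Proof.
apply: (irreducible_map phiE phi_proper); first by move=> e [].
split; first by exists (fun=> 0); split; [exact: axis_origin|exact: corigin].
move=> p q hpq; have h0 : uni p * uni q * uni U = 0.
  apply: (poly_eq_values uncountable) => t; rewrite !hornerM !uniE horner0.
  have [->|Ut] := eqVneq U.@[upd0 t] 0; first by rewrite mulr0.
  by rewrite hpq ?mul0r //; split=> // i ij; rewrite /upd0 (negPf ij).
have U1 : uni U != 0.
  apply/eqP => h; have := corigin c; rewrite uni_axis ?h ?horner0 ?eqxx //.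
move/eqP: h0; rewrite !mulf_eq0 (negPf U1) orbF => /orP [] /eqP h; [left|right] => v [av _];
by rewrite uni_axis // h horner0.
Qed.

Lemma zclosure_axis e : U.@[e] != 0 -> zclosure axis_points (phi e) -> axis e.
Proof.
move=> Ue h i ij; have := h (chart_poly 'X_i); rewrite ev_chart_poly // ceval_phi // mevalXU; apply.
move=> _ [e' [ae Ue'] <-] _; rewrite ev_chart_poly // ceval_phi // mevalXU; exact: ae.
Qed.
End Axis.

Section Curve.
Variable nd : P1 -> nat.
Hypothesis ndE : forall e, U.@[e] != 0 -> nd (phi e) = #|[set i | e i == 0]%SET|.
Hypothesis N0 : (0 < N)%N.
Variable C : set P1.
Hypothesis hC : irreducible_component [set y | V y /\ (N.-1 <= nd y)%N]%classic C.
Variable e0 : 'I_N -> K.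
Hypothesis U0 : U.@[e0] != 0.
Hypothesis Cx : C (phi e0).

Lemma axis_card e : (N.-1 <= #|[set i | (e i == 0)%R]%SET|)%N <-> exists j, axis j e.
Proof.
set Z := [set i | e i == 0]%SET; have cZ : (#|Z| + #|~: Z| = N)%N by rewrite cardsC card_ord.
split=> [h|[j aj]].
  have c1 : (#|~: Z| <= 1)%N by move: cZ N0 h; move: #|Z| #|~: Z|; lia.
  case: (pickP (fun i => i \in ~: Z)) => [j hj|h0].
    exists j => i ij; apply/eqP; have : i \notin ~: Z.
      apply/negP => hi; move: c1; rewrite leqNgt => /negP; apply.
      have sub : [set i; j]%SET \subset ~: Z.
        by apply/fintype.subsetP => l; rewrite finset.in_set2 => /orP [] /eqP ->.
      by have := subset_leq_card sub; rewrite cards2 ij.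
    by rewrite !inE negbK.
  exists (Ordinal N0) => i _; apply/eqP; have := h0 i; rewrite /= !inE => /negbT.
  by rewrite negbK.
have sub : ~: [set j]%SET \subset Z.
  by apply/fintype.subsetP => i; rewrite !inE => /aj ->.
by have := subset_leq_card sub; rewrite cardsC1 card_ord.
Qed.

Lemma curve_sub : (C `<=` V)%classic. Proof. by case: hC => h _ _ y /h []. Qed.

(** Within the chart [C] is covered by the axes, so by irreducibility it lies in the closure of one
    of them. Adding the points of this axis keeps [C] irreducible and within the locus, so
    maximality gives equality. *)
Lemma curve_axis : exists j, forall e, U.@[e] != 0 -> C (phi e) <-> axis j e.
Proof.
have [CL iC maxC] := hC; have [g gx hg] := local_param U0.
have dense := irreducible_dense iC Cx (in_chart_refl _) gx.
have [|j Cj] := irreducible_cover iC (fun j => zclosureK (V := axis_points j)) dense.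
  move=> y [Cy [xy gy]]; have [Vy ndy] := CL y Cy.
  have [e [Ue _ yE]] := hg y Vy xy gy; rewrite yE ndE // in ndy.
  have /axis_card [j aj] := ndy; exists j; rewrite yE; apply: sub_zclosure.
  by exists e.
exists j.
have E : (C `|` axis_points j)%classic = C.
  apply: maxC.
  - apply: (irreducible_between (irreducible_axis j)); first by move=> y hy; right.
    by move=> y [/Cj //|]; apply: sub_zclosure.
  - move=> y [/CL //|[e [ae Ue] <-]]; split; first exact: phi_V.
    by rewrite ndE //; apply/axis_card; exists j.
  - by move=> y hy; left.
move=> e Ue; split=> [/Cj|ae]; first exact: zclosure_axis.
by rewrite -E; right; exists e.
Qed.

Section Order.
Variable j : 'I_N.
Hypothesis hj : forall e, U.@[e] != 0 -> C (phi e) <-> axis j e.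
Variable F : {mpoly K[N]}.
Hypothesis F0 : uni j F != 0.
Local Notation x := (phi e0).
Local Notation a := (e0 j).
Local Notation m := (mup a (uni j F)).

Lemma near_curve (G : {mpoly K[N]}) (R : P1 -> Prop) : G.@[e0] != 0 ->
  (forall e, U.@[e] != 0 -> axis j e -> G.@[e] != 0 -> R (phi e)) -> zariski_near C x R.
Proof.
move=> G0 h; apply: (zariski_nearI (zariski_near_sub curve_sub (local_param U0)) (near_nonzero U0 C G0)).
move=> y Cy xy [e [Ue He yE]]; rewrite yE cfun_phi // => Ge.
by apply: h => //; apply/(hj Ue); rewrite -yE.
Qed.

Lemma axis_center : axis j e0. Proof. exact/(hj U0). Qed.

(** On the axis [e j - a] is a uniformizer, and [F] restricts to a power of it times a unit; the
    exponent is the multiplicity of the root. *)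
Lemma order_axis : order_at C x (cfun F) m%:Z.
Proof.
have [G Ga FE] := mup_factor a F0; pose pi := cfun ('X_j - a%:MP).
have piE e : U.@[e] != 0 -> pi (phi e) = e j - a.
  by move=> Ue; rewrite /pi cfun_phi // mevalB mevalXU mevalC.
exists pi, (cfun (back j G)), 0%N, m; split.
- split; first exact: regular_sub curve_sub (regular_cfun U0 _).
    exists 1 => [|_ -> _ _]; first by rewrite ev1 oner_neq0.
    by rewrite piE ?subrr.
  move=> g /(regular_quotient U0) [P [P' [P'0 hg]]] [q2 q2x hq2].
  have gx : g x = 0 by apply: hq2 => //; apply: in_chart_refl.
  have [_ gE] := hg e0 U0 P'0 Cx; have Pa : root (uni j P) a.
    rewrite /root -uni_axis; last exact: axis_center.
    by move: gx; rewrite gE => /eqP; rewrite mulf_eq0 invr_eq0 (negPf P'0) orbF.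
  have /factor_theorem [S PE] := Pa.
  exists (fun y => cfun (back j S) y / cfun P' y).
    exact: regular_sub curve_sub (regular_cfun_div U0 _ P'0).
  apply: (near_curve P'0) => e Ue ae Pe.
  have Ce : C (phi e) by apply/(hj Ue).
  have [_ ->] := hg e Ue Pe Ce; rewrite piE // !cfun_phi // backE.
  by rewrite (uni_axis P ae) PE hornerM hornerXsubC mulrA; congr (_ / _); rewrite mulrC.
- exact: regular_sub curve_sub (regular_cfun U0 _).
- by rewrite cfun_phi // backE.
- exists x => //; apply: (@near_curve 1); first by rewrite meval1 oner_neq0.
  move=> e Ue ae _; rewrite expr0 mulr1 piE // !cfun_phi // backE (uni_axis F ae) {1}FE.
  by rewrite hornerM horner_exp hornerXsubC mulrC.
- by rewrite subr0.
Qed.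

Lemma isolated_axis (D : set P1) : (forall e, U.@[e] != 0 -> D (phi e) -> F.@[e] = 0) ->
  zariski_near (C `&` D)%classic x (fun y => y = x).
Proof.
move=> hF; have [G Ga FE] := mup_factor a F0.
have sub : ((C `&` D) `<=` C)%classic by move=> y [].
have G0 : (back j G).@[e0] != 0 by rewrite backE.
suff [q qx hq] : zariski_near C x (fun y => D y -> y = x).
  by exists q => // y [Cy Dy] xy qy; apply: hq.
apply: (near_curve G0) => e Ue ae; rewrite backE => Ge De; congr phi.
rewrite (axis_upd0 ae) (axis_upd0 axis_center); congr upd0.
have := hF e Ue De; rewrite (uni_axis F ae) FE hornerM horner_exp hornerXsubC => /eqP.
rewrite mulf_eq0 expf_eq0 [G.[_] == 0](negPf Ge) orbF => /andP [_].
by rewrite subr_eq0 => /eqP.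
Qed.
End Order.
End Curve.
End ChartGeometry.

(** * Nonnegativity of intersection numbers *)

Section Degree.
Variable K : closedFieldType.
Hypothesis uncountable : forall f : nat -> K, exists a, forall i, f i != a.
Variables (Q : finType) (N : nat) (V0 : set (P1prod K Q)) (D : set (P1prod K Q)).
Local Notation P1 := (P1prod K Q).
Local Notation V := (zclosure V0).
Variable nd : P1 -> nat.
Hypothesis N0 : (0 < N)%N.
Hypothesis DV : (D `<=` V)%classic.
Hypothesis cD : zclosed D.
Hypothesis ndD : forall y, D y -> nd y != N.
Hypothesis charts : forall x, V x -> exists c : chart N V0,
  [/\ exists2 e, (cU c).@[e] != 0 & x = cphi c e,
      forall e, (cU c).@[e] != 0 -> nd (cphi c e) = #|[set i | e i == 0]%SET| &
      exists F, (forall e, (cU c).@[e] != 0 -> D (cphi c e) -> F.@[e] = 0) /\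
        (forall G, (forall e, (cU c).@[e] != 0 -> D (cphi c e) -> G.@[e] = 0) -> exists H, G = F * H)].

(** The reference point [x0] is the origin of a chart, which lies on [C] but not in [D]. There 1 is
    a local equation, so all orders are multiplicities of polynomials restricted to axes. *)
Theorem curve_degree C : irreducible_component [set y | V y /\ (N.-1 <= nd y)%N]%classic C ->
  exists2 d : int, intersection_number V D C d & 0 <= d.
Proof.
move=> hC; have CV : (C `<=` V)%classic := curve_sub hC.
have origin x : C x -> exists x0, C x0 /\ ~ D x0.
  move=> Cx; have [c [[e Ue xE] hnd _]] := charts (CV x Cx); rewrite xE in Cx.
  have [j hj] := curve_axis uncountable hnd N0 hC Ue Cx.
  exists (cphi c (fun=> 0)); split; first by apply/(hj _ (corigin c)).
  move/ndD; rewrite hnd ?corigin // => /negP; apply; rewrite -[X in _ == X]card_ord -cardsT.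
  by apply/eqP; congr #|pred_of_set _|; apply/setP => i; rewrite !inE eqxx.
have [x0 [Cx0 nDx0]] : exists x0, C x0 /\ ~ D x0 by case: hC => _ [[x Cx] _] _; apply: origin Cx.
have /boolp.choice [fm hfm] x : exists fm : (P1 -> K) * nat, C x ->
    [/\ local_equation V D x fm.1,
        (exists y, [/\ C y, regular_at V y fm.1 & fm.1 y != 0]),
        order_at C x fm.1 fm.2%:Z,
        (~ D x -> fm = (fun=> 1, 0%N)) &
        D x -> fm.2 != 0%N /\ zariski_near (C `&` D)%classic x (fun y => y = x)].
  have [Cx|nC] := pselect (C x); last by exists (fun=> 0, 0%N).
  have [c [[e0 U0 xE] hnd [F [hF1 hF2]]]] := charts (CV x Cx).
  have Cx' : C (cphi c e0) by rewrite -xE.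
  have [j hj] := curve_axis uncountable hnd N0 hC U0 Cx'.
  have [Dx|nD] := pselect (D x); last first.
    exists (fun=> 1, 0%N) => _; split=> //=; first exact: local_equation_unit.
      exists x; split=> //; last exact: oner_neq0.
      by exists 1, 1; rewrite ev1 oner_neq0; split=> // y _ _ _; rewrite ev1 divr1.
    have u1 : uni j (1 : {mpoly K[N]}) = 1 by rewrite /uni rmorph1.
    have := order_axis hC U0 Cx' hj (F := 1).
    rewrite u1 => /(_ (oner_neq0 _)); rewrite mupNroot ?root1 // -xE.
    by rewrite (_ : cfun c 1 = fun=> 1) //; apply/funext => y; rewrite /cfun meval1.
  have nD0 : ~ D (cphi c (fun=> 0)).
    move/ndD; rewrite hnd ?corigin // => /negP; apply; rewrite -[X in _ == X]card_ord -cardsT.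
    by apply/eqP; congr #|pred_of_set _|; apply/setP => i; rewrite !inE eqxx.
  (* Otherwise every polynomial vanishing on [D] in the chart, being a multiple of [F], would vanish
     at the origin, and the origin would lie in the closed set [D]. *)
  have F00 : F.@[fun=> 0] != 0.
    apply/eqP => F00; apply: nD0; apply: cD.
    have sub : ([set cphi c e | e in [set e | D (cphi c e) /\ (cU c).@[e] != 0]] `<=` D)%classic.
      by move=> _ [e [De _] <-].
    apply: (zclosureS sub); apply: (@phi_closure _ _ _ _ c [set e | D (cphi c e)]%classic); first exact: corigin.
    move=> P hP; have [H ->] := hF2 P (fun e Ue De => hP e De Ue).
    by rewrite mevalM F00 mul0r.
  have u0 : uni j F != 0.
    by apply: contraNneq F00 => h; rewrite (@uni_axis _ _ j F) ?h ?horner0.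
  exists (cfun c F, mup (e0 j) (uni j F)) => _ /=; rewrite xE; split=> //.
  - exact: local_equation_gen.
  - exists (cphi c (fun=> 0)); split; first by apply/(hj _ (corigin c)).
      exact: regular_cfun (corigin c) _.
    by rewrite cfun_phi ?corigin.
  - exact: (order_axis hC U0 Cx' hj u0).
  - by case; rewrite -xE.
  - move=> De; split; last exact: (isolated_axis hC U0 Cx' hj u0 hF1).
    rewrite -lt0n -XsubC_dvd // dvdp_XsubCl /root -uni_axis ?hF1 //.
    exact: (axis_center U0 Cx' hj).
pose f x := (fm x).1; pose m x := (fm x).2.
have iso x : (C `&` D)%classic x -> zariski_near (C `&` D)%classic x (fun y => y = x).
  by case=> Cx Dx; have [_ _ _ _ /(_ Dx) []] := hfm x Cx.
have [s us hs] := finite_isolated iso.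
exists (\sum_(x <- s) (m x)%:Z); last first.
  by rewrite -(big_morph Posz PoszD erefl).
(* As [f x0] is the constant 1, the quotient [u x] is [f x] itself. *)
exists f, f, (fun x => (m x)%:Z), x0, s; split=> //.
- by move=> x /hfm [].
- move=> x /hfm [_ [y [Cy ry fy]] _ _ _]; exists y; split=> //.
  have [_ _ _ /(_ nDx0) e _] := hfm x0 Cx0.
  by apply: zariski_near_all => z _ _; rewrite {2}/f e mul1r.
- by move=> x /hfm [].
- split=> // x; rewrite hs; split=> [[Cx Dx]|[Cx mx]].
    by have [_ _ _ _ /(_ Dx) [mx _]] := hfm x Cx.
  split=> //; apply: contrapT => nD; have [_ _ _ /(_ nD) e _] := hfm x Cx.
  by move: mx; rewrite /m e.
Qed.
End Degree.

(** * Equations of the stratum *)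


Lemma lprod_morph (T : finType) (R S : comNzRingType) (f : {rmorphism R -> S}) (B : {set T}) e (p : T -> R) :
  map_poly f (lprod B e p) = lprod B e (f \o p).
Proof.
rewrite /lprod rmorph_prod; apply: eq_bigr => i _.
by rewrite /= rmorphXn /= map_polyXsubC.
Qed.

Lemma residue_num_morph (R S : comNzRingType) (f : {rmorphism R -> S}) a N M e :
  f (residue_num a N M e) = residue_num (f a) (map_poly f N) (map_poly f M) e.
Proof.
have shift P : map_poly f (P \Po ('X + a%:P)) = map_poly f P \Po ('X + (f a)%:P).
  by rewrite map_comp_poly rmorphD /= map_polyX map_polyC.
rewrite /residue_num -coef_map rmorphM /= !shift rmorph_sum /= -!shift; congr (nth 0 (polyseq (_ * _)) _).
apply: eq_bigr => k _; rewrite rmorphM !rmorphXn rmorphB /= !map_polyC /= coef_map.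
by [].
Qed.

Lemma dif_morph n (o : 'I_n) (R S : comNzRingType) (f : {rmorphism R -> S}) q i j :
  f (dif o q i j) = dif o (f \o q) i j.
Proof. by rewrite /dif; case: (i == o); case: (j == o); rewrite ?rmorph_nat ?rmorphN1 ?rmorphB. Qed.

Lemma dif_self n (o : 'I_n) (R : comNzRingType) (q : 'I_n -> R) i : dif o q i i = 0.
Proof. by rewrite /dif; case: eqVneq => [//|_]; rewrite subrr. Qed.

Section Positions.
Variables (K : closedFieldType) (n s : nat) (o : 'I_n) (t : btree n).
Local Notation N := (n - 3)%N.
Local Notation O := (lshift s o).
Local Notation A := (~: [set O])%SET.

Definition pos (R : comNzRingType) (v : 'I_(N + s) -> R) (i : 'I_(n + s)) : R :=
  match fintype.split i with inl k => cpos t (v \o @lshift N s) k | inr j => v (rshift N j) end.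

Lemma pos_lshift (R : comNzRingType) (v : 'I_(N + s) -> R) k :
  pos v (lshift s k) = cpos t (v \o @lshift N s) k.
Proof. by rewrite /pos (unsplitK (inl k)). Qed.

Lemma pos_rshift (R : comNzRingType) (v : 'I_(N + s) -> R) j : pos v (rshift n j) = v (rshift N j).
Proof. by rewrite /pos (unsplitK (inr j)). Qed.

Lemma pos_morph (R S : comNzRingType) (f : {rmorphism R -> S}) v i : f (pos v i) = pos (f \o v) i.
Proof. by rewrite /pos; case: fintype.split => // k; apply: cpos_morph. Qed.

(* Opaque, so that unification never unfolds these polynomials. *)
Fact posp_def i : {P : {mpoly K[N + s]} | P = pos (fun i => 'X_i) i}. Proof. by eexists. Qed.
Definition posp i : {mpoly K[N + s]} := sval (posp_def i).

Lemma pospE v : meval v \o posp = pos v.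
Proof.
apply/funext => i; rewrite /= /posp (svalP (posp_def i)) pos_morph; congr (pos _ i).
by apply/funext => j /=; rewrite mevalXU.
Qed.

Lemma dif_lshift (v : 'I_(N + s) -> K) i j :
  dif O (pos v) (lshift s i) (lshift s j) = dif o (cpos t (v \o @lshift N s)) i j.
Proof.
have E k : (lshift s k == O) = (k == o) by [].
by rewrite /dif !E !pos_lshift.
Qed.

Definition param (v : 'I_(N + s) -> K) : cr_space K (n + s) := mline O (pos v).

Lemma forget_mline (v : 'I_(N + s) -> K) :
  forget (param v) = mline o (cpos t (v \o @lshift N s)).
Proof.
by apply/ffunP => q; rewrite !ffunE /cr_num /cr_den !crs_map !dif_lshift.
Qed.

(** For these quadruples the denominator vanishes identically and the convention 1 / 0 = 0 gives the
    value 0, which is written as 0 / 1. *)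
Definition degenerate (q : 4.-tuple 'I_(n + s)) : bool :=
  (crs q 0 == crs q 3) || (crs q 1 == crs q 2).
Definition parA q : {mpoly K[N + s]} := if degenerate q then 0 else cr_num O posp q.
Definition parB q : {mpoly K[N + s]} := if degenerate q then 1 else cr_den O posp q.

Lemma parB_neq0 v q : nondeg O (pos v) -> (parB q).@[v] != 0.
Proof.
move=> nd; rewrite /parB /degenerate /cr_den; case: ifPn => [_|]; first by rewrite meval1 oner_neq0.
rewrite negb_or => /andP [h1 h2]; rewrite mevalM !dif_morph pospE mulf_neq0 //; exact: nd.
Qed.

Lemma param_fraction v q : nondeg O (pos v) -> param v q =
  if (parB q).@[v] == 0 then None else Some ((parA q).@[v] / (parB q).@[v]).
Proof.
move=> nd; rewrite (negPf (parB_neq0 q nd)) ffunE /parA /parB /cr_num /cr_den /degenerate.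
case: ifP => [|_]; last by rewrite !mevalM !dif_morph pospE.
by rewrite meval0 mul0r => /orP [] /eqP ->; rewrite dif_self ?mulr0 ?mul0r invr0 mulr0.
Qed.

Lemma param_proper v q : nondeg O (pos v) -> (parA q).@[v] != 0 \/ (parB q).@[v] != 0.
Proof. by move=> nd; right; apply: parB_neq0. Qed.

Lemma open_poly : exists h : {mpoly K[N + s]}, forall v,
  h.@[v] != 0 <-> generic o t (v \o @lshift N s) /\ nondeg O (pos v).
Proof.
exists (chU o t (fun i => 'X_(lshift s i)) * (\prod_(i < N) 'X_(lshift s i)) *
  \prod_(x : 'I_(n + s) * 'I_(n + s) | x.1 != x.2) dif O posp x.1 x.2) => v.
rewrite !mevalM chU_morph !rmorph_prod /= !mulf_eq0 !negb_or.
have -> : meval v \o (fun i => 'X_(lshift s i)) = v \o @lshift N s.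
  by apply/funext => i /=; rewrite mevalXU.
split=> [/andP [/andP [hU /prodf_neq0 h0] /prodf_neq0 nd]|[[hU h0] nd]].
  split; first by split=> // i; have := h0 i isT; rewrite mevalXU.
  by move=> i j ij; have := nd (i, j) ij; rewrite dif_morph pospE.
rewrite hU /=; apply/andP; split; apply/prodf_neq0 => i; first by rewrite mevalXU => _; apply: h0.
by move=> ij; rewrite dif_morph pospE nd.
Qed.

Section Equations.
Hypothesis char0 : forall n, n.+1%:R != 0 :> K.
Variable kappa : 'I_(n + s) -> int.
Local Notation pe := (fun i => pexp kappa i + pind kappa i)%N.

Definition pole_equation i : {mpoly K[N + s]} :=
  residue_num (posp i) (lprod A (zexp kappa) posp) (lprod (A :\ i)%SET pe posp) (pe i).

Lemma pole_equationE v i : (pole_equation i).@[v] =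
  residue_num (pos v i) (lprod A (zexp kappa) (pos v)) (lprod (A :\ i)%SET pe (pos v)) (pe i).
Proof. by rewrite residue_num_morph !lprod_morph -(pospE v). Qed.

Lemma exact_equations v : nondeg O (pos v) ->
  exact kappa A (pos v) <-> forall i, i \in A -> kappa i < 0 -> (pole_equation i).@[v] = 0.
Proof.
move=> nd; have distinct i j : i \in A -> j \in A -> i != j -> pos v i - pos v j != 0.
  by rewrite !inE => iO jO /nd; rewrite /dif (negPf iO) (negPf jO).
have inj : {in A &, injective (pos v)}.
  by move=> i j iA jA e; apply/eqP; apply: contraT => /(distinct i j iA jA); rewrite e subrr eqxx.
have E i : i \in A -> kappa i < 0 ->
    has_residue (lprod A (zexp kappa) (pos v)) (lprod A pe (pos v)) (pos v i) 0 <-> (pole_equation i).@[v] = 0.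
  move=> iA ki; rewrite pole_equationE.
  have -> : lprod A pe (pos v) = ('X - (pos v i)%:P) ^+ pe i * lprod (A :\ i)%SET pe (pos v).
    by rewrite {1}/lprod (big_setD1 i iA).
  apply: residue_numP; first by rewrite /pind ki addn1.
  rewrite /root lprod_horner; apply/prodf_neq0 => j.
  by rewrite finset.in_setD1 => /andP [ji jA]; rewrite expf_neq0 // distinct // eq_sym.
by rewrite (exact_residues char0 _ inj); split=> h i iA ki; apply/E => //; apply: h.
Qed.
End Equations.
End Positions.

Section RationalMapComponents.
Variables (K : closedFieldType) (Q : finType) (M : nat) (A B : Q -> {mpoly K[M]}).
Variables (S : set ('I_M -> K)) (psi : ('I_M -> K) -> P1prod K Q).
Hypothesis psiE : forall v q, S v ->
  psi v q = if (B q).@[v] == 0 then None else Some ((A q).@[v] / (B q).@[v]).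
Hypothesis proper : forall v q, S v -> (A q).@[v] != 0 \/ (B q).@[v] != 0.

(** By irreducibility [W] lies in the closure of the image of one part of a prime decomposition of
    [Y], and equals it by maximality. *)
Lemma component_param (Y : set ('I_M -> K)) W : (Y `<=` S)%classic ->
  irreducible_component (zclosure (psi @` Y)%classic) W -> exists V h,
  [/\ (V `<=` Y)%classic, prime_set id V, W = zclosure (psi @` V)%classic,
      ~ vanishing id V h & forall v, Y v -> h.@[v] != 0 -> V v].
Proof.
move=> YS [WY iW maxW]; have [k [U [pU UE]]] := prime_decomposition id Y.
have UY i : (U i `<=` Y)%classic by move=> v Uv; apply/UE; exists i.
have US i : (U i `<=` S)%classic by move=> v /UY /YS.
pose Z i := zclosure (psi @` U i)%classic; pose van i := vanishing id (U i).
have iZ i : irreducible (Z i) by apply: irreducible_zclosure; apply: irreducible_map psiE proper _ _ _.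
have ZY i : (Z i `<=` zclosure (psi @` Y))%classic.
  by apply: zclosureS => _ [v /UY Yv <-]; exists v.
have leZ i (V : set ('I_M -> K)) : (V `<=` S)%classic -> (vanishing id V `<=` van i)%classic ->
    (Z i `<=` zclosure (psi @` V))%classic.
  move=> VS h; apply: zclosure_min; first exact: zclosureK.
  move=> _ [v Uv <-]; apply: (zclosure_map psiE proper VS (US i v Uv)) => P /h; exact.
have [|i0 hi0] := irreducible_cover iW (fun i => zclosureK (V := (psi @` U i)%classic)) WY.
  by move=> _ [v /UE [i Uv] <-]; exists i; apply: sub_zclosure; exists v.
pose below i := [set j | `[< (van j `<=` van i)%classic >]]%SET.
have /asboolP Wi0 : `[< (W `<=` Z i0)%classic >] by apply/asboolP.
(* Among the parts whose image closure contains [W], one with the fewest parts [below] it has a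
   minimal vanishing ideal, as [isolate_component] requires. *)
case: (@arg_minnP _ i0 (fun i => `[< (W `<=` Z i)%classic >]) (fun i => #|below i|)) => [|i /asboolP Wi imin].
  exact/asboolP.
have {}Wi : Z i = W by apply: maxW.
have top j : (van j `<=` van i)%classic -> (van i `<=` van j)%classic.
  move=> ji; have /imin le : `[< (W `<=` Z j)%classic >] by apply/asboolP; rewrite -Wi; apply: leZ.
  have sub : below j \subset below i.
    apply/fintype.subsetP => l lj; rewrite inE; apply/asboolP => p hp; apply: ji.
    by move: lj hp; rewrite inE => /asboolP; apply.
  have /eqP E : below j == below i by rewrite finset.eqEcard sub.
  have : i \in below i by rewrite inE; apply/asboolP.
  by rewrite -E inE => /asboolP.
have [h nh hh] := isolate_component pU (fun v => (UE v).1) top.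
(* The closure of [U i] in [Y]; unlike [U i] it contains every point of [Y] where [h] is nonzero. *)
pose V : set ('I_M -> K) := [set v | Y v /\ forall p, van i p -> p.@[v] = 0]%classic.
have UV : (U i `<=` V)%classic by move=> v Uv; split; [exact: UY Uv | move=> p; apply].
exists V, h; split.
- by move=> v [].
- have [[u Uu] pi] := pU i; split; first by exists u; apply: UV.
  move=> p q pq; have [|hp|hq] := pi p q; first by move=> v /UV /pq.
  + by left => v [_]; apply.
  + by right => v [_]; apply.
- rewrite -Wi; apply/seteqP; split; first by apply: zclosureS => _ [v /UV Vv <-]; exists v.
  apply: zclosure_min; first exact: zclosureK.
  by move=> _ [v [Yv hv] <-]; apply: (zclosure_map psiE proper (US i)) => //; apply: YS.
- by move=> hV; apply: nh => v /UV; apply: hV.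
- by move=> v Yv hv; split=> // p hp; apply: hh hp.
Qed.
End RationalMapComponents.

Lemma forget_zclosure (K : closedFieldType) n s (S : set (cr_space K (n + s))) w :
  zclosure S w -> zclosure (@forget K n s @` S)%classic (forget w).
Proof.
move=> hw; pose m (x : {x | S x}) := sval x.
have /closure_place [Phi hPhi hev] : zclosure (range m) w.
  by apply: zclosureS hw => x Sx; exists (exist _ x Sx).
have lim := closure_place_limit hPhi hev.
apply: (place_closure (m := fun x => forget (m x)) hPhi) => [x|q].
  by exists (m x) => //; apply: svalP x.
rewrite /= (_ : (fun i => _) = (fun x => m x (map_tuple (@lshift n s) q))) ?ffunE; first exact: lim.
by apply/funext => x; rewrite ffunE.
Qed.

Section LocalEquation.
Variables (K : closedFieldType).
Hypothesis char0 : forall n, n.+1%:R != 0 :> K.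
Hypothesis uncountable : forall f : nat -> K, exists a, forall i, f i != a.
Variables (n s : nat) (o : 'I_n) (t : btree n).
Hypothesis n3 : (3 <= n)%N.
Hypothesis ut : uniq (leaves t).
Hypothesis tE : forall k, (k \in leaves t) = (k != o).
Local Notation N := (n - 3)%N.
Local Notation O := (lshift s o).
Local Notation A := (~: [set O])%SET.

Lemma nondeg_affine m (o' : 'I_m) (q q' : 'I_m -> K) x y : x != 0 ->
  (forall k, k != o' -> q k = x * q' k + y) -> nondeg o' q -> nondeg o' q'.
Proof.
move=> x0 h nd i j ij; have := nd i j ij; rewrite /dif.
case: (eqVneq i o') => // io; case: (eqVneq j o') => // jo.
have -> : q i - q j = x * (q' i - q' j) by rewrite !h //; ring.
by rewrite mulf_eq0 (negPf x0).
Qed.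

Definition tree_chart : chart N (@M0 K n).
Proof.
refine (@Chart _ _ _ _ (chAp K o t) (chBp K o t) (chUp K o t) (chq o t) (phi o t) _ _ _ _ _ _).
- by move=> e q; rewrite ffunE chApE chBpE.
- by move=> e q; rewrite chUpE chApE chBpE; apply: (ch_proper n3 ut tE).
- by move=> e i; rewrite chUpE; apply: (phi_coord uncountable n3 ut tE).
- by rewrite chUpE; apply: (chU_at0 K ut tE).
- move=> e; rewrite chUpE => Ue e0; have ge : generic o t e by [].
  apply/(M0_mline o); exists (cpos t e); first exact: (generic_nondeg n3 ut tE).
  exact: (phi_generic n3 ut tE).
- move=> x /(M0_mline o) [q nd ->]; have [e [c [d [ge c0 h]]]] := phi_onto n3 ut tE nd.
  exists e; first by rewrite chUpE; case: ge.
  by rewrite (mline_affine c0 h) (phi_generic n3 ut tE).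
Defined.

Variable kappa : seq int.
Local Notation kap := (fun i : 'I_(n + s) => kappa`_i).
Hypothesis sum_kappa : \sum_(i < n + s) kappa`_i = -2.
Hypothesis no_simple_pole : forall i : 'I_(n + s), kappa`_i != -1.
Hypothesis kappa_O : kappa`_O < 0.

Local Notation pos := (pos t).
Local Notation param := (param o t).
Local Notation init v := (v \o @lshift N s).
Implicit Types v : 'I_(N + s) -> K.

Definition exact_configs : set ('I_(N + s) -> K) :=
  [set v : 'I_(N + s) -> K | [/\ generic o t (init v), nondeg O (pos v) & exact kap A (pos v)]]%classic.

Lemma forget_param v : generic o t (init v) -> forget (param v) = phi o t (init v).
Proof. by move=> ge; rewrite forget_mline (phi_generic n3 ut tE). Qed.

Lemma stratum_param : @stratum K (n + s) kappa = (param @` exact_configs)%classic.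
Proof.
apply/seteqP; split=> [x|_ [v [ge nd ex] <-]]; last first.
  by apply/(stratum_mline char0 _ sum_kappa no_simple_pole kappa_O); exists (pos v).
move=> /(stratum_mline char0 _ sum_kappa no_simple_pole kappa_O) [q [nd -> ex]] {x}.
have nd0 : nondeg o (q \o @lshift n s).
  move=> i j ij; have := nd (lshift s i) (lshift s j); rewrite eq_lshift => /(_ ij).
  by rewrite /dif !eq_lshift.
have [e [x [y [ge x0 h]]]] := phi_onto n3 ut tE nd0.
pose v (i : 'I_(N + s)) := match fintype.split i with inl a => e a | inr j => (q (rshift n j) - y) / x end.
have ve : init v = e by apply/funext => i; rewrite /v /= (unsplitK (inl i)).
have hq k : k != O -> q k = x * pos v k + y.
  case: (split_ordP k) => j ->; first by rewrite eq_lshift pos_lshift ve; apply: h.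
  by rewrite pos_rshift /v (unsplitK (inr j)) mulrC divfK // subrK.
exists v; last by rewrite /param (mline_affine x0 hq).
split; first by rewrite ve.
- exact: nondeg_affine x0 hq nd.
- apply: eq_exact (exact_affine y x0 ex) => k; rewrite !inE => kO.
  by rewrite hq // addrK mulrC mulKf.
Qed.

(** The affine position of a further point is recovered from its cross-ratio with two of the first n
    points and infinity. *)
Lemma param_inj v v' : nondeg O (pos v) -> nondeg O (pos v') -> init v = init v' ->
  param v = param v' -> v = v'.
Proof.
move=> nd nd' vv' pp'; apply/funext => i; case: (split_ordP i) => j ->; first exact: (congr1 (fun f => f j) vv').
have /card_gt1P [a [b [ha hb ab]]] : (1 < #|(~: [set o])%SET|)%N by rewrite cardsC1 card_ord; lia.
rewrite !inE in ha hb; have := congr1 (fun x : cr_space K (n + s) => x [tuple rshift n j; lshift s b; lshift s a; O]) pp'.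
have /= [c0 c1 c2 c3] := crs_tuple (rshift n j) (lshift s b) (lshift s a) O.
rewrite !ffunE /cr_num /cr_den c0 c1 c2 c3 => -[].
have jO : (rshift n j == O) = false by apply/negbTE; rewrite eq_sym eq_lrshift.
rewrite /dif !eq_lshift (negPf ha) (negPf hb) jO eqxx !pos_rshift !pos_lshift -vv' !mulN1r !mulrN1 !invrN !mulrNN.
have d0 : cpos t (init v) b - cpos t (init v) a != 0.
  have := nd (lshift s b) (lshift s a); rewrite eq_lshift eq_sym => /(_ ab).
  by rewrite /dif !eq_lshift (negPf ha) (negPf hb) !pos_lshift.
move=> /(mulIf (_ : _^-1 != 0)); rewrite invr_eq0 => /(_ d0); exact: addIr.
Qed.

Hypothesis N0 : (0 < N)%N.
Hypothesis poles : #|[set i in A | (kap i < 0)%R]%SET| = s.+1.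
Variables (W : set (cr_space K (n + s))) (D : set (cr_space K n)).
Hypothesis comp : irreducible_component (@stratum_closure K (n + s) kappa) W.
Hypothesis WD : (@forget K n s @` W)%classic = D.
Hypothesis finite_fibres : exists Z : set (cr_space K n), [/\ zclosed Z, ~ (D `<=` Z)%classic &
  forall y, D y -> ~ Z y -> exists l : seq (cr_space K (n + s)), forall x, W x -> forget x = y -> x \in l].

(** The component comes from a prime set [V] in coordinates (e, z), cut out on an open set by s + 1
    residue equations. Its projection to e is dense in [D] within the chart, and finite fibres of
    [W] become finite fibres of [V] by [param_inj]; so [image_hypersurface] applies. *)
Theorem divisor_equation : exists F : {mpoly K[N]},
  (forall e, (cU tree_chart).@[e] != 0 -> D (cphi tree_chart e) -> F.@[e] = 0) /\
  (forall G, (forall e, (cU tree_chart).@[e] != 0 -> D (cphi tree_chart e) -> G.@[e] = 0) ->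
     exists H, G = F * H).
Proof.
have [h0 hh0] := open_poly K s o t.
pose S : set ('I_(N + s) -> K) := [set v | nondeg O (pos v)]%classic.
have parE v q (Sv : S v) := param_fraction q Sv.
have par_proper v q (Sv : S v) := param_proper q Sv.
have YS : (exact_configs `<=` S)%classic by move=> v [].
have comp' := comp; rewrite /stratum_closure stratum_param in comp'.
have [V [h [VY pV WE nh hV]]] := component_param parE par_proper YS comp'.
have VW v : V v -> W (param v) by move=> Vv; rewrite WE; apply: sub_zclosure; exists v.
have VD v : V v -> D (phi o t (init v)).
  move=> Vv; have [ge _ _] := VY v Vv; rewrite -WD -forget_param //.
  by exists (param v) => //; apply: VW.
have VU v : V v -> chU o t (init v) != 0 by move=> /VY [[]].
have DV : (D `<=` zclosure [set phi o t (init v) | v in V])%classic.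
  rewrite -WD => _ [w + <-]; rewrite WE => /forget_zclosure; apply: zclosureS.
  by move=> _ [_ [v Vv <-] <-]; exists v => //; rewrite forget_param //; case: (VY v Vv).
have [g hg] : exists g : 'I_s.+1 -> 'I_(n + s), forall i,
    i \in [set i in A | (kap i < 0)%R]%SET <-> exists j, g j = i.
  exists (fun j => enum_val (cast_ord (esym poles) j)) => i; split=> [hi|[j <-]]; last exact: enum_valP.
  by exists (cast_ord poles (enum_rank_in hi i)); rewrite cast_ordK enum_rankK_in.
pose G j : {mpoly K[N + s]} := pole_equation K o t kap (g j).
have GE v : nondeg O (pos v) -> exact kap A (pos v) <-> forall j, (G j).@[v] = 0.
  move=> nd; rewrite (exact_equations char0 _ nd); split=> hG.
    move=> j; have /hg : exists j', g j' = g j by exists j.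
    by rewrite inE => /andP [h1 h2]; apply: hG.
  move=> i iA ki; have /hg [j <-] : i \in [set i in A | (kap i < 0)%R]%SET by rewrite inE iA.
  exact: hG.
have [Z [cZ DZ fin]] := finite_fibres.
have [v1 [V1 Z1]] : exists v, V v /\ ~ Z (phi o t (init v)).
  apply: contrapT => nv; apply: DZ; apply: subset_trans DV _; apply: zclosure_min => // _ [v Vv <-].
  by apply: contrapT => nZ; apply: nv; exists v.
have [p pZ p1] := notin_zclosure (fun hz => Z1 (cZ _ hz)).
(* [a] is an equation of the exceptional set [Z], pulled back to the chart, that fails at [init v1];
   where it is nonzero the fibres are finite. *)
have [a ha] := pullback_zeros (@phiE _ _ _ _ tree_chart) (@phi_proper _ _ _ _ tree_chart) (phi o t (init v1)) p.
rewrite /= in ha.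
have aZ eta : chU o t eta != 0 -> a.@[eta] != 0 -> ~ Z (phi o t eta).
  move=> Ue; rewrite -chUpE in Ue => /eqP ae Zy; apply: ae; apply/(ha _ Ue) => ch; exact: pZ.
pose P := [set f : {mpoly K[N]} | forall v : 'I_(N + s) -> K, V v -> f.@[init v] = 0]%classic.
have nPa : ~ P a.
  move=> /(_ v1 V1) a0; move/negP: p1; apply; apply/eqP.
  by have := VU v1 V1; rewrite -chUpE => U1; apply: (ha _ U1).1 => //; apply: in_chart_refl.
have nhh : ~ vanishing id V (h * h0).
  move=> hv; apply: nh => v Vv; have [ge nd _] := VY v Vv; apply/eqP.
  have := hv v Vv; rewrite mevalM => /eqP; rewrite mulf_eq0 => /orP [//|e0].
  by have /negP := (hh0 v).2 (conj ge nd).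
have hG v j : V v -> (G j).@[v] = 0 by move=> Vv; have [ge nd ex] := VY v Vv; apply: (GE v nd).1.
have hhV v : (forall j, (G j).@[v] = 0) -> (h * h0).@[v] != 0 -> V v.
  move=> Gv; rewrite mevalM mulf_eq0 negb_or => /andP [hv /(hh0 v) [ge nd]]; apply: hV => //.
  by split=> //; apply/(GE v nd).
have hfin eta : a.@[eta] != 0 -> exists l : seq ('I_s -> K), forall v,
    V v -> init v =1 eta -> v \o @rshift N s \in l.
  move=> ae; have [De|nD] := pselect (exists v, V v /\ init v = eta); last first.
    by exists [::] => v Vv /funext ve; case: nD; exists v.
  have [v2 [V2 ve2]] := De; have ve2' := VU _ V2; rewrite ve2 in ve2'.
  have Dy := VD _ V2; rewrite ve2 in Dy; have [l hl] := fin _ Dy (aZ _ ve2' ae).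
  (* Recovers the coordinates z of a parameter from its image, the coordinates [eta] being fixed. *)
  pose back x := xget (fun=> 0) [set z | exists v, [/\ V v, init v = eta, param v = x & z = v \o @rshift N s]]%classic.
  exists (map back l) => v Vv /funext ve; apply/seq.mapP; exists (param v).
    apply: hl; first exact: VW.
    by have [ge _ _] := VY v Vv; rewrite forget_param // ve.
  rewrite /back; case: xgetP => [z _ [v' [V' ve' pv' ->]]|/(_ (v \o @rshift N s)) []]; last by exists v.
  have [_ nd _] := VY v Vv; have [_ nd' _] := VY v' V'.
  by rewrite (@param_inj v v') // ve ve'.
have [F PF hF] := image_hypersurface uncountable N0 pV hG nhh hhV nPa hfin.
exists F; split=> [e Ue De|H hH].
  have := DV _ De; have := @ev_chart_poly _ _ _ _ tree_chart e F; rewrite /= => hev.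
  move=> /(_ (chart_poly tree_chart F)); rewrite hev // (ceval_phi (c := tree_chart)) //; apply.
  move=> _ [v Vv <-] _; rewrite hev // (ceval_phi (c := tree_chart)); first exact: PF.
  by rewrite /= chUpE; apply: VU.
apply: hF => v Vv; apply: hH; first by rewrite /= chUpE; apply: VU.
exact: VD.
Qed.
End LocalEquation.

Import Num.Theory.

(** * Positivity *)


Section Nef.
Variable K : closedFieldType.
Hypothesis char0 : forall n, n.+1%:R != 0 :> K.
Hypothesis uncountable : forall f : nat -> K, exists a, forall i, f i != a.

Lemma forget_M0 n s x : @M0 K (n + s) x -> @M0 K n (forget x).
Proof.
move=> [p inj ->]; exists (p \o @lshift n s); first by move=> i j /inj /lshift_inj.
by apply/ffunP => q; rewrite !ffunE !tnth_map.
Qed.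

Theorem F_nef_image n s (kappa : seq int) (W : set (cr_space K (n + s))) :
  (3 <= n)%N -> size kappa = (n + s)%N -> \sum_(a <- kappa) a = -2 -> -1 \notin kappa ->
  count (fun a => a < 0) kappa = s.+2 ->
  irreducible_component (@stratum_closure K (n + s) kappa) W ->
  (exists Z : set (cr_space K n), [/\ zclosed Z, ~ (@forget K n s @` W `<=` Z)%classic &
     forall y, (@forget K n s @` W)%classic y -> ~ Z y ->
       exists l : seq (cr_space K (n + s)), forall x, W x -> forget x = y -> x \in l]) ->
  F_nef (@forget K n s @` W)%classic.
Proof.
move=> n3 sz sumk nk cneg comp fin C hC; have [Wst [[w0 Ww0] _] _] := comp.
have few w : W w -> (nodes (forget w) + 4 <= n)%N.
  by move=> /Wst; apply: few_nodes.
(* A component is nonempty, and [few_nodes] at one of its points forces n to be at least 4. *)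
have N0 : (0 < n - 3)%N by have := few w0 Ww0; lia.
have [o ko] := pole_among_first sz cneg.
have kn1 (i : 'I_(n + s)) : kappa`_i != -1.
  by apply: contraNneq nk => <-; rewrite mem_nth // sz.
have sk : \sum_(i < n + s) kappa`_i = -2 by rewrite (sum_nth id sz).
have poles : #|[set i in ~: [set lshift s o] | (kappa`_i < 0)%R]%SET| = s.+1.
  have := card_nth (fun a => (a < 0)%R) sz; rewrite cneg (cardsD1 (lshift s o)) inE ko => -[<-].
  by congr #|pred_of_set _|; apply/setP => i; rewrite !inE.
apply: (@curve_degree K uncountable _ (n - 3) (@M0 K n) _ (@nodes K n)) => //.
- move=> _ [w /Wst hw <-]; apply: zclosureS (forget_zclosure hw) => _ [x [p [inj -> _]] <-].
  by apply: forget_M0; exists p.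
- exact: (zclosed_pullback (component_zclosed (@zclosureK _ _ _) comp)).
- by move=> _ [w /few h <-]; apply/eqP; lia.
- move=> x /(chart_exists o n3) [t [ut tE [e Ue xE]]].
  exists (tree_chart uncountable n3 ut tE); split.
  + by exists e => //; rewrite /= chUpE.
  + by move=> e'; rewrite /= chUpE; apply: (nodes_phi uncountable n3 ut tE).
  + exact: (divisor_equation char0 uncountable n3 ut tE sk kn1 ko N0 poles comp erefl fin).
- by rewrite (_ : (n - 3).-1 = n - 4)%N; last by lia.
Qed.
End Nef.

(** * Uncountability of the complex numbers *)

Section Uncountable.
Variable R : realType.

Definition cantor_step (x : R) (J : R * R) : R * R :=
  if x <= (J.1 + J.2) / 2 then ((J.1 + J.2 * 2) / 3, J.2) else (J.1, (J.1 * 2 + J.2) / 3).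

Lemma cantor_step_lt x J : J.1 < J.2 ->
  [/\ (cantor_step x J).1 < (cantor_step x J).2, J.1 <= (cantor_step x J).1,
      (cantor_step x J).2 <= J.2 & ~ (cantor_step x J).1 <= x <= (cantor_step x J).2].
Proof.
case: J => a b /= ab; rewrite /cantor_step; case: (Order.TotalTheory.leP x ((a + b) / 2)) => h /=;
by split=> [|||/andP [h1 h2]]; lra.
Qed.

(* Cantor's nested intervals: the n-th step leaves out f n. *)
Lemma real_uncountable (f : nat -> R) : exists a, forall i, f i != a.
Proof.
pose I := fix I n : R * R := if n is m.+1 then cantor_step (f m) (I m) else (0, 1).
have lt n : (I n).1 < (I n).2.
  by elim: n => [|n IH] /=; [lra | have [] := cantor_step_lt (f n) IH].
have mono m n : (m <= n)%N -> (I m).1 <= (I n).1 /\ (I n).2 <= (I m).2.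
  move/subnK <-; elim: (n - m)%N => [|d [h1 h2]]; first by rewrite add0n.
  by have [_ h3 h4 _] := cantor_step_lt (f (d + m)%N) (lt (d + m)%N); rewrite addSn /=; split; lra.
have below m n : (I m).1 <= (I n).2.
  have [h1 _] := mono m (maxn m n) (leq_maxl m n); have [_ h2] := mono n (maxn m n) (leq_maxr m n).
  by have := lt (maxn m n); lra.
pose E := [set (I n).1 | n in [set: nat]]%classic.
have ubE n : ubound E (I n).2 by move=> _ [m _ <-]; apply: below.
exists (sup E) => n; apply/eqP => fE.
have [_ _ _] := cantor_step_lt (f n) (lt n); apply.
suff : (I n.+1).1 <= f n <= (I n.+1).2 by [].
rewrite fE; apply/andP; split.
  by apply: ub_le_sup; [exists (I 0%N).2; apply: ubE | exists n.+1].
by apply: ge_sup; [exists (I 0%N).1; exists 0%N | apply: (ubE n.+1)].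
Qed.

Lemma complex_uncountable (f : nat -> R[i]) : exists a, forall i, f i != a.
Proof.
have [a ha] := real_uncountable (fun n => complex.Re (f n)); exists (a%:C)%C => i.
by apply: contraNneq (ha i) => ->.
Qed.
End Uncountable.

Theorem theorem1p4 (R : realType) (n m p : nat) (k : n.-tuple int)
    (f : 'I_m -> int) (alpha : 'I_m -> nat) (D : set (cr_space R[i] n)) :
  let kappa := (k ++ repeated f alpha : seq int) in
  (3 <= n)%N ->
  injective f ->
  \sum_(a <- kappa) a = -2 ->
  -1 \notin kappa ->
  p = count (fun a => a < 0) kappa ->
  (1 <= p)%N ->
  size kappa = (n + p - 2)%N ->
  Z_component k f alpha D ->
  F_nef D.
Proof.
move=> kappa n3 _ sumk nk pE p1 sz.
have sz' : size kappa = (n + \sum_i alpha i)%N.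
  rewrite size_cat size_tuple size_flatten /shape -map_comp sumnE big_map big_enum /=.
  by congr (_ + _)%N; apply: eq_bigr => i _; rewrite size_nseq.
(* Comparing the two expressions for the length of [kappa] shows that p - 2 is the number of
   forgotten points. *)
have cneg : count (fun a => a < 0) kappa = (\sum_i alpha i).+2 by lia.
rewrite /Z_component /Z_coefficient => /eqP Z0; apply: contrapT => nnef; apply: Z0.
rewrite fsbig1 ?mulr0 // => W [comp WD]; rewrite /forget_degree.
(* Without a finite general fibre the degree has its default value 0 and the summand vanishes; a
   nonzero coefficient therefore comes with a closed set off which the fibres are finite. *)
case: xgetP => // e _ [A [cA nA fib]]; case: nnef; rewrite -WD.
apply: F_nef_image sz' sumk nk cneg comp _ => //.
- by move=> i; rewrite pnatr_eq0.
- exact: complex_uncountable.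
- exists A; split=> // y Dy nAy; have [t [_ _ ht]] := fib y Dy nAy.
  by exists t => x Wx xy; apply/ht.
Qed.
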